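(* The sequence of $\mathcal{D}$-modules $$0 \to \mathcal{D} \xrightarrow{d} \mathcal{D}\otimes W^1 \xrightarrow{d}\cdots \to \mathcal{D}\otimes W^{g-1} \xrightarrow{d} \mathcal{D}\otimes H^g \xrightarrow{\widetilde{ev}} A \to 0$$ is exact, and hence gives a $\mathcal{D}$-free resolution of $A$.
   Context: Let $g\ge 2$, let $\tau$ be a symmetric $g\times g$ complex matrix with positive definite imaginary part, $J=\mathbb{C}^g/(\mathbb{Z}^g+\tau\mathbb{Z}^g)$, $\theta(z)=\sum_{n\in\mathbb{Z}^g}\exp(\pi i\,{}^tn\tau n+2\pi i\,{}^tnz)$, $z=(z_1,\dots,z_g)$, and $\Theta=(\theta(z)=0)\subset J$. Assume $\Theta$ is non-singular. For $n\ge0$ let $A_n$ be the space of meromorphic functions on $J$ with poles only on $\Theta$, of order at most $n$; $A_n=0$ for $n<0$; $A=\bigcup_n A_n$; $\operatorname{gr}_nA=A_n/A_{n-1}$; $\operatorname{gr}A=\bigoplus_{n\ge0}\operatorname{gr}_nA$. Let $\partial_i=\partial/\partial z_i$ and $\mathcal{D}=\mathbb{C}[\partial_1,\dots,\partial_g]$. Since $\partial_iA_n\subset A_{n+1}$, both $A$ and $\operatorname{gr}A$ are $\mathcal{D}$-modules, with $\partial_i:\operatorname{gr}_nA\to\operatorname{gr}_{n+1}A$. Let $T^*=\bigoplus_{i=1}^g\mathbb{C}\,dz_i$, with $\wedge^pT^*$ placed in degree $-p$, and $dz^g=dz_1\wedge\cdots\wedge dz_g$. Let $H^k$ be the $k$-th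 cohomology of the complex $(\operatorname{gr}A\otimes\wedge^\bullet T^*,d)$, $d=\sum_i\partial_i\otimes dz_i$; $d$ preserves degree, so $H^k=\bigoplus_nH^k_n$, and $H^g_{n-g}=\operatorname{gr}_nA\,dz^g/d(\operatorname{gr}_{n-1}A\otimes\wedge^{g-1}T^* )$. Let $V=V_-\oplus V_+$ with $V_-=\bigoplus_{i=1}^g\mathbb{C}\alpha_i$, $V_+=\bigoplus_{i=1}^g\mathbb{C}\beta_i$; grade $\wedge^pV$ ($p\ge1$) by $\deg(\beta_{i_1}\wedge\cdots\wedge\beta_{i_\ell}\wedge\alpha_{j_1}\wedge\cdots\wedge\alpha_{j_k})=1-k$ if $\ell\ge1$ and $\deg(\alpha_{j_1}\wedge\cdots\wedge\alpha_{j_k})=-k$. Let $\omega=\sum_{i=1}^g\beta_i\wedge\alpha_i$ and $W^k=\wedge^kV/(\omega\wedge\wedge^{k-2}V)$, a graded space, with $W^0=\mathbb{C}$. The $\mathcal{D}$-linear map $d:\mathcal{D}\otimes\wedge^kV\to\mathcal{D}\otimes\wedge^{k+1}V$, $d(P\otimes\eta)=\sum_i\partial_iP\otimes\alpha_i\wedge\eta$, induces $d:\mathcal{D}\otimes W^k\to\mathcal{D}\otimes W^{k+1}$. Let $\zeta_i=\partial_i\log\theta$. For index sets $I=(i_1,\dots,i_r)$, $K$ write $d\zeta_I=d\zeta_{i_1}\wedge\cdots\wedge d\zeta_{i_r}$, and similarly $dz_K,\alpha_K,\beta_I$. For $|I|=n-1\ge1$, $|K|=g-n+1$ one has $d\zeta_I\wedge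 dz_K\in A_n\,dz^g$, so it defines an element of $\operatorname{gr}_nA\,dz^g$ and of $H^g_{n-g}$. The assignment $\beta_I\wedge\alpha_K\mapsto d\zeta_I\wedge dz_K$ (with $\alpha_1\wedge\cdots\wedge\alpha_g\mapsto dz^g$) kills $\omega\wedge\wedge^{g-2}V$ and induces an injective graded map $W^g\to H^g$, by which $W^g$ is regarded as a graded subspace of $H^g$. Fix a graded complement $U^g$, so $H^g=W^g\oplus U^g$, a homogeneous basis $\{u_\beta\}_{\beta\in B}$ of $U^g$, and for each $u_\beta\in U^g_{m-g}$ a function $f_\beta\in A_m$ such that the image of $f_\beta dz^g$ in $\operatorname{gr}_mA\,dz^g$ represents $u_\beta$. The $\mathcal{D}$-linear map $\widetilde{ev}:\mathcal{D}\otimes H^g\to A$ sends $P\otimes f\,dz^g$ to $P(f)$: precisely, the class of $P\otimes(\beta_I\wedge\alpha_K)$ in $\mathcal{D}\otimes W^g$ goes to $P(f)\in A$ where $d\zeta_I\wedge dz_K=f\,dz^g$ with $f\in A$, and $P\otimes u_\beta$ goes to $P(f_\beta)\in A$. The map $d:\mathcal{D}\otimes W^{g-1}\to\mathcal{D}\otimes H^g=(\mathcal{D}\otimes W^g)\oplus(\mathcal{D}\otimes U^g)$ is $w\mapsto(dw,0)$. *)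

(* Defs.v *)
From HB Require Import structures.
From mathcomp Require Import all_boot all_order all_algebra.
From mathcomp Require Import complex.
From mathcomp Require Import all_classical all_reals all_analysis.
From mathcomp Require Import -(notations) finmap monalg mpoly.
From mathcomp.analysis.showcase Require summability.

Set Implicit Arguments.
Unset Strict Implicit.
Unset Printing Implicit Defensive.

Import Order.TTheory GRing.Theory Num.Theory.
Import numFieldNormedType.Exports.

Local Open Scope classical_set_scope.
Local Open Scope ring_scope.

Section Modules.
Variables (K : nzRingType) (M : lmodType K).

Inductive in_span (S : set M) : M -> Prop :=
  | in_span0 : in_span S 0
  | in_spanZD (a : K) (x y : M) : S x -> in_span S y -> in_span S (a *: x + y).

Definition span_pred (S : set M) : {pred M} := fun x => `[< in_span S x >].

Lemma span_predP (S : set M) x : reflect (in_span S x) (x \in span_pred S).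
Proof. exact: asboolP. Qed.

Lemma span_submod (S : set M) : submod_closed (span_pred S).
Proof.
split; first by apply/span_predP; exact: in_span0.
move=> a x y /span_predP xS /span_predP yS; apply/span_predP.
elim: xS => [|b u v uS _ IH]; first by rewrite scaler0 add0r.
by rewrite scalerDr scalerA -addrA; exact: in_spanZD.
Qed.

HB.instance Definition _ (S : set M) :=
  GRing.isSubmodClosed.Build K M (span_pred S) (span_submod S).

Lemma in_span_self (S : set M) x : S x -> x \in span_pred S.
Proof.
by move=> xS; apply/span_predP; rewrite -[x]addr0 -[x]scale1r;
   apply: in_spanZD xS _; exact: in_span0.
Qed.

(* M / <S>, the quotient of M by the submodule generated by S *)
Definition quotmod (S : set M) : Type := Quotient.quot (span_pred S).

HB.instance Definition _ (S : set M) := GRing.Zmodule.on (quotmod S).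

Definition qclass (S : set M) (x : M) : quotmod S :=
  (\pi_(Quotient.quot (span_pred S)) x)%qT.

Definition qrepr (S : set M) (q : quotmod S) : M :=
  repr (q : Quotient.quot (span_pred S)).

Lemma qreprK (S : set M) : cancel (@qrepr S) (@qclass S).
Proof. by move=> q; exact: reprK. Qed.

Lemma qclass_eq (S : set M) x y :
  (qclass S x = qclass S y) <-> (x - y \in span_pred S).
Proof.
by split=> [e|e]; [rewrite Quotient.idealrBE; apply/eqP
                  |apply/eqP; rewrite -Quotient.idealrBE].
Qed.

Lemma qclassB (S : set M) : {morph qclass S : x y / x - y}.
Proof. by move=> x y; rewrite /qclass raddfB. Qed.

HB.instance Definition _ (S : set M) :=
  GRing.isZmodMorphism.Build M (quotmod S) (qclass S) (@qclassB S).

Definition qscale (S : set M) (a : K) (q : quotmod S) : quotmod S :=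
  qclass S (a *: qrepr q).

Lemma qscaleE (S : set M) a x : qscale a (qclass S x) = qclass S (a *: x).
Proof.
apply/qclass_eq; rewrite -scalerBr; apply: rpredZ.
by apply/qclass_eq; rewrite qreprK.
Qed.

Lemma qscaleA (S : set M) a b (q : quotmod S) :
  qscale a (qscale b q) = qscale (a * b) q.
Proof. by rewrite -[q]qreprK !qscaleE scalerA. Qed.

Lemma qscale1 (S : set M) : left_id 1 (@qscale S).
Proof. by move=> q; rewrite -[q]qreprK !qscaleE scale1r. Qed.

Lemma qscaleDr (S : set M) : right_distributive (@qscale S) +%R.
Proof.
by move=> a p q; rewrite -[p]qreprK -[q]qreprK -raddfD !qscaleE -raddfD scalerDr.
Qed.

Lemma qscaleDl (S : set M) (q : quotmod S) :
  {morph (@qscale S)^~ q : a b / a + b}.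
Proof. by move=> a b; rewrite -[q]qreprK !qscaleE -raddfD scalerDl. Qed.

HB.instance Definition _ (S : set M) :=
  GRing.Zmodule_isLmodule.Build K (quotmod S)
    (@qscaleA S) (@qscale1 S) (@qscaleDr S) (@qscaleDl S).

Lemma qclassZ (S : set M) : scalable (qclass S).
Proof. by move=> a x; rewrite -qscaleE. Qed.

HB.instance Definition _ (S : set M) :=
  GRing.isScalable.Build K M (quotmod S) *:%R (qclass S) (@qclassZ S).

(* [monalg.malg I K] is the free K-module on the (possibly infinite) type I:
   its elements are the finitely supported functions I -> K. *)
Definition lincomb (I : choiceType) (b : I -> M) (c : monalg.malg I K) : M :=
  \sum_(i <- monalg.msupp c) monalg.mcoeff i c *: b i.

Definition is_basis (I : choiceType) (b : I -> M) (N : set M) : Prop :=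
  injective (lincomb b) /\ range (lincomb b) = N.

Definition free_module : Prop :=
  exists (I : choiceType) (b : I -> M), is_basis b [set: M].

Definition complement (W U : set M) : Prop :=
  [/\ forall a x y, U x -> U y -> U (a *: x + y),
      W `&` U = [set 0]
    & forall x, exists w u, [/\ W w, U u & x = w + u]].

End Modules.

Definition exact_at (X Y Z : Type) (zero : Z) (f : X -> Y) (h : Y -> Z) : Prop :=
  forall y, h y = zero <-> exists x, f x = y.

Notation ksubset n k := {S : {set 'I_n} | #|S| == k}.

Section Exterior.
Variables (K : comPzRingType) (n : nat).

(* The k-th exterior power of the free module with basis e_0, .., e_(n-1), in
   the basis e_S = e_(s_1) /\ .. /\ e_(s_k), S = {s_1 < .. < s_k}. *)
Definition ext (k : nat) := {ffun ksubset n k -> K^o}.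

HB.instance Definition _ k := GRing.Lmodule.on (ext k).

Definition ecoef (k : nat) (x : ext k) (S : {set 'I_n}) : K :=
  oapp x 0 (insub S).

Definition ebasis (k : nat) (S : ksubset n k) : ext k :=
  [ffun T => (T == S)%:R].

(* e_i /\ x.  The degree l of the target is left free in order to avoid casts
   (e.g. along g.-1.+1 = g); the result is 0 unless l = k.+1. *)
Definition wedge1 (k l : nat) (i : 'I_n) (x : ext k) : ext l :=
  [ffun S : ksubset n l => if i \in val S
             then (-1) ^+ #|[set j in val S | (j < i)%N]| * ecoef x (val S :\ i)
             else 0].

Definition wedge (k l : nat) (v : 'I_n -> K) (x : ext k) : ext l :=
  \sum_i v i *: wedge1 l i x.

Fixpoint wedge_seq (s : seq ('I_n -> K)) : ext (size s) :=
  if s is v :: s' then wedge (size s').+1 v (wedge_seq s') else [ffun=> 1].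

Lemma ecoefE k (x : ext k) (S : ksubset n k) : ecoef x (val S) = x S.
Proof. by rewrite /ecoef valK. Qed.

Lemma ecoef_out k (x : ext k) (S : {set 'I_n}) : #|S| != k -> ecoef x S = 0.
Proof. by move=> nS; rewrite /ecoef insubN. Qed.

Lemma ecoef_linear k a (x y : ext k) (S : {set 'I_n}) :
  ecoef (a *: x + y) S = a * ecoef x S + ecoef y S.
Proof.
by rewrite /ecoef; case: insub => [T|] /=; rewrite ?ffunE ?mulr0 ?addr0.
Qed.

Lemma ext_eqP k (x y : ext k) : (forall S, ecoef x S = ecoef y S) -> x = y.
Proof. by move=> e; apply/ffunP => S; rewrite -!ecoefE. Qed.

Lemma ecoef_wedge1 k l i (x : ext k) (S : {set 'I_n}) : l = k.+1 ->
  ecoef (wedge1 l i x) S =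
  if i \in S then (-1) ^+ #|[set j in S | (j < i)%N]| * ecoef x (S :\ i) else 0.
Proof.
move=> ->; rewrite {1}/ecoef; case: insubP => [T _ <-|nS]; first by rewrite /= ffunE.
case: ifP => // iS; rewrite ecoef_out ?mulr0 //.
by apply: contra nS; rewrite (cardsD1 i S) iS.
Qed.

Lemma wedge1_linear k l i : linear (wedge1 l i : ext k -> ext l).
Proof.
move=> a x y; apply/ffunP => S; rewrite !ffunE.
case: ifP => _; last by rewrite scaler0 addr0.
by rewrite ecoef_linear mulrDr; congr (_ + _); rewrite mulrCA.
Qed.

HB.instance Definition _ k l i :=
  GRing.isLinear.Build K (ext k) (ext l) *:%R (wedge1 l i) (@wedge1_linear k l i).

Lemma ecoef0 k (S : {set 'I_n}) : ecoef (0 : ext k) S = 0.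
Proof. by rewrite /ecoef; case: insub => //= ?; rewrite ffunE. Qed.

Lemma ecoefN k (x : ext k) (S : {set 'I_n}) : ecoef (- x) S = - ecoef x S.
Proof.
by rewrite -[- x]addr0 -scaleN1r ecoef_linear ecoef0 addr0 mulN1r.
Qed.

Lemma wedge1_wedge1 k i (x : ext k) : wedge1 k.+2 i (wedge1 k.+1 i x) = 0.
Proof.
apply: ext_eqP => S; rewrite ecoef0 !ecoef_wedge1 // !inE eqxx /= mulr0.
exact: if_same.
Qed.

Lemma wedge1_swap k i j (x : ext k) :
  wedge1 k.+2 i (wedge1 k.+1 j x) = - wedge1 k.+2 j (wedge1 k.+1 i x).
Proof.
wlog lt_ij : i j / (i < j)%N.
  move=> H; have [/H//|ji|/ord_inj ->] := ltngtP i j.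
    by rewrite (H j i ji) opprK.
  by rewrite wedge1_wedge1 oppr0.
apply: ext_eqP => S; rewrite ecoefN !ecoef_wedge1 // !inE [j == i]eq_sym.
have nij : i != j by apply: contraTneq lt_ij => ->; rewrite ltnn.
rewrite nij /=; case: ifP => iS; case: ifP => jS; rewrite ?mulr0 ?oppr0 //.
rewrite !mulrA !finset.setDDl [(_ :|: _)%SET]finset.setUC -mulNr; congr (_ * _).
have -> : [set t in S :\ j | (t < i)%N] = [set t in S | (t < i)%N].
  apply/finset.setP => t; rewrite !inE; case: eqVneq => // ->.
  by rewrite ltnNge (ltnW lt_ij) /= !andbF.
have -> : #|[set t in S | (t < j)%N]| = #|[set t in S :\ i | (t < j)%N]|.+1.
  rewrite (cardsD1 i) !inE iS lt_ij /= add1n; congr (_.+1); apply: eq_card => t.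
  by rewrite !inE andbA.
by rewrite exprS mulN1r !mulNr opprK mulrC.
Qed.

End Exterior.

Lemma wedge1_degree (K : comPzRingType) n k l i (x : ext K n k) :
  l != k.+1 -> wedge1 l i x = 0.
Proof.
move=> lk; apply/ffunP => S; rewrite !ffunE; case: ifP => // iS.
rewrite ecoef_out ?mulr0 //; apply: contra lk => /eqP <-.
by rewrite eq_sym; have := valP S; rewrite (cardsD1 i) iS.
Qed.

(* V has the basis e_0, .., e_(2g-1) = beta_1, .., beta_g, alpha_1, .., alpha_g,
   so that e_S is beta_I /\ alpha_K with I and K increasing. *)
Definition beta (g : nat) (i : 'I_g) : 'I_(g + g) := lshift g i.
Definition alpha (g : nat) (i : 'I_g) : 'I_(g + g) := rshift g i.
Definition beta_part (g : nat) (S : {set 'I_(g + g)}) : {set 'I_g} :=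
  [set i | beta i \in S].
Definition alpha_part (g : nat) (S : {set 'I_(g + g)}) : {set 'I_g} :=
  [set i | alpha i \in S].

(* D (x) W^k over a commutative ring D with chosen elements X_1, .., X_g *)
Section WComplex.
Variables (D : comNzRingType) (g : nat) (X : 'I_g -> D).

Local Notation extV k := (ext D (g + g) k).

Definition omega_wedge (k : nat) (x : extV k) : extV k.+2 :=
  \sum_i wedge1 k.+2 (beta i) (wedge1 k.+1 (alpha i) x).

Definition omega_ideal (k : nat) : set (extV k) :=
  if k is k'.+2 then range (@omega_wedge k') else [set 0].

(* D (x) W^k as the quotient of D (x) /\^k V by omega /\ (D (x) /\^(k-2) V) *)
Definition DW (k : nat) := quotmod (@omega_ideal k).

HB.instance Definition _ k := GRing.Lmodule.on (DW k).

(* As for [wedge1], the degree l of the target is free; only l = k.+1 is used. *)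
Definition dextV (k l : nat) (x : extV k) : extV l :=
  \sum_i X i *: wedge1 l (alpha i) x.

Lemma dextV_linear k l : linear (@dextV k l).
Proof.
move=> a x y; rewrite /dextV scaler_sumr -big_split /=; apply: eq_bigr => i _.
by rewrite linearP scalerDr !scalerA mulrC.
Qed.

HB.instance Definition _ k l :=
  GRing.isLinear.Build D (extV k) (extV l) *:%R (@dextV k l) (@dextV_linear k l).

Lemma dextV_omega k (x : extV k) :
  dextV k.+3 (omega_wedge x) = omega_wedge (dextV k.+1 x).
Proof.
rewrite /dextV /omega_wedge.
under eq_bigr do rewrite linear_sum scaler_sumr.
rewrite exchange_big /=; apply: eq_bigr => j _.
rewrite !linear_sum /=; apply: eq_bigr => i _.
rewrite linearZ linearZ; congr (_ *: _).
by rewrite wedge1_swap (wedge1_swap (alpha i) (alpha j)) linearN opprK.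
Qed.

Lemma dextV_ideal k l (x : extV k) :
  x \in span_pred (@omega_ideal k) -> dextV l x \in span_pred (@omega_ideal l).
Proof.
have [->|lk] := eqVneq l k.+1; last first.
  by rewrite /dextV big1 ?rpred0 // => i _; rewrite wedge1_degree ?scaler0.
move=> /span_predP; elim=> [|a y z yI _ IH]; first by rewrite linear0 rpred0.
rewrite linearP rpredD ?rpredZ //.
case: k {x} y {z IH} yI => [|[|k]] y; rewrite /omega_ideal /=.
- by move=> ->; rewrite linear0 rpred0.
- by move=> ->; rewrite linear0 rpred0.
- case=> w _ <-; apply: in_span_self; exists (dextV k.+1 w) => //.
  by rewrite dextV_omega.
Qed.

Definition dW (k l : nat) (q : DW k) : DW l := qclass _ (dextV l (qrepr q)).

Lemma dWE k l (x : extV k) : dW l (qclass _ x) = qclass _ (dextV l x).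
Proof.
apply/qclass_eq; rewrite -linearB; apply: dextV_ideal.
by apply/qclass_eq; rewrite qreprK.
Qed.

Lemma dW_linear k l : linear (@dW k l).
Proof.
by move=> a p q; rewrite -[p]qreprK -[q]qreprK -linearP !dWE !linearP.
Qed.

HB.instance Definition _ k l :=
  GRing.isLinear.Build D (DW k) (DW l) *:%R (@dW k l) (@dW_linear k l).

End WComplex.

Definition cexp (R : realType) (z : R[i]) : R[i] :=
  let: (a +i* b)%C := z in ((expR a * cos b) +i* (expR a * sin b))%C.

Section ThetaDivisor.
Variables (R : realType) (g : nat) (tau : 'M[R[i]]_g).

Local Notation C := R[i].
Local Notation Cg := 'rV[C]_g.
Local Notation zvec := (map_mx (intr : int -> C)).

Definition im_posdef : Prop :=
  forall x : 'rV[R]_g, x != 0 ->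
    0 < (x *m map_mx (@complex.Im R) tau *m x^T) 0 0.

(* unordered sum over Z^g: the limit along the finite subsets of Z^g *)
Definition theta (z : Cg) : C^o :=
  summability.sum (fun n : 'rV[int]_g =>
    cexp ((pi *i)%C * (zvec n *m tau *m (zvec n)^T) 0 0
          + 2 * (pi *i)%C * (zvec n *m z^T) 0 0) : C^o).

Definition theta_nonsingular : Prop :=
  forall z : Cg, theta z = 0 -> exists i : 'I_g, 'D_'e_i theta z != 0.

(* A meromorphic function on J with poles only on Theta is represented by its
   pull-back to C^g, with the junk value 0 along the zero locus of theta, so
   that equality of representatives is equality of meromorphic functions;
   [off_theta] restores this normalization. *)
Definition Jfun := Cg -> C^o.

HB.instance Definition _ := GRing.Lmodule.on Jfun.
HB.instance Definition _ := GRing.ComPzRing.on Jfun.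

Definition off_theta (f : Jfun) : Jfun := fun z => if theta z == 0 then 0 else f z.

Definition pd (i : 'I_g) (f : Jfun) : Jfun := off_theta (fun z => 'D_'e_i f z).

Definition holomorphic (h : Jfun) : Prop := forall z, differentiable h z.

Definition lattice_periodic (f : Jfun) : Prop :=
  forall (z : Cg) (m n : 'rV[int]_g), f (z + zvec m + zvec n *m tau) = f z.

(* f has poles only on Theta, of order at most n: theta^n f is holomorphic *)
Definition inA (n : nat) : set Jfun :=
  [set f | [/\ forall z, theta z = 0 -> f z = 0,
               lattice_periodic f
             & exists2 h, holomorphic h
                 & forall z, theta z != 0 -> theta z ^+ n * f z = h z]].

Definition inA_prev (n : nat) : set Jfun :=
  if n is n'.+1 then inA n' else [set 0].

Definition abelian_functions : set Jfun := [set f | exists n, inA n f].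

Definition A_pred (n : nat) : {pred Jfun} := fun f => `[< inA n f >].

Lemma A_submod n : submod_closed (A_pred n).
Proof.
split.
  apply/asboolP; split => //.
  by exists (fun=> 0) => [z|z _]; [exact: differentiable_cst|exact: mulr0].
move=> a f k /asboolP[f0 fP [hf Hf fE]] /asboolP[k0 kP [hk Hk kE]].
have E z : (a *: f + k) z = a *: f z + k z by [].
apply/asboolP; split.
- by move=> z z0; rewrite E f0 // k0 // scaler0 addr0.
- by move=> z m n'; rewrite !E fP kP.
- exists (fun z => a *: hf z + hk z) => [z|z nz].
    by apply: differentiableD; [apply: differentiableZ|].
  by rewrite E -fE // -kE // mulrDr scalerAr.
Qed.

HB.instance Definition _ n :=
  GRing.isSubmodClosed.Build C Jfun (A_pred n) (A_submod n).

Record Afun (n : nat) := MkAfun {Aval :> Jfun; Aprop : Aval \in A_pred n}.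

HB.instance Definition _ n := [isSub for @Aval n].
HB.instance Definition _ n := [Choice of Afun n by <:].
HB.instance Definition _ n := [SubChoice_isSubLmodule of Afun n by <:].

Definition grA (n : nat) := quotmod [set f : Afun n | inA_prev n (Aval f)].

HB.instance Definition _ n := GRing.Lmodule.on (grA n).

Definition gr_class (n : nat) (f : Afun n) : grA n :=
  qclass [set f : Afun n | inA_prev n (Aval f)] f.

(* differential forms sum_S w_S dz_S; d = sum_i d_i (x) dz_i *)
Definition dform (k l : nat) (w : ext Jfun g k) : ext Jfun g l :=
  \sum_i wedge1 l i [ffun S => pd i (w S)].

(* The image of d (gr_(n-1) A (x) /\^(g-1) T^* ) in gr_n A dz^g *)
Definition exact_gr (n : nat) : set (grA n) :=
  [set y | exists (f : Afun n) (w : ext Jfun g g.-1),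
     [/\ forall S, inA_prev n (w S),
         ecoef (dform g w) [set: 'I_g]%SET = Aval f & y = gr_class f]].

(* H^g_(n-g), indexed by n *)
Definition Hg (n : nat) := quotmod (@exact_gr n).

HB.instance Definition _ n := GRing.Lmodule.on (Hg n).

Definition Hclass (n : nat) (f : Afun n) : Hg n := qclass (@exact_gr n) (gr_class f).

Definition zeta (i : 'I_g) : Jfun := fun z => 'D_'e_i theta z / theta z.

Definition dzeta (i : 'I_g) : 'I_g -> Jfun := fun j => pd j (zeta i).
Definition dz (k : 'I_g) : 'I_g -> Jfun := fun j => (j == k)%:R.

(* the f with dzeta_I /\ dz_K = f dz^g, where e_S = beta_I /\ alpha_K *)
Definition Wfun (S : {set 'I_(g + g)}) : Jfun :=
  off_theta (ecoef
    (wedge_seq ([seq dzeta i | i <- enum (beta_part S)]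
                ++ [seq dz k | k <- enum (alpha_part S)]))
    [set: 'I_g]%SET).

(* deg (beta_I /\ alpha_K) + g, for #|I| + #|K| = g *)
Definition Wlevel (S : {set 'I_(g + g)}) : nat :=
  if beta_part S == finset.set0 then 0%N else #|beta_part S|.+1.

(* W^g_(n-g) as a subspace of H^g_(n-g) *)
Definition Wgr (n : nat) : set (Hg n) :=
  [set x | in_span [set Hclass f | f in
     [set f : Afun n | exists S : ksubset (g + g) g,
        Wlevel (val S) = n /\ Aval f = Wfun (val S)]] x].

Definition Dring : comNzRingType := mpoly g C.

Definition Dvar (i : 'I_g) : Dring := mpolyX C (mnm1 i).

Definition Dact (P : Dring) (f : Jfun) : Jfun :=
  \sum_(m <- msupp P) mcoeff m P *:
    foldr (fun i h => iter (m i) (pd i) h) f (enum 'I_g).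

Section Evaluation.
(* The degree n part of the chosen basis of U^g is indexed by B n. *)
Variables (B : nat -> choiceType) (f : forall n, B n -> Afun n).

Definition DU := monalg.malg {n : nat & B n} Dring.

HB.instance Definition _ := GRing.Lmodule.on DU.

(* D (x) H^g = (D (x) W^g) (+) (D (x) U^g) *)
Definition DH := (DW Dring g g * DU)%type.

Definition dTW (k : nat) : DW Dring g k -> DW Dring g k.+1 := @dW _ _ Dvar k k.+1.

Definition dH (w : DW Dring g g.-1) : DH := (dW Dvar g w, 0).

Definition D_linear (M : lmodType Dring) (ev : M -> Jfun) : Prop :=
  forall P x y, ev (P *: x + y) = Dact P (ev x) + ev y.

Definition is_evaluation (ev : DH -> Jfun) : Prop :=
  [/\ D_linear ev,
      forall (P : Dring) (S : ksubset (g + g) g),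
        ev (qclass _ (P *: ebasis Dring S), 0) = Dact P (Wfun (val S))
    & forall (P : Dring) (b : {n : nat & B n}),
        ev (0, monalg.mkmalgU b P) = Dact P (f (tagged b))].

End Evaluation.

End ThetaDivisor.

Arguments Wgr {R g} tau n _ : rename.
Arguments dTW {R g} k _.
Arguments Dvar {R g} i.

(* Main.v *)
(* A function with poles on Theta lifts to h / theta^n with h entire and Z^g-periodic,
   i.e. a Laurent series in the exp (2 pi i z_j), and it descends to J iff it is fixed
   by the translations T_j along the columns of tau.  Work with forms in the
   alpha_i = dz_i and in further generators beta_j that record cochains of the T_j.
   Three facts are combined:
   - the derivatives of theta and theta itself generate the unit ideal of the ring of
     periodic entire functions (Theta is non-singular), so that multiplication by
     zeta = sum_i zeta_i dz_i is exact up to lower poles;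
   - the Koszul complex of the T_j - 1 on functions with a pole of order n has
     cohomology only in degree 0 if n > 0, only in degree g if n < 0, and only from the
     constants if n = 0; on Fourier coefficients the T_j become shifts, and a Cholesky
     decomposition of Im tau turns growth conditions into one-variable ones;
   - omega /\ - is injective on /\^k V for k < g (Lefschetz).
   Descending along the pole order, a form of degree g - 1 and pole order n whose
   differential also has pole order n is, modulo exact forms and lower poles, a constant
   combination of the d zeta_I /\ dz_K; and such a combination in degree g is exact modulo
   lower poles only if it comes from omega /\ /\^(g-2) V.  Induction on the degree in
   D (x) H^g then gives exactness at the last two places.  The rest of the sequence is
   the Koszul complex of D modulo omega, where Lefschetz applies once more. *)

(* Lattice cochains stand in for sheaf cohomology: the Koszul complex of the T_j - 1 on Z^g-periodic
   functions h / theta^n computes the cohomology of O(n Theta) on J, so that alpha and beta together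
   carry the cohomology of J. The link between the two sides is T_j zeta_i - zeta_i = - 2 pi i
   delta_ij: moving zeta /\ - across the cochain differential costs - 2 pi i omega on constants,
   which is where omega, hence W^k and Lefschetz, come from. Since d (h theta^-n) = theta^-n dh - n
   zeta h theta^-n, a form of order n <> 0 has a differential of the same order exactly when its
   product with zeta has; this condition ([Om]) is what the descent preserves. Division by zeta
   needs the unit ideal globally, over all periodic entire functions: it is solved on thin tubes,
   merged along Laurent splittings, and extended over an exhaustion by cubes. The analysis is done
   without integrals: Fourier coefficients are limits of dyadic averages along an ultrafilter, and
   Goursat's argument is run on these averages. *)
Require Import Defs.
From HB Require Import structures.
From mathcomp Require Import all_boot all_order all_algebra.
From mathcomp Require Import complex.
From mathcomp Require Import all_classical all_reals all_analysis.
From mathcomp Require Import -(notations) finmap monalg mpoly.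
From mathcomp Require Import ring lra zify.

Set Implicit Arguments.
Unset Strict Implicit.
Unset Printing Implicit Defensive.

Import Order.TTheory GRing.Theory Num.Theory.
Import numFieldNormedType.Exports.

Local Open Scope classical_set_scope.
Local Open Scope ring_scope.

Notation nc := ComplexField.Normc.normc.

(** * Complex differentiability *)

Section ComplexModulus.
Variable R : realType.
Implicit Types z w : R[i].

Lemma normE z : `|z| = (nc z)%:C%C.
Proof. done. Qed.

Lemma nc0 : nc (0 : R[i]) = 0. Proof. exact: ComplexField.Normc.normc0. Qed.
Lemma nc1 : nc (1 : R[i]) = 1. Proof. exact: ComplexField.Normc.normc1. Qed.
Lemma ncM z w : nc (z * w) = nc z * nc w.
Proof. exact: ComplexField.Normc.normcM. Qed.
Lemma ncV z : nc z^-1 = (nc z)^-1.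
Proof. exact: ComplexField.Normc.normcV. Qed.
Lemma nc_eq0 z : nc z = 0 -> z = 0. Proof. exact: ComplexField.Normc.eq0_normc. Qed.
Lemma ncD z w : nc (z + w) <= nc z + nc w. Proof. exact: le_normcD. Qed.
Lemma ncN z : nc (- z) = nc z. Proof. exact: normcN. Qed.
Lemma ncB z w : nc (z - w) <= nc z + nc w. Proof. by rewrite -[nc w]ncN ncD. Qed.
Lemma nc_ge0 z : 0 <= nc z. Proof. by case: z => a b; rewrite sqrtr_ge0. Qed.
Lemma nc_gt0 z : z != 0 -> 0 < nc z.
Proof. by move=> z0; rewrite lt_neqAle nc_ge0 andbT eq_sym; apply: contra z0 => /eqP/nc_eq0->. Qed.
Lemma nc_distC z w : nc (z - w) = nc (w - z). Proof. by rewrite -ncN opprB. Qed.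
Lemma ncX z n : nc (z ^+ n) = nc z ^+ n.
Proof. by elim: n => [|n IH]; rewrite ?nc1 // !exprS ncM IH. Qed.
Lemma nc_real (x : R) : nc x%:C%C = `|x|.
Proof. by rewrite /= expr0n addr0 sqrtr_sqr. Qed.
Lemma nc_natr n : nc (n%:R : R[i]) = n%:R.
Proof. by rewrite -(rmorph_nat (real_complex R)) nc_real ger0_norm. Qed.
Lemma nc_sum (I : Type) (r : seq I) (P : pred I) (F : I -> R[i]) :
  nc (\sum_(i <- r | P i) F i) <= \sum_(i <- r | P i) nc (F i).
Proof.
elim/big_rec2: _ => [|i y x _ le]; first by rewrite nc0.
by apply: le_trans (ncD _ _) _; rewrite lerD2l.
Qed.
Lemma ler_nc_dist z w : nc z - nc w <= nc (z - w).
Proof. by rewrite lerBlDr; apply: le_trans (ncD _ _); rewrite subrK. Qed.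
Lemma Re_le_nc z : `|complex.Re z| <= nc z.
Proof.
case: z => a b; rewrite -sqrtr_sqr ler_wsqrtr // lerDl sqr_ge0 //.
Qed.
Lemma Im_le_nc z : `|complex.Im z| <= nc z.
Proof.
case: z => a b; rewrite -sqrtr_sqr ler_wsqrtr // lerDr sqr_ge0 //.
Qed.
Lemma nc_le_ReIm z : nc z <= `|complex.Re z| + `|complex.Im z|.
Proof.
rewrite {1}[z]complexE; apply: le_trans (ncD _ _) _; rewrite ncM !nc_real.
have -> : nc ('i%C : R[i]) = 1 by rewrite /= expr0n add0r expr1n sqrtr1.
lra.
Qed.
Lemma nc_small_eq0 z : (forall e : R, 0 < e -> nc z <= e) -> z = 0.
Proof.
move=> H; apply: nc_eq0; apply/eqP; rewrite eq_le nc_ge0 andbT.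
by apply/ler_addgt0Pr => e e0; rewrite add0r H.
Qed.

End ComplexModulus.

(** * Complex gradients of functions on C^g *)

Section FrechetDerivative.
Variables (R : realType) (g : nat).
Local Notation C := R[i].
Local Notation Cg := 'rV[C]_g.
Local Notation CgN := (Cg : normedModType C).
Implicit Types (f : Cg -> C^o) (z h : Cg) (L : 'I_g -> C).

(** Real moduli [nc] replace the norm of [R[i]], whose values lie in the partially ordered field
    itself; the l1 form of the remainder suits termwise estimates of series. *)
Definition has_grad f z L := forall e : R, 0 < e -> exists2 d : R, 0 < d &
  forall h, (forall i, nc (h 0 i) < d) ->
    nc (f (h + z) - f z - \sum_i h 0 i * L i) <= e * \sum_i nc (h 0 i).

Lemma mx_norm_le_sum h : `|h| <= (\sum_i nc (h 0 i))%:C%C.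
Proof.
rewrite -[leLHS]/(mx_norm h).
have [->|/mx_norm_neq0[[a b] ->]] := eqVneq (mx_norm h) 0.
  rewrite ler0c sumr_ge0 // => i _; exact: nc_ge0.
rewrite ord1 lecR (bigD1 b) //= lerDl sumr_ge0 // => i _; exact: nc_ge0.
Qed.

Lemma near0_entries (P : Cg -> Prop) :
  (\forall h \near (0 : CgN), P h) <->
  (exists2 d : R, 0 < d & forall h, (forall i, nc (h 0 i) < d) -> P h).
Proof.
split.
  move/nbhs_ballP => [e /= e0 be]; have := e0; rewrite ltcE => /andP[/eqP Ie].
  exists (complex.Re e) => // h hd; apply: be; split => // i j.
  rewrite !mxE ord1 /ball /= sub0r normrN.
  by rewrite ltcE Ie eqxx /=.
move=> [d d0 H]; apply/nbhs_ballP; exists d%:C%C => /=; first by rewrite ltcR.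
move=> h [_ hd]; apply: H => i.
have := hd ord0 i; rewrite !mxE /ball /= sub0r normrN.
by rewrite ltcR.
Qed.

Definition grad_lin L h : C^o := \sum_i h 0 i * L i.

Lemma grad_lin_linear L : linear (grad_lin L).
Proof.
move=> a x y; rewrite scaler_sumr -big_split; apply: eq_bigr => i.
by rewrite !mxE mulrDl scalerAl.
Qed.
HB.instance Definition _ L :=
  GRing.isLinear.Build C Cg C^o *:%R (grad_lin L) (@grad_lin_linear L).

Lemma grad_lin_continuous L : continuous (grad_lin L : CgN -> C^o).
Proof.
move=> x A /nbhs_ballP[e /= e0 be].
have [e1 e10] : exists2 e1, 0 < e1 & e = e1%:C%C.
  move: e0; rewrite ltcE => /andP[/eqP Ie]; exists (complex.Re e) => //.
  by apply/eqP; rewrite eq_complex Ie !eqxx.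
move=> ee; pose M := \sum_i nc (L i) + 1.
have M0 : 0 < M by rewrite ltr_wpDl // sumr_ge0 // => i _; exact: nc_ge0.
suff : nbhs (x : CgN) (grad_lin L @^-1` A) by [].
apply/nbhs_ballP; exists (e1 / 2 / M)%:C%C => /=; first by rewrite ltcR !divr_gt0.
move=> y [_ hd]; apply: be; rewrite /ball /= -linearB ee ltcR.
apply: (@le_lt_trans _ _ (e1 / 2)); last by rewrite ltr_pdivrMr // ltr_pMr // ltr1n.
apply: le_trans (nc_sum _ _ _) _.
apply: (@le_trans _ _ (\sum_i (e1 / 2 / M) * nc (L i))).
  apply: ler_sum => i; rewrite ncM ler_wpM2r ?nc_ge0 // !mxE ltW //.
  by have := hd ord0 i; rewrite /ball /= ltcR.
rewrite -mulr_sumr mulrAC ler_pdivrMr // ler_wpM2l ?divr_ge0 ?(ltW e10) //.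
by rewrite lerDl.
Qed.

Lemma has_grad_differentiable (f : CgN -> C^o) (z : CgN) L : has_grad f z L ->
  differentiable (f : CgN -> C^o) (z : CgN) /\ 'd (f : CgN -> C^o) (z : CgN) = grad_lin L :> (CgN -> C^o).
Proof.
move=> H.
have E : (f : CgN -> C^o) \o shift (z : CgN) = cst (f z) + (grad_lin L : CgN -> C^o) +o_ (0 : CgN) (id : CgN -> CgN).
  apply/eqaddoP => e e0.
  have [e1 e10 ->] : exists2 e1, 0 < e1 & e = e1%:C%C.
    move: e0; rewrite ltcE => /andP[/eqP Ie]; exists (complex.Re e) => //.
    by apply/eqP; rewrite eq_complex Ie !eqxx.
  have e2 : 0 < e1 / g.+1%:R by rewrite divr_gt0.
  have [d d0 Hd] := H _ e2.
  apply/near0_entries; exists d => // h hd.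
  have -> : (((f : CgN -> C^o) \o shift (z : CgN)) - (cst (f z) + grad_lin L)) h = f (h + z) - f z - \sum_i h 0 i * L i.
    by rewrite opprD addrA.
  rewrite normE; apply: (@le_trans _ _ ((e1 / g.+1%:R * \sum_i nc (h 0 i))%:C%C)).
    rewrite lecR; exact: Hd.
  rewrite rmorphM rmorphM -mulrA ler_wpM2l ?ler0c ?(ltW e10) //.
  rewrite rmorph_sum mulr_sumr.
  apply: (@le_trans _ _ (\sum_(i < g) (g.+1%:R^-1)%:C%C * `|h|)).
    apply: ler_sum => i; rewrite ler_wpM2l ?ler0c //.
    rewrite -[leRHS]/(mx_norm h).
    exact: (le_bigmax 0%:nng (fun i : 'I_1 * 'I_g => `|h i.1 i.2|%:nng) (ord0, i)).
  rewrite sumr_const card_ord -[leLHS]mulr_natl mulrA ler_piMl //.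
  rewrite fmorphV rmorph_nat ler_pdivrMr // mul1r ler_nat //.
have D := diff_unique (@grad_lin_continuous L) E; split => //.
apply/diff_locallyP; rewrite D; split => //; exact: (@grad_lin_continuous).
Qed.

Lemma differentiable_has_grad f z : differentiable (f : CgN -> C^o) (z : CgN) ->
  has_grad f z (fun i => 'D_'e_i (f : CgN -> C^o) z).
Proof.
move=> df e e0; have [_ /eqaddoP/(_ e%:C%C)] := (diff_locallyP (z : CgN) (f : CgN -> C^o)).1 df.
rewrite ltcR => /(_ e0)/near0_entries[d d0 Hd]; exists d => // h hd.
have := Hd h hd.
have -> : (((f : CgN -> C^o) \o shift (z : CgN)) - (cst (f z) + 'd (f : CgN -> C^o) (z : CgN))) h = f (h + z) - f z - 'd (f : CgN -> C^o) (z : CgN) h.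
  by rewrite opprD addrA.
have -> : 'd (f : CgN -> C^o) (z : CgN) h = \sum_i h 0 i * 'D_'e_i (f : CgN -> C^o) z.
  rewrite {1}(row_sum_delta h) linear_sum; apply: eq_bigr => i.
  by rewrite linearZ deriveE.
rewrite normE => le; rewrite -lecR; apply: le_trans le _.
by rewrite rmorphM ler_wpM2l ?ler0c ?(ltW e0) // mx_norm_le_sum.
Qed.

Lemma has_gradP f z L : has_grad f z L ->
  differentiable (f : CgN -> C^o) (z : CgN) /\ forall i, 'D_'e_i (f : CgN -> C^o) z = L i.
Proof.
move=> /has_grad_differentiable[df dE]; split => // i.
rewrite deriveE // dE /grad_lin (bigD1 i) //= big1 ?addr0 => [|j ji].
  by rewrite mxE !eqxx mul1r.
by rewrite mxE (negbTE ji) mul0r.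
Qed.

Definition cont_at f z := forall e : R, 0 < e -> exists2 d : R, 0 < d &
  forall h, (forall i, nc (h 0 i) < d) -> nc (f (h + z) - f z) <= e.

Lemma has_grad_cont f z L : has_grad f z L -> cont_at f z.
Proof.
move=> H e e0; have [d d0 Hd] := H 1 ltr01.
pose M := \sum_i (1 + nc (L i)) + 1.
have : 0 < M by rewrite ltr_wpDl // sumr_ge0 // => i; rewrite addr_ge0 ?nc_ge0.
exists (Num.min d (e / M)); first by rewrite lt_min d0 divr_gt0.
move=> h hd; rewrite -(subrK (\sum_i h 0 i * L i) (f (h + z) - f z)).
apply: le_trans (ncD _ _) _.
apply: (@le_trans _ _ (\sum_i nc (h 0 i) + \sum_i nc (h 0 i) * nc (L i))).
  apply: lerD; first by rewrite -[leRHS]mul1r; apply: Hd => i; have := hd i; rewrite lt_min => /andP[].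
  by apply: le_trans (nc_sum _ _ _) _; apply: ler_sum => i; rewrite ncM.
rewrite -big_split /=.
apply: (@le_trans _ _ (\sum_i (e / M) * (1 + nc (L i)))).
  apply: ler_sum => i; rewrite -{1}[nc _]mulr1 -mulrDr ler_wpM2r ?addr_ge0 ?nc_ge0 //.
  by have := hd i; rewrite lt_min => /andP[_ /ltW].
by rewrite -mulr_sumr mulrAC ler_pdivrMr // ler_wpM2l ?(ltW e0) // lerDl.
Qed.

End FrechetDerivative.

(** * Goursat's theorem *)

Section Bisection.
Variables (R : realType) (I : finType).

Lemma exp2_small (s d : R) : 0 < d -> exists n, s / 2 ^+ n < d.
Proof.
move=> d0; exists (Num.truncn (s / d)).+1; rewrite ltr_pdivrMr // mulrC -ltr_pdivrMr //.
have [sd|sd] := ltP (s / d) 0; first by rewrite (lt_trans sd).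
have /andP[_ lt1] := truncn_itv sd; apply: lt_le_trans lt1 _.
by rewrite -natrX ler_nat ltnW // ltn_expl.
Qed.

(** Compactness of the cube as a nested-cube argument: if [G] failed, it would fail on cubes of edge
    s0 / 2^n shrinking to a point, against the local hypothesis. It serves Goursat's theorem and the
    finite-cover arguments on tori and boxes. *)
Lemma bisection (G : (I -> R) -> R -> Prop) (x0 : I -> R) (s0 : R) : 0 < s0 ->
  (forall x s, 0 < s ->
     (forall c : {ffun I -> bool}, G (fun i => x i + (c i)%:R * (s / 2)) (s / 2)) -> G x s) ->
  (forall z, (forall i, x0 i <= z i <= x0 i + s0) ->
     exists2 d, 0 < d & forall x s, 0 < s < d -> (forall i, x i <= z i <= x i + s) -> G x s) ->
  G x0 s0.
Proof.
move=> s00 Hc Hl; apply: contrapT => nG.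
pose st := {p : (I -> R) * R | 0 < p.2 /\ ~ G p.1 p.2}.
have step (p : st) : {q : st | exists c : {ffun I -> bool},
   (sval q).1 = (fun i => (sval p).1 i + (c i)%:R * ((sval p).2 / 2)) /\ (sval q).2 = (sval p).2 / 2}.
  case: p => [[x s] [s_gt0 nGx]]; apply: cid.
  have /existsNP[c nGc] : ~ (forall c : {ffun I -> bool}, G (fun i => x i + (c i)%:R * (s / 2)) (s / 2)).
    by move=> H; apply: nGx; apply: Hc.
  have H : 0 < s / 2 /\ ~ G (fun i => x i + (c i)%:R * (s / 2)) (s / 2) by split => //; rewrite divr_gt0.
  by exists (exist _ (_, _) H); exists c.
pose fix sq n := if n is n'.+1 then sval (step (sq n')) else
  exist (fun p : (I -> R) * R => 0 < p.2 /\ ~ G p.1 p.2) (x0, s0) (conj s00 nG).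
pose x n := (sval (sq n)).1; pose s n := (sval (sq n)).2.
have sE n : s n = s0 / 2 ^+ n.
  elim: n => [|n]; first by rewrite divr1.
  rewrite /s; case: (svalP (step (sq n))) => c; rewrite exprSr.
  lra.
have sgt0 n : 0 < s n by rewrite sE divr_gt0.
have xS n i : x n i <= x n.+1 i /\ x n.+1 i + s n.+1 <= x n i + s n.
  rewrite /x; case: (svalP (step (sq n))) => c [->].
  have := sgt0 n; case: (c i) => /=; lra.
have xm n k i : x n i <= x (n + k)%N i /\ x (n + k)%N i + s (n + k)%N <= x n i + s n.
  elim: k => [|k [IH1]]; first by rewrite addn0.
  rewrite addnS; have := xS (n + k)%N i.
  lra.
have xub m n i : x m i <= x n i + s n.
  have [le|/ltnW le] := leqP m n.
    have := (xm m (n - m)%N i).1; rewrite subnKC // => h.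
    by apply: le_trans h _; rewrite lerDl ltW.
  have := (xm n (m - n)%N i).2; rewrite subnKC // => h.
  by apply: le_trans h; rewrite lerDl ltW.
(* The common point of the nested cubes, coordinate by coordinate. *)
pose z i := sup (range (fun n => x n i)).
have zb n i : x n i <= z i <= x n i + s n.
  apply/andP; split.
    apply: ub_le_sup; last by [].
    by exists (x 0%N i + s 0%N) => _ [m _ <-].
  by apply: ge_sup; [exists (x 0%N i); exists 0%N|move=> _ [m _ <-]; exact: xub].
have [|d d0 Hd] := Hl z.
  by move=> i; have := zb 0%N.
have [n sn] := exp2_small s0 d0.
have [_ nGn] := svalP (sq n); apply: nGn; apply: Hd; last by move=> i; exact: zb.
by rewrite -/(s n) sgt0 sE.
Qed.
End Bisection.

(** * Dyadic averages and contours *)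

Section DyadicAverage.
Variables (R : realType) (g : nat).
Local Notation C := R[i].
Local Notation Cg := 'rV[C]_g.
Implicit Types (f : Cg -> C) (p z w h : Cg) (v : 'I_g -> C) (s : R).

Definition corner v s (c : {ffun 'I_g -> bool}) : Cg := \row_i ((c i)%:R * (s / 2)%:C%C * v i).

(* the average of f over the 2 ^ (r g) dyadic points of the parallelepiped
   with vertex p and edges s v_i e_i *)
Fixpoint davg (r : nat) v s p f : C :=
  if r is r'.+1 then (2 ^+ g)^-1 * \sum_c davg r' v (s / 2) (p + corner v s c) f else f p.

Lemma card_corners : #|{ffun 'I_g -> bool}|%:R = 2 ^+ g :> C.
Proof. by rewrite card_ffun card_bool card_ord natrX. Qed.

Lemma davg_ext r v s p f1 f2 : f1 =1 f2 -> davg r v s p f1 = davg r v s p f2.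
Proof.
move=> e; elim: r s p => [|r IH] s p; [exact: e|congr (_ * _); apply: eq_bigr => c _; exact: IH].
Qed.

Lemma davgD r v s p f1 f2 : davg r v s p (fun z => f1 z + f2 z) = davg r v s p f1 + davg r v s p f2.
Proof.
elim: r s p => [//|r IH] s p; rewrite -mulrDr -big_split; congr (_ * _).
by apply: eq_bigr.
Qed.

Lemma davgZ r v s p a f : davg r v s p (fun z => a * f z) = a * davg r v s p f.
Proof.
elim: r s p => [//|r IH] s p; rewrite mulrCA; congr (_ * _); rewrite mulr_sumr.
by apply: eq_bigr.
Qed.

Lemma davg_cst r v s p a : davg r v s p (fun=> a) = a.
Proof.
elim: r s p => [//|r IH] s p /=; rewrite (eq_bigr (fun=> a)) ?sumr_const //.
by rewrite -[a *+ _]mulr_natl card_corners mulrA mulVf ?mul1r.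
Qed.

Lemma davg_sum (J : Type) (l : seq J) (P : pred J) r v s p (F : J -> Cg -> C) :
  davg r v s p (fun z => \sum_(j <- l | P j) F j z) = \sum_(j <- l | P j) davg r v s p (F j).
Proof.
elim: l => [|j l IH].
  by rewrite big_nil -[RHS](davg_cst r v s p); apply: davg_ext => z; rewrite big_nil.
rewrite big_cons -IH; case: ifP => Pj; last by apply: davg_ext => z; rewrite big_cons Pj.
by rewrite -davgD; apply: davg_ext => z; rewrite big_cons Pj.
Qed.

Lemma davg_bound r v s p f (B : R) : 0 <= s ->
  (forall u : 'I_g -> R, (forall i, 0 <= u i <= 1) -> nc (f (p + \row_i ((u i * s)%:C%C * v i))) <= B) ->
  nc (davg r v s p f) <= B.
Proof.
elim: r s p => [|r IH] s p s0 H.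
  have := H (fun=> 0); rewrite (_ : \row_i _ = 0) ?addr0; first by apply; rewrite ?lexx ?ler01.
  by apply/rowP => i; rewrite !mxE mul0r mul0r.
rewrite ncM ncV ncX (nc_natr) ler_pdivrMl //.
apply: le_trans (nc_sum _ _ _) _.
apply: (@le_trans _ _ (\sum_(c : {ffun 'I_g -> bool}) B)).
  apply: ler_sum => c _; apply: IH; first by rewrite divr_ge0.
  move=> u u01; have := H (fun i => (u i + (c i)%:R) / 2).
  rewrite -addrA (_ : corner v s c + _ = \row_i ((((u i + (c i)%:R) / 2) * s)%:C%C * v i)).
    apply => i; have := u01 i; case: (c i) => /=; lra.
  apply/rowP => i; rewrite !mxE.
  ring.
by rewrite sumr_const card_ffun card_bool card_ord -[_ *+ _]mulr_natl natrX.
Qed.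

Lemma davg_shift r v s p w f : davg r v s (p + w) f = davg r v s p (fun z => f (z + w)).
Proof.
elim: r s p => [//|r IH] s p; congr (_ * _); apply: eq_bigr => c.
by rewrite addrAC.
Qed.

Lemma davg_affine r v s p w (a : C) (L : 'I_g -> C) (z0 : Cg) :
  davg r v s (p + w) (fun z => a + \sum_i (z - z0) 0 i * L i)
  - davg r v s p (fun z => a + \sum_i (z - z0) 0 i * L i) = \sum_i w 0 i * L i.
Proof.
rewrite davg_shift; apply/eqP; rewrite subr_eq addrC; apply/eqP.
rewrite -[X in _ + X](davg_cst r v s p) -davgD; apply: davg_ext => z.
rewrite -[RHS]addrA; congr (_ _); rewrite -big_split /=; apply: eq_bigr => i.
by rewrite -mulrDl !mxE addrAC.
Qed.

Definition estep (j : 'I_g) (a : C) : Cg := a *: delta_mx 0 j.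

(** Edge vectors of the box whose j-th edge points in the direction sigma; it carries the second
    pair of sides of [contour]. *)
Definition skew (j : 'I_g) (sigma : C) : 'I_g -> C := fun i => if i == j then sigma else 1.

(** The integral around the parallelogram with sides s e_j and s sigma e_j, divided by s and
    averaged over the other coordinates, with dyadic averages in place of integrals. *)
Definition contour r (j : 'I_g) (sigma : C) s p f : C :=
  (davg r (fun=> 1) s p f - davg r (fun=> 1) s (p + estep j (s%:C%C * sigma)) f)
  + sigma * (davg r (skew j sigma) s (p + estep j s%:C%C) f - davg r (skew j sigma) s p f).

(** [None] is the coordinate along sigma e_j, so the bisection runs in dimension g + 1. *)
Definition bpoint (j : 'I_g) (sigma : C) (p : Cg) (x : option 'I_g -> R) : Cg :=
  p + \row_i ((x (Some i))%:C%C) + estep j ((x None)%:C%C * sigma).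

(** Inner sides of the 2^(g+1) half-size contours cancel in pairs. For the sides in the direction
    sigma, the j-th corner bit and the bit of [None] are first exchanged ([sw]) so that the sum
    telescopes. *)
Lemma contour_halve r j sigma s p x f :
  contour r.+1 j sigma s (bpoint j sigma p x) f = (2 ^+ g)^-1 *
    \sum_(c : {ffun option 'I_g -> bool})
      contour r j sigma (s / 2) (bpoint j sigma p (fun i => x i + (c i)%:R * (s / 2))) f.
Proof.
pose pr (c : {ffun option 'I_g -> bool}) := ([ffun i => c (Some i)], c None) : {ffun 'I_g -> bool} * bool.
pose prV (q : {ffun 'I_g -> bool} * bool) := [ffun i => if i is Some i' then q.1 i' else q.2].
have prK : cancel pr prV by move=> c; apply/ffunP => -[i|]; rewrite !ffunE.
have prVK : cancel prV pr.
  by move=> [c d]; rewrite /pr ffunE; congr (_, _); apply/ffunP => i; rewrite !ffunE.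
rewrite (reindex prV); last by exists pr => c _; [exact: prVK|exact: prK].
rewrite -(pair_bigA _ (fun c d => contour r j sigma (s / 2)
  (bpoint j sigma p (fun i => x i + (prV (c, d) i)%:R * (s / 2))) f)) /=.
have P c d : bpoint j sigma p (fun i => x i + (prV (c, d) i)%:R * (s / 2)) =
    bpoint j sigma p x + (corner (fun=> 1) s c + estep j (d%:R * (s / 2)%:C%C * sigma)).
  apply/rowP => i; rewrite !mxE !ffunE !rmorphD !rmorphM !rmorph_nat /=.
  by rewrite -?[(GRing.natmul _ (nat_of_bool _))]/(_%:R); ring.
set P0 := bpoint j sigma p x in P *.
pose H q := davg r (fun=> 1) (s / 2) (P0 + q) f.
pose V q := davg r (skew j sigma) (s / 2) (P0 + q) f.
pose t := estep j ((s / 2)%:C%C * sigma); pose u := estep j (s / 2)%:C%C.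
pose K (q : {ffun 'I_g -> bool} * bool) := corner (fun=> 1) s q.1 + estep j (q.2%:R * (s / 2)%:C%C * sigma).
have hs : s%:C%C = (s / 2)%:C%C + (s / 2)%:C%C :> C by rewrite -rmorphD /=; congr (_%:C)%C; field.
have estepD a b : estep j (a + b) = estep j a + estep j b by rewrite /estep scalerDl.
have -> : \sum_c \sum_d contour r j sigma (s / 2) (bpoint j sigma p
      (fun i => x i + (prV (c, d) i)%:R * (s / 2))) f =
    \sum_c \sum_d (H (K (c, d)) - H (K (c, d) + t)) +
    sigma * \sum_c \sum_d (V (K (c, d) + u) - V (K (c, d))).
  rewrite mulr_sumr -big_split; apply: eq_bigr => c _.
  rewrite mulr_sumr -big_split; apply: eq_bigr => d _.
  by rewrite P /contour /H /V !addrA.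
pose sw (q : {ffun 'I_g -> bool} * bool) := ([ffun i => if i == j then q.2 else q.1 i], q.1 j).
have swK : involutive sw.
  move=> [c d]; rewrite /sw /= ffunE eqxx; congr (_, _); apply/ffunP => i; rewrite !ffunE.
  by case: eqVneq => // ->.
pose Q (q : {ffun 'I_g -> bool} * bool) := corner (skew j sigma) s q.1 + estep j (q.2%:R * (s / 2)%:C%C).
have KQ q : K (sw q) = Q q.
  case: q => c d; apply/rowP => i; rewrite !mxE !ffunE /skew; case: eqVneq => [->|_] /=.
    ring.
  ring.
have -> : \sum_c \sum_d (V (K (c, d) + u) - V (K (c, d))) =
    \sum_c (V (corner (skew j sigma) s c + estep j s%:C%C) - V (corner (skew j sigma) s c)).
  rewrite (pair_bigA _ (fun c d => V (K (c, d) + u) - V (K (c, d)))).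
  rewrite (reindex_inj (inv_inj swK)).
  rewrite (eq_bigr (fun q => V (Q q + u) - V (Q q))) => [|q]; last by rewrite -!KQ.
  rewrite -(pair_bigA _ (fun c d => V (Q (c, d) + u) - V (Q (c, d)))).
  apply: eq_bigr => c; rewrite big_bool /Q mul1r mul0r /estep scale0r addr0.
  pose A := corner (skew j sigma) s c.
  transitivity (V (A + u + u) - V (A + u) + (V (A + u) - V A)); first by [].
  by rewrite addrA subrK -addrA -estepD -hs.
have -> : \sum_c \sum_d (H (K (c, d)) - H (K (c, d) + t)) =
    \sum_c (H (corner (fun=> 1) s c) - H (corner (fun=> 1) s c + estep j (s%:C%C * sigma))).
  apply: eq_bigr => c; rewrite big_bool /K mul1r !mul0r /estep scale0r addr0.
  pose A := corner (fun=> 1) s c.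
  transitivity (H (A + t) - H (A + t + t) + (H A - H (A + t))); first by [].
  by rewrite addrC addrA subrK -addrA -estepD -mulrDl -hs.
rewrite mulrDr mulrCA; congr (_ + _).
  rewrite -mulrBr -sumrB; congr (_ _); apply: eq_bigr => c.
  by rewrite /H !addrA [P0 + _ + _]addrAC.
rewrite -mulrBr -sumrB; congr (_ (_ * _)); apply: eq_bigr => c.
by rewrite /V !addrA [P0 + _ + _]addrAC.
Qed.

Lemma contour_bound r j sigma s p f (B : R) : 0 <= s ->
  (forall (a : 'I_g -> R) (b : R), (forall i, 0 <= a i <= 1) -> 0 <= b <= 1 ->
     nc (f (p + \row_i ((a i * s)%:C%C) + estep j ((b * s)%:C%C * sigma))) <= B) ->
  nc (contour r j sigma s p f) <= (2 + 2 * nc sigma) * B.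
Proof.
move=> s0 H.
have HH b : 0 <= b <= 1 -> nc (davg r (fun=> 1) s (p + estep j ((b * s)%:C%C * sigma)) f) <= B.
  move=> b01; apply: davg_bound => // u u01; have := H u b u01 b01; rewrite addrAC.
  by congr (nc (f (_)) <= _); apply/rowP => i; rewrite !mxE mulr1.
have HV a : 0 <= a <= 1 -> nc (davg r (skew j sigma) s (p + estep j (a * s)%:C%C) f) <= B.
  move=> a01; apply: davg_bound => // u u01.
  have := H (fun i => if i == j then a else u i).
  have -> : p + estep j (a * s)%:C%C + \row_i ((u i * s)%:C%C * skew j sigma i) =
    p + \row_i (((if i == j then a else u i) * s)%:C%C) + estep j ((u j * s)%:C%C * sigma).
    apply/rowP => i; rewrite !mxE /skew /=; case: eqVneq => [->|_] /=.
      ring.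
    ring.
  by apply => // i; case: eqP.
have z01 : 0 <= (0 : R) <= 1 by rewrite lexx ler01.
have o01 : 0 <= (1 : R) <= 1 by rewrite lexx ler01.
have := HH 0 z01; rewrite /estep !mul0r scale0r addr0 => h0; have := HH 1 o01; rewrite mul1r => h1.
have := HV 0 z01; rewrite /estep !mul0r scale0r addr0 => v0; have := HV 1 o01; rewrite mul1r => v1.
apply: le_trans (ncD _ _) _; rewrite mulrDl; apply: lerD.
  by apply: le_trans (ncB _ _) _; rewrite mulr_natl; apply: lerD.
rewrite ncM [2 * _]mulrC -mulrA; apply: ler_wpM2l; first exact: nc_ge0.
by apply: le_trans (ncB _ _) _; rewrite mulr_natl; apply: lerD.
Qed.

Lemma contourD r j sigma s p f1 f2 :
  contour r j sigma s p (fun z => f1 z + f2 z) = contour r j sigma s p f1 + contour r j sigma s p f2.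
Proof. rewrite /contour !davgD; ring. Qed.

Lemma contour_affine r j sigma s p (a : C) (L : 'I_g -> C) (z0 : Cg) :
  contour r j sigma s p (fun z => a + \sum_i (z - z0) 0 i * L i) = 0.
Proof.
have E b : \sum_i estep j b 0 i * L i = b * L j.
  rewrite (bigD1 j) //= big1 ?addr0 => [|i ij]; rewrite !mxE ?eqxx ?mulr1 //.
  by rewrite (negbTE ij) mulr0 mul0r.
rewrite /contour -opprB !davg_affine !E; ring.
Qed.

(* Goursat's bisection argument: [contour] vanishes on affine functions. *)
Lemma goursat j sigma p f :
  (forall x : option 'I_g -> R, (forall i, 0 <= x i <= 1) -> exists L, has_grad f (bpoint j sigma p x) L) ->
  forall e : R, 0 < e -> exists r0, forall r, (r0 <= r)%N -> nc (contour r j sigma 1 p f) <= e.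
Proof.
move=> df e e0.
(* Contours are already divided by s, so the classical bound e s^2 becomes e s; 2^(g+1) halves
   weighted by 2^-g reproduce it. *)
pose G (x : option 'I_g -> R) s := exists r0, forall r, (r0 <= r)%N ->
  nc (contour r j sigma s (bpoint j sigma p x) f) <= e * s.
suff : G (fun=> 0) 1.
  move=> [r0 H]; exists r0 => r rr; have := H r rr; rewrite mulr1 (_ : _ _ = p) //.
  by apply/rowP => i; rewrite !mxE !mul0r !addr0.
apply: bisection => //.
- move=> x s s0 H; have /choice[r1 Hr1] := H.
  exists (\max_c r1 c).+1 => -[//|r] rr; rewrite contour_halve ncM ncV ncX (nc_natr).
  rewrite ler_pdivrMl //; apply: le_trans (nc_sum _ _ _) _.
  apply: (@le_trans _ _ (\sum_(c : {ffun option 'I_g -> bool}) e * (s / 2))).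
    apply: ler_sum => c _; apply: Hr1; exact: leq_trans (leq_bigmax c) rr.
  rewrite sumr_const card_ffun card_bool card_option card_ord -[_ *+ _]mulr_natl natrX exprS.
  lra.
- move=> z zb; have [|L dL] := df z; first by move=> i; have := zb; rewrite add0r.
  pose rho := 1 + nc sigma; have rho0 : 0 < rho by rewrite ltr_wpDr // nc_ge0.
  pose M := (2 + 2 * nc sigma) * (g.+1%:R * rho).
  have M0 : 0 < M by rewrite !mulr_gt0 // ltr_wpDr // mulr_ge0 ?nc_ge0.
  have [d d0 Hd] := dL (e / M) (divr_gt0 e0 M0).
  exists (d / rho); first exact: divr_gt0.
  move=> x s /andP[s0 sd] xz; exists 0%N => r _.
  set z0 := bpoint j sigma p z.
  rewrite [f](_ : _ = fun w => (f w - (f z0 + \sum_i (w - z0) 0 i * L i)) + (f z0 + \sum_i (w - z0) 0 i * L i)); last first.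
    by apply/funext => w; rewrite subrK.
  rewrite contourD contour_affine addr0.
  apply: (@le_trans _ _ ((2 + 2 * nc sigma) * (e / M * (g.+1%:R * (rho * s))))); last first.
    rewrite le_eqVlt; apply/orP; left; apply/eqP; rewrite /M; field.
    apply/and3P; split; apply: lt0r_neq0; first exact: rho0.
      done.
    have := nc_ge0 sigma; lra.
  apply: contour_bound; first exact: ltW.
  move=> a b a01 b01; set w := _ + estep _ _.
  have wz i : nc ((w - z0) 0 i) <= rho * s.
    have sh (t : option 'I_g) (c : R) : 0 <= c <= 1 -> `|x t + c * s - z t| <= s.
      move=> /andP[c0]; have := xz t; rewrite ler_norml; nra.
    have -> : (w - z0) 0 i = (x (Some i) + a i * s - z (Some i))%:C%C +
        (x None + b * s - z None)%:C%C * (sigma * (i == j)%:R).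
      rewrite !mxE; ring.
    apply: le_trans (ncD _ _) _; rewrite mulrDl mul1r ncM !nc_real; apply: lerD; first exact: sh.
    rewrite mulrC; apply: ler_pM; rewrite ?nc_ge0 //; last exact: sh.
    by rewrite ncM; case: (i == j); rewrite ?nc0 ?nc1 ?mulr1 ?mulr0 ?nc_ge0.
  have := Hd (w - z0); rewrite subrK => h; rewrite opprD addrA.
  apply: le_trans (h _) _; first by move=> i; apply: le_lt_trans (wz i) _; rewrite mulrC -ltr_pdivlMr.
  apply: ler_wpM2l; first by rewrite divr_ge0 ?ltW.
  apply: le_trans (ler_sum _ (fun i _ => wz i)) _.
  rewrite sumr_const card_ord -[leLHS]mulr_natl ler_wpM2r ?mulr_ge0 ?ltW // ltr_nat //.
Qed.
End DyadicAverage.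

(** * Laurent series and Laurent expansions *)

Section UnorderedSums.
Variables (R : realType) (I : choiceType).
Local Notation C := R[i].
Implicit Types (F G : I -> C) (t u : seq I).

(** Unordered convergence over duplicate-free lists; [summability_sum] identifies it with the sum in
    the definition of theta. *)
Definition hsum F (s : C) := forall e : R, 0 < e -> exists t0, forall t, uniq t ->
  {subset t0 <= t} -> nc (\sum_(i <- t) F i - s) <= e.

Definition asum F (B : R) := forall t, uniq t -> \sum_(i <- t) nc (F i) <= B.

Lemma big_sub_split (V : nmodType) (F : I -> V) t u : uniq t -> uniq u -> {subset t <= u} ->
  \sum_(i <- u) F i = \sum_(i <- t) F i + \sum_(i <- u | i \notin t) F i.
Proof.
move=> ut uu tu; rewrite (bigID (mem t)) /=; congr (_ + _).
rewrite -big_filter; apply: perm_big; apply: uniq_perm; rewrite ?filter_uniq //.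
by move=> i; rewrite mem_filter; case: (boolP (i \in t)) => //= /tu.
Qed.

Lemma ler_sum_sub (F : I -> R) t u : (forall i, 0 <= F i) -> uniq t -> uniq u -> {subset t <= u} ->
  \sum_(i <- t) F i <= \sum_(i <- u) F i.
Proof.
by move=> F0 ut uu tu; rewrite (big_sub_split F ut uu tu) lerDl sumr_ge0.
Qed.

Lemma nonneg_hsum (F : I -> R) (B : R) : (forall i, 0 <= F i) ->
  (forall t, uniq t -> \sum_(i <- t) F i <= B) ->
  exists S, forall e : R, 0 < e -> exists t0, uniq t0 /\ forall t, uniq t -> {subset t0 <= t} ->
    `|\sum_(i <- t) F i - S| <= e.
Proof.
move=> F0 HB; pose A := [set x | exists2 t, uniq t & x = \sum_(i <- t) F i].
have hA : has_sup A.
  split; first by exists 0; exists [::]; rewrite ?big_nil.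
  exists B => _ [t ut ->]; exact: HB.
exists (sup A) => e e0; have [_ [t0 ut0 ->]] := sup_adherent e0 hA.
exists t0; split => // t ut sub; rewrite ler_distl; apply/andP; split.
  apply: le_trans (ler_sum_sub F0 ut0 ut sub); exact: ltW.
by apply: le_trans (ub_le_sup _ _) _; [exact: hA.2|exists t|rewrite lerDl ltW].
Qed.

Lemma asum_hsum F B : asum F B -> exists s, hsum F s.
Proof.
move=> HB.
have part (f : I -> R) : (forall i, `|f i| <= nc (F i)) -> exists S, forall e, 0 < e ->
    exists t0, forall t, uniq t -> {subset t0 <= t} -> `|\sum_(i <- t) f i - S| <= e.
  move=> Hf.
  have h1 : forall t, uniq t -> \sum_(i <- t) (`|f i| + f i) <= 2 * B.
    move=> t ut; apply: le_trans (_ : _ <= \sum_(i <- t) 2 * nc (F i)) _.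
      apply: ler_sum => i; have := Hf i; have := ler_norm (f i); lra.
    by rewrite -mulr_sumr ler_wpM2l // HB.
  have h2 : forall t, uniq t -> \sum_(i <- t) (`|f i| - f i) <= 2 * B.
    move=> t ut; apply: le_trans (_ : _ <= \sum_(i <- t) 2 * nc (F i)) _.
      apply: ler_sum => i; have := Hf i; have := ler_norm (- f i); rewrite normrN; lra.
    by rewrite -mulr_sumr ler_wpM2l // HB.
  have [i|S1 H1] := nonneg_hsum _ h1; first by have := ler_norm (- f i); rewrite normrN; lra.
  have [i|S2 H2] := nonneg_hsum _ h2; first by have := ler_norm (f i); lra.
  exists ((S1 - S2) / 2) => e e0.
  have [t1 [_ T1]] := H1 e e0; have [t2 [_ T2]] := H2 e e0.
  exists (t1 ++ t2) => t ut sub.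
  have := T1 t ut (fun x xt => sub x (etrans (mem_cat _ _ _) (introT orP (or_introl xt)))).
  have := T2 t ut (fun x xt => sub x (etrans (mem_cat _ _ _) (introT orP (or_intror xt)))).
  rewrite !big_split /= sumrN.
  rewrite !ler_norml; lra.
have [S1 H1] := part (fun i => complex.Re (F i)) (fun => Re_le_nc _).
have [S2 H2] := part (fun i => complex.Im (F i)) (fun => Im_le_nc _).
exists (S1 +i* S2)%C => e e0; have e2 : 0 < e / 2 by rewrite divr_gt0.
have [t1 T1] := H1 _ e2; have [t2 T2] := H2 _ e2.
exists (t1 ++ t2) => t ut sub.
have a1 := T1 t ut (fun x xt => sub x (etrans (mem_cat _ _ _) (introT orP (or_introl xt)))).
have a2 := T2 t ut (fun x xt => sub x (etrans (mem_cat _ _ _) (introT orP (or_intror xt)))).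
have sE : \sum_(i <- t) F i = ((\sum_(i <- t) complex.Re (F i)) +i* (\sum_(i <- t) complex.Im (F i)))%C.
  elim: t {ut sub a1 a2} => [|i t IH]; first by rewrite !big_nil.
  by rewrite !big_cons IH; case: (F).
apply: le_trans (nc_le_ReIm _) _; rewrite sE; lra.
Qed.

Lemma hsum_unique F s1 s2 : hsum F s1 -> hsum F s2 -> s1 = s2.
Proof.
move=> H1 H2; apply/eqP; rewrite -subr_eq0; apply/eqP; apply: nc_small_eq0 => e e0.
have e2 : 0 < e / 2 by rewrite divr_gt0.
have [t1 T1] := H1 _ e2; have [t2 T2] := H2 _ e2; pose t := undup (t1 ++ t2).
have a1 : nc (\sum_(i <- t) F i - s1) <= e / 2.
  by apply: T1; rewrite ?undup_uniq // => x xt; rewrite mem_undup mem_cat xt.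
have a2 : nc (\sum_(i <- t) F i - s2) <= e / 2.
  by apply: T2; rewrite ?undup_uniq // => x xt; rewrite mem_undup mem_cat xt orbT.
rewrite -(subrKA (\sum_(i <- t) F i)); apply: le_trans (ncD _ _) _.
rewrite nc_distC; lra.
Qed.

Lemma eq_hsum F G s : F =1 G -> hsum F s -> hsum G s.
Proof. by move=> e; rewrite (_ : G = F) //; apply/funext. Qed.

Lemma hsumD F G s1 s2 : hsum F s1 -> hsum G s2 -> hsum (fun i => F i + G i) (s1 + s2).
Proof.
move=> H1 H2 e e0; have e2 : 0 < e / 2 by rewrite divr_gt0.
have [t1 T1] := H1 _ e2; have [t2 T2] := H2 _ e2; exists (t1 ++ t2) => t ut sub.
have a1 := T1 t ut (fun x xt => sub x (etrans (mem_cat _ _ _) (introT orP (or_introl xt)))).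
have a2 := T2 t ut (fun x xt => sub x (etrans (mem_cat _ _ _) (introT orP (or_intror xt)))).
rewrite big_split opprD addrACA; apply: le_trans (ncD _ _) _; lra.
Qed.

Lemma hsumZ a F s : hsum F s -> hsum (fun i => a * F i) (a * s).
Proof.
move=> H e e0; have a0 : 0 < 1 + nc a by rewrite ltr_wpDr // nc_ge0.
have [t0 T0] := H _ (divr_gt0 e0 a0); exists t0 => t ut sub.
rewrite -mulr_sumr -mulrBr ncM.
have := T0 t ut sub; rewrite ler_pdivlMr // => h; apply: le_trans h.
by rewrite mulrC; apply: ler_wpM2l; rewrite ?nc_ge0 ?lerDr.
Qed.

Lemma hsumB F G s1 s2 : hsum F s1 -> hsum G s2 -> hsum (fun i => F i - G i) (s1 - s2).
Proof.
move=> H1 H2; have := hsumD H1 (hsumZ (-1) H2); rewrite mulN1r.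
by apply: eq_hsum => i; rewrite mulN1r.
Qed.

Lemma hsum0 : hsum (fun=> 0) 0.
Proof. by move=> e0; exists [::] => t; rewrite big1 // subrr nc0 ltW. Qed.

Lemma hsum_sum (J : Type) (l : seq J) (P : pred J) (F : J -> I -> C) (s : J -> C) :
  (forall j, hsum (F j) (s j)) -> hsum (fun i => \sum_(j <- l | P j) F j i) (\sum_(j <- l | P j) s j).
Proof.
move=> H; elim: l => [|j l IH].
  by rewrite big_nil; apply: eq_hsum hsum0 => i; rewrite big_nil.
rewrite big_cons; case: ifP => Pj; last by apply: eq_hsum IH => i; rewrite big_cons Pj.
by apply: eq_hsum (hsumD (H j) IH) => i; rewrite big_cons Pj.
Qed.

Lemma hsum_bound F s B : hsum F s -> asum F B -> nc s <= B.
Proof.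
move=> H HB; apply/ler_addgt0Pr => e e0; have [t0 T0] := H _ e0.
have := T0 (undup t0) (undup_uniq _) (fun x xt => etrans (mem_undup _ _) xt).
rewrite nc_distC => h; have := le_trans (ler_nc_dist _ _) h.
rewrite lerBlDr addrC => h2; apply: le_trans h2 _; rewrite lerD2r.
apply: le_trans (nc_sum _ _ _) _; apply: HB; exact: undup_uniq.
Qed.

Lemma asum_tail F B : asum F B -> forall e : R, 0 < e -> exists t0, uniq t0 /\
  asum (fun i => if i \in t0 then 0 else F i) e.
Proof.
move=> HB e e0; have e2 : 0 < e / 2 by rewrite divr_gt0.
have [S HS] := nonneg_hsum (fun i => nc_ge0 (F i)) HB.
have [t0 [ut0 T0]] := HS _ e2; exists t0; split => // t ut.
pose u := undup (t0 ++ t).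
have su : {subset t0 <= u} by move=> x xt; rewrite mem_undup mem_cat xt.
have := T0 u (undup_uniq _) su; have := T0 t0 ut0 (fun x xt => xt).
rewrite (big_sub_split _ ut0 (undup_uniq _) su) !ler_distl => /andP[a1 a2] /andP[b1 b2].
apply: le_trans (_ : _ <= \sum_(i <- u | i \notin t0) nc (F i)) _; last lra.
rewrite [leRHS]big_mkcond (eq_bigr (fun i => if i \notin t0 then nc (F i) else 0)).
  apply: ler_sum_sub => [i|||x xt]; rewrite ?undup_uniq //; first by case: ifP; rewrite ?nc_ge0.
  by rewrite mem_undup mem_cat xt orbT.
by move=> i; case: (i \in t0); rewrite ?nc0.
Qed.

Lemma hsum_fin F t : uniq t -> (forall i, i \notin t -> F i = 0) -> hsum F (\sum_(i <- t) F i).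
Proof.
move=> ut; exists t => u uu sub; rewrite (big_sub_split F ut uu sub).
by rewrite [X in _ X - _]big1 ?addr0 ?subrr ?nc0 ?ltW.
Qed.

Lemma asum_le F G B : (forall i, nc (F i) <= nc (G i)) -> asum G B -> asum F B.
Proof. by move=> le HB t ut; apply: le_trans (HB t ut); apply: ler_sum. Qed.

Lemma summability_sum F s : hsum F s -> summability.sum (F : I -> C^o) = s.
Proof.
move=> H; have FF := @summability.totally_filter; apply: cvg_lim; first exact: norm_hausdorff.
apply/cvgrPdist_le => e e0.
have [e1 e10 ->] : exists2 e1, 0 < e1 & e = e1%:C%C.
  move: e0; rewrite ltcE => /andP[/eqP Ie]; exists (complex.Re e) => //.
  by apply/eqP; rewrite eq_complex Ie !eqxx.
have [t0 T0] := H _ e10; exists (seq_fset tt t0) => // A sub0.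
have sub : fsubset (seq_fset tt t0) A by [].
move: sub0 => _.
rewrite /summability.partial_sum -(big_seq_fsetE _ _ xpredT) lecR nc_distC.
by apply: T0; [exact: fset_uniq|move=> x xt; apply: (fsubsetP sub); rewrite seq_fsetE].
Qed.
End UnorderedSums.

Lemma hsum_reindex (R : realType) (I J : choiceType) (h : J -> I) (h' : I -> J) (F : I -> R[i]) s :
  cancel h h' -> cancel h' h -> hsum F s -> hsum (fun j => F (h j)) s.
Proof.
move=> hK hK' H e e0; have [t0 T0] := H _ e0; exists (map h' t0) => t ut sub.
have := T0 (map h t); rewrite big_map; apply; first by rewrite map_inj_uniq //; exact: can_inj.
by move=> x xt; rewrite -[x]hK' map_f // sub // map_f.
Qed.

(** * Series over Z^g dominated by geometric ones *)

Section GeometricBound.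
Variables (R : realType) (g : nat) (q : R).
Hypotheses (q0 : 0 <= q) (q1 : q < 1).

Lemma geom_sum N : (\sum_(k < (N + N).+1) q ^+ `|(k : int) - (N : int)|) * (1 - q) = 1 + q - 2 * q ^+ N.+1.
Proof.
elim: N => [|N IH]; first by rewrite big_ord1; ring.
rewrite addnS big_ord_recl big_ord_recr /= !mulrDl.
rewrite (eq_bigr (fun k : 'I_(N + N).+1 => q ^+ `|(k : int) - (N : int)|)) => [|k]; last first.
  rewrite (_ : (bump 0 k : int) - (N.+1 : int) = (k : int) - (N : int)) // !intS; ring.
rewrite [X in _ + (X + _)]IH.
rewrite subn0.
have -> : `|((bump 0 (N.+1 + N) : int) - (N.+1 : int))|%N = N.+1 by rewrite /bump; lia.
rewrite !exprS; ring.
Qed.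

Lemma geom_sum_le N : \sum_(k < (N + N).+1) q ^+ `|(k : int) - (N : int)| <= 2 / (1 - q).
Proof.
rewrite ler_pdivlMr ?subr_gt0 // geom_sum.
have : 0 <= q ^+ N.+1 by rewrite exprn_ge0.
have := q1; lra.
Qed.

(** Finitely many indices lie in a box [-N, N]^g, where the product bound factors into g
    one-variable geometric sums, each at most 2 / (1 - q). *)
Lemma asum_geom (F : 'rV[int]_g -> R[i]) (A : R) : 0 <= A ->
  (forall m, nc (F m) <= A * \prod_i q ^+ `|m 0 i|) -> asum F (A * (2 / (1 - q)) ^+ g).
Proof.
move=> A0 HF t ut.
apply: le_trans (ler_sum _ (fun i _ => HF i)) _; rewrite -mulr_sumr ler_wpM2l //.
pose N := (\max_(m <- t) \max_i `|m 0%R i|)%N.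
have HN (m : 'rV[int]_g) (i : 'I_g) : m \in t -> (`|m 0%R i| <= N)%N.
  move=> mt; rewrite /N (big_rem m) //= leq_max.
  by rewrite (leq_bigmax (F := fun i => `|m 0%R i|%N)).
pose mk (k : {ffun 'I_g -> 'I_(N + N).+1}) := \row_i ((k i : int) - (N : int)).
have mkI : injective mk.
  move=> k k' /rowP e; apply/ffunP => i; apply: val_inj; have := e i; rewrite !mxE /=; lia.
apply: le_trans (ler_sum_sub _ ut (_ : uniq (map mk (enum {: {ffun 'I_g -> 'I_(N + N).+1}}))) _) _.
- by move=> m; rewrite prodr_ge0 // => i; rewrite exprn_ge0.
- by rewrite map_inj_uniq // enum_uniq.
- move=> m mt; apply/mapP.
  have k1 (x : int) (n : nat) : (`|x| <= n)%N -> (`|(x + (n : int))%R| < (n + n).+1)%N by lia.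
  have k2 (x : int) (n : nat) : (`|x| <= n)%N -> x = (`|(x + (n : int))%R|%N : int) - (n : int) by lia.
  have lt i : (`|(m 0 i + (N : int))%R| < (N + N).+1)%N by apply: k1; exact: HN.
  exists [ffun i => Ordinal (lt i)]; first by rewrite mem_enum.
  apply/rowP => i; rewrite !mxE ffunE; apply: k2; exact: HN.
rewrite big_map big_enum.
rewrite (eq_bigr (fun k : {ffun 'I_g -> 'I_(N + N).+1} => \prod_i q ^+ `|(k i : int) - (N : int)|)).
  rewrite -(bigA_distr_bigA (fun (i : 'I_g) (k : 'I_(N + N).+1) => q ^+ `|(k : int) - (N : int)|)).
  rewrite prodr_const card_ord; apply: lerXn2r; rewrite ?nnegrE ?geom_sum_le //.
    by rewrite sumr_ge0 // => k; rewrite exprn_ge0.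
  by rewrite divr_ge0 // subr_ge0 ltW.
by move=> k _; apply: eq_bigr => i; rewrite mxE.
Qed.
End GeometricBound.

(** * The complex exponential and its second-order remainder *)

Section ComplexExponential.
Variable R : realType.
Local Notation C := R[i].
Implicit Types z w : C.

Lemma cexpE z : cexp z = (expR (complex.Re z) * cos (complex.Im z) +i* (expR (complex.Re z) * sin (complex.Im z)))%C.
Proof. by case: z. Qed.

Lemma cexpD z w : cexp (z + w) = cexp z * cexp w.
Proof.
case: z => a b; case: w => c d; apply/eqP; rewrite eq_complex /= expRD cosD sinD.
apply/andP; split; apply/eqP; ring.
Qed.

Lemma cexp0 : cexp (0 : C) = 1.
Proof. by apply/eqP; rewrite /= expR0 cos0 sin0 mulr1 mulr0. Qed.

Lemma nc_cexp z : nc (cexp z) = expR (complex.Re z).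
Proof.
case: z => a b /=; rewrite !exprMn -mulrDr cos2Dsin2 mulr1 sqrtr_sqr ger0_norm //.
Qed.

Lemma cexp_neq0 z : cexp z != 0.
Proof.
apply/eqP => e; have := nc_cexp z; rewrite e nc0 => h.
by have := expR_gt0 (complex.Re z); rewrite -h ltxx.
Qed.

Lemma cexpN z : cexp (- z) = (cexp z)^-1.
Proof.
by apply: (mulfI (cexp_neq0 z)); rewrite -cexpD subrr cexp0 divff ?cexp_neq0.
Qed.

Lemma cexp_nat z n : cexp (n%:R * z) = cexp z ^+ n.
Proof.
elim: n => [|n IH]; first by rewrite mul0r cexp0.
by rewrite -addn1 natrD mulrDl mul1r cexpD IH addn1 exprSr.
Qed.

Lemma cexp_int_period (k : int) : cexp (2 * (pi *i)%C * k%:~R) = (1 : C).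
Proof.
have h : cexp (2 * (pi *i)%C : C) = 1.
  have -> : 2 * (pi *i)%C = (0 +i* (pi *+ 2))%C :> C.
    by apply/eqP; rewrite eq_complex mulr_natl /= addr0 !eqxx.
  by apply/eqP; rewrite /= expR0 cos2pi sin2pi mulr1 mulr0.
case: k => n.
  by rewrite mulrC cexp_nat h expr1n.
rewrite mulrN cexpN mulrC cexp_nat h expr1n invr1 //.
Qed.

Lemma cexp_half_period : cexp ((pi *i)%C : C) = -1.
Proof. by apply/eqP; rewrite eq_complex /= expR0 cospi sinpi mulr0 mul1r oppr0 !eqxx. Qed.

Lemma abs_sin_le (x : R) : `|sin x| <= `|x|.
Proof.
wlog x0 : x / 0 <= x => [H|].
  by have [|/ltW x0] := leP 0 x; [exact: H|rewrite -normrN -sinN -[leRHS]normrN H // oppr_ge0].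
rewrite //; have := x0; rewrite le_eqVlt => /orP[/eqP <-|xp].
  by rewrite sin0 normr0.
have dv y : y \in `]0, x[ -> is_derive y 1 sin (cos y) by move=> _; exact: is_derive_sin.
have cn : {within `[0, x], continuous (@sin R)} by apply: continuous_subspaceT; exact: continuous_sin.
have [c _] := MVT xp dv cn.
rewrite sin0 !subr0 => ->; rewrite normrM (ger0_norm x0).
by rewrite -[leRHS]mul1r ler_wpM2r // cos_max.
Qed.

Lemma cos_sub1_le (x : R) : 0 <= 1 - cos x <= x ^+ 2 / 2.
Proof.
have : cos x = cos ((x / 2) *+ 2) by congr cos; field.
rewrite cos_mulr2n cos2sin2.
have := abs_sin_le (x / 2); have := (sin (x / 2)) => h0 h1.
have h2 : sin (x / 2) ^+ 2 <= (x / 2) ^+ 2.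
  by rewrite -[leLHS]real_normK // -[leRHS]real_normK ?num_real // lerXn2r.
have := sqr_ge0 (sin (x / 2)).
have h4 : (x / 2) ^+ 2 = x ^+ 2 / 4 by field.
rewrite h4 in h2.
lra.
Qed.

Lemma sin_sub_le (x : R) : `|sin x - x| <= x ^+ 2.
Proof.
wlog x0 : x / 0 <= x => [H|].
  have [|/ltW x0] := leP 0 x; first exact: H.
  by rewrite -normrN -[x ^+ 2]sqrrN opprD -sinN H // oppr_ge0.
have := x0; rewrite le_eqVlt => /orP[/eqP <-|xp].
  by rewrite sin0 subrr normr0.
have dv y : y \in `]0, x[ -> is_derive y 1 (fun y => sin y - y) (cos y - 1) by move=> _; apply: is_deriveB.
have cn : {within `[0, x], continuous (fun y => sin y - y)}.
  apply: continuous_subspaceT => y; apply: continuousB => //; exact: continuous_sin.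
have [c] := MVT xp dv cn.
rewrite in_itv /= => /andP[c0 cx]; rewrite sin0 !subr0 => ->.
rewrite normrM (ger0_norm x0) ler_wpM2r //.
have := cos_sub1_le c; rewrite distrC ger0_norm //.
have := cos_geN1 c; have [c2|c2] := leP.
  apply: _; nra.
lra.
Qed.

Lemma expR_sub_le (a : R) : `|expR a - 1| <= `|a| * expR `|a|.
Proof.
have [a0|a0] := leP 0 a.
  rewrite (ger0_norm a0) ger0_norm ?subr_ge0 -?expR0 ?ler_expR //.
  have := expR_ge1Dx (- a); rewrite expRN => h; have e0 := expR_gt0 a.
  have : (1 - a) * expR a <= 1 by rewrite -ler_pdivlMr // div1r.
  rewrite expR0; lra.
rewrite (ltr0_norm a0) ler0_norm ?subr_le0 -?expR0 ?ler_expR ?(ltW a0) // expR0.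
have := expR_ge1Dx a; have : 1 <= expR (- a) by rewrite -expR0 ler_expR; lra.
nra.
Qed.

Lemma expR_taylor2 (a : R) : `|expR a - 1 - a| <= a ^+ 2 * expR `|a|.
Proof.
have h := expR_ge1Dx a; rewrite ger0_norm; last lra.
have [a0|a0] := leP 0 a.
  have := expR_sub_le a; rewrite (ger0_norm a0) ger0_norm ?subr_ge0 -?expR0 ?ler_expR // expR0.
  nra.
have := expR_ge1Dx (- a); rewrite expRN => h1; have e0 := expR_gt0 a.
have : (1 - a) * expR a <= 1 by rewrite -ler_pdivlMr // div1r.
have : 1 <= expR `|a| by rewrite -expR0 ler_expR.
nra.
Qed.

(** The remainder splits into four terms, each controlled by a real remainder of expR, cos or sin;
    hence the constant 4. *)
Lemma cexp_taylor2 z : nc (cexp z - 1 - z) <= 4 * nc z ^+ 2 * expR (nc z).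
Proof.
have ha := Re_le_nc z; have hb := Im_le_nc z; set N := nc z.
set a := complex.Re z; set b := complex.Im z.
have zE : z = (a%:C + b%:C * 'i)%C by rewrite mulrC -complexE.
have -> : cexp z - 1 - z = ((expR a * (cos b - 1))%:C + (expR a * (sin b - b))%:C * 'i
   + (expR a - 1 - a)%:C + (b * (expR a - 1))%:C * 'i)%C.
  rewrite cexpE -/a -/b {1}zE; apply/eqP; rewrite eq_complex /=; apply/andP; split; apply/eqP; ring.
have nci : nc ('i%C : C) = 1 by rewrite /= expr0n add0r expr1n sqrtr1.
have N0 : 0 <= N := nc_ge0 z.
have e1 : expR a <= expR N by rewrite ler_expR; apply: le_trans (ler_norm _) ha.
have e2 : expR `|a| <= expR N by rewrite ler_expR.
have b2 : b ^+ 2 <= N ^+ 2 by rewrite -[leLHS]real_normK ?num_real // lerXn2r.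
have a2 : a ^+ 2 <= N ^+ 2 by rewrite -[leLHS]real_normK ?num_real // lerXn2r.
apply: le_trans (ncD _ _) _; apply: le_trans (lerD (ncD _ _) (lexx _)) _.
apply: le_trans (lerD (lerD (ncD _ _) (lexx _)) (lexx _)) _.
rewrite !ncM nci !mulr1 !nc_real.
have -> : 4 * N ^+ 2 * expR N = expR N * N ^+ 2 + expR N * N ^+ 2 + N ^+ 2 * expR N + N * (N * expR N) by ring.
rewrite !normrM (ger0_norm (expR_ge0 a)).
apply: lerD; [apply: lerD; [apply: lerD|]|].
- apply: ler_pM; rewrite //; have /andP[c1] := cos_sub1_le b.
  rewrite distrC ger0_norm; lra.
- by apply: ler_pM; rewrite //; apply: le_trans (sin_sub_le b) _.
- by apply: le_trans (expR_taylor2 a) _; apply: ler_pM; rewrite ?sqr_ge0.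
- apply: ler_pM; rewrite //; apply: le_trans (expR_sub_le a) _.
  by apply: ler_pM.
Qed.
End ComplexExponential.

(** * Laurent series in the exp (2 pi i z_j) on tube domains *)

Section LaurentSeries.
Variables (R : realType) (g : nat).
Local Notation C := R[i].
Local Notation Cg := 'rV[C]_g.
Local Notation Zg := 'rV[int]_g.
Implicit Types (m n : Zg) (z h : Cg) (y : 'I_g -> R) (a b : Zg -> C) (U : 'I_g -> set R).

Definition dot m y : R := \sum_i (m 0 i)%:~R * y i.
Definition imz z : 'I_g -> R := fun i => complex.Im (z 0 i).
Definition l1 m : nat := (\sum_i `|m 0%R i|)%N.
Definition lin m z : C := \sum_i (m 0 i)%:~R * z 0 i.
Definition chr m z : C := cexp (2 * (pi *i)%C * lin m z).

Lemma linDl m n z : lin (m + n) z = lin m z + lin n z.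
Proof. by rewrite -big_split; apply: eq_bigr => i; rewrite !mxE rmorphD mulrDl. Qed.
Lemma linDr m z h : lin m (z + h) = lin m z + lin m h.
Proof. by rewrite -big_split; apply: eq_bigr => i; rewrite !mxE mulrDr. Qed.
Lemma chrDl m n z : chr (m + n) z = chr m z * chr n z.
Proof. by rewrite /chr linDl mulrDr cexpD. Qed.
Lemma chrDr m z h : chr m (z + h) = chr m z * chr m h.
Proof. by rewrite /chr linDr mulrDr cexpD. Qed.
Lemma chr0 z : chr 0 z = 1.
Proof. by rewrite /chr /lin big1 ?mulr0 ?cexp0 // => i; rewrite mxE mul0r. Qed.
Lemma chr_neq0 m z : chr m z != 0. Proof. exact: cexp_neq0. Qed.
Lemma chrN m z : chr (- m) z = (chr m z)^-1.
Proof. by apply: (mulfI (chr_neq0 m z)); rewrite -chrDl subrr chr0 divff ?chr_neq0. Qed.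

Lemma chr_period m (n : Zg) : chr m (map_mx (intr : int -> C) n) = 1.
Proof.
rewrite /chr /lin (eq_bigr (fun i => (m 0 i * n 0 i)%:~R)) => [|i]; last by rewrite mxE rmorphM.
by rewrite -rmorph_sum cexp_int_period.
Qed.

Lemma Re_2pi_i w : complex.Re (2 * (pi *i)%C * w : C) = - (2 * pi) * complex.Im w.
Proof.
have -> : 2 * (pi *i)%C = ((0 : R) +i* (2 * pi))%C.
  by apply/eqP; rewrite eq_complex !mulr_natl /= addr0 !eqxx.
by case: w => c d /=; rewrite mul0r sub0r mulNr.
Qed.

Lemma Im_lin m z : complex.Im (lin m z) = dot m (imz z).
Proof.
rewrite raddf_sum; apply: eq_bigr => i.
rewrite /imz; case: (z 0) => c d.
by rewrite -(rmorph_int (real_complex R)) /= mul0r addr0.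
Qed.

Lemma nc_chr m z : nc (chr m z) = expR (- (2 * pi) * dot m (imz z)).
Proof. by rewrite nc_cexp Re_2pi_i Im_lin. Qed.

Lemma nc_2pi_i : nc (2 * (pi *i)%C : C) = 2 * pi.
Proof.
rewrite ncM (nc_natr) /= expr0n add0r sqrtr_sqr ger0_norm // pi_ge0 //.
Qed.

Lemma nc_intr (k : int) : nc (k%:~R : C) = `|k|%N%:R.
Proof. by rewrite -(rmorph_int (real_complex R)) nc_real -intr_norm. Qed.

Lemma nc_lin m z (d : R) : 0 <= d -> (forall i, nc (z 0 i) <= d) -> nc (lin m z) <= (l1 m)%:R * d.
Proof.
move=> d0 H; apply: le_trans (nc_sum _ _ _) _; rewrite natr_sum mulr_suml.
by apply: ler_sum => i; rewrite ncM nc_intr ler_wpM2l.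
Qed.

Lemma dot_le m y (d : R) : (forall i, `|y i| <= d) -> `|dot m y| <= (l1 m)%:R * d.
Proof.
move=> H; apply: le_trans (ler_norm_sum _ _ _) _; rewrite natr_sum mulr_suml.
apply: ler_sum => i; rewrite normrM -intr_norm.
by rewrite ler_wpM2l.
Qed.

(** The second clause is convexity of each factor: segments in one coordinate stay inside the tube,
    as Goursat's argument requires. *)
Definition open_box U := (forall i x, U i x -> exists2 e : R, 0 < e & forall x', `|x' - x| <= e -> U i x')
  /\ (forall i (s t x : R), U i s -> U i t -> s <= x <= t -> U i x).

Definition in_box U y := forall i, U i (y i).

Lemma open_boxP U y : open_box U -> in_box U y ->
  exists2 e : R, 0 < e & forall y', (forall i, `|y' i - y i| <= e) -> in_box U y'.
Proof.
move=> [Uo _] yU; have /choice[ee Hee] : forall i, exists e, 0 < e /\ forall x', `|x' - y i| <= e -> U i x'.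
  by move=> i; have [e] := Uo i _ (yU i); exists e.
exists (\big[Num.min/1]_i ee i).
  by elim/big_ind: _ => // [u v u0 v0|i _]; [rewrite lt_min u0|exact: (Hee i).1].
move=> y' H i; apply: (Hee i).2; apply: le_trans (H i) _; exact: bigmin_le_cond.
Qed.

(** Boundedness of the terms at each height y is enough: openness of U upgrades it to exponential
    decay ([decay_strong]). *)
Definition decay U a := forall y, in_box U y -> exists B : R, forall m, nc (a m) * expR (- (2 * pi) * dot m y) <= B.

(** The signs of m select a corner of a box around y; moving there multiplies the m-th term by exp
    (2 pi e |m|_1). The choice d (1 + 2 pi) <= 2 pi e pays both for replacing y by y' and for the
    factor exp (- d |m|_1). *)
Lemma decay_strong U a y : open_box U -> decay U a -> in_box U y ->
  exists d B : R, [/\ 0 < d, 0 <= B & forall y', (forall i, `|y' i - y i| <= d) ->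
    forall m, nc (a m) * expR (- (2 * pi) * dot m y') <= B * expR (- d) ^+ l1 m].
Proof.
move=> Uo da yU; have [e e0 He] := open_boxP Uo yU.
have corner (s : {ffun 'I_g -> bool}) : exists B, forall m,
    nc (a m) * expR (- (2 * pi) * dot m (fun i => y i + (if s i then e else - e))) <= B.
  apply: da; apply: He => i; rewrite addrAC subrr add0r.
  by case: (s i); rewrite ?normrN ger0_norm // ltW.
have /choice[BB HB] := corner.
have pi0 := pi_gt0 R.
pose d := Num.min e (2 * pi * e / (1 + 2 * pi)).
have : 0 < d by rewrite lt_min e0 divr_gt0 ?mulr_gt0 // addr_gt0 // mulr_gt0.
have BB0 s : 0 <= BB s by apply: le_trans (HB s 0); rewrite mulr_ge0 ?nc_ge0.
exists d, (\sum_s BB s); split => //; first by rewrite sumr_ge0.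
move=> y' y'd m.
pose s : {ffun 'I_g -> bool} := [ffun i => m 0 i <= 0].
rewrite -expRM_natr.
rewrite -ler_pdivrMr ?expR_gt0 // -expRN -mulrA -expRD.
apply: le_trans (_ : _ <= BB s) _; last by rewrite (bigD1 s) //= lerDl sumr_ge0.
apply: le_trans (HB s m); rewrite ler_wpM2l ?nc_ge0 // ler_expR.
have -> : dot m (fun i => y i + (if s i then e else - e)) = dot m y - (l1 m)%:R * e.
  rewrite natr_sum mulr_suml -sumrB; apply: eq_bigr => i.
  rewrite mulrDr; rewrite ffunE; case: lerP => mi.
    by rewrite pmulrn abszE ler0_norm // rmorphN mulNr opprK.
  by rewrite pmulrn abszE gtr0_norm // mulrN.
have -> : dot m y' = dot m y + dot m (fun i => y' i - y i).
  rewrite -big_split; apply: eq_bigr => i _ /=; ring.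
have := dot_le m y'd; rewrite ler_norml => /andP[h1].
have dle : d * (1 + 2 * pi) <= 2 * pi * e.
  by rewrite -ler_pdivlMr ?ge_min ?lexx ?orbT // addr_gt0 // mulr_gt0.
have : 2 * pi * - (dot m (fun i => y' i - y i)) <= 2 * pi * ((l1 m)%:R * d).
  rewrite ler_wpM2l; lra.
have : (l1 m)%:R * (d * (1 + 2 * pi)) <= (l1 m)%:R * (2 * pi * e) by rewrite ler_wpM2l.
lra.
Qed.

Lemma asum_l1 (q B : R) a : 0 <= q < 1 -> 0 <= B -> (forall m, nc (a m) <= B * q ^+ l1 m) ->
  asum a (B * (2 / (1 - q)) ^+ g).
Proof.
move=> /andP[q0 q1] B0 H; apply: asum_geom => // m; apply: le_trans (H m) _.
by rewrite expr_sum.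
Qed.

Definition inT U z := in_box U (imz z).

Definition ser a z : C := xget 0 [set s | hsum (fun m => a m * chr m z) s].

Lemma decay_asum U a z : open_box U -> decay U a -> inT U z -> exists B, asum (fun m => a m * chr m z) B.
Proof.
move=> Uo da zU; have [d [B [d0 B0 H]]] := decay_strong Uo da zU.
eexists; apply: (@asum_l1 (expR (- d)) B) => // [|m].
  by rewrite expR_ge0 expR_lt1 oppr_lt0.
by rewrite ncM nc_chr; apply: H => i; rewrite subrr normr0 ltW.
Qed.

Lemma serP U a z : open_box U -> decay U a -> inT U z -> hsum (fun m => a m * chr m z) (ser a z).
Proof.
move=> Uo da zU; have [B /asum_hsum[s Hs]] := decay_asum Uo da zU.
rewrite /ser; exact: (xgetPex 0 (ex_intro _ s Hs)).
Qed.

Lemma ser_eq a z s : hsum (fun m => a m * chr m z) s -> ser a z = s.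
Proof. move=> Hs; apply: (hsum_unique _ Hs); exact: (xgetPex 0 (ex_intro _ s Hs)). Qed.

Lemma decayD U a b : decay U a -> decay U b -> decay U (fun m => a m + b m).
Proof.
move=> da db y yU; have [A HA] := da y yU; have [B HB] := db y yU; exists (A + B) => m.
apply: le_trans (lerD (HA m) (HB m)); rewrite -mulrDl ler_wpM2r ?ncD //.
Qed.

Lemma decayZ U c a : decay U a -> decay U (fun m => c * a m).
Proof.
move=> da y yU; have [A] := da y yU; exists (nc c * A) => m.
by rewrite ncM -mulrA ler_wpM2l ?nc_ge0.
Qed.

Lemma decay_le U a b : (forall m, nc (a m) <= nc (b m)) -> decay U b -> decay U a.
Proof.
by move=> H db y yU; have [A HA] := db y yU; exists A => m; apply: le_trans (HA m); rewrite ler_wpM2r.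
Qed.

Lemma expR_quadr (t c : R) : 0 <= t -> 0 < c -> t ^+ 2 <= 2 / c ^+ 2 * expR (c * t).
Proof.
move=> t0 c0; have := @expR_ge1Dxn R (c * t) 1 (mulr_ge0 (ltW c0) t0).
rewrite (_ : 2`!%:R = 2) // => h; have c2 : 0 < c ^+ 2 by rewrite exprn_gt0.
rewrite mulrAC ler_pdivlMr; lra.
Qed.

Lemma expR_linear (t c : R) : 0 < c -> t <= c^-1 * expR (c * t).
Proof.
move=> c0; rewrite mulrC ler_pdivlMr; have := expR_ge1Dx (c * t); lra.
Qed.

Lemma decay_mulm U i a : open_box U -> decay U a -> decay U (fun m => 2 * (pi *i)%C * (m 0 i)%:~R * a m).
Proof.
move=> Uo da y yU; have [d [B [d0 B0 H]]] := decay_strong Uo da yU.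
exists (2 * pi * (d^-1 * B)) => m; rewrite ncM ncM nc_2pi_i nc_intr -!mulrA.
have pi0 := pi_gt0 R; do 2 (apply: ler_wpM2l; first by rewrite ltW).
have h1 := H y (fun i => _ : `|y i - y i| <= d).
have {}h1 : nc (a m) * expR (- (2 * pi) * dot m y) <= B * expR (- d) ^+ l1 m.
  by apply: h1 => j; rewrite subrr normr0 ltW.
have h2 : (`|m 0%R i|%N%:R : R) <= (l1 m)%:R by rewrite ler_nat /l1 (bigD1 i) //= leq_addr.
apply: le_trans (ler_pM _ _ h2 h1) _; rewrite ?mulr_ge0 ?nc_ge0 //.
have h3 := expR_linear (l1 m)%:R d0; rewrite -expRM_natr mulrCA [d^-1 * B]mulrC ler_wpM2l //.
rewrite mulNr expRN ler_pdivrMr ?expR_gt0 //.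
Qed.

(** Termwise Taylor bound: the m-th remainder is of size |m|^2 s^2 exp (c |m|) with c = d / 4, and
    half of the decay exp (- d |m|) absorbs |m|^2 exp (c |m|), leaving the ratio q = exp (- d /
    2). *)
Lemma ser_has_grad U a z : open_box U -> decay U a -> inT U z ->
  has_grad (ser a) z (fun i => ser (fun m => 2 * (pi *i)%C * (m 0 i)%:~R * a m) z).
Proof.
move=> Uo da zU e e0; have [d [B [d0 B0 H]]] := decay_strong Uo da zU.
have pi0 := pi_gt0 R.
pose c := d / 4; have c0 : 0 < c by rewrite divr_gt0.
pose A := B * (4 * (2 * pi) ^+ 2 * (2 / c ^+ 2)).
have A0 : 0 <= A by rewrite !mulr_ge0 ?exprn_ge0 ?mulr_ge0 ?invr_ge0 ?exprn_ge0 ?(ltW pi0) ?(ltW c0).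
pose q := expR (- (d / 2)).
have q01 : 0 <= q < 1 by rewrite expR_ge0 /= expR_lt1 oppr_lt0 divr_gt0.
pose K := (A + 1) * (2 / (1 - q)) ^+ g.
have K0 : 0 < K by rewrite mulr_gt0 ?exprn_gt0 ?divr_gt0 ?subr_gt0 //; [lra|case/andP: q01].
have [e1 e10 He1] := open_boxP Uo zU.
pose eta := Num.min (Num.min (Num.min (e / K) d) (c / (2 * pi))) e1.
have h1 : 0 < e / K := divr_gt0 e0 K0.
have h2 : 0 < c / (2 * pi) by rewrite divr_gt0 // mulr_gt0.
have eta0 : 0 < eta by rewrite !lt_min h1 h2 d0 e10.
exists (eta / g.+1%:R); first by rewrite divr_gt0.
move=> h hd; set s := \sum_i nc (h 0 i).
have s0 : 0 <= s by rewrite sumr_ge0 // => i _; rewrite nc_ge0.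
have se : s <= eta.
  apply: le_trans (ler_sum _ (fun i _ => ltW (hd i))) _; rewrite sumr_const card_ord -[leLHS]mulr_natl.
  by rewrite mulrCA ler_piMr ?(ltW eta0) // ler_pdivrMr ?ltr0n // mul1r ler_nat.
have hi i : nc (h 0 i) <= s by rewrite /s (bigD1 i) //= lerDl sumr_ge0 // => j _; rewrite nc_ge0.
have [[[se1 se2] se3] se4] : ((s <= e / K /\ s <= d) /\ s <= c / (2 * pi)) /\ s <= e1.
  by move: se; rewrite !le_min => /andP[/andP[/andP[]]].
have zhU : inT U (h + z).
  apply: He1 => i; apply: le_trans se4; apply: le_trans (hi i).
  by rewrite /imz mxE raddfD /= addrK Im_le_nc.
have S1 := serP Uo da zhU; have S0 := serP Uo da zU.
have Si i := serP Uo (decay_mulm i Uo da) zU.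
have HS := hsumB (hsumB S1 S0) (hsum_sum (index_enum 'I_g) xpredT (fun i => hsumZ (h 0 i) (Si i))).
apply: le_trans (hsum_bound HS (_ : asum _ (K * s ^+ 2))) _; last first.
  by rewrite expr2 mulrA ler_wpM2r // mulrC -ler_pdivlMr.
have -> : K * s ^+ 2 = ((A + 1) * s ^+ 2) * (2 / (1 - q)) ^+ g by rewrite /K; ring.
apply: asum_l1 => // [|m]; first by rewrite mulr_ge0 ?sqr_ge0 //; lra.
pose w := 2 * (pi *i)%C * lin m h.
have -> : a m * chr m (h + z) - a m * chr m z -
   \sum_i h 0 i * (2 * (pi *i)%C * (m 0 i)%:~R * a m * chr m z) =
   a m * chr m z * (cexp w - 1 - w).
  rewrite chrDr {1}/chr -/w.
  have -> : \sum_i h 0 i * (2 * (pi *i)%C * (m 0 i)%:~R * a m * chr m z) = a m * chr m z * w.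
    rewrite /w /lin !mulr_sumr; apply: eq_bigr => i _; ring.
  by ring.
have nw : nc w <= 2 * pi * ((l1 m)%:R * s) by rewrite ncM nc_2pi_i ler_wpM2l ?mulr_ge0 ?(ltW pi0) // nc_lin.
have L0 : 0 <= (l1 m)%:R :> R by rewrite ler0n.
have nw2 : nc w <= c * (l1 m)%:R.
  apply: le_trans nw _; rewrite mulrCA [c * _]mulrC ler_wpM2l // mulrC -ler_pdivlMr ?mulr_gt0 //.
rewrite ncM ncM nc_chr; apply: le_trans (ler_pM _ _ (H (imz z) _ m) (cexp_taylor2 w)) _.
- by rewrite mulr_ge0 ?nc_ge0 ?expR_ge0.
- exact: nc_ge0.
- by move=> i; rewrite subrr normr0 ltW.
apply: (@le_trans _ _ (B * expR (- d) ^+ l1 m * (4 * (2 * pi * ((l1 m)%:R * s)) ^+ 2 * expR (c * (l1 m)%:R)))).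
  rewrite ler_wpM2l ?mulr_ge0 //; apply: ler_pM; rewrite ?mulr_ge0 ?nc_ge0 ?ler_expR //.
  by rewrite ler_wpM2l // lerXn2r ?nnegrE // (le_trans (nc_ge0 w)).
have T := expR_quadr L0 c0.
apply: (@le_trans _ _ (B * expR (- d) ^+ l1 m * (4 * ((2 * pi) ^+ 2 * (2 / c ^+ 2 * expR (c * (l1 m)%:R)) * s ^+ 2) * expR (c * (l1 m)%:R)))).
  rewrite ler_wpM2l ?mulr_ge0 // ler_wpM2r // ler_wpM2l //.
  have -> : (2 * pi * ((l1 m)%:R * s)) ^+ 2 = (2 * pi) ^+ 2 * (l1 m)%:R ^+ 2 * s ^+ 2 by ring.
  by rewrite ler_wpM2r ?sqr_ge0 // ler_wpM2l ?sqr_ge0.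
apply: (@le_trans _ _ (A * s ^+ 2 * q ^+ l1 m)).
  rewrite le_eqVlt; apply/orP; left; apply/eqP; rewrite /A -!expRM_natr.
  have -> : expR (- (d / 2) * (l1 m)%:R) = expR (- d * (l1 m)%:R) * (expR (c * (l1 m)%:R) * expR (c * (l1 m)%:R)).
    by rewrite -!expRD /c; congr expR; field.
  ring.
rewrite ler_wpM2r ?exprn_ge0 ?expR_ge0 // ler_wpM2r ?sqr_ge0 //; lra.
Qed.

End LaurentSeries.

(** * Rules of differentiation *)

Section HolomorphicCalculus.
Variables (R : realType) (g : nat).
Local Notation C := R[i].
Local Notation Cg := 'rV[C]_g.
Local Notation CgN := (Cg : normedModType C).
Implicit Types (f k : Cg -> C^o) (z : Cg).

Lemma Im_realM (t : R) (w : C) : complex.Im (t%:C%C * w) = t * complex.Im w.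
Proof. by case: w => a b /=; rewrite mul0r addr0. Qed.

Lemma has_grad_unique f z L L' : has_grad f z L -> has_grad f z L' -> L =1 L'.
Proof. by move=> /has_gradP[_ H] /has_gradP[_ H'] i; rewrite -H. Qed.

Lemma has_gradD f k z L L' : has_grad f z L -> has_grad k z L' ->
  has_grad (fun z => f z + k z) z (fun i => L i + L' i).
Proof.
move=> /has_gradP[df Lf] /has_gradP[dk Lk].
have d := differentiableD df dk; have := differentiable_has_grad d.
congr has_grad; apply/funext => i; rewrite -Lf -Lk.
exact: (deriveD (@diff_derivable C CgN C^o f z 'e_i df) (@diff_derivable C CgN C^o k z 'e_i dk)).
Qed.

Lemma has_gradM f k z L L' : has_grad f z L -> has_grad k z L' ->
  has_grad (fun z => f z * k z) z (fun i => f z * L' i + k z * L i).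
Proof.
move=> /has_gradP[df Lf] /has_gradP[dk Lk].
have d := differentiableM df dk; have := differentiable_has_grad d.
congr has_grad; apply/funext => i; rewrite -Lf -Lk.
exact: (deriveM (@diff_derivable C CgN C^o f z 'e_i df) (@diff_derivable C CgN C^o k z 'e_i dk)).
Qed.

Lemma has_gradV f z L : f z != 0 -> has_grad f z L ->
  has_grad (fun z => (f z)^-1) z (fun i => - (f z) ^- 2 * L i).
Proof.
move=> fz /has_gradP[df Lf].
have d := differentiableV df fz; have := differentiable_has_grad d.
congr has_grad; apply/funext => i; rewrite -Lf.
exact: (deriveV fz (@diff_derivable C CgN C^o f z 'e_i df)).
Qed.

Lemma has_grad_cst z (c : C) : has_grad (fun=> c) z (fun=> 0).
Proof.
move=> e e0; exists 1 => // h; rewrite big1 ?subrr ?nc0; last by move=> i; rewrite mulr0.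
by rewrite mulr_ge0 ?(ltW e0) ?sumr_ge0 // => i; rewrite nc_ge0.
Qed.

Lemma has_gradZ (c : C) f z L : has_grad f z L -> has_grad (fun z => c * f z) z (fun i => c * L i).
Proof.
move=> H; have := has_gradM (has_grad_cst z c) H.
by congr has_grad; apply/funext => i; rewrite mulr0 addr0.
Qed.

Lemma has_grad_near f k z L : has_grad f z L ->
  (exists2 d : R, 0 < d & forall h : Cg, (forall i, nc (h 0 i) < d) -> f (h + z) = k (h + z)) ->
  has_grad k z L.
Proof.
move=> H [d d0 Hd] e e0; have [d1 d10 Hd1] := H e e0.
exists (Num.min d d1); first by rewrite lt_min d0.
move=> h hd; rewrite -Hd; last by move=> i; have := hd i; rewrite lt_min => /andP[].
have -> : k z = f z by have := Hd 0; rewrite add0r => -> // i; rewrite mxE nc0.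
by apply: Hd1 => i; have := hd i; rewrite lt_min => /andP[].
Qed.

Lemma eq_has_grad f k z L L' : f =1 k -> L =1 L' -> has_grad f z L -> has_grad k z L'.
Proof. by move=> /funext -> /funext ->. Qed.

(** Read off from [ser_has_grad] for a series with one nonzero coefficient. *)
Lemma has_grad_chr m z : has_grad (@chr R g m) z (fun i => 2 * (pi *i)%C * (m 0 i)%:~R * chr m z).
Proof.
pose a n : C := (n == m)%:R; pose U : 'I_g -> set R := fun=> setT.
have Uo : open_box U by split => //; exists 1.
have sm (b : 'rV[int]_g -> C) w : hsum (fun n => b n * a n * chr n w) (b m * chr m w).
  have := @hsum_fin R _ (fun n => b n * a n * chr n w) [:: m] isT; rewrite big_seq1.
  have -> : a m = 1 by rewrite /a eqxx.
  rewrite mulr1; apply.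
  by move=> n; rewrite inE /a => /negbTE ->; rewrite mulr0 mul0r.
have da : decay U a.
  move=> y; exists (expR (- (2 * pi) * dot m y)) => n; rewrite /a.
  by case: eqP => [->|_]; rewrite ?nc1 ?mul1r // nc0 mul0r.
have zU : inT U z by [].
have := ser_has_grad Uo da zU; apply: eq_has_grad => [w|i].
  by apply: ser_eq; have := sm (fun=> 1) w; rewrite mul1r; apply: eq_hsum => n; rewrite mul1r.
exact: ser_eq (sm (fun n => 2 * (pi *i)%C * (n 0 i)%:~R) z).
Qed.
End HolomorphicCalculus.

(** * Limits of bounded sequences along an ultrafilter *)

Section UltraLimit.
Variable R : realType.
Local Notation C := R[i].
Implicit Types (u v : nat -> C) (l : C).

Lemma exists_ultra : exists F : set_system nat, UltraFilter F /\ forall n, F [set r | (n <= r)%N].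
Proof.
have [F [FU sF]] := @ultraFilterLemma nat (nbhs \oo); exists F; split => // n; apply: sF.
by exists n.
Qed.

(** A fixed free ultrafilter: bounded sequences have a limit along it, linear and bounded, which is
    all that Fourier coefficients need; the dyadic averages are not shown to converge. *)
Definition ultra : set_system nat := xget [set setT] [set F | UltraFilter F /\ forall n, F [set r | (n <= r)%N]].

Lemma ultraP : UltraFilter ultra /\ forall n, ultra [set r | (n <= r)%N].
Proof. have [F HF] := exists_ultra; exact: (@xgetPex _ [set setT] [set F | UltraFilter F /\ forall n, F [set r | (n <= r)%N]] (ex_intro _ F HF)). Qed.

#[local] Instance ultra_ultra : UltraFilter ultra := ultraP.1.

Definition ulim u l := forall e : R, 0 < e -> ultra [set r | nc (u r - l) <= e].

Lemma ultra_real (v : nat -> R) (B : R) : (forall r, `|v r| <= B) ->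
  exists x : R, forall e : R, 0 < e -> ultra [set r | `|v r - x| <= e].
Proof.
move=> HB; pose A := [set x | ultra [set r | x <= v r]].
have hA : has_sup A.
  split.
    exists (- B); apply: filterS filterT => r.
    by have := HB r; rewrite ler_norml => /andP[].
  exists B => x /filter_ex[r xr]; apply: le_trans xr _; exact: le_trans (ler_norm _) (HB r).
exists (sup A) => e e0; have [x Ax xl] := sup_adherent e0 hA.
have nA : ~ ultra [set r | sup A + e <= v r].
  move=> /(ub_le_sup hA.2); rewrite gerDl leNgt e0 //.
have [//|H] := @in_ultra_setVsetC _ ultra [set r | sup A + e <= v r].
apply: filterS2 Ax H => r /= h1 /negP; rewrite -ltNge => h2.
rewrite ler_distl (ltW h2) andbT; apply: le_trans h1; exact: ltW.
Qed.

Lemma ulim_exists u (B : R) : (forall r, nc (u r) <= B) -> exists l, ulim u l.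
Proof.
move=> HB.
have [a Ha] := @ultra_real (fun r => complex.Re (u r)) B (fun r => le_trans (Re_le_nc _) (HB r)).
have [b Hb] := @ultra_real (fun r => complex.Im (u r)) B (fun r => le_trans (Im_le_nc _) (HB r)).
exists (a +i* b)%C => e e0; have e2 : 0 < e / 2 by rewrite divr_gt0.
apply: filterS2 (Ha _ e2) (Hb _ e2) => r /= h1 h2; apply: le_trans (nc_le_ReIm _) _.
case: (u) h1 h2 => h1 h2; lra.
Qed.

Lemma ulim_unique u l1 l2 : ulim u l1 -> ulim u l2 -> l1 = l2.
Proof.
move=> H1 H2; apply/eqP; rewrite -subr_eq0; apply/eqP; apply: nc_small_eq0 => e e0.
have e2 : 0 < e / 2 by rewrite divr_gt0.
have [r /= [h1 h2]] := filter_ex (filterI (H1 _ e2) (H2 _ e2)).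
rewrite -(subrKA (u r)); apply: le_trans (ncD _ _) _; rewrite nc_distC; lra.
Qed.

Lemma ulimD u v l1 l2 : ulim u l1 -> ulim v l2 -> ulim (fun r => u r + v r) (l1 + l2).
Proof.
move=> H1 H2 e e0; have e2 : 0 < e / 2 by rewrite divr_gt0.
apply: filterS2 (H1 _ e2) (H2 _ e2) => r /= h1 h2.
rewrite opprD addrACA; apply: le_trans (ncD _ _) _; lra.
Qed.

Lemma ulimZ a u l : ulim u l -> ulim (fun r => a * u r) (a * l).
Proof.
move=> H e e0; have a0 : 0 < 1 + nc a by rewrite ltr_wpDr // nc_ge0.
apply: filterS (H _ (divr_gt0 e0 a0)) => r /=; rewrite ler_pdivlMr // => h.
rewrite -mulrBr ncM; apply: le_trans h; rewrite mulrC.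
by apply: ler_wpM2l; rewrite ?nc_ge0 ?lerDr.
Qed.

Lemma ulim_sum (J : Type) (t : seq J) (u : J -> nat -> C) (l : J -> C) :
  (forall j, ulim (u j) (l j)) -> ulim (fun r => \sum_(j <- t) u j r) (\sum_(j <- t) l j).
Proof.
move=> H; elim: t => [|j t IH].
  move=> e e0; apply: filterS filterT => r /=.
  by rewrite !big_nil subrr nc0 ltW.
rewrite big_cons; have := ulimD (H j) IH.
by congr ulim; apply/funext => r; rewrite big_cons.
Qed.

Lemma ulim_event u l (P : nat -> Prop) : ulim u l -> (exists n, forall r, (n <= r)%N -> P r) ->
  forall e : R, 0 < e -> exists r, P r /\ nc (u r - l) <= e.
Proof.
move=> H [n Hn] e e0; have [r [h1]] := filter_ex (filterI (H _ e0) (ultraP.2 n)).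
exists r; split => //; exact: Hn.
Qed.

Lemma ulim_cvg u l : (forall e : R, 0 < e -> exists n, forall r, (n <= r)%N -> nc (u r - l) <= e) -> ulim u l.
Proof. by move=> H e e0; have [n Hn] := H e e0; apply: filterS (ultraP.2 n). Qed.

Lemma ulim_bound u l (B : R) : ulim u l -> (forall r, nc (u r) <= B) -> nc l <= B.
Proof.
move=> H HB; apply/ler_addgt0Pr => e e0; have [r /=] := filter_ex (H e e0).
have := ler_nc_dist l (u r); rewrite nc_distC; have := HB r; lra.
Qed.
End UltraLimit.

(** * Averages of characters and independence of the base point *)

Section FourierCoefficients.
Variables (R : realType) (g : nat).
Local Notation C := R[i].
Local Notation Cg := 'rV[C]_g.
Local Notation Zg := 'rV[int]_g.
Local Notation zvec := (map_mx (intr : int -> C)).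
Implicit Types (m n : Zg) (z p h : Cg) (y : 'I_g -> R) (a : Zg -> C) (U : 'I_g -> set R) (f b : Cg -> C).
Local Notation avg r := (davg r (fun=> 1) 1).

Lemma davg_chrD r s p w n : davg r (fun=> 1) s (p + w) (chr n) = chr n w * davg r (fun=> 1) s p (@chr R g n).
Proof. by rewrite davg_shift -davgZ; apply: davg_ext => z; rewrite chrDr mulrC. Qed.

(** At depth v the corner sum factors over the coordinates, and the factor of coordinate i is 1 +
    exp (pi i n_i s / 2^v) = 0. *)
Lemma davg_chr_vanish v s p n i : cexp ((pi *i)%C * ((n 0 i)%:~R * (s / 2 ^+ v)%:C%C)) = (-1 : C) ->
  forall r, (v < r)%N -> davg r (fun=> 1) s p (@chr R g n) = 0.
Proof.
elim: v s p => [|v IH] s p E [//|r] vr /=; last first.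
  rewrite big1 ?mulr0 // => c _; apply: IH => //.
  have -> : s / 2 / 2 ^+ v = s / 2 ^+ v.+1 by rewrite exprS invfM mulrA.
  done.
under eq_bigr do rewrite davg_chrD.
rewrite -mulr_suml.
rewrite (eq_bigr (fun c : {ffun 'I_g -> bool} => \prod_k
   (if c k then cexp (2 * (pi *i)%C * ((n 0 k)%:~R * (s / 2)%:C%C)) else 1))); last first.
  move=> c _; rewrite /chr mulr_sumr (big_morph _ (@cexpD R) (@cexp0 R)).
  apply: eq_bigr => k; rewrite !mxE mulr1; case: (c k); first by rewrite mul1r.
  by rewrite mul0r !mulr0 cexp0.
rewrite -(bigA_distr_bigA (fun (k : 'I_g) (b : bool) =>
   if b then cexp (2 * (pi *i)%C * ((n 0 k)%:~R * (s / 2)%:C%C)) else 1)).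
rewrite (bigD1 i) //= big_bool /=.
have -> : 2 * (pi *i)%C * ((n 0 i)%:~R * (s / 2)%:C%C) = (pi *i)%C * ((n 0 i)%:~R * (s / 2 ^+ 0)%:C%C).
  rewrite mulrCA.
  by rewrite -(rmorph_nat (real_complex R)); field.
by rewrite E addNr !mul0r mulr0.
Qed.

Lemma avg_chr_vanish n : n != 0 -> exists r0, forall r p, (r0 <= r)%N -> avg r p (@chr R g n) = 0.
Proof.
move=> n0; have [i ni] : exists i, n 0 i != 0.
  by apply/existsP; apply: contraNT n0; rewrite negb_exists => /forallP H; apply/eqP/rowP => i; rewrite mxE; apply/eqP; have := H i; rewrite negbK.
pose N := `|n 0%R i|%N; have N0 : (0 < N)%N by rewrite absz_gt0.
(* With n_i = 2^v d up to sign and d odd, the factor at depth v is 1 + exp (pi i d) = 0. *)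
exists (logn 2 N).+1 => r p rr; apply: (@davg_chr_vanish (logn 2 N) 1 p n i) => //.
have [d cd NE] := pfactor_coprime (isT : prime 2) N0.
have od : odd d by rewrite coprime2n in cd.
have E : cexp ((pi *i)%C * d%:R) = (-1 : C).
  by rewrite mulrC cexp_nat cexp_half_period -signr_odd od expr1.
have H : (N%:R : C) * (1 / 2 ^+ logn 2 N)%:C%C = d%:R.
  rewrite {1}NE natrM natrX -[2]/(2%:R) -!(rmorph_nat (real_complex R)) -rmorphXn -!rmorphM /=; congr (_%:C)%C.
  by field.
have [ni0|ni0] := leP 0 (n 0 i).
  have -> : (n 0 i)%:~R = N%:R :> C by rewrite pmulrn gez0_abs.
  by rewrite H.
have -> : (n 0 i)%:~R = - N%:R :> C by rewrite pmulrn ltz0_abs // rmorphN opprK.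
by rewrite mulNr H mulrN cexpN E invrN1.
Qed.

Lemma davg_le r s p f b : 0 <= s ->
  (forall u : 'I_g -> R, (forall i, 0 <= u i <= 1) ->
     nc (f (p + \row_i (u i * s)%:C%C)) <= complex.Re (b (p + \row_i (u i * s)%:C%C))) ->
  nc (davg r (fun=> 1) s p f) <= complex.Re (davg r (fun=> 1) s p b).
Proof.
elim: r s p => [|r IH] s p s0 H /=.
  have := H (fun=> 0); rewrite (_ : \row_i _ = 0) ?addr0; first by apply; rewrite lexx ler01.
  by apply/rowP => i; rewrite !mxE mul0r.
have -> : (2 ^+ g)^-1 = ((2 ^+ g)^-1 : R)%:C%C by rewrite fmorphV rmorphXn rmorph_nat.
have ReZ (t : R) (w : C) : complex.Re (t%:C%C * w) = t * complex.Re w by case: w => x y' /=; rewrite mul0r subr0.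
rewrite ReZ ncM nc_real ger0_norm // ler_wpM2l //.
rewrite raddf_sum; apply: le_trans (nc_sum _ _ _) _; apply: ler_sum => c _.
apply: IH; first by rewrite divr_ge0.
move=> u u01; have := H (fun i => (u i + (c i)%:R) / 2).
have -> : p + corner (fun=> 1) s c + \row_i (u i * (s / 2))%:C%C =
    p + \row_i ((((u i + (c i)%:R) / 2) * s)%:C%C).
  apply/rowP => i; rewrite !mxE.
  ring.
apply => i; have := u01 i.
case: (c i) => /=; lra.
Qed.

Definition periodic U f := forall z n, inT U z -> f (z + zvec n) = f z.

(** Asymptotic form of Cauchy's theorem for the averages that define the m-th Fourier
    coefficient. *)
Definition shift_invariant U f := forall m j sigma p, inT U p -> inT U (p + estep j sigma) ->
  forall e : R, 0 < e -> exists r0, forall r, (r0 <= r)%N ->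
    nc (avg r p (fun z => f z * chr (- m) z) - avg r (p + estep j sigma) (fun z => f z * chr (- m) z)) <= e.

(** What the Laurent expansion uses of a holomorphic function. These conditions pass directly to
    locally uniform limits, so Weierstrass's theorem follows from the expansion
    ([quasi_hol_approx]). *)
Definition quasi_hol U f := [/\ forall z, inT U z -> cont_at f z, periodic U f & shift_invariant U f].

Lemma imzD z h i : imz (z + h) i = imz z i + complex.Im (h 0 i).
Proof. by rewrite /imz mxE raddfD. Qed.

Lemma imz_real z (u : 'I_g -> R) i : imz (z + \row_i (u i)%:C%C) i = imz z i.
Proof. by rewrite imzD mxE addr0. Qed.

Lemma inT_real U z (u : 'I_g -> R) : inT U z -> inT U (z + \row_i (u i)%:C%C).
Proof. by move=> zU i; rewrite imz_real. Qed.

Lemma inT_zvec U z n : inT U z -> inT U (z + zvec n).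
Proof. by move=> zU i; rewrite imzD mxE -(rmorph_int (real_complex R)) addr0. Qed.

(** Goursat for f chr (- m) on the parallelogram with sides e_j and sigma e_j: the two sides
    parallel to sigma e_j differ by the period e_j and cancel. *)
Lemma hol_quasi_hol U f : open_box U -> (forall z, inT U z -> exists L, has_grad f z L) ->
  periodic U f -> quasi_hol U f.
Proof.
move=> Uo fh fp; split => //.
  move=> z /fh[L HL]; exact: has_grad_cont HL.
move=> m j sigma p pU psU e e0.
pose F z := f z * chr (- m) z.
have Fh z : inT U z -> exists L, has_grad F z L.
  move=> zU; have [L HL] := fh z zU.
  eexists; apply: has_gradM HL (has_grad_chr _ _).
have seg (t : R) (w : Cg) : 0 <= t <= 1 -> (forall i, complex.Im (w 0 i) = (i == j)%:R * (t * complex.Im sigma)) ->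
    inT U (p + w).
  move=> /andP[t0 t1] Hw i; rewrite imzD Hw; case: eqVneq => [->|_]; last by rewrite mul0r addr0.
  rewrite mul1r; have := pU j; have := psU j; rewrite imzD !mxE !eqxx mulr1.
  set j; set v := complex.Im sigma => h1 h2.
  have [v0|v0] := leP 0 v.
    apply: (Uo.2 j _ _ _ h2 h1); nra.
  apply: (Uo.2 j _ _ _ h1 h2); nra.
have [|r0 Hr0] := @goursat R g j sigma p F _ e e0.
  move=> x x01; apply: Fh; rewrite /bpoint -addrA; apply: (seg (x None)) => // i.
  by rewrite !mxE raddfD /= add0r; case: (i == j); rewrite ?mulr1 ?mulr0 ?mul1r ?mul0r // Im_realM.
exists r0 => r rr; have := Hr0 r rr; rewrite /contour mul1r.
have -> : davg r (skew j sigma) 1 (p + estep j 1%:C%C) F = davg r (skew j sigma) 1 p F.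
  rewrite davg_shift; apply/eqP; rewrite -subr_eq0; apply/eqP; apply: nc_eq0; apply/eqP; rewrite eq_le nc_ge0 andbT.
  rewrite -[- _]mulN1r -davgZ -davgD; apply: davg_bound => // u u01.
  set w := p + _.
  have wU : inT U w.
    apply: (seg (u j)) => // i; rewrite !mxE /skew mulr1; case: eqVneq => [->|_] /=.
      by rewrite mul1r Im_realM.
    lra.
  have -> : estep j 1%:C%C = zvec (delta_mx 0 j).
    by apply/rowP => i; rewrite !mxE mul1r; case: (_ && _).
  by rewrite /F fp // chrDr chr_period mulr1 mulN1r subrr nc0.
by rewrite subrr mulr0 addr0.
Qed.

End FourierCoefficients.

(** * A positive trigonometric kernel *)

Section FejerKernel.
Variables (R : realType) (g : nat).
Local Notation C := R[i].
Local Notation Cg := 'rV[C]_g.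
Local Notation Zg := 'rV[int]_g.
Implicit Types (m n : Zg) (z p h : Cg) (nu : 'I_g -> nat) (f : Cg -> C).
Local Notation avg r := (davg r (fun=> 1) 1).
Local Notation e_ j := (delta_mx 0 j : Zg).

(** For real h this is cos (pi h_j)^2; the characters make its powers visibly trigonometric
    polynomials. *)
Definition fejer j h : C := (1 + chr (e_ j) h) * (1 + chr (- e_ j) h) / 4.
Definition fejer_prod nu h : C := \prod_j fejer j h ^+ nu j.
(** The mean of cos (pi t)^(2 N) over a period. *)
Definition kap (N : nat) : R := 'C(N + N, N)%:R / 4 ^+ N.

Lemma kap_gt0 N : 0 < kap N.
Proof. by rewrite divr_gt0 // ltr0n bin_gt0 leq_addr. Qed.

(** The loss 1 / (2 (N + 1)) is the mean of 1 - cos (pi t)^2 against the normalized N-th kernel: it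
    measures how fast the kernel concentrates at 0. *)
Lemma kapS N : kap N.+1 = kap N * (1 - (2 * N.+1%:R)^-1).
Proof.
have H : ('C(N.+1 + N.+1, N.+1) * N.+1 = 2 * (N + N).+1 * 'C(N + N, N))%N.
  have h1 := mul_bin_diag (N + N).+1.
  have h4 : 'C((N + N).+1, N.+1) = 'C((N + N).+1, N).
    rewrite -(bin_sub (m := N.+1)) ?ltnS ?leq_addl //; congr 'C(_, _); lia.
  have h5 : 'C((N + N).+2, N.+1) = ('C((N + N).+1, N) * 2)%N by rewrite binS h4 muln2 addnn.
  have -> : (N.+1 + N.+1 = (N + N).+2)%N by lia.
  rewrite /=; rewrite h5 -h4 -[(2 * _ * _)%N]mulnA h1; ring.
have N0 : (N.+1%:R : R) != 0 by [].
have E : ('C(N.+1 + N.+1, N.+1)%:R : R) = 2 * (N + N).+1%:R * 'C(N + N, N)%:R / N.+1%:R.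
  by apply: (mulIf N0); rewrite mulfVK // -!natrM H.
rewrite /kap E exprS -addn1 -[(N + N).+1]addn1 !natrD in N0 *.
by field; rewrite expf_neq0 //= N0.
Qed.

Definition fej_coef nu M (k : {ffun 'I_g -> 'I_M.+1}) : C := \prod_j ('C(nu j + nu j, k j)%:R / 4 ^+ nu j).
Definition fej_idx nu M (k : {ffun 'I_g -> 'I_M.+1}) : Zg := \row_j ((k j : int) - (nu j : int)).

Lemma chr_eM (k : int) j h : chr (k *: e_ j) h = cexp (2 * (pi *i)%C * (k%:~R * h 0 j)).
Proof.
rewrite /chr /lin (bigD1 j) //= big1 ?addr0; last by move=> i ij; rewrite !mxE (negbTE ij) mulr0 mul0r.
by rewrite !mxE !eqxx mulr1.
Qed.

Lemma fejer_prodE nu M h : (forall j, (nu j + nu j <= M)%N) ->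
  fejer_prod nu h = \sum_(k : {ffun 'I_g -> 'I_M.+1}) fej_coef nu k * chr (fej_idx nu k) h.
Proof.
move=> HM.
have E j : fejer j h ^+ nu j = \sum_(k < M.+1) 'C(nu j + nu j, k)%:R / 4 ^+ nu j * chr (((k : int) - (nu j : int)) *: e_ j) h.
  set X := chr (e_ j) h; have X0 : X != 0 := chr_neq0 _ _.
  have -> : fejer j h ^+ nu j = X ^- nu j * (1 + X) ^+ (nu j + nu j) / 4 ^+ nu j.
    rewrite /fejer chrN !exprMn exprVn exprD.
    have -> : 1 + X^-1 = X^-1 * (1 + X) by rewrite mulrDr mulr1 mulVf // addrC.
    rewrite exprMn exprVn; ring.
  have -> : (1 + X) ^+ (nu j + nu j) = \sum_(k < M.+1) 'C(nu j + nu j, k)%:R * X ^+ k.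
    rewrite exprDn (big_ord_widen M.+1 (fun k => 1 ^+ (nu j + nu j - k) * X ^+ k *+ 'C(nu j + nu j, k))) ?ltnS //.
    rewrite big_mkcond; apply: eq_bigr => k; case: ltnP => kn.
      by rewrite expr1n mul1r mulr_natl.
    by rewrite bin_small ?mul0r.
  rewrite mulr_sumr mulr_suml; apply: eq_bigr => k _.
  have Xk (l : nat) : X ^+ l = chr ((l : int) *: e_ j) h.
    rewrite chr_eM mulrCA cexp_nat; congr (_ ^+ _).
    by have := chr_eM 1 j h; rewrite scale1r mul1r.
  rewrite scalerBl chrDl chrN -!Xk; ring.
rewrite /fejer_prod (eq_bigr _ (fun j _ => E j)).
rewrite bigA_distr_bigA; apply: eq_bigr => k _; rewrite big_split; congr (_ _).
rewrite -(big_morph _ (@cexpD R) (@cexp0 R)) -mulr_sumr; congr (cexp (_ _)).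
rewrite exchange_big; apply: eq_bigr => j; rewrite -mulr_suml.
rewrite (bigD1 j) //= big1 ?addr0; first by rewrite !mxE !eqxx mulr1.
by move=> i ij; rewrite !mxE eq_sym (negbTE ij) mulr0.
Qed.

Lemma avg_fejer nu z : exists r0, forall r, (r0 <= r)%N ->
  avg r z (fun w => fejer_prod nu (w - z)) = \prod_j (kap (nu j))%:C%C.
Proof.
pose M := (\sum_j (nu j + nu j))%N.
have HM j : (nu j + nu j <= M)%N by rewrite /M (bigD1 j) //= leq_addr.
have idx0 (k : {ffun 'I_g -> 'I_M.+1}) : fej_idx nu k = 0 -> forall j, (k j : nat) = nu j.
  by move=> /rowP H j; have := H j; rewrite !mxE => /eqP; rewrite subr_eq0 => /eqP[].
have R0 (k : {ffun 'I_g -> 'I_M.+1}) : exists r0, fej_idx nu k != 0 -> forall r p, (r0 <= r)%N -> avg r p (@chr R g (fej_idx nu k)) = 0.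
  have [e|ne] := eqVneq (fej_idx nu k); first by exists 0%N.
  by have [r0] := @avg_chr_vanish R g _ ne; exists r0.
have /choice[r0 Hr0] := R0.
exists (\max_k r0 k) => r rr.
rewrite (@davg_ext R g r _ 1 z _ (fun w => \sum_(k : {ffun 'I_g -> 'I_M.+1})
   (fej_coef nu k * chr (fej_idx nu k) (- z)) * chr (fej_idx nu k) w)); last first.
  move=> w; rewrite (fejer_prodE _ HM); apply: eq_bigr => k _; rewrite chrDr; ring.
rewrite davg_sum; have lt j : (nu j < M.+1)%N by rewrite ltnS; apply: leq_trans (HM j); exact: leq_addr.
rewrite (bigD1 [ffun j => Ordinal (lt j)]) //= big1 ?addr0 => [|k kn].
  have e0 : fej_idx nu [ffun j => Ordinal (lt j)] = 0.
    by apply/rowP => j; rewrite !mxE ffunE subrr.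
  rewrite davgZ e0 (@davg_ext R g r _ 1 z _ (fun=> 1)); last by move=> w; rewrite chr0.
  rewrite davg_cst chr0 !mulr1; apply: eq_bigr => j; rewrite ffunE.
  by rewrite rmorphM fmorphV rmorphXn !rmorph_nat.
rewrite davgZ Hr0 ?mulr0 //; last by apply: leq_trans rr; exact: leq_bigmax.
apply: contra kn => /eqP/idx0 H; apply/eqP/ffunP => j; apply: val_inj.
by rewrite ffunE /=.
Qed.

Lemma fejer_real j (u : 'I_g -> R) : fejer j (\row_i (u i)%:C%C) = ((1 + cos (2 * pi * u j)) / 2)%:C%C.
Proof.
have E (s : int) : chr (s *: e_ j) (\row_i (u i)%:C%C) = (cos (s%:~R * (2 * pi * u j)) +i* sin (s%:~R * (2 * pi * u j)))%C.
  rewrite chr_eM mxE.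
  have -> : 2 * (pi *i)%C * (s%:~R * (u j)%:C%C) = (0 +i* (s%:~R * (2 * pi * u j)))%C.
    rewrite -(rmorph_int (real_complex R)) -(rmorph_nat (real_complex R)).
    apply/eqP; rewrite eq_complex /=; apply/andP; split; apply/eqP; ring.
  by rewrite /= expR0 !mul1r.
have := E 1; have := E (-1); rewrite scaleN1r scale1r mul1r mulN1r cosN sinN /fejer => -> ->.
rewrite -(rmorph_nat (real_complex R)) -fmorphV; apply/eqP; rewrite eq_complex /=.
have := cos2Dsin2 (2 * pi * u j); set c := cos _; set s := sin _ => h.
apply/andP; split; apply/eqP; last by field.
transitivity (((1 + c) * (1 + c) + s * s) / 4); first ring.
lra.
Qed.

End FejerKernel.

(** * Uniqueness of Fourier coefficients and existence of Laurent expansions *)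

Section LaurentExpansion.
Variables (R : realType) (g : nat).
Local Notation C := R[i].
Local Notation Cg := 'rV[C]_g.
Local Notation Zg := 'rV[int]_g.
Local Notation zvec := (map_mx (intr : int -> C)).
Implicit Types (m n : Zg) (z p h w : Cg) (a : Zg -> C) (U : 'I_g -> set R) (f : Cg -> C).
Local Notation avg r := (davg r (fun=> 1) 1).
Local Notation rvec u := (\row_i (u i)%:C%C : Cg).

(** Bisection on the unit cube of real parts, then reduction modulo the periods. *)
Lemma torus_bounded U f z : (forall w, inT U w -> cont_at f w) -> periodic U f -> inT U z ->
  exists B : R, forall u : 'I_g -> R, nc (f (z + rvec u)) <= B.
Proof.
move=> fc fp zU.
pose G (x : 'I_g -> R) s := exists B, forall u, (forall i, x i <= u i <= x i + s) -> nc (f (z + rvec u)) <= B.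
have [B HB] : G (fun=> 0) 1.
  apply: bisection => //.
  - move=> x s s0 H; have /choice[BB HBB] := H; exists (\sum_c `|BB c|) => u ux.
    pose c : {ffun 'I_g -> bool} := [ffun i => x i + s / 2 <= u i].
    apply: le_trans (HBB c u _) _; last first.
      by apply: le_trans (ler_norm _) _; rewrite (bigD1 c) //= lerDl sumr_ge0.
    move=> i; have := ux i; rewrite ffunE.
    case hh : (x i + s / 2 <= u i); rewrite /=; lra.
  - move=> t; have [d d0 Hd] := fc (z + rvec t) (inT_real t zU) 1 ltr01.
    exists d => // x s /andP[s0 sd] xt; exists (1 + nc (f (z + rvec t))) => u ux.
    rewrite -lerBlDr; apply: le_trans (ler_nc_dist _ _) _.
    have := Hd (rvec (fun i => u i - t i)).
    rewrite (_ : rvec (fun i => u i - t i) + (z + rvec t) = z + rvec u).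
      apply => i; rewrite mxE nc_real; apply: le_lt_trans sd.
      have := xt i; have := ux i.
      rewrite ler_norml; lra.
    apply/rowP => i; rewrite !mxE; ring.
exists B => u; pose n := \row_i Num.floor (u i).
have -> : z + rvec u = z + rvec (fun i => u i - (Num.floor (u i))%:~R) + zvec n.
  by apply/rowP => i; rewrite !mxE rmorphB rmorph_int -addrA subrK.
rewrite fp; last exact: inT_real.
apply: HB => i; have := floor_itv (u i).
lra.
Qed.

Definition coef U f m c := forall z, inT U z -> ulim (fun r => avg r z (fun w => f w * chr (- m) w)) c.

(** Coordinates are changed one at a time; intermediate points stay in the tube because U is a
    product. *)
Lemma base_change U f m c z w : shift_invariant U f -> inT U z -> inT U w ->
  ulim (fun r => avg r z (fun w => f w * chr (- m) w)) c -> ulim (fun r => avg r w (fun w => f w * chr (- m) w)) c.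
Proof.
move=> fs zU wU Hz.
pose p (k : nat) := \row_i (if (i < k)%N then w 0 i else z 0 i).
have pU k : inT U (p k) by move=> i; rewrite /imz mxE; case: ifP.
suff H k : ulim (fun r => avg r (p k) (fun w => f w * chr (- m) w)) c.
  by have := H g; rewrite (_ : p g = w) //; apply/rowP => i; rewrite mxE ltn_ord.
elim: k => [|k IH]; first by rewrite (_ : p 0%N = z) //; apply/rowP => i; rewrite mxE.
have [kg|kg] := ltnP k g; last first.
  rewrite (_ : p k.+1 = p k) //; apply/rowP => i; rewrite !mxE; have := ltn_ord i => ig; congr (if _ then _ else _); lia.
pose j := Ordinal kg.
have E : p k.+1 = p k + estep j (w 0 j - z 0 j).
  apply/rowP => i; rewrite !mxE ltnS leq_eqVlt; case: (eqVneq i) => [->|ij] /=.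
    by rewrite eqxx ltnn mulr1 addrC subrK.
  by rewrite mulr0 addr0 (_ : (i == k :> nat) = false) //; apply/negbTE.
have pU1 : inT U (p k + estep j (w 0 j - z 0 j)) by rewrite -E.
have D : ulim (fun r => avg r (p k.+1) (fun w => f w * chr (- m) w) - avg r (p k) (fun w => f w * chr (- m) w)) 0.
  apply: ulim_cvg => e e0; have [r0 Hr0] := fs m j _ _ (pU k) pU1 e e0.
  exists r0 => rr; rewrite subr0 E nc_distC; exact: Hr0.
have := ulimD IH D; rewrite addr0; congr ulim; apply/funext => r.
ring.
Qed.

Lemma coef_exists U f m z : quasi_hol U f -> inT U z -> exists c, coef U f m c.
Proof.
move=> [fc fp fs] zU; have [B HB] := torus_bounded fc fp zU.
have [|c Hc] := @ulim_exists R (fun r => avg r z (fun w => f w * chr (- m) w)) (B * nc (chr (- m) z)).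
  move=> r; apply: davg_bound => // u _.
  have -> : \row_i ((u i * 1)%:C%C * 1) = rvec u by apply/rowP => i; rewrite !mxE !mulr1.
  rewrite ncM; apply: ler_pM; rewrite ?nc_ge0 //.
  by rewrite !nc_chr /dot; under eq_bigr do rewrite imz_real.
exists c => w wU; exact: base_change wU Hc.
Qed.

Lemma coef_bound U f m c z (B : R) : coef U f m c -> inT U z -> (forall u, nc (f (z + rvec u)) <= B) ->
  nc c * expR (- (2 * pi) * dot m (imz z)) <= B.
Proof.
move=> Hc zU HB; rewrite -ler_pdivlMr ?expR_gt0 // -expRN.
apply: ulim_bound (Hc z zU) _ => r; apply: davg_bound => // u _.
have -> : \row_i ((u i * 1)%:C%C * 1) = rvec u by apply/rowP => i; rewrite !mxE !mulr1.
rewrite ncM; apply: ler_pM; rewrite ?nc_ge0 //.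
rewrite nc_chr ler_expR /dot; under eq_bigr do rewrite imz_real mxE rmorphN mulNr.
rewrite sumrN; lra.
Qed.

Lemma ser_coef U a m : open_box U -> decay U a -> coef U (ser a) m (a m).
Proof.
move=> Uo da z zU; apply: ulim_cvg => e e0.
have [B HB] := decay_asum Uo da zU.
have N0 : 0 < nc (chr (- m) z) by apply: nc_gt0; exact: chr_neq0.
have [t0 [ut0 Ht0]] := asum_tail HB (divr_gt0 e0 N0).
have R0 (n : Zg) : exists r0, n - m != 0 -> forall r p, (r0 <= r)%N -> avg r p (@chr R g (n - m)) = 0.
  have [e1|ne] := eqVneq (n - m); first by exists 0%N.
  by have [r0] := @avg_chr_vanish R g _ ne; exists r0.
have /choice[r0 Hr0] := R0.
exists (\max_(n <- m :: t0) r0 n)%N => r rr.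
have rrn n : n \in m :: t0 -> (r0 n <= r)%N by move=> nt; apply: leq_trans rr; rewrite (big_rem n) //= leq_maxl.
pose t := undup (m :: t0).
have [ut mt] : uniq t /\ m \in t by rewrite undup_uniq mem_undup mem_head.
have t0t : {subset t0 <= t} by move=> x xt; rewrite mem_undup in_cons xt orbT.
have E : avg r z (fun w => (\sum_(n <- t) a n * chr n w) * chr (- m) w) = a m.
  rewrite (@davg_ext R g r _ 1 z _ (fun w => \sum_(n <- t) a n * chr (n - m) w)); last first.
    by move=> w; rewrite mulr_suml; apply: eq_bigr => n; rewrite -mulrA -chrDl.
  rewrite davg_sum (big_rem m) //= davgZ subrr (@davg_ext R g r _ 1 z _ (fun=> 1)); last by move=> w; rewrite chr0.
  rewrite davg_cst mulr1 big_seq big1 ?addr0 // => n.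
  rewrite rem_filter // mem_filter => /andP[nm nt].
  by rewrite davgZ Hr0 ?mulr0 ?subr_eq0 // rrn // -mem_undup.
rewrite -E -[- avg _ _ _]mulN1r -davgZ -davgD; apply: davg_bound => // u _.
have -> : \row_i ((u i * 1)%:C%C * 1) = rvec u by apply/rowP => i; rewrite !mxE !mulr1.
set w := z + rvec u; have wU : inT U w by exact: inT_real.
rewrite mulN1r -mulrBl ncM.
have nchr n : nc (chr n w) = nc (chr n z).
  by rewrite !nc_chr; congr (expR (_ _)); apply: eq_bigr => i; rewrite imz_real.
rewrite nchr -ler_pdivlMr //.
have H1 := hsumB (serP Uo da wU) (hsum_fin ut (_ : forall n, n \notin t -> (if n \in t then a n * chr n w else 0) = 0)).
have -> : \sum_(n <- t) a n * chr n w = \sum_(n <- t) (if n \in t then a n * chr n w else 0).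
  by rewrite big_seq [RHS]big_seq; apply: eq_bigr => n ->.
apply: hsum_bound (H1 _) _; first by move=> n /negbTE ->.
apply: asum_le Ht0 => n; case: ifP => [_|nt]; first by rewrite subrr; rewrite ?nc0 ?nc_ge0.
rewrite subr0; case: ifP => [/t0t|_]; first by rewrite nt.
by rewrite !ncM nchr.
Qed.

Lemma cos_gap (d : R) : 0 < d -> exists2 eta : R, 0 < eta & forall t : R, `|t| <= 1 / 2 -> d <= `|t| -> eta <= 1 - cos (2 * pi * t).
Proof.
move=> d0; have pi0 := pi_gt0 R; pose d1 := Num.min d (1 / 2).
have d10 : 0 < d1 by rewrite lt_min d0 divr_gt0.
have d1h : d1 <= 1 / 2 by rewrite ge_min lexx orbT.
have : (0 : R) \in `[0, pi] by rewrite in_itv /= lexx ltW.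
have : 2 * pi * d1 \in `[0, pi].
  rewrite in_itv //=; nra.
exists (1 - cos (2 * pi * d1)).
  have : cos (2 * pi * d1) < cos 0 by rewrite ltr_cos // !mulr_gt0.
  by rewrite cos0 subr_gt0.
move=> t t1 td; have -> : cos (2 * pi * t) = cos (2 * pi * `|t|).
  by have [h|h] := ger0P; rewrite // mulrN cosN.
have m2 : 2 * pi * `|t| \in `[0, pi].
  rewrite in_itv //=; nra.
rewrite lerD2l lerN2 leNgt ltr_cos //.
have : d1 <= `|t| by rewrite ge_min td.
nra.
Qed.

(** Approximate identity. Vanishing coefficients kill the average of f against the kernel, so f(z)
    times the mass kg is, up to e kg, the average of f(z) - f(w) against it. The increment is at
    most e + A sum_j (1 - cos (2 pi u_j)), and by [kapS] the second term averages to A g kg / (N +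
    1) <= e kg. *)
Lemma fourier_unique U f : (forall w, inT U w -> cont_at f w) -> periodic U f ->
  (forall m, coef U f m 0) -> forall z, inT U z -> f z = 0.
Proof.
move=> fc fp f0 z zU; have [B HB] := torus_bounded fc fp zU.
have B0 : 0 <= B by apply: le_trans (HB (fun=> 0)); exact: nc_ge0.
apply: nc_small_eq0 => e3 e30; pose e := e3 / 3; have e0 : 0 < e by rewrite divr_gt0.
have [d d0 Hd] := fc z zU e e0.
have [eta eta0 Heta] := cos_gap d0.
pose A := 2 * B / eta; have A0 : 0 <= A by rewrite divr_ge0 ?mulr_ge0 // ltW.
(* near z continuity controls the increment, elsewhere some [1 - cos] is bounded below *)
have near u : nc (f (z + rvec u) - f z) <= e + A * \sum_j (1 - cos (2 * pi * u j)).
  have c0 (t : R) : 0 <= 1 - cos t by rewrite subr_ge0 cos_le1.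
  pose k j := Num.floor (u j + 1 / 2); pose t j := u j - (k j)%:~R.
  have t2 j : `|t j| <= 1 / 2.
    have /andP[h1 h2] := floor_itv (u j + 1 / 2); rewrite -/(k j) intrD1 in h1 h2.
    by rewrite /t ler_norml; lra.
  have cosE j : cos (2 * pi * u j) = cos (2 * pi * t j).
    have E (v : R) : complex.Re (cexp (2 * (pi *i)%C * v%:C%C)) = cos (2 * pi * v).
      have -> : 2 * (pi *i)%C * v%:C%C = (0 +i* (2 * pi * v))%C.
        by rewrite -(rmorph_nat (real_complex R) 2); apply/eqP; rewrite eq_complex /=; apply/andP; split; apply/eqP; ring.
      by rewrite /= expR0 mul1r.
    have -> : t j = u j - (k j)%:~R by [].
    rewrite -!E [X in _ = complex.Re (cexp (_ * X))](_ : _ = (u j)%:C%C - (k j)%:~R).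
      by rewrite mulrBr cexpD cexpN cexp_int_period invr1 mulr1.
    by rewrite rmorphB rmorph_int.
  have fE : f (z + rvec u) = f (z + rvec t).
    rewrite (_ : z + rvec u = z + rvec t + zvec (\row_j k j)); first by rewrite fp //; exact: inT_real.
    by apply/rowP => i; rewrite !mxE /t rmorphB /= rmorph_int -addrA subrK.
  have S0 : 0 <= \sum_j (1 - cos (2 * pi * u j)) by rewrite sumr_ge0.
  have [[j dj]|H] := pselect (exists j, d <= `|t j|).
    apply: (@le_trans _ _ (2 * B)).
      by apply: le_trans (ncB _ _) _; rewrite mulr_natl mulr2n; apply: lerD; rewrite // -[z]addr0 (_ : 0 = rvec (fun=> 0)) //; apply/rowP => i; rewrite !mxE.
    apply: (@le_trans _ _ (A * eta)); first by rewrite /A mulfVK // gt_eqF.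
    apply: (@le_trans _ _ (A * \sum_j (1 - cos (2 * pi * u j)))); last by rewrite lerDr ltW.
    rewrite ler_wpM2l //; apply: le_trans (Heta _ (t2 j) dj) _; rewrite -cosE.
    by rewrite (bigD1 j) //= lerDl sumr_ge0.
  rewrite fE; apply: le_trans (_ : _ <= e) _; last by rewrite lerDl mulr_ge0.
  rewrite [z + rvec t]addrC; apply: Hd => i; rewrite mxE nc_real.
  by rewrite ltNge; apply/negP => h; apply: H; exists i.
pose N := Num.truncn (A * g%:R / e).
have HN : A * g%:R / N.+1%:R <= e.
  rewrite ler_pdivrMr ?ltr0n // [e * _]mulrC -ler_pdivrMr //; apply: ltW.
  by have /andP[_] := truncn_itv (divr_ge0 (mulr_ge0 A0 (ler0n _ g)) (ltW e0)).
pose nu0 : 'I_g -> nat := fun=> N; pose nu1 j : 'I_g -> nat := fun i => (N + (i == j))%N.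
have [r0 Hr0] := avg_fejer nu0 z.
have /choice[r1 Hr1] : forall j, exists r1, forall r, (r1 <= r)%N ->
  avg r z (fun w => fejer_prod (nu1 j) (w - z)) = \prod_i (kap R (nu1 j i))%:C%C by move=> j; exact: avg_fejer.
pose kg := kap R N ^+ g; have kg0 : 0 < kg by rewrite exprn_gt0 // kap_gt0.
have F0 : ulim (fun r => avg r z (fun w => f w * fejer_prod nu0 (w - z))) 0.
  pose M := (\sum_j (nu0 j + nu0 j))%N.
  have HM j : (nu0 j + nu0 j <= M)%N by rewrite /M (bigD1 j) //= leq_addr.
  have := ulim_sum (index_enum {ffun 'I_g -> 'I_M.+1}) (fun k => ulimZ (fej_coef R nu0 k * chr (fej_idx nu0 k) (- z)) (f0 (- fej_idx nu0 k) z zU)).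
  rewrite big1 => [|k _]; last by rewrite mulr0.
  congr ulim; apply/funext => r; rewrite -[RHS](@davg_ext R g r _ 1 z (fun w => \sum_(k : {ffun 'I_g -> 'I_M.+1})
    (fej_coef R nu0 k * chr (fej_idx nu0 k) (- z)) * (f w * chr (- - fej_idx nu0 k) w))).
    by rewrite davg_sum; apply: eq_bigr => k _; rewrite davgZ.
  by move=> w; rewrite (fejer_prodE _ HM) mulr_sumr; apply: eq_bigr => k _; rewrite opprK chrDr; ring.
have [r [rr Hr]] := ulim_event F0 (ex_intro _ (maxn r0 (\max_j r1 j)) (fun r rr => rr)) (mulr_gt0 e0 kg0).
move: rr; rewrite geq_max => /andP[rr0 rr1].
have prodK : \prod_(j : 'I_g) (kap R (nu0 j))%:C%C = kg%:C%C :> C.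
  by rewrite /kg rmorphXn (eq_bigr (fun=> (kap R N)%:C%C)) // prodr_const card_ord.
have K1 j : \prod_i (kap R (nu1 j i))%:C%C = (kg * (1 - (2 * N.+1%:R)^-1))%:C%C :> C.
  rewrite (bigD1 j) //= /nu1 eqxx addn1 kapS.
  rewrite (eq_bigr (fun=> (kap R N)%:C%C)) => [|i /negbTE ->]; last by rewrite addn0.
  have H : kg%:C%C = (kap R N)%:C%C * \prod_(i | i != j) (kap R N)%:C%C :> C.
    by rewrite -prodK (bigD1 j).
  by rewrite [RHS](rmorphM (real_complex R)) /= H (rmorphM (real_complex R)) /= mulrAC.
have KR u : fejer_prod nu0 (rvec u) = (\prod_j ((1 + cos (2 * pi * u j)) / 2) ^+ N)%:C%C.
  by rewrite rmorph_prod; apply: eq_bigr => j _; rewrite fejer_real rmorphXn.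
have Kge u : 0 <= \prod_(j < g) ((1 + cos (2 * pi * u j)) / 2) ^+ N :> R.
  by rewrite prodr_ge0 // => j _; rewrite exprn_ge0 // divr_ge0 // -lerBlDl sub0r cos_geN1.
pose b w := (e%:C%C + A%:C%C * \sum_j 2 * (1 - fejer j (w - z))) * fejer_prod nu0 (w - z).
have avgb : avg r z b = (e * kg + A * \sum_(j < g) (2 * (kg - kg * (1 - (2 * N.+1%:R)^-1))))%:C%C.
  rewrite (@davg_ext R g r _ 1 z _ (fun w => e%:C%C * fejer_prod nu0 (w - z) + A%:C%C *
     \sum_j (2 * (fejer_prod nu0 (w - z) + -1 * fejer_prod (nu1 j) (w - z))))); last first.
    move=> w; rewrite /b mulrDl; congr (_ + _); rewrite -mulrA; congr (_ * _); rewrite mulr_suml.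
    apply: eq_bigr => j _; rewrite -mulrA; congr (_ * _); rewrite mulrBl mul1r mulN1r; congr (_ - _).
    rewrite /fejer_prod (bigD1 j) //= (bigD1 (P := predT) (F := fun i => _ ^+ nu1 j i) j) //= /nu1 /nu0 eqxx addn1 exprS mulrA; congr (_ * _).
    by apply: eq_bigr => i /negbTE ->; rewrite addn0.
  rewrite davgD !davgZ Hr0 // prodK rmorphD !rmorphM; congr (_ + _ * _).
  rewrite davg_sum rmorph_sum; apply: eq_bigr => j _.
  rewrite davgZ davgD davgZ Hr0 // prodK Hr1 ?K1; last by apply: leq_trans rr1; exact: leq_bigmax.
  by rewrite mulN1r -(rmorph_nat (real_complex R) 2) [RHS](rmorphM (real_complex R)) (rmorphB (real_complex R)).
have main : nc (f z) * kg <= e * kg + (e * kg + A * \sum_(j < g) (2 * (kg - kg * (1 - (2 * N.+1%:R)^-1)))).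
  have -> : nc (f z) * kg = nc (f z * kg%:C%C) by rewrite ncM nc_real gtr0_norm.
  have -> : f z * kg%:C%C = avg r z (fun w => f w * fejer_prod nu0 (w - z)) +
      avg r z (fun w => (f z - f w) * fejer_prod nu0 (w - z)).
    rewrite -davgD -prodK -(Hr0 r rr0) -davgZ; apply: davg_ext => w; ring.
  apply: le_trans (ncD _ _) _; apply: lerD; first by move: Hr; rewrite subr0.
  have -> : e * kg + A * \sum_(j < g) (2 * (kg - kg * (1 - (2 * N.+1%:R)^-1))) = complex.Re (avg r z b) by rewrite avgb.
  apply: davg_le => // u; have -> : rvec (fun i => u i * 1) = rvec u by apply/rowP => i; rewrite !mxE mulr1.
  have zu : z + rvec u - z = rvec u by rewrite addrC addrA addNr add0r.
  rewrite /b zu KR.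
  have -> : (e%:C%C + A%:C%C * \sum_j 2 * (1 - fejer j (rvec u))) * (\prod_j ((1 + cos (2 * pi * u j)) / 2) ^+ N)%:C%C =
     ((e + A * \sum_j (1 - cos (2 * pi * u j))) * \prod_j ((1 + cos (2 * pi * u j)) / 2) ^+ N)%:C%C.
    have -> : \sum_j 2 * (1 - fejer j (rvec u)) = (\sum_j (1 - cos (2 * pi * u j)))%:C%C.
      rewrite [RHS](rmorph_sum (real_complex R)); apply: eq_bigr => j _.
      rewrite fejer_real; apply/eqP; rewrite eq_complex /=.
      lra.
    ring.
  rewrite ncM nc_real (ger0_norm (Kge u)) ler_wpM2r // nc_distC; exact: near.
rewrite sumr_const card_ord in main.
rewrite -(ler_pM2r kg0); apply: le_trans main _.
have -> : e3 = e + e + e by rewrite /e; field.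
rewrite -[X in A * X]mulr_natl.
have N1 : N.+1%:R != 0 :> R by [].
have -> : 2 * (kg - kg * (1 - (2 * N.+1%:R)^-1)) = kg / N.+1%:R by set N1; field.
have -> : A * (g%:R * (kg / N.+1%:R)) = A * g%:R / N.+1%:R * kg by ring.
have := ler_wpM2r (ltW kg0) HN; set X := _ / _.
lra.
Qed.

(** The ultrafilter limits give coefficients a; f - ser a has all coefficients 0 by [ser_coef],
    hence vanishes. *)
Theorem quasi_hol_laurent U f : open_box U -> quasi_hol U f ->
  exists2 a, decay U a & forall z, inT U z -> f z = ser a z.
Proof.
move=> Uo fq; have [fc fp] := fq.
have [[z0 z0U]|nU] := pselect (exists z, inT U z); last first.
  exists (fun=> 0).
    by move=> y yU; exfalso; apply: nU; exists (\row_i (0 +i* y i)%C) => i; rewrite /imz mxE.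
  by move=> z zU; exfalso; apply: nU; exists z.
have /choice[a Ha] : forall m, exists c, coef U f m c by move=> m; exact: coef_exists.
have da : decay U a.
  move=> y yU; pose z := \row_i (0 +i* y i)%C.
  have zU : inT U z by move=> i; rewrite /imz mxE.
  have [B HB] := torus_bounded fc fp zU; exists B => m.
  have := coef_bound (Ha m) zU HB; congr (_ * expR (_ * _) <= _).
  by apply: eq_bigr => i; rewrite /imz mxE.
exists a => // z zU; apply/eqP; rewrite -subr_eq0; apply/eqP.
have sg w : inT U w -> has_grad (ser a) w _ := fun wU => ser_has_grad Uo da wU.
apply: (@fourier_unique U (fun z => f z - ser a z)) zU.
- move=> w wU e e0; have e2 : 0 < e / 2 by rewrite divr_gt0.
  have [d d0 Hd] := fc w wU _ e2; have [d' d'0 Hd'] := has_grad_cont (sg w wU) e2.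
  exists (Num.min d d'); first by rewrite lt_min d0.
  move=> h hd; rewrite (_ : _ _ = (f (h + w) - f w) - (ser a (h + w) - ser a w)); last ring.
  apply: le_trans (ncB _ _) _.
  rewrite [leRHS]splitr; apply: lerD; first by apply: Hd => i; have := hd i; rewrite lt_min => /andP[].
  by apply: Hd' => i; have := hd i; rewrite lt_min => /andP[].
- move=> w n wU; rewrite fp //; congr (_ - _).
  by congr (xget); congr hsum; apply/funext => m; rewrite chrDr chr_period mulr1.
- move=> m w wU; have := ulimD (Ha m w wU) (ulimZ (-1) (ser_coef m Uo da wU)).
  rewrite mulN1r subrr; congr ulim; apply/funext => r.
  by rewrite -davgZ -davgD; apply: davg_ext => v; rewrite mulrBl mulN1r.
Qed.

End LaurentExpansion.

(** * The unit ideal in periodic entire functions *)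

Section Holomorphic.
Variables (R : realType) (g : nat).
Local Notation C := R[i].
Local Notation Cg := 'rV[C]_g.
Local Notation Zg := 'rV[int]_g.
Local Notation zvec := (map_mx (intr : int -> C)).
Implicit Types (m n : Zg) (z h w : Cg) (a : Zg -> C) (U : 'I_g -> set R) (y : 'I_g -> R).
Local Notation rvec u := (\row_i (u i)%:C%C : Cg).
Local Notation ivec y := (\row_i (0 +i* y i)%C : Cg).

Definition hol U (f : Cg -> C^o) := (forall z, inT U z -> exists L, has_grad f z L) /\ periodic U f.

Lemma holM U (f k : Cg -> C^o) : hol U f -> hol U k -> hol U (fun z => f z * k z).
Proof.
move=> [hf pf] [hk pk]; split => [z zU|z n zU]; last by rewrite pf ?pk.
have [L HL] := hf z zU; have [L' HL'] := hk z zU; eexists; exact: has_gradM HL HL'.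
Qed.

Lemma holD U (f k : Cg -> C^o) : hol U f -> hol U k -> hol U (fun z => f z + k z).
Proof.
move=> [hf pf] [hk pk]; split => [z zU|z n zU]; last by rewrite pf ?pk.
have [L HL] := hf z zU; have [L' HL'] := hk z zU; eexists; exact: has_gradD HL HL'.
Qed.

Lemma hol_cst U (c : C) : hol U (fun=> c).
Proof. split => //; exists (fun=> 0); exact: has_grad_cst. Qed.

Lemma holZ U (c : C) (f : Cg -> C^o) : hol U f -> hol U (fun z => c * f z).
Proof. exact: holM (hol_cst _ _). Qed.

Lemma holB U (f k : Cg -> C^o) : hol U f -> hol U k -> hol U (fun z => f z - k z).
Proof.
move=> hf hk; have := holD hf (holZ (-1) hk).
by congr hol; apply/funext => z; rewrite mulN1r.
Qed.

Lemma hol_sum (J : Type) (t : seq J) (P : pred J) U (F : J -> Cg -> C^o) :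
  (forall j, hol U (F j)) -> hol U (fun z => \sum_(j <- t | P j) F j z).
Proof.
move=> H; elim: t => [|j t IH].
  by have := hol_cst U 0; congr hol; apply/funext => z; rewrite big_nil.
case Pj: (P j); last by move: IH; congr hol; apply/funext => z; rewrite big_cons Pj.
by have := holD (H j) IH; congr hol; apply/funext => z; rewrite big_cons Pj.
Qed.

Lemma hol_chr U m : hol U (@chr R g m).
Proof.
split => [z _|z n]; first by eexists; exact: has_grad_chr.
by rewrite chrDr chr_period mulr1.
Qed.

Lemma hol_ser U a : open_box U -> decay U a -> hol U (ser a).
Proof.
move=> da; split => [z zU|z n zU]; first by eexists; exact: ser_has_grad zU.
rewrite /ser; congr (xget); congr hsum.
by apply/funext => m; rewrite chrDr chr_period mulr1.
Qed.

Lemma hol_sub U U' (f : Cg -> C^o) : (forall i, U' i `<=` U i) -> hol U f -> hol U' f.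
Proof. by move=> sub [hf pf]; split => [z zU|z n zU]; [apply: hf|apply: pf] => i; apply: sub. Qed.

Lemma hol_laurent U (f : Cg -> C^o) : open_box U -> hol U f -> exists2 a, decay U a & forall z, inT U z -> f z = ser a z.
Proof. move=> Uo [hf pf]; apply: quasi_hol_laurent => //; exact: hol_quasi_hol. Qed.

Definition obox (p q : 'I_g -> R) : 'I_g -> set R := fun i t => p i < t < q i.

Lemma obox_open p q : open_box (obox p q).
Proof.
split.
  move=> i x /andP[h1]; exists (Num.min (x - p i) (q i - x) / 2).
    by rewrite divr_gt0 // lt_min !subr_gt0 h1.
  move=> x'; have := ler_norm (x' - x); have := ler_norm (x - x'); rewrite distrC.
  have : Num.min (x - p i) (q i - x) <= x - p i by rewrite ge_min lexx.
  have : Num.min (x - p i) (q i - x) <= q i - x by rewrite ge_min lexx orbT.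
  rewrite /obox; lra.
move=> i s t x /andP[? ?] /andP[? ?] /andP[? ?]; apply/andP; lra.
Qed.

Definition nbox p q (e : R) := obox (fun i => p i - e) (fun i => q i + e).

Lemma near_inT U z : open_box U -> inT U z -> exists2 d : R, 0 < d &
  forall h, (forall i, nc (h 0 i) < d) -> inT U (h + z).
Proof.
move=> Uo zU; have [e e0 He] := open_boxP Uo zU; exists e => // h hd.
apply: (He (imz (h + z))) => i; rewrite (addrC h) imzD addrAC subrr add0r.
apply: le_trans (Im_le_nc _) _; exact: ltW.
Qed.

Lemma hol_near U (f k : Cg -> C^o) : open_box U -> (forall z, inT U z -> f z = k z) -> hol U f -> hol U k.
Proof.
move=> Uo E [hf pf]; split => [z zU|z n zU]; last by rewrite -!E ?pf //; exact: inT_zvec.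
have [L HL] := hf z zU; have [d d0 Hd] := near_inT Uo zU.
exists L; apply: has_grad_near HL _; exists d => // h hd; apply: E; exact: Hd.
Qed.

Lemma holV U (f : Cg -> C^o) : (forall z, inT U z -> f z != 0) -> hol U f -> hol U (fun z => (f z)^-1).
Proof.
move=> f0 [hf pf]; split => [z zU|z n zU]; last by rewrite pf.
have [L HL] := hf z zU; eexists; exact: has_gradV (f0 z zU) HL.
Qed.

(** * The Bezout identity for periodic entire functions without common zeros *)

Section Nullstellensatz.
Variables (I : finType) (x : I -> Cg -> C^o).
Let UT : 'I_g -> set R := fun=> setT.
Hypotheses (xhol : forall i, hol UT (x i)) (x0 : forall z, exists i, x i z != 0).

Lemma UT_open : open_box UT. Proof. by split => //; exists 1. Qed.

Lemma xholU U i : hol U (x i). Proof. by apply: hol_sub (xhol i). Qed.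

Definition good U := exists2 b : I -> Cg -> C^o, forall i, hol U (b i) &
  forall z, inT U z -> \sum_i b i z * x i z = 1.

Lemma good_sub U U' : (forall i, U' i `<=` U i) -> good U -> good U'.
Proof.
by move=> sub [b hb bx]; exists b => [i|z zU]; [exact: hol_sub (hb i)|apply: bx => i; apply: sub].
Qed.

Lemma conj_cexp (w : C) : conjc (cexp w) = cexp (conjc w).
Proof. by case: w => a b /=; rewrite cosN sinN mulrN. Qed.

Lemma conj_2pi_i (v : C) : conjc (2 * (pi *i)%C * v) = 2 * (pi *i)%C * - conjc v.
Proof.
rewrite -(rmorph_nat (real_complex R)); case: v => a b; apply/eqP; rewrite eq_complex /=.
apply/andP; split; apply/eqP; ring.
Qed.

Lemma hsum_conj (J : choiceType) (F : J -> C) s : hsum F s -> hsum (fun j => conjc (F j)) (conjc s).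
Proof.
move=> H e e0; have [t0 T0] := H e e0; exists t0 => t ut sub.
by rewrite -rmorph_sum -rmorphB; have := T0 t ut sub; case: (_ - _) => a b /=; rewrite sqrrN.
Qed.

(* conj (f (conj z + 2 i y)), which agrees with conj f on Im z = y *)
Lemma reflection (f : Cg -> C^o) y : hol UT f -> exists2 k, hol UT k & forall u, k (ivec y + rvec u) = conjc (f (ivec y + rvec u)).
Proof.
move=> /(hol_laurent UT_open)[a da fE].
pose k m := conjc (a (- m)) * chr m (ivec (fun i => - (2 * y i))).
have im_ivec v i : imz (ivec v) i = v i by rewrite /imz mxE.
have dk : decay UT k.
  move=> v; have [B HB] := da (fun i => 2 * y i - v i) (fun=> Logic.I); exists B => m.
  have := HB (- m); rewrite ncM nc_chr -mulrA -expRD.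
  have -> : nc (conjc (a (- m))) = nc (a (- m)) by case: (a) => c d /=; rewrite sqrrN.
  congr (_ * expR _ <= _); rewrite !mulr_sumr -big_split; apply: eq_bigr => i _ /=.
  rewrite im_ivec mxE; ring.
exists (ser k); first exact: hol_ser UT_open dk.
move=> u; set z := _ + _; apply: ser_eq; rewrite fE //.
have := hsum_conj (serP UT_open da ((fun=> Logic.I) : inT UT z)).
move=> /(@hsum_reindex R _ _ (fun m => - m) (fun m => - m) _ _ (@opprK _) (@opprK _)).
apply: eq_hsum => m; rewrite rmorphM -mulrA; congr (_ _).
rewrite -chrDr /= conj_cexp conj_2pi_i; congr (cexp (_ _)).
rewrite rmorph_sum -sumrN; apply: eq_bigr => i _.
rewrite !mxE -!(rmorph_int (real_complex R)).
apply/eqP; rewrite eq_complex /=; apply/andP; split; apply/eqP; ring.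
Qed.

Lemma im_ivec y i : imz (ivec y) i = y i. Proof. by rewrite /imz mxE. Qed.

Lemma zE z : z = ivec (imz z) + rvec (fun i => complex.Re (z 0 i)).
Proof.
by apply/rowP => i; rewrite !mxE; apply/eqP; rewrite eq_complex /= add0r addr0 !eqxx.
Qed.

(** On the slice Im z = y the reflections xs_i are the conjugates of the x_i, so S = sum_i x_i xs_i
    equals sum_i |x_i|^2 > 0. Modulo Z^g the slice is compact, so S has no zero on a thin tube, and
    b_i = xs_i / S. *)
Lemma good_local y : exists2 e : R, 0 < e & good (nbox y y e).
Proof.
have /choice[xs xsP] : forall i, exists k, hol UT k /\ forall u, k (ivec y + rvec u) = conjc (x i (ivec y + rvec u)).
  by move=> i; have [k hk kE] := reflection y (xhol i); exists k.
pose S z := \sum_i x i z * xs i z.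
have hS : hol UT S by apply: hol_sum => i; apply: holM => //; exact: (xsP i).1.
have S0 u : S (ivec y + rvec u) != 0.
  set z := _ + _; have -> : S z = (\sum_i (nc (x i z)) ^+ 2)%:C%C.
    rewrite rmorph_sum; apply: eq_bigr => i _; rewrite (xsP i).2 -/z rmorphXn /= -normE.
    case: (x i z) => a b; rewrite normc_def -rmorphXn /= sqr_sqrtr ?addr_ge0 ?sqr_ge0 //.
    apply/eqP; rewrite eq_complex /=; apply/andP; split; apply/eqP; ring.
  rewrite -(rmorph0 (real_complex R)) (inj_eq (@complexI R)) gt_eqF //.
  have [i xi] := x0 z; rewrite (bigD1 i) //= ltr_pwDl ?exprn_gt0 ?nc_gt0 //.
  by rewrite sumr_ge0 // => j; rewrite sqr_ge0.
pose G (s : 'I_g -> R) l := exists2 e, 0 < e & forall u v, (forall i, s i <= u i <= s i + l) ->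
  (forall i, `|v i - y i| < e) -> S (ivec v + rvec u) != 0.
have [e e0 He] : G (fun=> 0) 1.
  apply: bisection => //.
  - move=> s l l0 H; have /choice[e He] : forall c : {ffun 'I_g -> bool}, exists e, 0 < e /\
      forall u v, (forall i, s i + (c i)%:R * (l / 2) <= u i <= s i + (c i)%:R * (l / 2) + l / 2) ->
      (forall i, `|v i - y i| < e) -> S (ivec v + rvec u) != 0.
      by move=> c; have [e] := H c; exists e.
    exists (\big[Num.min/1]_c e c).
      by elim/big_ind: _ => // [a b a0 b0|c _]; [rewrite lt_min a0|exact: (He c).1].
    move=> u v us vy; pose c : {ffun 'I_g -> bool} := [ffun i => s i + l / 2 <= u i].
    apply: (He c).2 => [i|i]; last by apply: lt_le_trans (vy i) _; exact: bigmin_le_cond.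
    have := us i; rewrite ffunE.
    case hh : (s i + l / 2 <= u i); rewrite /=; lra.
  - move=> t; set z := ivec y + rvec t.
    have N0 : 0 < nc (S z) by apply: nc_gt0; exact: S0.
    have [L HL] := hS.1 z (fun=> Logic.I); have [d d0 Hd] := has_grad_cont HL (divr_gt0 N0 (ltr0n _ 2)).
    exists (d / 2); first by rewrite divr_gt0.
    move=> s l /andP[l0 ld] st; exists (d / 2); first by rewrite divr_gt0.
    move=> u v us vy; apply/eqP => Suv.
    have := Hd (ivec v + rvec u - z); rewrite subrK Suv sub0r ncN => h.
    have : nc (S z) <= nc (S z) / 2.
      apply: h => i; have -> : (ivec v + rvec u - z) 0 i = ((u i - t i) +i* (v i - y i))%C.
        rewrite !mxE; apply/eqP; rewrite eq_complex /=; apply/andP; split; apply/eqP; ring.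
      apply: le_lt_trans (nc_le_ReIm _) _; have := vy i.
      have /andP[a1 a2] := us i; have /andP[b1 b2] := st i.
      have : `|u i - t i| <= l by rewrite ler_norml; lra.
      lra.
    lra.
exists e => //; have T z : inT (nbox y y e) z -> S z != 0.
  move=> zU; pose n := \row_i Num.floor (complex.Re (z 0 i)).
  rewrite (zE z) (_ : _ _ = ivec (imz z) + rvec (fun i => complex.Re (z 0 i) - (Num.floor (complex.Re (z 0 i)))%:~R) + zvec n); last first.
    by apply/rowP => i; rewrite !mxE rmorphB rmorph_int -!addrA addNr addr0.
  rewrite hS.2 //; apply: He => i.
    rewrite add0r; have := floor_itv (complex.Re (z 0 i)); lra.
  have /andP[h1] := zU i; rewrite ltr_norml; lra.
exists (fun i z => xs i z * (S z)^-1) => [i|z zU].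
  apply: holM; first by apply: hol_sub (xsP i).1.
  by apply: holV => //; apply: hol_sub hS.
rewrite (eq_bigr (fun i => x i z * xs i z * (S z)^-1)) => [|i]; last by rewrite mulrC mulrA.
by rewrite -mulr_suml divff // T.
Qed.

(** Additive Cousin problem: terms with m_j < 0 shrink as Im z_j decreases, so they converge over
    [U1]; the others converge over [U2]. Each bound is taken at a height y' moved into the common
    strip. *)
Lemma laurent_split U1 U2 j (c1 c2 : R) (c : Cg -> C^o) : open_box U1 -> open_box U2 -> c1 < c2 ->
  (forall i, i != j -> U1 i = U2 i) -> (forall t, U1 j t -> t < c2) -> (forall t, U2 j t -> c1 < t) ->
  (forall t, c1 < t < c2 -> U1 j t /\ U2 j t) ->
  hol (fun i => U1 i `&` U2 i) c -> exists l k : Cg -> C^o, [/\ hol U1 l, hol U2 k &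
    forall z, inT (fun i => U1 i `&` U2 i) z -> c z = l z + k z].
Proof.
move=> o1 o2 c12 Eij B1 B2 Bj hc; pose UI i := U1 i `&` U2 i.
have oI : open_box UI.
  split.
    move=> i t [t1 t2]; have [e e0 He] := o1.1 i t t1; have [e' e'0 He'] := o2.1 i t t2.
    exists (Num.min e e'); first by rewrite lt_min e0.
    move=> t'; rewrite le_min => /andP[a1]; split; [exact: He|exact: He'].
  move=> i s t v [s1 s2] [t1 t2] stv.
  split; [exact: o1.2 stv|exact: o2.2 stv].
have [aa daa aaE] := hol_laurent oI hc.
pose lo m := if m 0 j < 0 then aa m else 0; pose hi m := if m 0 j < 0 then 0 else aa m.
pose mid := (c1 + c2) / 2; have midc : c1 < mid < c2 by rewrite /mid; lra.
have pi0 := pi_gt0 R.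
have dotj (m : Zg) y y' : (forall i, i != j -> y i = y' i) -> dot m y = dot m y' + (m 0 j)%:~R * (y j - y' j).
  move=> H; rewrite /dot (bigD1 j) //= [in RHS](bigD1 j) //= (eq_bigr (fun i => (m 0 i)%:~R * y' i)).
    lra.
  by move=> i ij; rewrite H.
have dlo : decay U1 lo.
  move=> y yU; pose y' i := if i == j then Num.max (y i) mid else y i.
  have [B HB] : exists B, forall m, nc (aa m) * expR (- (2 * pi) * dot m y') <= B.
    apply: daa => i'; rewrite /y'; case: eqVneq => [->|ij]; last by split; [exact: yU|rewrite -Eij].
    have := yU j => yj; have lt := B1 _ yj; case: leP => hm; first exact: Bj.
    by apply: Bj; rewrite lt andbT; apply: lt_trans hm; case/andP: midc.
  exists (Num.max B 0) => m; rewrite /lo; case: ifP => mj; last by rewrite nc0 mul0r le_max lexx orbT.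
  rewrite le_max; apply/orP; left; apply: le_trans (HB m); rewrite ler_wpM2l ?nc_ge0 // ler_expR.
  rewrite (@dotj m y' y); last by move=> i' /negbTE e; rewrite /y' e.
  rewrite /y' eqxx; have h : 0 <= Num.max (y j) mid - y j by rewrite subr_ge0 le_max lexx.
  have mr : (m 0 j)%:~R <= 0 :> R by rewrite lerz0 ltW.
  have : (m 0 j)%:~R * (Num.max (y j) mid - y j) <= 0 by rewrite mulr_le0_ge0.
  nra.
have dhi : decay U2 hi.
  move=> y yU; pose y' i := if i == j then Num.min (y i) mid else y i.
  have [B HB] : exists B, forall m, nc (aa m) * expR (- (2 * pi) * dot m y') <= B.
    apply: daa => i'; rewrite /y'; case: eqVneq => [->|ij]; last by split; [rewrite Eij|exact: yU].
    have := yU j => yj; have lt := B2 _ yj; case: leP => hm; last exact: Bj.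
    by apply: Bj; rewrite lt; apply: le_lt_trans hm _; case/andP: midc.
  exists (Num.max B 0) => m; rewrite /hi; case: ifP => mj; first by rewrite nc0 mul0r le_max lexx orbT.
  rewrite le_max; apply/orP; left; apply: le_trans (HB m); rewrite ler_wpM2l ?nc_ge0 // ler_expR.
  rewrite (@dotj m y' y); last by move=> i' /negbTE e; rewrite /y' e.
  rewrite /y' eqxx; have h : Num.min (y j) mid - y j <= 0 by rewrite subr_le0 ge_min lexx.
  have mr : 0 <= (m 0 j)%:~R :> R by rewrite ler0z leNgt mj.
  have : (m 0 j)%:~R * (Num.min (y j) mid - y j) <= 0 by rewrite mulr_ge0_le0.
  nra.
exists (ser lo), (ser hi); split; [exact: hol_ser dlo|exact: hol_ser|].
move=> z zU; rewrite aaE //; apply: ser_eq.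
have := hsumD (serP o1 dlo (fun i => (zU i).1)) (serP o2 dhi (fun i => (zU i).2)).
by apply: eq_hsum => m; rewrite /lo /hi; case: ifP; rewrite mul0r ?addr0 ?add0r.
Qed.

Lemma hol_glue U1 U2 U (f1 f2 : Cg -> C^o) : open_box U1 -> open_box U2 ->
  (forall z, inT U z -> inT U1 z \/ inT U2 z) -> (forall z, inT U1 z -> inT U2 z -> f1 z = f2 z) ->
  hol U1 f1 -> hol U2 f2 -> exists f : Cg -> C^o, [/\ hol U f, forall z, inT U1 z -> f z = f1 z & forall z, inT U2 z -> f z = f2 z].
Proof.
move=> o1 o2 cov E [h1 p1] [h2 p2].
pose f z := if `[< inT U1 z >] then f1 z else f2 z.
have F1 z : inT U1 z -> f z = f1 z by move=> z1; rewrite /f asboolT.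
have F2 z : inT U2 z -> f z = f2 z by move=> z2; rewrite /f; case: ifP => // /asboolP z1; exact: E.
exists f; split => //; split => [z /cov[zU|zU]|z n /cov[zU|zU]].
- have [L HL] := h1 z zU; have [d d0 Hd] := near_inT o1 zU.
  exists L; apply: has_grad_near HL _; exists d => // h hd; rewrite F1 //; exact: Hd.
- have [L HL] := h2 z zU; have [d d0 Hd] := near_inT o2 zU.
  exists L; apply: has_grad_near HL _; exists d => // h hd; rewrite F2 //; exact: Hd.
- rewrite !F1 ?p1 //; exact: inT_zvec.
- rewrite !F2 ?p2 //; exact: inT_zvec.
Qed.

Lemma antisym_sum (l : I -> I -> C) (v : I -> C) : (forall i k, l i k = - l k i) ->
  \sum_i (\sum_k v k * l i k) * v i = 0.
Proof.
move=> anti; set S := LHS; have : S + S = 0; last first.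
  by rewrite -mulr2n -mulr_natl => /eqP; rewrite mulf_eq0 pnatr_eq0 => /eqP.
rewrite {1}/S (eq_bigr (fun i => \sum_k v k * l i k * v i)) => [|i]; last by rewrite mulr_suml.
rewrite exchange_big -big_split big1 // => i.
rewrite mulr_suml -big_split big1 // => k _ /=; rewrite [l k i]anti; ring.
Qed.

Lemma koszul_diff U1 U2 (b1 b2 : I -> Cg -> C^o) : (forall z, inT U1 z -> \sum_i b1 i z * x i z = 1) ->
  (forall z, inT U2 z -> \sum_i b2 i z * x i z = 1) ->
  forall z i, inT U1 z -> inT U2 z -> b1 i z - b2 i z = \sum_k x k z * (b1 i z * b2 k z - b1 k z * b2 i z).
Proof.
move=> E1 E2 z i z1 z2.
rewrite (eq_bigr (fun k => b1 i z * (b2 k z * x k z) - b2 i z * (b1 k z * x k z))) => [|k _]; last ring.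
by rewrite sumrB -!mulr_sumr E1 // E2 // !mulr1.
Qed.

(* The Koszul relation b - b' = x _| c, c antisymmetric, is split along the sign of the
   Fourier index in the direction j. *)
Lemma good_merge U1 U2 j (c1 c2 : R) : open_box U1 -> open_box U2 -> c1 < c2 ->
  (forall i, i != j -> U1 i = U2 i) -> (forall t, U1 j t -> t < c2) -> (forall t, U2 j t -> c1 < t) ->
  (forall t, c1 < t < c2 -> U1 j t /\ U2 j t) ->
  good U1 -> good U2 -> good (fun i => U1 i `|` U2 i).
Proof.
move=> o1 o2 c12 Eij B1 B2 Bj [b1 h1 E1] [b2 h2 E2].
pose UI i := U1 i `&` U2 i; pose c i k z := b1 i z * b2 k z - b1 k z * b2 i z.
have hc i k : hol UI (c i k).
  have s1 l : hol UI (b1 l) by apply: hol_sub (h1 l) => i' t [].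
  have s2 l : hol UI (b2 l) by apply: hol_sub (h2 l) => i' t [].
  apply: holB; exact: holM.
have /choice[lh Hlh] : forall ik : I * I, exists lk : (Cg -> C^o) * (Cg -> C^o), [/\ hol U1 lk.1, hol U2 lk.2 &
    forall z, inT UI z -> c ik.1 ik.2 z = lk.1 z + lk.2 z].
  move=> [i k]; have [l [l' [?]]] := laurent_split o1 o2 c12 Eij B1 B2 Bj (hc i k).
  by exists (l, l').
(* Antisymmetrized corrections pair to 0 with x, so sum_i b_i x_i = 1 survives. *)
pose lo i k z := 2^-1 * ((lh (i, k)).1 z - (lh (k, i)).1 z).
pose hi i k z := 2^-1 * ((lh (i, k)).2 z - (lh (k, i)).2 z).
have hlo i k : hol U1 (lo i k) by apply: holZ; apply: holB; have [] := Hlh (i, k); have [] := Hlh (k, i).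
have hhi i k : hol U2 (hi i k) by apply: holZ; apply: holB; have [] := Hlh (i, k); have [] := Hlh (k, i).
have cE i k z : inT UI z -> c i k z = lo i k z + hi i k z.
  move=> zU; have [_ _ /(_ z zU) e1] := Hlh (i, k); have [_ _ /(_ z zU) e2] := Hlh (k, i).
  have -> : lo i k z + hi i k z = 2^-1 * (c i k z - c k i z) by rewrite e1 e2 /lo /hi; ring.
  by rewrite /c; field.
have anti1 i k z : lo i k z = - lo k i z by rewrite /lo; ring.
have anti2 i k z : hi i k z = - hi k i z by rewrite /hi; ring.
pose f1 i z := b1 i z - \sum_k x k z * lo i k z; pose f2 i z := b2 i z + \sum_k x k z * hi i k z.
have /choice[f Hf] : forall i, exists f : Cg -> C^o, [/\ hol (fun i => U1 i `|` U2 i) f,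
    forall z, inT U1 z -> f z = f1 i z & forall z, inT U2 z -> f z = f2 i z].
  move=> i; apply: (hol_glue o1 o2).
  - move=> z zU; have [jz|jz] := zU j.
      by left=> i'; have [->//|ij] := eqVneq i' j; have := zU i'; rewrite Eij // setUid.
    by right=> i'; have [->//|ij] := eqVneq i' j; have := zU i'; rewrite Eij // setUid.
  - move=> z z1 z2; have := koszul_diff E1 E2 i z1 z2.
    rewrite (eq_bigr (fun k => x k z * lo i k z + x k z * hi i k z)) => [|k]; last first.
      by rewrite -mulrDr -cE.
    rewrite big_split /= /f1 /f2 => /eqP; rewrite subr_eq => /eqP ->; ring.
  - apply: holB => //; apply: hol_sum => k; apply: holM => //; exact: xholU.
  - apply: holD => //; apply: hol_sum => k; apply: holM => //; exact: xholU.
exists f => [i|z zU]; first by have [] := Hf i.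
have [z1|z2] : inT U1 z \/ inT U2 z.
  have [jz|jz] := zU j.
    by left=> i'; have [->//|ij] := eqVneq i' j; have := zU i'; rewrite Eij // setUid.
  by right=> i'; have [->//|ij] := eqVneq i' j; have := zU i'; rewrite Eij // setUid.
  rewrite (eq_bigr (fun i => b1 i z * x i z - (\sum_k x k z * lo i k z) * x i z)) => [|i]; last first.
    by have [_ -> //] := Hf i; rewrite mulrBl.
  by rewrite sumrB E1 // (antisym_sum (fun k => x k z)) ?subr0.
rewrite (eq_bigr (fun i => b2 i z * x i z + (\sum_k x k z * hi i k z) * x i z)) => [|i]; last first.
  by have [_ _ -> //] := Hf i; rewrite mulrDl.
by rewrite big_split /= E2 // (antisym_sum (fun k => x k z)) ?addr0.
Qed.

(** The margin e provides the overlap needed to merge two closed boxes that share a face. *)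
Definition gbox (p q : 'I_g -> R) := exists2 e : R, 0 < e & good (nbox p q e).

Lemma gbox_merge j (mid : R) p q : p j <= mid <= q j ->
  gbox p (fun i => if i == j then mid else q i) -> gbox (fun i => if i == j then mid else p i) q -> gbox p q.
Proof.
move=> /andP[pm mq] [e1 e10 G1] [e2 e20 G2]; exists (Num.min e1 e2); first by rewrite lt_min e10.
set e := Num.min _ _; have e0 : 0 < e by rewrite lt_min e10.
have le1 : e <= e1 by rewrite ge_min lexx. have le2 : e <= e2 by rewrite ge_min lexx orbT.
have sub (r s : 'I_g -> R) e' : e <= e' -> forall i, nbox r s e i `<=` nbox r s e' i.
  move=> le i t /andP[h1 h2]; apply/andP; lra.
have G1' := good_sub (sub _ _ _ le1) G1; have G2' := good_sub (sub _ _ _ le2) G2.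
have := good_merge (obox_open _ _) (obox_open _ _) _ _ _ _ _ G1' G2' => /(_ j (mid - e) (mid + e)) H.
apply: good_sub (H _ _ _ _ _).
- move=> i t /andP[h1]; have [ij|ij] := eqVneq i j.
    have [tm|tm] := ltP t (mid + e); [left|right]; apply/andP; subst; rewrite ?eqxx; lra.
  by left; apply/andP; rewrite (negbTE ij).
- lra.
- by move=> i /negbTE ij; rewrite /obox ij.
- by move=> t; rewrite /obox eqxx => /andP[].
- by move=> t; rewrite /obox eqxx => /andP[].
- move=> t; rewrite /obox eqxx; lra.
Qed.

Lemma gbox_cube (s0 : 'I_g -> R) (l0 : R) : 0 < l0 -> gbox s0 (fun i => s0 i + l0).
Proof.
move=> l00; apply: (bisection (G := fun s l => gbox s (fun i => s i + l)) (x0 := s0)) => // [s l lp H|z]; last first.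
  have [e e0 Ge] := good_local z; exists (e / 2); first by rewrite divr_gt0.
  move=> s l /andP[lp le] sz; exists (e / 2); first by rewrite divr_gt0.
  apply: good_sub Ge => i t /andP[h1 h2]; have /andP[h3 h4] := sz i; apply/andP; lra.
(* At stage k the first k coordinates run over the whole edge, the others over the half selected by
   c. *)
pose P k (c : {ffun 'I_g -> bool}) := fun i : 'I_g => if (i < k)%N then s i else s i + (c i)%:R * (l / 2).
pose Q k (c : {ffun 'I_g -> bool}) := fun i : 'I_g => if (i < k)%N then s i + l else s i + (c i)%:R * (l / 2) + l / 2.
have K k : (k <= g)%N -> forall c, gbox (P k c) (Q k c).
  elim: k => [_ c|k IH kg c]; first exact: H.
  pose j := Ordinal kg; apply: (@gbox_merge j (s j + l / 2)).
    rewrite /P /Q ltnSn; lra.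
  - have := IH (ltnW kg) [ffun i => if i == j then false else c i]; congr gbox; apply/funext => i; rewrite /P /Q !ffunE.
      by rewrite -val_eqE ltnS; case: ltngtP => [| |e] //=; rewrite mul0r addr0.
    rewrite ltnS; case: (eqVneq) => [->|]; rewrite ?ltnn ?mul0r ?addr0 //.
    by rewrite -val_eqE; case: ltngtP.
  - have := IH (ltnW kg) [ffun i => if i == j then true else c i]; congr gbox; apply/funext => i; rewrite /P /Q !ffunE.
      rewrite ltnS; case: (eqVneq) => [->|]; rewrite ?ltnn ?mul1r //.
      by rewrite -val_eqE; case: ltngtP.
    rewrite ltnS; case: (eqVneq) => [->|]; rewrite ?ltnn ?leqnn ?mul1r -?addrA -?splitr //.
    by rewrite -val_eqE; case: ltngtP.
have := K g (leqnn g) [ffun=> false]; congr gbox; apply/funext => i; by rewrite /P /Q ltn_ord.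
Qed.

(** Half-width N + 1, so that the closed cube |Im z_i| <= N, on which estimates are made, lies
    inside. *)
Definition cube (N : nat) : 'I_g -> set R := fun i t => - N.+1%:R < t < N.+1%:R.

Lemma cube_open N : open_box (cube N). Proof. exact: obox_open. Qed.

Lemma cube_in N z : (forall i, `|imz z i| <= N%:R) -> inT (cube N) z.
Proof. move=> H i; have := H i; rewrite ler_norml /cube; lra. Qed.

Lemma good_cube N : good (cube N).
Proof.
have [e e0 G] := @gbox_cube (fun=> - N.+1%:R) (N.+1%:R + N.+1%:R) (addr_gt0 (ltr0Sn _ N) (ltr0Sn _ N)).
apply: good_sub G => i t /andP[h1 h2]; apply/andP; lra.
Qed.

(** On the closed cube each term is largest at the corner selected by the signs of m, so the sum
    over all corners is a single summable majorant. *)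
Lemma corner_majorant N a : decay (cube N) a -> exists (w : Zg -> C) (B : R), asum w B /\
  forall z m, (forall i, `|imz z i| <= N%:R) -> nc (a m * chr m z) <= nc (w m).
Proof.
move=> da; pose v (s : {ffun 'I_g -> bool}) i : R := if s i then - N%:R else N%:R.
have vin s : inT (cube N) (ivec (v s)).
  apply: cube_in => i; by rewrite im_ivec /v; case: ifP; rewrite ?normrN ger0_norm.
have /choice[B HB] := fun s => decay_asum (cube_open N) da (vin s).
pose w m := (\sum_s nc (a m * chr m (ivec (v s))))%:C%C.
have wE m : nc (w m) = \sum_s nc (a m * chr m (ivec (v s))).
  rewrite nc_real ger0_norm // sumr_ge0 // => s _; exact: nc_ge0.
exists w, (\sum_s B s); split.
  move=> t ut; rewrite (eq_bigr _ (fun m _ => wE m)) exchange_big; apply: ler_sum => s _; exact: HB.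
move=> z m zN; pose s : {ffun 'I_g -> bool} := [ffun i => 0 <= m 0 i].
rewrite wE (bigD1 s) //= ler_wpDr ?sumr_ge0 // => [s' _|]; first exact: nc_ge0.
rewrite !ncM ler_wpM2l ?nc_ge0 // !nc_chr ler_expR !mulNr lerN2 ler_wpM2l ?mulr_ge0 ?pi_ge0 //.
rewrite /dot; apply: ler_sum => i; rewrite im_ivec /v ffunE; have := zN i; rewrite ler_norml => /andP[h1 h2].
case: ifP => [mi|/negbT]; first by rewrite ler_wpM2l // ler0z.
by rewrite -ltNge => mi; rewrite ler_wnM2l // lerz0 ltW.
Qed.

Lemma hol_bounded N (f : Cg -> C^o) : hol (cube N) f -> exists B : R, forall z, (forall i, `|imz z i| <= N%:R) -> nc (f z) <= B.
Proof.
move=> /(hol_laurent (cube_open N))[a da fE]; have [w [B [wB Hw]]] := corner_majorant da.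
exists B => z zN; rewrite fE; last exact: cube_in.
apply: hsum_bound (serP (cube_open N) da (cube_in zN)) _; apply: asum_le wB => m; exact: Hw.
Qed.

(** Runge approximation by a finite part of the Laurent series, uniform thanks to the majorant. *)
Lemma trig_approx N (f : Cg -> C^o) (e : R) : 0 < e -> hol (cube N) f -> exists2 k : Cg -> C^o, hol UT k &
  forall z, (forall i, `|imz z i| <= N%:R) -> nc (f z - k z) <= e.
Proof.
move=> e0 /(hol_laurent (cube_open N))[a da fE]; have [w [B [wB Hw]]] := corner_majorant da.
have [t [ut Ht]] := asum_tail wB e0.
exists (fun z => \sum_(m <- t) a m * chr m z); first by apply: hol_sum => m; apply: holZ; exact: hol_chr.
move=> z zN; have zU := cube_in zN; rewrite fE //.
have H1 : hsum (fun m => if m \in t then a m * chr m z else 0) (\sum_(m <- t) a m * chr m z).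
  rewrite (eq_big_seq (fun m => if m \in t then a m * chr m z else 0)) => [|m ->] //.
  by apply: hsum_fin => // m /negbTE ->.
apply: hsum_bound (hsumB (serP (cube_open N) da zU) H1) _; apply: asum_le Ht => m.
case: ifP => _; rewrite ?subrr ?subr0 //; exact: Hw.
Qed.

Lemma imz_bounded z : exists N : nat, forall i, `|imz z i| <= N%:R.
Proof.
exists (\sum_i (Num.truncn `|imz z i|).+1)%N => i; rewrite (bigD1 i) //= natrD.
have /andP[_ h] := truncn_itv (normr_ge0 (imz z i)).
by apply: le_trans (ltW h) _; rewrite lerDl.
Qed.

(** Each defining condition of [quasi_hol] survives uniform approximation on cubes; this makes the
    limit in [nullstellensatz] entire. *)
Lemma quasi_hol_approx (f : Cg -> C^o) : (forall N (e : R), 0 < e -> exists2 k : Cg -> C^o, hol (cube N) k &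
   forall z, (forall i, `|imz z i| <= N%:R) -> nc (f z - k z) <= e) -> quasi_hol UT f.
Proof.
move=> H; split.
- move=> z _ e e0; have [N HN] := imz_bounded z; have e3 : 0 < e / 3 by rewrite divr_gt0.
  have [k [hk _] kf] := H N.+1 _ e3.
  have HN1 i : `|imz z i| + 1 <= N.+1%:R by rewrite -natr1 lerD2r.
  have zN : inT (cube N.+1) z by apply: cube_in => i; apply: le_trans (HN1 i); rewrite lerDl.
  have [L HL] := hk z zN; have [d d0 Hd] := has_grad_cont HL e3.
  exists (Num.min d 1); first by rewrite lt_min d0 ltr01.
  move=> h hd; have h1 := kf z (fun i => le_trans (ler_wpDr ler01 (lexx _)) (HN1 i)).
  have h2 : nc (f (h + z) - k (h + z)) <= e / 3.
    apply: kf => i; apply: le_trans (HN1 i); rewrite addrC imzD; apply: le_trans (ler_normD _ _) _.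
    rewrite lerD2l; apply: le_trans (Im_le_nc _) _; have := hd i; rewrite lt_min => /andP[_ /ltW]; exact.
  have h3 : nc (k (h + z) - k z) <= e / 3 by apply: Hd => i; have := hd i; rewrite lt_min => /andP[].
  rewrite (_ : _ _ = (f (h + z) - k (h + z)) + (k (h + z) - k z) - (f z - k z)); last ring.
  apply: le_trans (ncB _ _) _; have := ncD (f (h + z) - k (h + z)) (k (h + z) - k z); lra.
- move=> z n _; apply/eqP; rewrite -subr_eq0; apply/eqP; apply: nc_small_eq0 => e e0.
  have [N HN] := imz_bounded z; have e2 : 0 < e / 2 by rewrite divr_gt0.
  have [k [_ pk] kf] := H N _ e2; have h1 := kf z HN.
  have h2 : nc (f (z + zvec n) - k (z + zvec n)) <= e / 2.
    by apply: kf => i; rewrite imzD mxE -(rmorph_int (real_complex R)) addr0.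
  rewrite pk in h2; last exact: cube_in.
  rewrite (_ : _ _ = (f (z + zvec n) - k z) - (f z - k z)); last ring.
  by apply: le_trans (ncB _ _) _; rewrite [e]splitr lerD.
- move=> m j sigma p _ _ e e0.
  have [N1 HN1] := imz_bounded p; have [N2 HN2] := imz_bounded (p + estep j sigma).
  pose N := maxn N1 N2.
  have HNp i : `|imz p i| <= N%:R by apply: le_trans (HN1 i) _; rewrite ler_nat leq_maxl.
  have HNq i : `|imz (p + estep j sigma) i| <= N%:R by apply: le_trans (HN2 i) _; rewrite ler_nat leq_maxr.
  pose E q : R := expR (- (2 * pi) * dot (- m) (imz q)).
  pose A := E p + E (p + estep j sigma).
  have Ep : 0 < E p by rewrite expR_gt0. have Eq : 0 < E (p + estep j sigma) by rewrite expR_gt0.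
  have A0 : 0 < A by rewrite /A; lra.
  have d0 : 0 < e / 4 / A by rewrite !divr_gt0.
  have [k hk kf] := H N _ d0.
  have [_ _ sk] := hol_quasi_hol (cube_open N) hk.1 hk.2.
  have e2 : 0 < e / 2 by rewrite divr_gt0.
  have [r0 Hr] := sk m j sigma p (cube_in HNp) (cube_in HNq) _ e2; exists r0 => r rr.
  have dif q : (forall i, `|imz q i| <= N%:R) -> E q <= A ->
     nc (davg r (fun=> 1) 1 q (fun z => f z * chr (- m) z) - davg r (fun=> 1) 1 q (fun z => k z * chr (- m) z)) <= e / 4.
    move=> qN qA; rewrite -[- davg _ _ _ _ _]mulN1r -davgZ -davgD; apply: davg_bound => // u _.
    set w := q + _; have wq i : imz w i = imz q i.
      by rewrite imzD mxE !mulr1 addr0.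
    have -> : f w * chr (- m) w + -1 * (k w * chr (- m) w) = (f w - k w) * chr (- m) w by ring.
    rewrite ncM nc_chr (_ : expR _ = E q); last by rewrite /dot; congr expR; congr (_ _); apply: eq_bigr => i; rewrite wq.
    apply: (@le_trans _ _ (e / 4 / A * A)); last by rewrite divfK ?gt_eqF.
    apply: ler_pM; rewrite ?nc_ge0 ?(ltW (expR_gt0 _)) //; apply: kf => i; by rewrite wq.
  have := dif _ HNp; have := dif _ HNq; have := Hr r rr.
  set a1 := _ _ _ _ _; set a2 := _ _ _ _ _; set b1 := davg _ _ _ _ _; set b2 := davg _ _ _ _ _ => h1 h2 h3.
  have := h2; have := h3; rewrite /A => h3' h2'.
  rewrite (_ : _ _ = (b2 - a1) + (a1 - a2) - (b1 - a2)); last ring.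
  apply: le_trans (ncB _ _) _; have := ncD (b2 - a1) (a1 - a2); lra.
Qed.

Definition unit_comb N (b : I -> Cg -> C^o) := (forall i, hol (cube N) (b i)) /\
  forall z, inT (cube N) z -> \sum_i b i z * x i z = 1.

(** Any solution b0 on the larger cube is moved towards b by an antisymmetric correction: the exact
    correction c lives on the small cube only and is replaced by a periodic entire approximation
    p. *)
Lemma unit_comb_step N b (e : R) : 0 < e -> unit_comb N b -> exists2 b', unit_comb N.+1 b' &
  forall i z, (forall j, `|imz z j| <= N%:R) -> nc (b' i z - b i z) <= e.
Proof.
move=> e0 [hb Eb]; have [b0 h0 E0] := good_cube N.+1.
have subN j : cube N j `<=` cube N.+1 j.
  move=> t /andP[h1 h2]; apply/andP; lra.
have E0' z : inT (cube N) z -> \sum_i b0 i z * x i z = 1 by move=> zN; apply: E0 => j; exact: subN.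
pose c i k z := b i z * b0 k z - b k z * b0 i z.
have hc i k : hol (cube N) (c i k) by apply: holB; apply: holM => //; exact: hol_sub.
have /choice[B HB] := fun k => hol_bounded (@xholU (cube N) k).
pose A := 1 + \sum_k `|B k|; have A0 : 0 < A by rewrite ltr_pwDl ?sumr_ge0.
have /choice[P HP] : forall ik : I * I, exists P : Cg -> C^o, hol UT P /\
    forall z, (forall i, `|imz z i| <= N%:R) -> nc (c ik.1 ik.2 z - P z) <= e / A.
  by move=> ik; have [P] := trig_approx (divr_gt0 e0 A0) (hc ik.1 ik.2); exists P.
pose p i k z := 2^-1 * (P (i, k) z - P (k, i) z).
have hp i k : hol UT (p i k) by apply: holZ; apply: holB; exact: (HP _).1.
exists (fun i z => b0 i z + \sum_k x k z * p i k z).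
  split=> [i|z zN].
    apply: holD => //; apply: hol_sum => k; apply: holM; [exact: xholU|exact: hol_sub (hp i k)].
  rewrite (eq_bigr (fun i => b0 i z * x i z + (\sum_k x k z * p i k z) * x i z)) => [|i _]; last exact: mulrDl.
  rewrite big_split /= E0 // (antisym_sum (fun k => x k z)) ?addr0 // => i k; rewrite /p; ring.
move=> i z zN; have zc := cube_in zN.
have := koszul_diff Eb E0' i zc zc => kd.
have -> : b0 i z + \sum_k x k z * p i k z - b i z = \sum_k x k z * (p i k z - c i k z).
  rewrite [RHS](eq_bigr (fun k => x k z * p i k z - x k z * c i k z)) => [|k _]; last ring.
  rewrite sumrB -kd; ring.
apply: le_trans (nc_sum _ _ _) _.
apply: (@le_trans _ _ (\sum_k `|B k| * (e / A))); last first.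
  by rewrite -mulr_suml mulrA ler_pdivrMr // [_ e]mulrC (ler_wpM2l (ltW e0)) // ler_wpDl.
apply: ler_sum => k _; rewrite ncM; apply: ler_pM; rewrite ?nc_ge0 //.
  apply: le_trans (ler_norm _); exact: HB.
have -> : p i k z - c i k z = 2^-1 * ((c k i z - P (k, i) z) - (c i k z - P (i, k) z)) by rewrite /p /c; field.
rewrite ncM (_ : nc 2^-1 = 2^-1); last by rewrite ncV nc_natr.
have := ncB (c k i z - P (k, i) z) (c i k z - P (i, k) z).
have := (HP (i, k)).2 z zN; have := (HP (k, i)).2 z zN; lra.
Qed.

(** Mittag-Leffler argument: step n moves the solution by at most w_n - w_(n+1) on the cube of size
    n, so the tails telescope to at most w_n = 1 / (n + 1). Limits are taken along the ultrafilter
    and are uniform by these bounds. *)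
Theorem nullstellensatz : exists b : I -> Cg -> C^o, (forall i, hol UT (b i)) /\ forall z, \sum_i b i z * x i z = 1.
Proof.
pose w (n : nat) : R := (n.+1%:R)^-1.
have w_gt (n : nat) : w n.+1 < w n by rewrite ltf_pV2 ?posrE // ltr_nat.
have w_small (N : nat) (e : R) : 0 < e -> exists2 n, (N <= n)%N & w n <= e.
  move=> e0; exists (maxn N (Num.truncn e^-1)); first exact: leq_maxl.
  rewrite -[leRHS]invrK lef_pV2 ?posrE ?invr_gt0 //.
  have ei : 0 <= e^-1 by rewrite invr_ge0 ltW.
  by have /andP[_ h] := truncn_itv ei; apply: le_trans (ltW h) _; rewrite ler_nat ltnS leq_maxr.
have /choice[F HF] : forall nb : nat * (I -> Cg -> C^o), exists b', unit_comb nb.1 nb.2 -> unit_comb nb.1.+1 b' /\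
    forall i z, (forall j, `|imz z j| <= nb.1%:R) -> nc (b' i z - nb.2 i z) <= w nb.1 - w nb.1.+1.
  move=> [n b]; have [ok|nok] := pselect (unit_comb n b); last by exists b.
  by have [b'] := unit_comb_step (etrans (subr_gt0 _ _) (w_gt n)) ok; exists b'.
have [b0 hb0 Eb0] := good_cube 0.
pose fix sq (n : nat) := if n is n'.+1 then F (n', sq n') else b0.
have ok (n : nat) : unit_comb n (sq n) by elim: n => [//|n IH]; have [] := HF (n, sq n).
have tele (n k : nat) i z : (forall j, `|imz z j| <= n%:R) -> nc (sq (n + k)%N i z - sq n i z) <= w n - w (n + k)%N.
  move=> zn; elim: k => [|k IH]; first by rewrite addn0 !subrr nc0.
  have [_ /(_ i z)] := HF ((n + k)%N, sq (n + k)%N) (ok _) => H.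
  rewrite addnS /= (_ : _ _ = (F ((n + k)%N, sq (n + k)%N) i z - sq (n + k)%N i z) + (sq (n + k)%N i z - sq n i z)); last ring.
  apply: le_trans (ncD _ _) _; have := H (fun j => le_trans (zn j) (etrans (ler_nat R _ _) (leq_addr _ _))).
  lra.
have wp (n : nat) : 0 < w n by rewrite invr_gt0.
have lim i z : exists l, forall n : nat, (forall j, `|imz z j| <= n%:R) -> nc (l - sq n i z) <= w n.
  have [N HN] := imz_bounded z.
  have [l Hl] : exists l, ulim (fun r => sq (N + r)%N i z) l.
    apply: (@ulim_exists R _ (nc (sq N i z) + w N)) => r.
    rewrite -lerBlDl; apply: le_trans (ler_nc_dist _ _) _; apply: le_trans (tele _ _ _ _ HN) _; have := wp (N + r)%N; lra.
  exists l => n zn; apply/ler_addgt0Pr => e e0.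
  have [r [nr hr]] := ulim_event Hl (ex_intro _ n (fun r (h : (n <= r)%N) => h)) e0.
  have := tele n (N + r - n)%N i z zn; rewrite subnKC; last apply: leq_trans nr (leq_addl _ _).
  have := wp (N + r)%N; have := ncD (l - sq (N + r)%N i z) (sq (N + r)%N i z - sq n i z).
  rewrite addrA subrK nc_distC in hr *; lra.
have /choice[b Hb] : forall i, exists b : Cg -> C^o, forall z (n : nat), (forall j, `|imz z j| <= n%:R) -> nc (b z - sq n i z) <= w n.
  by move=> i; have /choice[b] := lim i; exists b.
exists b; split=> [i|z].
  have [a da aE] : exists2 a, decay UT a & forall z, inT UT z -> b i z = ser a z.
    apply: quasi_hol_laurent UT_open _; apply: quasi_hol_approx => N e e0.
    have [n Nn we] := w_small N e e0; exists (sq n i).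
      apply: hol_sub ((ok n).1 i) => j t; rewrite /cube.
      have : N.+1%:R <= n.+1%:R :> R by rewrite ler_nat.
      lra.
    move=> z zN; apply: le_trans we; apply: Hb => j; apply: le_trans (zN j) _; by rewrite ler_nat.
  apply: hol_near UT_open (fun z zU => esym (aE z zU)) (hol_ser UT_open da).
apply/eqP; rewrite -subr_eq0; apply/eqP; apply: nc_small_eq0 => e e0.
have [N HN] := imz_bounded z; pose A := 1 + \sum_i nc (x i z).
have A0 : 0 < A by rewrite ltr_pwDl // sumr_ge0 // => i _; exact: nc_ge0.
have [n Nn we] := w_small N _ (divr_gt0 e0 A0).
have zn j : `|imz z j| <= n%:R by apply: le_trans (HN j) _; rewrite ler_nat.
rewrite -(((ok n).2 z (cube_in zn))) -sumrB; apply: le_trans (nc_sum _ _ _) _.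
apply: (@le_trans _ _ (\sum_i nc (x i z) * (e / A))).
  apply: ler_sum => i; rewrite -mulrBl ncM mulrC ler_wpM2l ?nc_ge0 //.
  apply: le_trans we; exact: Hb.
by rewrite -mulr_suml mulrA ler_pdivrMr // [_ e]mulrC (ler_wpM2l (ltW e0)) // ler_wpDl.
Qed.

End Nullstellensatz.
End Holomorphic.

(** * Exterior forms *)

Section Forms.
Variables (K : comPzRingType) (n : nat).
(** All degrees at once, so that wedge and contraction are endomorphisms and no degree casts
    occur. *)
Definition form := {ffun {set 'I_n} -> K^o}.
HB.instance Definition _ := GRing.Lmodule.on form.
Implicit Types (i j : 'I_n) (S : {set 'I_n}) (x y : form) (a : K).

Definition esgn i S : K := (-1) ^+ #|[set j in S | (j < i)%N]|%SET.

Lemma esgn2 i S : esgn i S * esgn i S = 1.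
Proof. by rewrite -exprMn mulrNN mulr1 expr1n. Qed.

Lemma esgnD1 i j S : j \in S -> esgn i S = (if (j < i)%N then -1 else 1) * esgn i (S :\ j).
Proof.
move=> jS; rewrite /esgn (cardsD1 j [set t in S | (t < i)%N]%SET) inE jS.
have -> : [set t in S | (t < i)%N]%SET :\ j = [set t in S :\ j | (t < i)%N]%SET.
  by apply/finset.setP => t; rewrite !inE andbA.
by rewrite exprD; case: ifP.
Qed.

Definition ew i x : form := [ffun S : {set 'I_n} => if i \in S then esgn i S * x (S :\ i)%SET else 0].
Definition ei i x : form := [ffun S : {set 'I_n} => if i \in S then 0 else esgn i S * x (i |: S)%SET].

Lemma ewE i x S : ew i x S = if i \in S then esgn i S * x (S :\ i)%SET else 0. Proof. by rewrite ffunE. Qed.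
Lemma eiE i x S : ei i x S = if i \in S then 0 else esgn i S * x (i |: S)%SET. Proof. by rewrite ffunE. Qed.

Lemma formD x y S : (x + y) S = x S + y S :> K. Proof. by rewrite ffunE. Qed.
Lemma formZ a x S : (a *: x) S = a * x S :> K. Proof. by rewrite ffunE. Qed.
Lemma formN x S : (- x) S = - x S :> K. Proof. by rewrite ffunE. Qed.
Lemma form0 S : (0 : form) S = 0 :> K. Proof. by rewrite ffunE. Qed.
Lemma form_sum (I : Type) (r : seq I) (P : pred I) (F : I -> form) S :
  (\sum_(t <- r | P t) F t) S = \sum_(t <- r | P t) (F t S : K).
Proof. by rewrite sum_ffunE. Qed.

Lemma ew_linear i : linear (ew i).
Proof.
move=> a x y; apply/ffunP => S; rewrite ewE formD formZ formD formZ !ewE.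
by case: ifP; rewrite ?mulr0 ?addr0 // mulrDr mulrCA.
Qed.
HB.instance Definition _ i := GRing.isLinear.Build K form form *:%R (ew i) (ew_linear i).

Lemma ei_linear i : linear (ei i).
Proof.
move=> a x y; apply/ffunP => S; rewrite !(ffunE, eiE).
by case: ifP; rewrite ?scaler0 ?addr0 // mulrDr mulrCA.
Qed.
HB.instance Definition _ i := GRing.isLinear.Build K form form *:%R (ei i) (ei_linear i).

Lemma ewew0 i x : ew i (ew i x) = 0.
Proof. by apply/ffunP => S; rewrite form0 !ewE !inE eqxx mulr0 if_same. Qed.

Lemma eiei0 i x : ei i (ei i x) = 0.
Proof. by apply/ffunP => S; rewrite form0 !eiE !inE eqxx mulr0 if_same. Qed.

Lemma ewew i j x : ew i (ew j x) = - ew j (ew i x).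
Proof.
have [->|ij] := eqVneq i j; first by rewrite ewew0 oppr0.
apply/ffunP => S; rewrite formN !ewE !inE [j == i]eq_sym ij /=.
case iS : (i \in S); case jS : (j \in S); rewrite ?mulr0 ?oppr0 //.
rewrite (esgnD1 i jS) (esgnD1 j iS) !finset.setDDl [[set j; i]%SET]finset.setUC.
have := ij; rewrite -val_eqE; case: ltngtP => // _ _; ring.
Qed.

(** Canonical anticommutation relation, on which the commutators below rest. *)
Lemma ei_ew i j x : ei i (ew j x) = (if i == j then x else 0) - ew j (ei i x).
Proof.
apply/ffunP => S; rewrite formD formN !(ewE, eiE) !inE.
have [->|ij] := eqVneq i.
  case jS : (j \in S).
    by rewrite finset.setD1K // {1}(esgnD1 j jS) ltnn mul1r mulrA esgn2 mul1r subrr.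
  rewrite subr0 (esgnD1 j (finset.setU11 j S)) ltnn mul1r finset.setU1K ?jS // mulrA esgn2 mul1r //.
rewrite form0 sub0r /=.
case iS : (i \in S); case jS : (j \in S); rewrite ?mulr0 ?oppr0 //.
have -> : (i |: S) :\ j = (i |: (S :\ j))%SET.
  by apply/finset.setP => t; rewrite !inE; case: eqVneq => [->|] //=; rewrite eq_sym (negbTE ij).
rewrite (esgnD1 i jS) (esgnD1 j (finset.setU11 i S)) finset.setU1K ?iS //.
have := ij; rewrite -val_eqE; case: ltngtP => // _ _; ring.
Qed.

Lemma eiei i j x : ei i (ei j x) = - ei j (ei i x).
Proof.
have [->|ij] := eqVneq i j; first by rewrite eiei0 oppr0.
apply/ffunP => S; rewrite formN !eiE !inE [j == i]eq_sym (negbTE ij).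
case iS : (i \in S); case jS : (j \in S); rewrite ?mulr0 ?oppr0 //=.
rewrite [(j |: (i |: S))%SET]finset.setUCA.
rewrite (esgnD1 j (finset.setU11 i S)) (esgnD1 i (finset.setU11 j S)) !finset.setU1K ?iS ?jS //.
have := ij; rewrite -val_eqE; case: ltngtP => // _ _; ring.
Qed.

Lemma card_form x S : (\sum_i ew i (ei i x)) S = #|S|%:R * x S.
Proof.
rewrite form_sum (bigID (mem S)) /= [X in _ + X]big1 ?addr0 => [|i /negbTE iS]; last by rewrite ewE iS.
rewrite (eq_bigr (fun=> x S)) => [|i iS]; first by rewrite sumr_const mulr_natl.
rewrite ewE eiE !inE iS eqxx finset.setD1K // (esgnD1 i iS) ltnn mul1r mulrA esgn2 mul1r //.
Qed.

End Forms.

Section FormMap.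
Variables (K K' : comPzRingType) (n : nat) (phi : K -> K').
Implicit Types (x : form K n) (i : 'I_n).

Definition fmap x : form K' n := [ffun S : {set 'I_n} => phi (x S)].

Lemma fmapE x S : fmap x S = phi (x S). Proof. by rewrite ffunE. Qed.

Lemma fmap_ew i x : phi 0 = 0 -> (forall S, phi (- x S) = - phi (x S)) -> fmap (ew i x) = ew i (fmap x).
Proof.
move=> p0 pN; apply/ffunP => S; rewrite fmapE !ewE fmapE; case: ifP => //.
by rewrite /esgn -[in LHS]signr_odd -[in RHS]signr_odd; case: odd; rewrite ?mulN1r ?mul1r.
Qed.

Lemma fmap_ei i x : phi 0 = 0 -> (forall S, phi (- x S) = - phi (x S)) -> fmap (ei i x) = ei i (fmap x).
Proof.
move=> p0 pN; apply/ffunP => S; rewrite fmapE !eiE fmapE; case: ifP => // _.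
by rewrite /esgn -[in LHS]signr_odd -[in RHS]signr_odd; case: odd; rewrite ?mulN1r ?mul1r.
Qed.

End FormMap.

(** * The Lefschetz theorem for omega *)

Section Lefschetz.
Variables (K : comPzRingType) (g : nat).
Local Notation F := (form K (g + g)).
Implicit Types (x y : F) (S : {set 'I_(g + g)}).
Local Notation be i := (@ew K (g + g) (beta i)).
Local Notation al i := (@ew K (g + g) (alpha i)).
Local Notation ib i := (@ei K (g + g) (beta i)).
Local Notation ia i := (@ei K (g + g) (alpha i)).

Lemma beta_alpha (i j : 'I_g) : (beta i == alpha j) = false.
Proof. by rewrite eq_lrshift. Qed.
Lemma alpha_beta (i j : 'I_g) : (alpha i == beta j) = false.
Proof. by rewrite eq_rlshift. Qed.
Lemma alpha_eq (i j : 'I_g) : (alpha i == alpha j) = (i == j).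
Proof. by rewrite eq_rshift. Qed.

Lemma ib_be i j x : ib i (be j x) = (if i == j then x else 0) - be j (ib i x).
Proof. by rewrite ei_ew. Qed.
Lemma ia_al i j x : ia i (al j x) = (if i == j then x else 0) - al j (ia i x).
Proof. by rewrite ei_ew alpha_eq. Qed.
Lemma ib_al i j x : ib i (al j x) = - al j (ib i x).
Proof. by rewrite ei_ew beta_alpha sub0r. Qed.
Lemma ia_be i j x : ia i (be j x) = - be j (ia i x).
Proof. by rewrite ei_ew alpha_beta sub0r. Qed.

Definition om x : F := \sum_i be i (al i x).
Definition lam x : F := \sum_i ia i (ib i x).

Lemma om_linear : linear om.
Proof. by move=> a x y; rewrite scaler_sumr -big_split; apply: eq_bigr => i; rewrite !linearP. Qed.
HB.instance Definition _ := GRing.isLinear.Build K F F *:%R om om_linear.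
Lemma lam_linear : linear lam.
Proof. by move=> a x y; rewrite scaler_sumr -big_split; apply: eq_bigr => i; rewrite !linearP. Qed.
HB.instance Definition _ := GRing.isLinear.Build K F F *:%R lam lam_linear.

(** The sl2 relation [omega, lambda] = degree - g; the degree appears as two counting operators,
    evaluated by [card_form2]. *)
Lemma om_lam x : om (lam x) = lam (om x) + (\sum_i be i (ib i x) + \sum_i al i (ia i x) - x *+ g).
Proof.
rewrite /om /lam.
rewrite (eq_bigr (fun i => \sum_j be i (al i (ia j (ib j x))))) => [|i]; last by rewrite !linear_sum.
rewrite [X in X + _](eq_bigr (fun j => \sum_i ia j (ib j (be i (al i x))))) => [|i]; last by rewrite !linear_sum.
rewrite [X in X + _]exchange_big.
have -> : x *+ g = \sum_(i < g) x by rewrite sumr_const card_ord.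
rewrite -!big_split -sumrB -big_split; apply: eq_bigr => i _.
rewrite (bigD1 i) //= [in RHS](bigD1 i) //= [in RHS]addrAC; congr (_ + _); last first.
  apply: eq_bigr => j ji; rewrite ib_be (negbTE ji) sub0r ib_al !linearN /= opprK.
  by rewrite ia_be ia_al (negbTE ji) sub0r linearN opprK.
rewrite ib_be eqxx ib_al linearN opprK linearD /= ia_al ia_be ia_al eqxx linearB.
rewrite !opprB.
apply/ffunP => S; rewrite !(formD, formN); ring.
Qed.

Lemma card_form2 x S : (\sum_i be i (ib i x) + \sum_i al i (ia i x)) S = #|S|%:R * x S.
Proof. by rewrite -card_form big_split_ord. Qed.

Lemma lam_iter_deg k r x : (forall S, #|S| != k -> x S = 0) -> forall S, (#|S| + r.*2 != k)%N -> iter r lam x S = 0.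
Proof.
move=> xk; elim: r => [|r IH] S; first by rewrite addn0; exact: xk.
move=> nk; rewrite form_sum big1 // => i; rewrite !eiE !inE.
case: ifP => // aS; rewrite beta_alpha.
case: ifP => bS; rewrite ?mulr0 // IH ?mulr0 //.
by rewrite !cardsU1 !inE beta_alpha bS aS; apply: contra nk => /eqP <-; rewrite !addnS.
Qed.

(** The contributions k - 2 i - g of [om_lam], for i from 0 to r, add up to - (r + 1) (g - k +
    r). *)
Lemma om_lam_iter k r x : (k < g)%N -> (forall S, #|S| != k -> x S = 0) -> om x = 0 ->
  om (iter r.+1 lam x) = - ((r.+1 * (g - k + r))%:R *: iter r lam x).
Proof.
move=> kg xk ox; elim: r => [|r IH].
  rewrite om_lam ox linear0 add0r; apply/ffunP => S; rewrite formD formN card_form2 formN formZ.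
  rewrite -[x *+ g]scaler_nat formZ; have [kE|/xk ->] := eqVneq #|S| k; last by rewrite !mulr0 subrr oppr0.
  rewrite kE mul1n addn0 (natrB _ (ltnW kg)); ring.
rewrite [iter r.+2 _ _]iterS om_lam IH linearN linearZ; set y := iter r.+1 lam x.
apply/ffunP => S; rewrite formD formD card_form2 !formN -[y *+ g]scaler_nat !formZ.
have [kE|nk] := eqVneq (#|S| + (r.+1).*2)%N k; last by rewrite (lam_iter_deg xk nk) !mulr0 subrr addr0.
have E : (r.+2 * (g - k + r.+1) = r.+1 * (g - k + r) + (g - k) + r.+1.*2)%N by nia.
have kR : k%:R = #|S|%:R + (r.+1).*2%:R :> K by rewrite -natrD kE.
rewrite E !natrD (natrB _ (ltnW kg)) kR; ring.
Qed.

(** For degree reasons some power of [lam] kills x, and [om_lam_iter] climbs back from lam^(r+1) x =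
    0 to lam^r x = 0, its factor being nonzero as k < g. *)
Lemma lefschetz k x : (forall m (v : K), m.+1%:R * v = 0 -> v = 0) -> (k < g)%N ->
  (forall S, #|S| != k -> x S = 0) -> om x = 0 -> x = 0.
Proof.
move=> char0 kg xk ox.
have H r : iter r lam x = 0 -> x = 0.
  elim: r => [//|r IH] E; apply: IH; have := om_lam_iter r kg xk ox; rewrite E linear0.
  move=> /(congr1 -%R); rewrite oppr0 opprK => /esym /ffunP e; apply/ffunP => S.
  have := e S; rewrite formZ form0 (_ : (r.+1 * (g - k + r))%N = (r.+1 * (g - k + r)).-1.+1); last nia.
  exact: char0.
apply: (H k.+1); apply/ffunP => S; rewrite form0; apply: (lam_iter_deg xk); lia.
Qed.

End Lefschetz.

(** * Koszul complexes of commuting operators *)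

Section Koszul.
Variables (K : comPzRingType) (g : nat) (D : 'I_g -> K -> K).
Local Notation F := (form K (g + g)).
Implicit Types (x y b f : F) (S : {set 'I_(g + g)}) (u v : K) (i j : 'I_g).
Local Notation be i := (@ew K (g + g) (beta i)).
Local Notation ib i := (@ei K (g + g) (beta i)).
Hypotheses (DB : forall i u v, D i (u - v) = D i u - D i v) (DC : forall i j u, D i (D j u) = D j (D i u)).

Lemma D0 i : D i 0 = 0. Proof. by have := DB i 0 0; rewrite !subrr. Qed.
Lemma DN i u : D i (- u) = - D i u. Proof. by rewrite -sub0r DB D0 sub0r. Qed.
Lemma DD i u v : D i (u + v) = D i u + D i v. Proof. by rewrite -{1}[v]opprK DB DN opprK. Qed.

Local Notation fD i := (fmap (D i)).

Lemma fDB i x y : fD i (x - y) = fD i x - fD i y.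
Proof. by apply/ffunP => S; rewrite !(fmapE, formD, formN). Qed.
Lemma fD_ew i l x : fD i (ew l x) = ew l (fD i x). Proof. by apply: fmap_ew => [|S]; rewrite ?D0 ?DN. Qed.
Lemma fD_ei i l x : fD i (ei l x) = ei l (fD i x). Proof. by apply: fmap_ei => [|S]; rewrite ?D0 ?DN. Qed.
Lemma fDC i j x : fD i (fD j x) = fD j (fD i x). Proof. by apply/ffunP => S; rewrite !fmapE. Qed.

(** Koszul differential of the D_i with i >= m only: the inductions eliminate one operator at a
    time. *)
Definition kz (m : nat) x : F := \sum_(i < g | (m <= i)%N) be i (fD i x).

Lemma kzB m x y : kz m (x - y) = kz m x - kz m y.
Proof. by rewrite -sumrB; apply: eq_bigr => i; rewrite fDB linearB. Qed.

Lemma kz_sub0 m x : kz m (- x) = - kz m x.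
Proof. by rewrite -sub0r kzB /kz big1 ?sub0r // => i; rewrite (_ : fD i 0 = 0) ?linear0 //; apply/ffunP => S; rewrite fmapE form0 D0. Qed.

Lemma kz_kz m x : kz m (kz m x) = 0.
Proof.
have fsum i : fD i (kz m x) = \sum_(j < g | (m <= j)%N) be j (fD i (fD j x)).
  apply/ffunP => S; rewrite fmapE !form_sum.
  rewrite (big_morph (D i) (DD i) (D0 i)); apply: eq_bigr => j.
  by rewrite -fmapE fD_ew.
set z := kz m (kz m x); have zE : z = \sum_(i < g | (m <= i)%N) \sum_(j < g | (m <= j)%N) be i (be j (fD i (fD j x))).
  by rewrite /z; apply: eq_bigr => i; rewrite fsum linear_sum.
apply/ffunP => S; rewrite form0 zE form_sum.
under eq_bigr do rewrite form_sum.
pose G i j := be i (be j (fD i (fD j x))) S.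
have GN i j : G i j = - G j i by rewrite /G ewew formN fDC.
have G0 i : G i i = 0 by rewrite /G ewew0 form0.
have H (s : seq 'I_g) : \sum_(i <- s) \sum_(j <- s) G i j = 0.
  elim: s => [|i s IH]; first by rewrite big_nil.
  rewrite big_cons big_cons G0 add0r; under [X in _ + X]eq_bigr do rewrite big_cons.
  rewrite big_split /= IH addr0 -big_split big1 // => j _; rewrite GN; exact: addNr.
rewrite -[RHS](H [seq i : 'I_g <- index_enum 'I_g | (m <= i)%N]) big_filter.
by apply: eq_bigr => i; rewrite big_filter.
Qed.

(** Cartan's formula: contraction with beta_j is a homotopy for D_j. *)
Lemma ib_kz m j x : (m <= j)%N -> ib j (kz m x) = fD j x - kz m (ib j x).
Proof.
move=> mj; rewrite linear_sum /=.
under eq_bigr do rewrite ib_be -fD_ei.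
rewrite sumrB; rewrite (bigD1 j) //= eqxx big1 ?addr0 // => i /andP[_ /negbTE ij].
by rewrite eq_sym ij.
Qed.

Lemma ib_kz' m j x : (j < m)%N -> ib j (kz m x) = - kz m (ib j x).
Proof.
move=> mj; rewrite linear_sum /= -sumrN; apply: eq_bigr => i mi.
rewrite ib_be -fD_ei; case: eqVneq => [ji|_]; last by rewrite sub0r.
by move: mi; rewrite -ji leqNgt mj.
Qed.

Lemma kz_be m j x : kz m (be j x) = - be j (kz m x).
Proof.
rewrite linear_sum -sumrN; apply: eq_bigr => i _; rewrite fD_ew.
exact: ewew.
Qed.

Lemma kz_split (j : 'I_g) x : kz j x = be j (fD j x) + kz j.+1 x.
Proof.
rewrite /kz (bigD1 j) //=; congr (_ _); apply: eq_bigl => i.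
by rewrite ltn_neqAle andbC eq_sym.
Qed.

Lemma ib0P i x : ib i x = 0 <-> forall S, beta i \in S -> x S = 0.
Proof.
split=> [e S iS|H]; last by apply/ffunP => S; rewrite form0 eiE; case: ifP => //; rewrite H ?mulr0 // !inE eqxx.
have := congr1 (fun y => y (S :\ beta i)) e; rewrite form0 eiE !inE eqxx finset.setD1K //.
by move=> /(congr1 (fun v => esgn K (beta i) (S :\ beta i) * v)); rewrite mulrA esgn2 mul1r mulr0.
Qed.

Definition coefs (P : K -> Prop) x := forall S, P (x S).

Definition subgroup (P : K -> Prop) := P 0 /\ forall u v, P u -> P v -> P (u - v).

Lemma subgroupN P u : subgroup P -> P u -> P (- u).
Proof. by move=> [p0 pB] /(pB _ _ p0); rewrite sub0r. Qed.

Lemma coefsB P x y : subgroup P -> coefs P x -> coefs P y -> coefs P (x - y).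
Proof. move=> [_ pB] px py S; rewrite formD formN; exact: pB. Qed.

Lemma subgroup_sgn P l S u : subgroup P -> P u -> P (esgn K l S * u).
Proof.
move=> Pu; rewrite /esgn -signr_odd; case: odd; rewrite ?mulN1r ?mul1r //.
exact: subgroupN.
Qed.

Lemma coefs_ew P l x : subgroup P -> coefs P x -> coefs P (ew l x).
Proof. move=> sP px S; rewrite ewE; case: ifP => _; [exact: subgroup_sgn|exact: sP.1]. Qed.

Lemma coefs_ei P l x : subgroup P -> coefs P x -> coefs P (ei l x).
Proof. move=> sP px S; rewrite eiE; case: ifP => _; [exact: sP.1|exact: subgroup_sgn]. Qed.

Lemma coefs_sum P (I : Type) (r : seq I) (Q : pred I) (G : I -> F) : subgroup P ->
  (forall i : I, Q i -> coefs P (G i)) -> coefs P (\sum_(i <- r | Q i) G i).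
Proof.
move=> sP H S; rewrite form_sum; elim/big_rec: _ => [|i y Qi Py]; first exact: sP.1.
rewrite -[y]opprK; apply: sP.2; [exact: H|exact: subgroupN].
Qed.

Lemma coefs_kz P m x : subgroup P -> (forall i u, (m <= i)%N -> P u -> P (D i u)) -> coefs P x -> coefs P (kz m x).
Proof.
move=> sP pD px; apply: coefs_sum => // i mi; apply: coefs_ew => // S; rewrite fmapE; exact: pD.
Qed.

Lemma form_choice (P : K -> K -> Prop) x : (forall S, exists u, P (x S) u) -> exists y, forall S, P (x S) (y S).
Proof.
move=> /choice[y Hy]; exists [ffun S : {set 'I_(g + g)} => y S] => S; rewrite ffunE; exact: Hy.
Qed.

Lemma kzD m x y : kz m (x + y) = kz m x + kz m y.
Proof. by rewrite -{1}[y]opprK kzB kz_sub0 opprK. Qed.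

Lemma kz0 m : kz m 0 = 0. Proof. by have := kzB m 0 0; rewrite !subrr. Qed.

Lemma coefs0 P : subgroup P -> coefs P 0. Proof. move=> sP S; rewrite form0; exact: sP.1. Qed.

Lemma card_beta_part j S : beta j \notin S -> #|beta_part (beta j |: S)%SET| = #|beta_part S|.+1.
Proof.
move=> jS; rewrite (_ : beta_part _ = j |: beta_part S)%SET; first by rewrite cardsU1 inE jS.
by apply/finset.setP => i; rewrite !inE.
Qed.

Section Positive.
Variable N : nat -> K -> Prop.
Hypotheses (Nsub : forall m : nat, subgroup (N m)) (ND : forall (m : nat) i u, N m u -> N m (D i u))
  (Nonto : forall j v, N j v -> exists2 u, N j u & D j u = v)
  (Nstep : forall j u, N j u -> D j u = 0 -> N j.+1 u) (Nmono : forall (m : nat) u, N m.+1 u -> N m u)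
  (Nkill : forall (m : nat) i u, (i < m)%N -> N m u -> D i u = 0).

(** [N m] models functions killed by the D_i with i < m, on which D_m is onto. Stage j solves D_j f1
    = iota_j b and so removes beta_j from b; by Cartan's formula D_j then kills b, whose
    coefficients fall into [N j.+1]. After g stages only the beta-free part is left, and it is 0. *)
Lemma koszul_pos b : coefs (N 0) b -> kz 0 b = 0 -> (forall S, beta_part S = finset.set0 -> b S = 0) ->
  exists2 f, coefs (N 0) f & kz 0 f = b.
Proof.
move=> Nb cb b0.
have N0 m u : N m u -> N 0 u by elim: m => // m IH /Nmono.
have stage m : (m <= g)%N -> exists f, [/\ coefs (N 0) f, coefs (N m) (b - kz 0 f) &
    forall i, (i < m)%N -> ib i (b - kz 0 f) = 0].
  elim: m => [_|m IH mg].
    exists 0; rewrite kz0 subr0; split => //; exact: coefs0.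
  have [f [f0 fm fi]] := IH (ltnW mg); pose j := Ordinal mg; set b' := b - kz 0 f.
  have cb' : kz 0 b' = 0 by rewrite kzB cb kz_kz subrr.
  (* Choosing 0 over 0 keeps f1 free of beta_i for i <= j. *)
  have [|f1 Hf1] := @form_choice (fun v u => [/\ N j u, D j u = v & v = 0 -> u = 0]) (ib j b').
    move=> S; have [e|ne] := pselect (ib j b' S = 0).
      exists 0; rewrite D0; split => //; exact: (Nsub j).1.
    have [|u] := @Nonto j (ib j b' S); first exact: coefs_ei.
    by exists u.
  have f1N : coefs (N j) f1 by move=> S; have [] := Hf1 S.
  have f1D : fD j f1 = ib j b' by apply/ffunP => S; rewrite fmapE; have [] := Hf1 S.
  have f1i i : (i <= j)%N -> ib i f1 = 0.
    move=> ij; apply/ib0P => S iS; have [_ _] := Hf1 S; apply; move: S iS; apply/ib0P.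
    move: ij; rewrite leq_eqVlt => /orP[/eqP/val_inj ->|ij]; first exact: eiei0.
    by rewrite eiei fi // linear0 oppr0.
  have kf1 : kz 0 f1 = kz j f1.
    rewrite /kz [in RHS]big_mkcond; apply: eq_bigr => i _; case: leqP => // ij.
    rewrite (_ : fD i f1 = 0) ?linear0 //; apply/ffunP => S; rewrite fmapE form0.
    exact: (Nkill ij (f1N S)).
  have E : b - kz 0 (f + f1) = b' - kz j f1 by rewrite kzD kf1 opprD addrA.
  exists (f + f1); rewrite E.
  have bi i : (i < m.+1)%N -> ib i (b' - kz j f1) = 0.
    rewrite ltnS leq_eqVlt => /orP[/eqP im|im].
      have -> : i = j by exact/val_inj.
      by rewrite linearB /= ib_kz // f1D f1i // kz0 subr0 subrr.
    rewrite linearB /= fi // ib_kz' // f1i; last exact: ltnW.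
    by rewrite kz0 oppr0 subr0.
  split => // [S|S].
    rewrite formD -[f1 S]opprK; apply: (Nsub 0).2 => //; apply: subgroupN => //.
    exact: N0.
  apply: (Nstep (j := j)).
    apply: coefsB => //; apply: coefs_kz => // i u _; exact: ND.
  have k0 : kz 0 (b' - kz j f1) = 0 by rewrite -kf1 kzB cb' kz_kz subrr.
  have := ib_kz (b' - kz j f1) (leq0n j); rewrite k0 linear0 bi // kz0 subr0 => /esym/ffunP/(_ S).
  by rewrite fmapE form0.
have [f [f0 _ fi]] := stage g (leqnn g); exists f => //.
apply/esym/eqP; rewrite -subr_eq0; apply/eqP/ffunP => S; rewrite form0.
have [S0|[l]] := finset.set_0Vmem (beta_part S); last first.
  rewrite inE => iS; exact: (ib0P l _).1 (fi l (ltn_ord l)) S iS.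
rewrite formD formN b0 // form_sum big1 ?subrr // => i; rewrite ewE; case: ifP => // iS.
by have : i \in beta_part S; [rewrite inE|rewrite S0 inE].
Qed.
End Positive.

Section Negative.
Variables (N : nat -> K -> Prop) (sg : 'I_g -> K -> K).
Hypotheses (Nsub : forall m : nat, subgroup (N m)) (ND : forall (m : nat) i u, (m <= i)%N -> N m u -> N m (D i u))
  (Ninj : forall j u, N j u -> D j u = 0 -> u = 0)
  (sgN : forall j u, N j u -> N j.+1 (sg j u))
  (sgB : forall j u v, N j u -> N j v -> sg j (u - v) = sg j u - sg j v)
  (sgD : forall j i u, (j < i)%N -> N j u -> sg j (D i u) = D i (sg j u))
  (sg_D : forall j u, N j u -> sg j (D j u) = 0)
  (sg_onto : forall j v, N j.+1 v -> exists2 u, N j u & sg j u = v)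
  (sg_ker : forall j u, N j u -> sg j u = 0 -> exists2 r, N j r & D j r = u).

Lemma sg0 j : sg j 0 = 0.
Proof. by have := sgB (Nsub j).1 (Nsub j).1; rewrite !subrr. Qed.

Lemma sgNeg j u : N j u -> sg j (- u) = - sg j u.
Proof. by move=> Nu; have := sgB (Nsub j).1 Nu; rewrite !sub0r sg0 sub0r. Qed.

Lemma sg_sum j (r : seq 'I_g) (P : pred 'I_g) (G : 'I_g -> K) : (forall i, P i -> N j (G i)) ->
  N j (\sum_(i <- r | P i) G i) /\ sg j (\sum_(i <- r | P i) G i) = \sum_(i <- r | P i) sg j (G i).
Proof.
move=> NG; elim/big_rec2: _ => [|i y1 y2 Pi [N2 E]]; first by rewrite sg0; split => //; exact: (Nsub j).1.
have : N j (- y2) by exact: subgroupN.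
split; first by rewrite -[y2]opprK; apply: (Nsub j).2 => //; exact: NG.
by rewrite -[y2]opprK sgB //; [rewrite sgNeg // opprK E|exact: NG].
Qed.

Lemma fsg_kz j x : coefs (N j) x -> fmap (sg j) (kz j.+1 x) = kz j.+1 (fmap (sg j) x).
Proof.
move=> Nx; apply/ffunP => S; rewrite fmapE !form_sum.
have [|_ ->] := @sg_sum j (index_enum 'I_g) (fun i => (j < i)%N) (fun i => be i (fD i x) S).
  move=> i ji; apply: coefs_ew => // T; rewrite fmapE; apply: ND => //; exact: ltnW.
apply: eq_bigr => i ji; rewrite -fmapE fmap_ew ?sg0 //; last first.
  move=> T; rewrite fmapE sgNeg //; apply: ND => //; exact: ltnW.
by congr (be i _ S); apply/ffunP => T; rewrite !fmapE sgD.
Qed.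

Lemma fsg_ei j l x : coefs (N j) x -> fmap (sg j) (ei l x) = ei l (fmap (sg j) x).
Proof. by move=> Nx; apply: fmap_ei => [|S]; rewrite ?sg0 ?sgNeg. Qed.

(** Induction along the exact sequences of D_j : N_j -> N_j followed by sg_j : N_j -> N_(j+1). The
    image under sg_j of c = iota_j b is a cocycle for the remaining operators; a lift t of its
    primitive and a solution r of D_j r = c - kz t combine to the primitive r - beta_j /\ t.
    Injectivity of D_j removes what remains. *)
Lemma koszul_neg_stage d (m : nat) b : (m + d = g)%N -> coefs (N m) b -> (forall i, (i < m)%N -> ib i b = 0) ->
  kz m b = 0 -> (forall S, (d <= #|beta_part S|)%N -> b S = 0) ->
  exists f, [/\ coefs (N m) f, forall i, (i < m)%N -> ib i f = 0 & kz m f = b].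
Proof.
elim: d m b => [|d IH] m b mdg Nb bi cb bd.
  exists 0; split => [|i _|]; [exact: coefs0|exact: linear0|].
  by rewrite kz0; apply/ffunP => S; rewrite form0 bd.
have mg : (m < g)%N by lia.
pose j := Ordinal mg; pose c := ib j b.
have Nc : coefs (N j) c by exact: coefs_ei.
have ci i : (i <= j)%N -> ib i c = 0.
  rewrite leq_eqVlt => /orP[/eqP/val_inj ->|ij]; first exact: eiei0.
  by rewrite eiei bi // linear0 oppr0.
have Dc : fD j (b - be j c) = kz j.+1 c.
  have := ib_kz b (leqnn j); rewrite cb linear0 => /eqP; rewrite eq_sym subr_eq0 => /eqP E.
  by rewrite fDB fD_ew E kz_split addrC addKr.
have Nbc : coefs (N j) (b - be j c) by apply: coefsB => //; exact: coefs_ew.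
have [|||||s [Ns si ks]] := IH m.+1 (fmap (sg j) c); first lia.
- by move=> S; rewrite fmapE; apply: (sgN (j := j)).
- by move=> i ij; rewrite -fsg_ei // ci //; apply/ffunP => S; rewrite fmapE !form0 sg0.
- rewrite -[m]/(val j) -fsg_kz // -Dc; apply/ffunP => S; rewrite !fmapE form0; exact: sg_D.
- move=> S dS; rewrite fmapE eiE; case: ifP => jS; first exact: sg0.
  by rewrite bd ?mulr0 ?sg0 // card_beta_part ?jS.
have [|t Ht] := @form_choice (fun v u => [/\ N j u, sg j u = v & v = 0 -> u = 0]) s.
  move=> S; have [e|ne] := pselect (s S = 0).
    exists 0; rewrite sg0; split => //; exact: (Nsub j).1.
  by have [u] := @sg_onto j (s S) (Ns S); exists u.
have Nt : coefs (N j) t by move=> S; have [] := Ht S.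
have st : fmap (sg j) t = s by apply/ffunP => S; rewrite fmapE; have [] := Ht S.
have ti i : (i <= j)%N -> ib i t = 0.
  move=> ij; apply/ib0P => S iS; have [_ _] := Ht S; apply; move: S iS; apply/ib0P; exact: si.
pose w := c - kz j.+1 t.
have Nkt : coefs (N j) (kz j.+1 t) by apply: coefs_kz => // i u ji; apply: ND; exact: ltnW.
have Nw : coefs (N j) w by exact: coefsB.
have sw S : sg j (w S) = 0.
  rewrite formD formN sgB // -!fmapE fsg_kz // st ks !fmapE subrr //.
have [|r Hr] := @form_choice (fun v u => [/\ N j u, D j u = v & v = 0 -> u = 0]) w.
  move=> S; have [e|ne] := pselect (w S = 0).
    exists 0; rewrite D0; split => //; exact: (Nsub j).1.
  by have [u] := sg_ker (Nw S) (sw S); exists u.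
have Nr : coefs (N j) r by move=> S; have [] := Hr S.
have Dr : fD j r = w by apply/ffunP => S; rewrite fmapE; have [] := Hr S.
have wi i : (i <= j)%N -> ib i w = 0.
  by move=> ij; rewrite linearB /= ci // ib_kz' // ti // kz0 oppr0 subr0.
have ri i : (i <= j)%N -> ib i r = 0.
  move=> ij; apply/ib0P => S iS; have [_ _] := Hr S; apply; move: S iS; apply/ib0P; exact: wi.
pose f := r - be j t.
have Nf : coefs (N j) f by apply: coefsB => //; exact: coefs_ew.
have kf : kz j f = be j c + kz j.+1 r.
  rewrite kzB kz_be opprK !kz_split linearD /= ewew0 add0r Dr linearB.
  by rewrite addrAC subrK.
have b1 : b - kz j f = 0.
  have i1 : ib j (b - kz j f) = 0.
    rewrite kf linearB linearD /= ib_be eqxx ci // linear0 subr0 ib_kz' // ri // kz0 oppr0 addr0.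
    by rewrite subrr.
  have k1 : kz j (b - kz j f) = 0 by rewrite kzB cb kz_kz subrr.
  have := ib_kz (b - kz j f) (leqnn j); rewrite k1 i1 linear0 kz0 subr0 => /esym/ffunP E.
  apply/ffunP => S; rewrite form0; apply: (Ninj (j := j)); last by have := E S; rewrite fmapE form0.
  apply: coefsB => //; apply: coefs_kz => //; exact: ND.
exists f; split => // [i ij|]; last by apply/esym/eqP; rewrite -subr_eq0 b1.
rewrite linearB /= ri ?(ltnW ij) // ib_be.
by case: eqVneq => [ij'|_]; [move: ij; rewrite ij' ltnn|rewrite ti ?(ltnW ij) // linear0 !subr0].
Qed.

Lemma koszul_neg b : coefs (N 0) b -> kz 0 b = 0 -> (forall S, (g <= #|beta_part S|)%N -> b S = 0) ->
  exists2 f, coefs (N 0) f & kz 0 f = b.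
Proof.
move=> Nb cb bd; have [f [?]] := koszul_neg_stage (add0n g) Nb (fun i (h : (i < 0)%N) => match notF h with end) cb bd.
by exists f.
Qed.
End Negative.

End Koszul.

(** * Triangular diagonalization of positive quadratic forms *)

Section Cholesky.
Variable R : realType.

Definition qform n (Y : 'I_n -> 'I_n -> R) (x : 'I_n -> R) : R := \sum_i \sum_j x i * x j * Y i j.

(** Completing the square in the first variable. The triangular shape is the point: x_k enters only
    the squares with i <= k, so a shift of x_k leaves the later squares alone. *)
Lemma cholesky n (Y : 'I_n -> 'I_n -> R) : (forall i j, Y i j = Y j i) ->
  (forall x, (exists i, x i != 0) -> 0 < qform Y x) ->
  exists (L : 'I_n -> 'I_n -> R) (a : 'I_n -> R), [/\ forall i, 0 < a i, forall i, L i i = 1,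
    forall k i : 'I_n, (k < i)%N -> L k i = 0 &
    forall x, qform Y x = \sum_i a i * (\sum_k x k * L k i) ^+ 2].
Proof.
elim: n Y => [|n IH] Y Ysym Ypos.
  by exists (fun => 0), (fun=> 1); split => [[]|[]|[]|x] //; rewrite /qform !big_ord0.
pose y0 := Y ord0 ord0; pose s (x : 'I_n -> R) := \sum_j x j * Y ord0 (lift ord0 j).
have y00 : 0 < y0.
  have := Ypos (fun i => if i == ord0 then 1 else 0); rewrite /qform big_ord_recl big_ord_recl /= !mul1r.
  rewrite big1 => [|i]; last by rewrite mul0r.
  rewrite addr0 big1 => [|i]; last by rewrite big1 // => j; rewrite !mul0r.
  by rewrite addr0; apply; exists ord0.
pose Y' i j := Y (lift ord0 i) (lift ord0 j) - Y ord0 (lift ord0 i) * Y ord0 (lift ord0 j) / y0.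
have Y'E x : qform Y' x = \sum_i \sum_j x i * x j * Y (lift ord0 i) (lift ord0 j) - s x ^+ 2 / y0.
  rewrite expr2 mulr_suml mulr_suml -sumrB; apply: eq_bigr => i _.
  rewrite mulr_sumr mulr_suml -sumrB; apply: eq_bigr => j _.
  rewrite /Y'; ring.
have YE x : qform Y x = y0 * (x ord0 + s (fun i => x (lift ord0 i)) / y0) ^+ 2 + qform Y' (fun i => x (lift ord0 i)).
  rewrite Y'E /qform big_ord_recl big_ord_recl; set u := s _.
  have -> : \sum_(i < n) x ord0 * x (lift ord0 i) * Y ord0 (lift ord0 i) = x ord0 * u.
    by rewrite mulr_sumr; apply: eq_bigr => i; rewrite mulrA.
  rewrite [X in _ + X](eq_bigr (fun i => x (lift ord0 i) * x ord0 * Y ord0 (lift ord0 i) +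
     \sum_j x (lift ord0 i) * x (lift ord0 j) * Y (lift ord0 i) (lift ord0 j))); last first.
    by move=> i; rewrite big_ord_recl Ysym.
  rewrite big_split /= -/y0.
  have -> : \sum_(i < n) x (lift ord0 i) * x ord0 * Y ord0 (lift ord0 i) = x ord0 * u.
    rewrite mulr_sumr; apply: eq_bigr => i _; ring.
  by set W := \sum_(i < n) \sum_(j < n) _; field; rewrite gt_eqF.
have [||L [a [a0 L1 L0 LE]]] := IH Y'.
- by move=> i j; rewrite /Y' Ysym; congr (_ - _ / _); rewrite mulrC.
- move=> x [l xl]; pose x1 i := if unlift ord0 i is Some k then x k else - (s x / y0).
  have xS : (fun i => x1 (lift ord0 i)) = x by apply/funext => i; rewrite /x1 liftK.
  have x0 : x1 ord0 = - (s x / y0) by rewrite /x1 unlift_none.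
  have := Ypos x1; rewrite YE xS x0 addNr expr0n mulr0 add0r; apply.
  by exists (lift ord0 l); rewrite /x1 liftK.
pose L1' (k i : 'I_n.+1) := match unlift ord0 k, unlift ord0 i with
  | None, None => 1 | None, _ => 0
  | Some k', None => Y ord0 (lift ord0 k') / y0 | Some k', Some i' => L k' i' end.
exists L1', (fun i => if unlift ord0 i is Some i' then a i' else y0); split.
- by move=> i; case: unliftP.
- by move=> i; rewrite /L1'; case: unliftP.
- move=> k i; rewrite /L1'; case: unliftP => [k' ->|->]; case: unliftP => [i' ->|->] //.
  rewrite ltnS; exact: L0.
move=> x; rewrite YE LE big_ord_recl unlift_none; congr (_ * _ ^+ 2 + _).
  rewrite big_ord_recl /L1' !unlift_none mulr1; congr (_ _).
  by rewrite mulr_suml; apply: eq_bigr => i; rewrite liftK mulrA.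
apply: eq_bigr => i _; rewrite liftK; congr (_ * _ ^+ 2).
rewrite big_ord_recl /L1' unlift_none liftK mulr0 add0r.
by apply: eq_bigr => k; rewrite !liftK.
Qed.

End Cholesky.

(** * Difference equations in classes of Gaussian growth or decay *)

Section GrowthClasses.
Variables (R : realType) (g : nat).
Local Notation C := R[i].
Local Notation Zg := 'rV[int]_g.

Definition unitv (j : 'I_g) : Zg := delta_mx 0 j.

Lemma unitvE (n : int) j i : (unitv j *~ n) 0 i = if i == j then n else 0.
Proof. by rewrite -scaler_int !mxE intz; case: (i == j); rewrite ?mulr1 ?mulr0. Qed.

Definition cfun := Zg -> C^o.
HB.instance Definition _ := GRing.ComPzRing.on cfun.

Variables (L : 'I_g -> 'I_g -> R) (a : 'I_g -> R) (rho eps : R) (s : nat).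
Hypotheses (a0 : forall i, 0 < a i) (L1 : forall i, L i i = 1) (L0 : forall k i : 'I_g, (k < i)%N -> L k i = 0)
  (rho0 : 0 < rho) (s0 : (0 < s)%N) (eps1 : `|eps| = 1).
Implicit Types (m v : Zg) (d u : cfun) (i j : 'I_g).

Definition tt i m : R := \sum_k (m 0 k)%:~R * L k i.
Definition sv j : Zg := unitv j *~ s.

Lemma ttD i m v : tt i (m + v) = tt i m + tt i v.
Proof. by rewrite -big_split; apply: eq_bigr => k; rewrite !mxE rmorphD mulrDl. Qed.

Lemma tt_sv i j (n : int) : tt i (sv j *~ n) = (s%:Z * n)%:~R * L j i.
Proof.
rewrite /tt (bigD1 j) //= big1 ?addr0 => [|k kj]; rewrite -mulrzA unitvE ?eqxx //.
by rewrite (negbTE kj) mul0r.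
Qed.

Definition qt i m : R := rho * a i * tt i m ^+ 2.
Definition ee (K : R) i m : R := eps * qt i m - K * `|tt i m|.
Definition EE (l : nat) (K : R) m : R := \sum_(i < g | (l <= i)%N) ee K i m.

(** For d a Fourier coefficient divided by a Gaussian, level 0 corresponds to entire functions
    ([cls_dcl], [dcl_cls]); level l describes what is left after the first l shifts have been dealt
    with. *)
Definition cls (l : nat) (d : cfun) :=
  (forall K, 0 <= K -> exists B : R, forall m, nc (d m) <= B * expR (EE l K m)) /\
  (forall i m, (i < l)%N -> d (m + sv i) = d m).

Lemma EE_split j K m : EE j K m = ee K j m + EE j.+1 K m.
Proof.
rewrite /EE (bigD1 j) //=; congr (_ _); apply: eq_bigl => i.
by rewrite ltn_neqAle andbC eq_sym.
Qed.

Lemma ee_mono K K' i m : K <= K' -> ee K' i m <= ee K i m.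
Proof. by move=> KK; rewrite lerD2l lerN2 ler_wpM2r. Qed.

Lemma EE_mono l K K' m : K <= K' -> EE l K' m <= EE l K m.
Proof. move=> KK; apply: ler_sum => i _; exact: ee_mono. Qed.

Lemma ttS i j m (n : int) : (j < i)%N -> tt i (m + sv j *~ n) = tt i m.
Proof. by move=> ji; rewrite ttD tt_sv L0 // mulr0 addr0. Qed.

Lemma ttj j m (n : int) : tt j (m + sv j *~ n) = tt j m + s%:R * n%:~R.
Proof. by rewrite ttD tt_sv L1 mulr1 rmorphM. Qed.

Lemma EE_sv j K m (n : int) : EE j.+1 K (m + sv j *~ n) = EE j.+1 K m.
Proof. by apply: eq_bigr => i ji; rewrite /ee /qt !ttS. Qed.

Lemma cls_sub l : subgroup (cls l).
Proof.
split; first by split => //; exists 0 => m; rewrite nc0.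
move=> d u [bd pd'] [bu pu]; split => [K K0|i m il].
  have [B] := bd K K0; have [B'] := bu K K0; exists (B + B') => m.
  rewrite mulrDl; apply: le_trans (ncB _ _) _; exact: lerD.
by rewrite -[LHS]/(d _ - _) pd' // pu.
Qed.

(** A shift changes t_i^2 by a term linear in t_i, absorbed by passing from K to K + W. *)
Lemma cls_shift l v d : cls l d -> cls l (fun m => d (m + v)).
Proof.
move=> [bd pd']; split => [K K0|i m il]; last by rewrite addrAC pd'.
pose W := \sum_i 2 * (rho * a i) * `|tt i v|.
have W0 i : 2 * (rho * a i) * `|tt i v| <= W.
  by rewrite /W (bigD1 i) //= lerDl sumr_ge0 // => k; rewrite !mulr_ge0 // ltW.
have Wp : 0 <= W by rewrite sumr_ge0 // => k; rewrite !mulr_ge0 // ltW.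
have [B HB] := bd (K + W) (addr_ge0 K0 Wp).
exists (B * expR (\sum_(i < g | (l <= i)%N) (rho * a i * tt i v ^+ 2 + (K + W) * `|tt i v|))) => m.
have B0 : 0 <= B by have := HB m => /(le_trans (nc_ge0 _)); rewrite pmulr_lge0 // expR_gt0.
apply: le_trans (HB _) _; rewrite -mulrA -expRD ler_wpM2l // ler_expR -big_split /=.
apply: ler_sum => i; rewrite /ee /qt ttD; set x := tt i m; set y := tt i v.
have ra : 0 < rho * a i by rewrite mulr_gt0.
have : eps * (rho * a i * (2 * x * y + y ^+ 2)) <= W * `|x| + rho * a i * y ^+ 2.
  apply: le_trans (ler_norm _) _; rewrite normrM eps1 mul1r normrM gtr0_norm //.
  apply: (@le_trans _ _ (rho * a i * (2 * `|x| * `|y| + y ^+ 2))).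
    rewrite ler_wpM2l ?(ltW ra) //; apply: le_trans (ler_normD _ _) _.
    have n2 : `|y ^+ 2| = y ^+ 2 by exact: ger0_norm (sqr_ge0 y).
    by rewrite n2 !normrM (ger0_norm (ler0n R 2)).
  rewrite mulrDr; have := ler_wpM2r (normr_ge0 x) (W0 i); lra.
have e3 : `|x| - `|y| <= `|x + y|.
  by rewrite lerBlDr; have := ler_normB (x + y) y; rewrite addrK.
have := ler_wpM2l (addr_ge0 K0 Wp) e3; lra.
Qed.

(** The number of the strip of width s in t_j that contains m; [sv j] moves m up by one strip. *)
Definition qq j m : int := Num.floor (tt j m / s%:R).

Lemma sR : 0 < s%:R :> R. Proof. by rewrite ltr0n. Qed.

Lemma qqP j m : s%:R * (qq j m)%:~R <= tt j m < s%:R * (qq j m)%:~R + s%:R.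
Proof.
have /andP[h1 h2] := floor_itv (tt j m / s%:R).
rewrite ler_pdivlMr ?sR in h1; rewrite ltr_pdivrMr ?sR // in h2.
lra.
Qed.

Lemma qqS j m (n : int) : qq j (m + sv j *~ n) = qq j m + n.
Proof.
rewrite /qq ttj mulrDl [s%:R * _]mulrC mulfK ?gt_eqF ?sR //.
by rewrite floorDrz // intrKfloor.
Qed.

Lemma qq_lt i j m (n : int) : (i < j)%N -> qq j (m + sv i *~ n) = qq j m.
Proof. by move=> ij; rewrite /qq ttS. Qed.

Lemma conv_bound (c K x y : R) : 0 <= c -> 0 <= x <= y -> c * x ^+ 2 - K * x <= Num.max 0 (c * y ^+ 2 - K * y).
Proof.
move=> c0 /andP[x0 xy]; rewrite le_max; have [h|h] := leP (c * x) K.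
  apply/orP; have := ler_wpM2r x0 h; lra.
apply/orP; have h1 : 0 <= c * x - K by lra.
have h2 : c * x - K <= c * y - K by rewrite lerD2r ler_wpM2l.
have := ler_pM x0 h1 xy h2; lra.
Qed.

Lemma sum_const_le (n : nat) (F : 'I_n -> R) (B : R) : (forall k, F k <= B) -> \sum_k F k <= n%:R * B.
Proof. move=> H; rewrite mulr_natl -[X in _ *+ X]card_ord -sumr_const; exact: ler_sum. Qed.

Lemma abs_q_le j m : (`|qq j m|%N)%:R <= `|tt j m| + 1.
Proof.
have /andP[h1 h2] := qqP j m; have s1 : 1 <= s%:R :> R by rewrite ler1n.
have : (`|qq j m|%N)%:R = `|(qq j m)%:~R| :> R by rewrite -intr_norm.
set q := (qq j m)%:~R; set t := tt j m in h1 h2.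
have [q0|q0] := leP 0 q.
  rewrite ger0_norm //; have := ler_norm t; have : q <= s%:R * q by rewrite ler_peMl.
  lra.
rewrite ltr0_norm //; have := ler_norm (- t); rewrite normrN.
have [t0|t0] := leP 0 (q + 1); first by have := normr_ge0 t; lra.
have : - (q + 1) <= s%:R * - (q + 1) by rewrite ler_peMl // oppr_ge0 ltW.
lra.
Qed.

Section PositiveShift.
Hypothesis epsE : eps = 1.

Definition Dp j (d : cfun) : cfun := fun m => d (m - sv j) - d m.

(** The solution of the difference equation that is 0 on the strip 0 <= t_j < s: a finite sum of
    values of v on the orbit between m and that strip. *)
Definition pos_sol j (v : cfun) : cfun := fun m =>
  match qq j m with
  | Posz n => - \sum_(k < n) v (m - sv j *+ k)
  | Negz n => \sum_(k < n.+1) v (m + sv j *+ k.+1)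
  end.

Lemma Dp_pos_sol j (v : cfun) : Dp j (pos_sol j v) = v.
Proof.
apply/funext => m; rewrite /Dp /pos_sol -[m - sv j]/(m - sv j).
have -> : qq j (m - sv j) = qq j m - 1 := qqS j m (-1).
have shift1 (k : nat) : m - sv j + sv j *+ k.+1 = m + sv j *+ k by rewrite mulrS -addrA [- _ + _]addrA addNr add0r.
case: (qq) => [[|n]|n] /=.
- by rewrite big_ord1 big_ord0 shift1 addr0 oppr0 subr0.
- rewrite subn1.
  rewrite big_ord_recl subr0 opprK addrC -addrA [X in _ + X](_ : _ = 0) ?addr0 //.
  by rewrite -sumrB big1 // => k; rewrite mulrS opprD addrA subrr.
- rewrite addn0 big_ord_recl shift1 -addrA [X in _ + X](_ : _ = 0) ?addr0 //.
  by rewrite -sumrB big1 // => k; rewrite shift1 subrr.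
Qed.

(** Convexity of c x^2 - K x bounds it on an interval by its values at the ends ([conv_bound]);
    overshooting by s costs a linear term, paid for by enlarging K. *)
Lemma pos_bound j (K : R) : 0 <= K -> exists K' c : R, K <= K' /\ forall m v,
  EE j.+1 K m = EE j.+1 K v -> EE j.+1 K' v <= EE j.+1 K v -> `|tt j v| <= `|tt j m| + s%:R -> EE j K' v <= EE j K m + c.
Proof.
move=> K0; pose c := rho * a j; have c0 : 0 < c by rewrite mulr_gt0.
pose K' := K + 2 * c * s%:R.
exists K', (K ^+ 2 / (4 * c) + c * s%:R ^+ 2); split => [|m v E1 E2 tv].
  by rewrite lerDl !mulr_ge0 // ltW.
rewrite !EE_split; suff : ee K' j v <= ee K j m + (K ^+ 2 / (4 * c) + c * s%:R ^+ 2) by lra.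
rewrite /ee /qt epsE !mul1r -/c -[tt j v ^+ 2]real_normK ?num_real // -[tt j m ^+ 2]real_normK ?num_real //.
set x := `|tt j v|; set y := `|tt j m| in tv *.
have := @conv_bound c K' x (y + s%:R) (ltW c0); rewrite normr_ge0 tv => /(_ isT) h; apply: le_trans h _.
rewrite ge_max; apply/andP; split.
  have : 0 <= c * (y - K / (2 * c)) ^+ 2 by rewrite mulr_ge0 ?sqr_ge0 // ltW.
  have : c * (y - K / (2 * c)) ^+ 2 = c * y ^+ 2 - K * y + K ^+ 2 / (4 * c) by field; rewrite gt_eqF.
  have : 0 <= c * s%:R ^+ 2 by rewrite mulr_ge0 // ltW.
  lra.
have : 0 <= K ^+ 2 / (4 * c) by rewrite divr_ge0 // mulr_ge0 // ltW.
have : 0 <= K * s%:R by rewrite mulr_ge0.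
have : 0 <= c * s%:R * s%:R by rewrite !mulr_ge0 // ltW.
rewrite /K'.
lra.
Qed.

Lemma Dp_onto j (v : cfun) : cls j v -> exists2 u, cls j u & Dp j u = v.
Proof.
move=> [bv pv]; exists (pos_sol j v); last exact: Dp_pos_sol.
split => [K K0|i m ij]; last first.
  have E (w : Zg) : v (m + sv i + w) = v (m + w) by rewrite addrAC pv.
  rewrite /pos_sol (_ : qq j (m + sv i) = qq j m); last by have := @qq_lt i j m 1 ij.
  case: (qq) => n; last by apply: eq_bigr.
  by congr (- _); apply: eq_bigr.
(* The extra unit of K pays for the number of summands, at most |t_j| + 1. *)
have [K' [c [KK Hc]]] := @pos_bound j (K + 1) (addr_ge0 K0 ler01).
have K'0 : 0 <= K' by apply: le_trans KK; exact: addr_ge0.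
have [B HB] := bv K' K'0.
have : 0 <= B by have := HB 0 => /(le_trans (nc_ge0 _)); rewrite pmulr_lge0 // expR_gt0.
exists (B * expR (c + 1)) => m.
have T (n : int) : `|tt j (m + sv j *~ n)| <= `|tt j m| + s%:R -> nc (v (m + sv j *~ n)) <= B * expR (EE j (K + 1) m + c).
  move=> h; apply: le_trans (HB _) _; rewrite ler_wpM2l // ler_expR; apply: Hc => //.
    by rewrite EE_sv.
  exact: EE_mono.
have [/andP[h1 h2] sp] := (qqP j m, sR).
have S : nc (pos_sol j v m) <= (`|qq j m|%N)%:R * (B * expR (EE j (K + 1) m + c)).
  rewrite /pos_sol; case: (qq) h1 h2 => n h1 h2.
    rewrite ncN; apply: le_trans (nc_sum _ _ _) (sum_const_le _) => k.
    rewrite -[sv j *+ k]/(sv j *~ k) -mulrNz; apply: T; rewrite ttj.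
    have kn : k%:R <= n%:R :> R by rewrite ler_nat ltnW.
    have := ler_wpM2l (ltW sp) kn; move=> h.
    have : 0 <= s%:R * k%:R :> R by [].
    rewrite ger0_norm; last lra.
    have := ler_norm (tt j m); lra.
  apply: le_trans (nc_sum _ _ _) (sum_const_le _) => k.
  apply: (T k.+1%:Z); rewrite ttj.
  have kn : k.+1%:R <= n.+1%:R :> R by rewrite ler_nat.
  have := ler_wpM2l (ltW sp) kn.
  have : 0 <= s%:R * k.+1%:R :> R by [].
  have := ler_norm (tt j m); have := ler_norm (- tt j m); rewrite normrN.
  rewrite ler_norml; lra.
apply: le_trans S _; rewrite mulrCA -mulrA ler_wpM2l //.
have q1 := abs_q_le j m; have q2 := expR_ge1Dx (`|tt j m|).
apply: (@le_trans _ _ (expR `|tt j m| * expR (EE j (K + 1) m + c))).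
  rewrite ler_wpM2r //; lra.
rewrite -!expRD ler_expR !EE_split.
have : EE j.+1 (K + 1) m <= EE j.+1 K m by apply: EE_mono; rewrite lerDl.
have : ee (K + 1) j m = ee K j m - `|tt j m| by rewrite /ee; ring.
lra.
Qed.

(** Being periodic, u takes all its values on the strip 0 <= t_j < s, where the t_j part of the
    bound is a constant. *)
Lemma Dp_step j u : cls j u -> Dp j u = 0 -> cls j.+1 u.
Proof.
move=> [bu pu] D0'.
have per1 m : u (m + sv j) = u m.
  have := congr1 (fun d => d (m + sv j)) D0'; rewrite /Dp addrK => /eqP.
  by rewrite -[X in _ == X]/0 subr_eq0 => /eqP.
have perz (n : int) m : u (m + sv j *~ n) = u m.
  have pn (k : nat) w : u (w + sv j *+ k) = u w.
    by elim: k w => [|k IH] w; rewrite ?addr0 // mulrSr addrA per1.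
  case: n => n; first exact: pn.
  by rewrite -(pn n.+1) subrK.
split => [K K0|i m]; last first.
  by rewrite ltnS leq_eqVlt => /orP[/eqP/val_inj ->|/pu].
have [B HB] := bu K K0; have : 0 <= B by have := HB 0 => /(le_trans (nc_ge0 _)); rewrite pmulr_lge0 // expR_gt0.
exists (B * expR (rho * a j * s%:R ^+ 2)) => m; rewrite -(perz (- qq j m)).
apply: le_trans (HB _) _; rewrite -mulrA -expRD ler_wpM2l // ler_expR EE_split EE_sv.
have /andP[h1 h2] := qqP j m.
rewrite /ee /qt ttj epsE; set t := tt j m + _.
have t0 : 0 <= t <= s%:R by rewrite /t; lra.
have t2 : t ^+ 2 <= s%:R ^+ 2 by case/andP: t0 => ? ?; rewrite lerXn2r // nnegrE.
have := ler_wpM2l (ltW (mulr_gt0 rho0 (a0 j))) t2; have := mulr_ge0 K0 (normr_ge0 t); lra.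
Qed.

(** For eps = 1 the t_l part of the exponent is bounded below, by - K^2 / (4 c). *)
Lemma cls_mono (l : nat) u : cls l.+1 u -> cls l u.
Proof.
move=> [bu pu]; split => [K K0|i m il]; last by rewrite pu // ltnW.
have [B HB] := bu K K0; have : 0 <= B by have := HB 0 => /(le_trans (nc_ge0 _)); rewrite pmulr_lge0 // expR_gt0.
have [lg|gl] := ltnP l g; last first.
  exists B => m; have := HB m; rewrite /EE !big_pred0 // => i; have := ltn_ord i; lia.
pose j := Ordinal lg; pose c := rho * a j; have : 0 < c by rewrite mulr_gt0.
exists (B * expR (K ^+ 2 / (4 * c))) => m; apply: le_trans (HB m) _; rewrite -mulrA -expRD ler_wpM2l // ler_expR.
rewrite -[l]/(val j) EE_split /ee /qt epsE -/c -[tt j m ^+ 2]real_normK ?num_real //; set y := `|tt j m|.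
have : 0 <= c * (y - K / (2 * c)) ^+ 2 by rewrite mulr_ge0 ?sqr_ge0 // ltW.
have : c * (y - K / (2 * c)) ^+ 2 = c * y ^+ 2 - K * y + K ^+ 2 / (4 * c) by field; rewrite gt_eqF.
lra.
Qed.

Lemma Dp_kill (l : nat) i u : (i < l)%N -> cls l u -> Dp i u = 0.
Proof.
move=> il [_ pu]; apply/funext => m; rewrite /Dp -[u (m - sv i)](pu i) // subrK.
ring.
Qed.

Lemma Dp_cls (l : nat) i u : cls l u -> cls l (Dp i u).
Proof. move=> cu; apply: (cls_sub l).2 => //; exact: cls_shift. Qed.

Lemma DpB i u (v : cfun) : Dp i (u - v) = Dp i u - Dp i v.
Proof. apply/funext => m; rewrite -[RHS]/((u (m - sv i) - u m) - (v (m - sv i) - v m)) -[LHS]/((u (m - sv i) - v (m - sv i)) - (u m - v m)); ring. Qed.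

Lemma DpC i j u : Dp i (Dp j u) = Dp j (Dp i u).
Proof. apply/funext => m; rewrite /Dp (addrAC m); ring. Qed.

Lemma shift_pos (b : form cfun (g + g)) : coefs (cls 0) b -> kz Dp 0 b = 0 ->
  (forall S, beta_part S = finset.set0 -> b S = 0) -> exists2 f, coefs (cls 0) f & kz Dp 0 f = b.
Proof.
apply: koszul_pos; [exact: DpB|exact: DpC|exact: cls_sub|exact: Dp_cls|exact: Dp_onto|exact: Dp_step|exact: cls_mono|exact: Dp_kill].
Qed.

End PositiveShift.

Section NegativeShift.
Hypothesis epsE : eps = -1.

(** Sums over Z are taken over integer rows of length 1 so that [asum_l1] applies. *)
Definition zsum (F : int -> C) : C := xget 0 [set t | hsum (fun k : 'rV[int]_1 => F (k 0 0)) t].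

Lemma zsum_eq F t : hsum (fun k : 'rV[int]_1 => F (k 0 0)) t -> zsum F = t.
Proof. move=> H; apply: (hsum_unique _ H); exact: (xgetPex 0 (ex_intro _ t H)). Qed.

Lemma zsumP F (B : R) : 0 <= B -> (forall k : int, nc (F k) <= B * expR (- 1) ^+ `|k|%N) ->
  hsum (fun k : 'rV[int]_1 => F (k 0 0)) (zsum F) /\ nc (zsum F) <= B * (2 / (1 - expR (- 1))).
Proof.
move=> B0 H; have q01 : 0 <= (expR (- 1) : R) < 1 by rewrite expR_ge0 /=.
have as1 : asum (fun k : 'rV[int]_1 => F (k 0 0)) (B * (2 / (1 - expR (- 1))) ^+ 1).
  by apply: asum_l1 => // k; rewrite /l1 big_ord1.
have [t Ht] := asum_hsum as1; rewrite (zsum_eq Ht); split => //.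
exact: hsum_bound as1.
Qed.

Lemma zsum_shift (F : int -> C) (c : int) t : hsum (fun k : 'rV[int]_1 => F (k 0 0)) t -> hsum (fun k : 'rV[int]_1 => F (k 0 0 + c)) t.
Proof.
move=> /(@hsum_reindex R _ _ (fun k => k + const_mx c) (fun k => k - const_mx c) _ _ (addrK _) (subrK _)).
by apply: eq_hsum => k; rewrite !mxE.
Qed.

Lemma zsum_single (F : int -> C) (c : int) : (forall k, k != c -> F k = 0) -> hsum (fun k : 'rV[int]_1 => F (k 0 0)) (F c).
Proof.
move=> H; have := @hsum_fin R _ (fun k : 'rV[int]_1 => F (k 0 0)) [:: const_mx c] isT.
rewrite big_seq1 mxE; apply => k; rewrite inE => kc; apply: H; apply: contra kc => /eqP <-.
by apply/eqP/rowP => i; rewrite !mxE !ord1.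
Qed.

Definition Dn j (d : cfun) : cfun := fun m => d (m + sv j) - d m.
(** The sum over the orbit of the j-th shift, convergent as the bounds decay for eps = -1; it
    identifies the cokernel of [Dn j]. *)
Definition sg j (d : cfun) : cfun := fun m => zsum (fun k => d (m + sv j *~ k)).

Lemma neg_term j d K : 0 <= K -> cls j d -> exists2 B : R, 0 <= B & forall m (k : int),
  nc (d (m + sv j *~ k)) <= B * expR (EE j.+1 K m - qt j (m + sv j *~ k) - (K + 1) * `|tt j m + s%:R * k%:~R|).
Proof.
move=> K0 [bd]; have [B HB] := bd (K + 1) (addr_ge0 K0 ler01).
have : 0 <= B by have := HB 0 => /(le_trans (nc_ge0 _)); rewrite pmulr_lge0 // expR_gt0.
exists B => // m k; apply: le_trans (HB _) _; rewrite ler_wpM2l // ler_expR EE_split EE_sv /ee epsE ttj.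
have : EE j.+1 (K + 1) m <= EE j.+1 K m by apply: EE_mono; rewrite lerDl.
lra.
Qed.

Lemma qt_ge0 i m : 0 <= qt i m. Proof. by rewrite mulr_ge0 ?sqr_ge0 // ltW // mulr_gt0. Qed.

Lemma abs_ks (k : int) : (`|k|%N)%:R <= `|s%:R * k%:~R| :> R.
Proof.
rewrite normrM (ger0_norm (ltW sR)) -intr_norm ler_peMl //.
by rewrite ler1n.
Qed.

Lemma sg_sum1 j d m : cls j d -> hsum (fun k : 'rV[int]_1 => d (m + sv j *~ k 0 0)) (sg j d m).
Proof.
move=> cd; have [B B0 HB] := neg_term (lexx 0) cd.
apply: (zsumP (F := fun k => d (m + sv j *~ k)) (B := B * expR (EE j.+1 0 m + `|tt j m|)) _ _).1.
  by rewrite mulr_ge0.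
move=> k; apply: le_trans (HB m k) _; rewrite -mulrA ler_wpM2l // -expRM_natl -expRD ler_expR.
have := qt_ge0 j (m + sv j *~ k); have := abs_ks k; have := ler_normB (tt j m + s%:R * k%:~R) (tt j m).
rewrite addrAC subrr add0r; lra.
Qed.

Lemma sg_per j d m : cls j d -> sg j d (m + sv j) = sg j d m.
Proof.
move=> cd; apply: zsum_eq; have := @zsum_shift (fun k => d (m + sv j *~ k)) 1 _ (sg_sum1 m cd); apply: eq_hsum => k.
by rewrite mulrzDr [sv j *~ _ + _]addrC addrA.
Qed.

Lemma per_int (u : cfun) j m (n : int) : (forall m, u (m + sv j) = u m) -> u (m + sv j *~ n) = u m.
Proof.
move=> per1; have pn (k : nat) w : u (w + sv j *+ k) = u w.
  by elim: k w => [|k IH] w; rewrite ?addr0 // mulrSr addrA per1.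
by case: n => n; [exact: pn|rewrite -(pn n.+1) subrK].
Qed.

Lemma sg_cls j d : cls j d -> cls j.+1 (sg j d).
Proof.
move=> cd; split => [K K0|i m]; last first.
  rewrite ltnS leq_eqVlt => /orP[/eqP/val_inj ->|ij]; first exact: sg_per.
  apply: zsum_eq; have := sg_sum1 m cd; apply: eq_hsum => k.
  by rewrite addrAC cd.2.
have [B B0 HB] := neg_term K0 cd.
exists (B * expR s%:R * (2 / (1 - expR (- 1)))) => m.
rewrite -(per_int m (- qq j m) (fun m => sg_per m cd)).
set m' := m + _; have tm' : 0 <= tt j m' <= s%:R.
  have := qqP j m; rewrite ttj; lra.
have EEm : EE j.+1 K m' = EE j.+1 K m by exact: EE_sv.
rewrite -EEm mulrAC.
apply: (zsumP (F := fun k => d (m' + sv j *~ k)) _ _).2; first by rewrite !mulr_ge0.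
move=> k; apply: le_trans (HB m' k) _.
rewrite (_ : _ _ * _ = B * (expR (EE j.+1 K m') * expR s%:R * expR (-1) ^+ `|k|%N)); last ring.
rewrite ler_wpM2l // -expRM_natl -!expRD ler_expR.
have := qt_ge0 j (m' + sv j *~ k); have := abs_ks k; have := ler_normB (tt j m' + s%:R * k%:~R) (tt j m').
rewrite addrAC subrr add0r; have : `|tt j m'| <= s%:R by case/andP: tm' => ?; rewrite ger0_norm.
have := mulr_ge0 K0 (normr_ge0 (tt j m' + s%:R * k%:~R)); lra.
Qed.

Lemma sgB j d u : cls j d -> cls j u -> sg j (d - u) = sg j d - sg j u.
Proof. move=> cd cu; apply/funext => m; apply: zsum_eq; exact: hsumB (sg_sum1 m cd) (sg_sum1 m cu). Qed.

Lemma Dn_cls (l : nat) i u : cls l u -> cls l (Dn i u).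
Proof. move=> cu; apply: (cls_sub l).2 => //; exact: cls_shift. Qed.

Lemma sg_Dn_gt j i u : cls j u -> sg j (Dn i u) = Dn i (sg j u).
Proof.
move=> cu; apply/funext => m; apply: zsum_eq.
have := hsumB (sg_sum1 (m + sv i) cu) (sg_sum1 m cu); apply: eq_hsum => k.
by rewrite addrAC.
Qed.

Lemma sg_Dn j u : cls j u -> sg j (Dn j u) = 0.
Proof. by move=> cu; rewrite sg_Dn_gt //; apply/funext => m; rewrite /Dn sg_per // subrr. Qed.

(** A periodic function that decays along its orbits is 0. *)
Lemma Dn_inj j u : cls j u -> Dn j u = 0 -> u = 0.
Proof.
move=> cu D0'; have per1 m : u (m + sv j) = u m.
  by have := congr1 (fun d => d m) D0'; rewrite /Dn => /eqP; rewrite -[X in _ == X]/0 subr_eq0 => /eqP.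
apply/funext => m; apply: nc_small_eq0 => e e0; have [B B0 HB] := neg_term (lexx 0) cu.
pose A := B * expR (EE j.+1 0 m + `|tt j m|); have A0 : 0 <= A by rewrite mulr_ge0.
pose n := Num.truncn (A / e).
rewrite -(per_int m n per1); apply: le_trans (HB m n) _.
have h1 := qt_ge0 j (m + sv j *~ n); have h2 := abs_ks n; have h3 := ler_normB (tt j m + s%:R * n%:~R) (tt j m).
rewrite addrAC subrr add0r in h3.
apply: (@le_trans _ _ (A * expR (- n%:R))).
  rewrite -mulrA -expRD ler_wpM2l // ler_expR; lra.
rewrite expRN ler_pdivrMr // mulrC -ler_pdivrMr //.
have /andP[_ h4] := truncn_itv (divr_ge0 A0 (ltW e0)); apply: le_trans (ltW h4) _.
rewrite -natr1 addrC; exact: expR_ge1Dx.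
Qed.

(** Restricting v to the strip 0 <= t_j < s leaves one point of each orbit. *)
Lemma sg_onto j (v : cfun) : cls j.+1 v -> exists2 u, cls j u & sg j u = v.
Proof.
move=> [bv pv]; pose u := fun m => if qq j m == 0 then v m else 0.
have pj m : v (m + sv j) = v m by apply: pv.
exists u; last first.
  apply/funext => m; apply: zsum_eq.
  have := @zsum_single (fun k => u (m + sv j *~ k)) (- qq j m).
  rewrite {3}/u qqS subrr per_int //; apply => k kq; rewrite /u qqS.
  by case: eqP => /eqP; rewrite addrC addr_eq0 (negbTE kq).
split => [K K0|i m ij]; last first.
  by rewrite /u (_ : qq j (m + sv i) = qq j m) ?pv //; [exact: ltnW|have := @qq_lt i j m 1 ij; rewrite mulr1z].
have [B HB] := bv K K0; have : 0 <= B by have := HB 0 => /(le_trans (nc_ge0 _)); rewrite pmulr_lge0 // expR_gt0.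
exists (B * expR (rho * a j * s%:R ^+ 2 + K * s%:R)) => m; rewrite /u; case: eqP => [q0|_]; last first.
  by rewrite nc0 !mulr_ge0.
apply: le_trans (HB m) _; rewrite -mulrA -expRD ler_wpM2l // ler_expR EE_split /ee epsE /qt.
have /andP[h1 h2] := qqP j m; rewrite q0 mulr0 add0r in h1 h2.
have t2 : tt j m ^+ 2 <= s%:R ^+ 2 by rewrite lerXn2r // ?nnegrE ltW // sR.
have := ler_wpM2l (ltW (mulr_gt0 rho0 (a0 j))) t2; have := ler_wpM2l K0 (ltW h2); rewrite (ger0_norm); lra.
Qed.

(** Minus the sum over k >= 0 solves the equation. Since full orbit sums vanish, it is also the sum
    over k < 0, and for each m the side leading away from t_j = 0 preserves the decay. *)
Lemma sg_ker j u : cls j u -> sg j u = 0 -> exists2 r, cls j r & Dn j r = u.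
Proof.
move=> cu su; have S1 m : hsum (fun k : 'rV[int]_1 => u (m + sv j *~ k 0 0)) 0.
  by have := sg_sum1 m cu; rewrite su.
pose P m (k : int) := if 0 <= k then u (m + sv j *~ k) else 0.
pose Q m (k : int) := if 0 <= k then 0 else u (m + sv j *~ k).
pose r := fun m => - zsum (P m).
have SP m : hsum (fun k : 'rV[int]_1 => P m (k 0 0)) (zsum (P m)).
  have [B B0 HB] := neg_term (lexx 0) cu.
  apply: (zsumP (F := P m) (B := B * expR (EE j.+1 0 m + `|tt j m|)) _ _).1; first by rewrite mulr_ge0.
  move=> k; rewrite /P; case: ifP => _; last by rewrite nc0 !mulr_ge0.
  apply: le_trans (HB m k) _; rewrite -mulrA ler_wpM2l // -expRM_natl -expRD ler_expR.
  have := qt_ge0 j (m + sv j *~ k); have := abs_ks k; have := ler_normB (tt j m + s%:R * k%:~R) (tt j m).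
  rewrite addrAC subrr add0r; lra.
have SQ m : hsum (fun k : 'rV[int]_1 => Q m (k 0 0)) (r m).
  have := hsumB (S1 m) (SP m); rewrite sub0r; apply: eq_hsum => k; rewrite /P /Q.
  by case: ifP; rewrite ?subrr ?subr0.
exists r; last first.
  apply/funext => m; rewrite /Dn opprK addrC.
  have H := hsumB (SP m) (zsum_shift (-1) (SP (m + sv j))).
  apply: (hsum_unique H); have := @zsum_single (fun k => P m k - P (m + sv j) (k - 1)) 0.
  have P0 : P m 0 - P (m + sv j) (0 - 1) = u m by rewrite /P addr0 subr0.
  rewrite P0; apply => k k0; rewrite /P.
  have -> : (0 <= k - 1) = (0 <= k) by lia.
  by case: ifP; rewrite ?subrr // mulrzBr [sv j *~ k - _]addrC addrA addrK subrr.
split => [K K0|i m ij]; last first.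
  by congr (- zsum); apply/funext => k; rewrite /P addrAC cu.2.
have [B B0 HB] := neg_term K0 cu; exists (B * (2 / (1 - expR (- 1)))) => m.
rewrite mulrAC EE_split.
have ra : 0 < rho * a j by rewrite mulr_gt0.
have key (k : int) : `|tt j m + s%:R * k%:~R| = `|tt j m| + `|s%:R * k%:~R| ->
    nc (u (m + sv j *~ k)) <= B * expR (ee K j m + EE j.+1 K m) * expR (- 1) ^+ `|k|%N.
  move=> tk; apply: le_trans (HB m k) _; rewrite -mulrA ler_wpM2l // -expRM_natl -expRD ler_expR /ee epsE tk.
  have := abs_ks k; have := normr_ge0 (tt j m); have kk := normr_ge0 (s%:R * k%:~R : R).
  have : qt j m <= qt j (m + sv j *~ k).
    by rewrite /qt ttj ler_wpM2l ?(ltW ra) // -[leLHS]real_normK ?num_real // -[leRHS]real_normK ?num_real // tk lerXn2r ?nnegrE // lerDl.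
  have := mulr_ge0 K0 kk; lra.
have [t0|t0] := leP 0 (tt j m).
  rewrite ncN; apply: (zsumP (F := P m) _ _).2; first by rewrite mulr_ge0.
  move=> k; rewrite /P; case: ifP => k0; last by rewrite nc0 !mulr_ge0.
  apply: key; have k1 : 0 <= s%:R * k%:~R :> R by rewrite mulr_ge0 ?ler0z.
  by rewrite !ger0_norm // addr_ge0.
rewrite -(zsum_eq (SQ m)); apply: (zsumP (F := Q m) _ _).2; first by rewrite mulr_ge0.
move=> k; rewrite /Q; case: ifPn => k0; first by rewrite nc0 !mulr_ge0.
apply: key; have k1 : s%:R * k%:~R <= 0 :> R by rewrite mulr_ge0_le0 // lerz0 ltW // ltNge.
rewrite (ler0_norm k1) (ltr0_norm t0) ler0_norm; last lra.
lra.
Qed.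

Lemma DnB i u (v : cfun) : Dn i (u - v) = Dn i u - Dn i v.
Proof. apply/funext => m; rewrite -[RHS]/((u (m + sv i) - u m) - (v (m + sv i) - v m)) -[LHS]/((u (m + sv i) - v (m + sv i)) - (u m - v m)); ring. Qed.

Lemma DnC i j u : Dn i (Dn j u) = Dn j (Dn i u).
Proof. apply/funext => m; rewrite /Dn (addrAC m); ring. Qed.

Lemma shift_neg (b : form cfun (g + g)) : coefs (cls 0) b -> kz Dn 0 b = 0 ->
  (forall S, (g <= #|beta_part S|)%N -> b S = 0) -> exists2 f, coefs (cls 0) f & kz Dn 0 f = b.
Proof.
apply: (koszul_neg (sg := sg) DnB DnC cls_sub) => [m i u _|j u|j u|j u|j i u _|j u|j v|j].
- exact: Dn_cls.
- exact: Dn_inj.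
- exact: sg_cls.
- exact: sgB.
- exact: sg_Dn_gt.
- exact: sg_Dn.
- exact: sg_onto.
- exact: sg_ker.
Qed.

End NegativeShift.

End GrowthClasses.

Lemma sum_antisym (V : zmodType) (I : finType) (G : I -> I -> V) : (forall i j, G i j = - G j i) -> (forall i, G i i = 0) ->
  \sum_i \sum_j G i j = 0.
Proof.
move=> GN G0; have H (s : seq I) : \sum_(i <- s) \sum_(j <- s) G i j = 0; last exact: H.
elim: s => [|i s IH]; first by rewrite big_nil.
rewrite big_cons big_cons G0 add0r; under [X in _ + X]eq_bigr do rewrite big_cons.
rewrite big_split /= IH addr0 -big_split big1 // => j _; rewrite GN; exact: addNr.
Qed.

(** * Contractions, substitutions and bidegrees *)

Section Operators.
Variables (K : comPzRingType) (g : nat).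
Local Notation F := (form K (g + g)).
Implicit Types (x y : F) (S : {set 'I_(g + g)}) (u v : 'I_g -> K) (h : 'I_g -> 'I_g -> K).
Local Notation be i := (@ew K (g + g) (beta i)).
Local Notation al i := (@ew K (g + g) (alpha i)).
Local Notation ib i := (@ei K (g + g) (beta i)).
Local Notation ia i := (@ei K (g + g) (alpha i)).

Definition Aw u x : F := \sum_i u i *: al i x.
Definition Iw u x : F := \sum_i u i *: ib i x.
Definition Sw u x : F := \sum_i u i *: ia i x.
(** The derivation of the exterior algebra with beta_i |-> sum_j h_ij alpha_j and alpha_j |-> 0; for
    h = [dzeta] it substitutes d zeta_i for beta_i. *)
Definition Mw h x : F := \sum_i Aw (h i) (ib i x).

Lemma Aw_linear u : linear (Aw u).
Proof. by move=> a x y; rewrite scaler_sumr -big_split; apply: eq_bigr => i; rewrite linearP scalerDr !scalerA mulrC. Qed.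
HB.instance Definition _ u := GRing.isLinear.Build K F F *:%R (Aw u) (Aw_linear u).
Lemma Iw_linear u : linear (Iw u).
Proof. by move=> a x y; rewrite scaler_sumr -big_split; apply: eq_bigr => i; rewrite linearP scalerDr !scalerA mulrC. Qed.
HB.instance Definition _ u := GRing.isLinear.Build K F F *:%R (Iw u) (Iw_linear u).
Lemma Sw_linear u : linear (Sw u).
Proof. by move=> a x y; rewrite scaler_sumr -big_split; apply: eq_bigr => i; rewrite linearP scalerDr !scalerA mulrC. Qed.
HB.instance Definition _ u := GRing.isLinear.Build K F F *:%R (Sw u) (Sw_linear u).
Lemma Mw_linear h : linear (Mw h).
Proof. by move=> a x y; rewrite scaler_sumr -big_split; apply: eq_bigr => i; rewrite !linearP. Qed.
HB.instance Definition _ h := GRing.isLinear.Build K F F *:%R (Mw h) (Mw_linear h).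

Lemma sum_alal h x : (forall i j, h i j = h j i) -> \sum_i \sum_j h i j *: al i (al j x) = 0.
Proof.
move=> hs; apply: sum_antisym => [i j|i]; first by rewrite hs ewew scalerN.
by rewrite ewew0 scaler0.
Qed.

Lemma Aw_al u i x : Aw u (al i x) = - al i (Aw u x).
Proof. by rewrite linear_sum -sumrN; apply: eq_bigr => j; rewrite ewew scalerN [in RHS]linearZ. Qed.
Lemma Aw_be u i x : Aw u (be i x) = - be i (Aw u x).
Proof. by rewrite linear_sum -sumrN; apply: eq_bigr => j; rewrite ewew scalerN [in RHS]linearZ. Qed.
Lemma ib_Aw u i x : ib i (Aw u x) = - Aw u (ib i x).
Proof. by rewrite linear_sum -sumrN; apply: eq_bigr => j; rewrite linearZ /= ib_al scalerN. Qed.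
Lemma Aw_Aw0 u x : Aw u (Aw u x) = 0.
Proof.
rewrite -[RHS](@sum_alal (fun i j => u i * u j) x) => [|i j]; last exact: mulrC.
apply: eq_bigr => i _; rewrite linear_sum scaler_sumr; apply: eq_bigr => j.
by rewrite linearZ scalerA.
Qed.
Lemma Iw_Aw u v x : Iw u (Aw v x) = - Aw v (Iw u x).
Proof. by rewrite [Aw v (\sum_i _)]linear_sum -sumrN; apply: eq_bigr => j; rewrite linearZ ib_Aw scalerN. Qed.
Lemma Iw_Iw0 u x : Iw u (Iw u x) = 0.
Proof.
rewrite -[RHS](@sum_antisym F 'I_g (fun i j => (u i * u j) *: ib i (ib j x))) => [|i j|i]; last 2 first.
- by rewrite mulrC eiei scalerN.
- by rewrite eiei0 scaler0.
apply: eq_bigr => i _; rewrite linear_sum scaler_sumr; apply: eq_bigr => j.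
by rewrite linearZ scalerA.
Qed.
Lemma Sw_Aw u v x : Sw u (Aw v x) = (\sum_i u i * v i) *: x - Aw v (Sw u x).
Proof.
rewrite [Aw v (\sum_i _)]linear_sum scaler_suml -sumrB; apply: eq_bigr => i _.
rewrite [in RHS]linearZ -scalerA -scalerBr; congr (_ _).
rewrite linear_sum (bigD1 i) //= [X in - X](bigD1 i) //= linearZ /= ia_al eqxx scalerBr -addrA opprD; congr (_ (_ + _)).
by rewrite -sumrN; apply: eq_bigr => j ji; rewrite linearZ /= ia_al eq_sym (negbTE ji) sub0r scalerN.
Qed.

Lemma Mw_al h i x : Mw h (al i x) = al i (Mw h x).
Proof. by rewrite linear_sum; apply: eq_bigr => j; rewrite ib_al linearN /= Aw_al opprK. Qed.
Lemma Mw_ib h i x : Mw h (ib i x) = ib i (Mw h x).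
Proof. by rewrite linear_sum; apply: eq_bigr => j; rewrite eiei linearN -ib_Aw. Qed.
Lemma Mw_Aw h u x : Mw h (Aw u x) = Aw u (Mw h x).
Proof. by rewrite linear_sum; apply: eq_bigr => j; rewrite linearZ /= Mw_al. Qed.
Lemma Mw_Iw h u x : Mw h (Iw u x) = Iw u (Mw h x).
Proof. by rewrite linear_sum; apply: eq_bigr => j; rewrite linearZ /= Mw_ib. Qed.
Lemma Mw_be h i x : Mw h (be i x) = Aw (h i) x + be i (Mw h x).
Proof.
rewrite /Mw linear_sum (bigD1 i) //= [X in _ = _ X](bigD1 i) //= ib_be eqxx linearB /= Aw_be opprK -addrA; congr (_ (_ + _)).
by apply: eq_bigr => j ji; rewrite ib_be (negbTE ji) sub0r linearN /= Aw_be opprK.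
Qed.
(** By symmetry of h the derivation sends omega to sum_ij h_ij alpha_j /\ alpha_i = 0. *)
Lemma Mw_om h x : (forall i j, h i j = h j i) -> Mw h (om x) = om (Mw h x).
Proof.
move=> hs; rewrite linear_sum [LHS](eq_bigr (fun i => Aw (h i) (al i x) + be i (al i (Mw h x)))) => [|i]; last by rewrite /= Mw_be Mw_al.
rewrite big_split /= [X in X + _](_ : _ = 0) ?add0r // exchange_big.
by apply: sum_alal.
Qed.

Lemma iter_com (f k : F -> F) n x : (forall y, f (k y) = k (f y)) -> iter n f (k x) = k (iter n f x).
Proof. by move=> fk; elim: n => //= n ->. Qed.

Lemma iter_Mw_linear h n : linear (iter n (Mw h)).
Proof. by move=> a x y; elim: n => //= n ->; rewrite linearP. Qed.
HB.instance Definition _ h n := GRing.isLinear.Build K F F *:%R (iter n (Mw h)) (iter_Mw_linear h n).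

(* With X = H - (u /\ -) o iota_u, the powers of X differ from those of H by one term only. *)
Lemma iter_Mw_sub h u n x : let X := fun i j => h i j - u i * u j in
  iter n.+1 (Mw X) x + n.+1%:R *: Aw u (iter n (Mw X) (Iw u x)) = iter n.+1 (Mw h) x /\
  iter n (Mw X) (Iw u x) = iter n (Mw h) (Iw u x).
Proof.
move=> X; have XE y : Mw X y = Mw h y - Aw u (Iw u y).
  rewrite /Mw /Iw [Aw u (\sum_i _)]linear_sum -sumrB; apply: eq_bigr => i _; rewrite linearZ /= /Aw scaler_sumr -sumrB.
  by apply: eq_bigr => j _; rewrite scalerBl scalerA.
have hI n' y : Iw u (iter n' (Mw h) (Iw u y)) = 0.
  by rewrite -(iter_com _ _ (fun y => Mw_Iw h u y)) Iw_Iw0 linear0.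
have H2 n' : iter n' (Mw X) (Iw u x) = iter n' (Mw h) (Iw u x).
  by elim: n' => //= n' ->; rewrite XE hI linear0 subr0.
split; last exact: H2.
elim: n => [|n IH]; first by rewrite /= scale1r XE subrK.
rewrite !H2 in IH *; rewrite [iter n.+2 (Mw X) x]iterS (canRL (addrK _) IH) linearB linearZ /= -!iterS.
set v := iter n _ _; set w := _ x.
have -> : Mw X (Aw u v) = Aw u (Mw h v) by rewrite XE Mw_Aw Iw_Aw linearN /= Aw_Aw0 oppr0 subr0.
have -> : Mw X w = Mw h w - Aw u (Mw h v) by rewrite XE -(iter_com _ _ (fun y => Mw_Iw h u y)).
rewrite scalerDl scale1r.
rewrite -(addrA (Mw h w)) -opprD subrK; exact: erefl.
Qed.

Lemma count_beta x S : (\sum_i be i (ib i x)) S = #|beta_part S|%:R * x S.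
Proof.
rewrite form_sum (bigID (mem (beta_part S))) /= [X in _ + X]big1 ?addr0 => [|i]; last first.
  by rewrite inE => /negbTE iS; rewrite ewE iS.
rewrite (eq_bigr (fun=> x S)) => [|i]; first by rewrite sumr_const mulr_natl.
rewrite inE => iS; rewrite ewE eiE !inE iS eqxx finset.setD1K // (esgnD1 _ _ iS) ltnn mul1r mulrA esgn2 mul1r //.
Qed.

(** Integer degrees spare side conditions when a degree is lowered; forms of negative degree are 0
    ([hom_neg]). *)
Definition bideg (q k : int) S := (#|beta_part S|%:Z == q) && (#|alpha_part S|%:Z == k).
Definition hom q k x := forall S, ~~ bideg q k S -> x S = 0.
Definition proj q k x : F := [ffun S : {set 'I_(g + g)} => if bideg q k S then x S else 0].

Lemma bideg_be q k i S : beta i \in S -> bideg (q + 1) k S = bideg q k (S :\ beta i).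
Proof.
move=> iS; rewrite /bideg -{1 2}(finset.setD1K iS) card_beta_part; last by rewrite !inE eqxx.
rewrite (_ : alpha_part (_) = alpha_part (S :\ beta i)); last by apply/finset.setP => j; rewrite !inE alpha_beta.
by congr (_); rewrite -[_.+1]addn1 PoszD (inj_eq (addIr _)).
Qed.

Lemma bideg_al q k i S : alpha i \in S -> bideg q (k + 1) S = bideg q k (S :\ alpha i).
Proof.
move=> iS; rewrite /bideg -{1 2}(finset.setD1K iS).
rewrite (_ : (_ _) = beta_part (S :\ alpha i)); last by apply/finset.setP => j; rewrite !inE beta_alpha.
rewrite (_ : alpha_part (_) = i |: alpha_part (S :\ alpha i))%SET; last by apply/finset.setP => j; rewrite !inE alpha_eq.
by rewrite cardsU1 !inE eqxx add1n -[_.+1]addn1 PoszD (inj_eq (addIr _)).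
Qed.

Lemma hom_be q k i x : hom q k x -> hom (q + 1) k (be i x).
Proof. by move=> hx S nS; rewrite ewE; case: ifP => // iS; rewrite hx ?mulr0 // -bideg_be. Qed.
Lemma hom_al q k i x : hom q k x -> hom q (k + 1) (al i x).
Proof. by move=> hx S nS; rewrite ewE; case: ifP => // iS; rewrite hx ?mulr0 // -bideg_al. Qed.
Lemma hom_ib q k i x : hom q k x -> hom (q - 1) k (ib i x).
Proof.
move=> hx S nS; rewrite eiE; case: ifPn => // iS; rewrite hx ?mulr0 // -{1}[q](subrK 1) (@bideg_be _ _ i) ?finset.setU11 //.
by rewrite finset.setU1K.
Qed.
Lemma hom_ia q k i x : hom q k x -> hom q (k - 1) (ia i x).
Proof.
move=> hx S nS; rewrite eiE; case: ifPn => // iS; rewrite hx ?mulr0 // -{1}[k](subrK 1) (@bideg_al _ _ i) ?finset.setU11 //.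
by rewrite finset.setU1K.
Qed.
Lemma hom0 q k : hom q k 0. Proof. by move=> S; rewrite form0. Qed.
Lemma homD q k x y : hom q k x -> hom q k y -> hom q k (x + y).
Proof. by move=> hx hy S nS; rewrite formD hx // hy // addr0. Qed.
Lemma homN q k x : hom q k x -> hom q k (- x).
Proof. by move=> hx S nS; rewrite formN hx // oppr0. Qed.
Lemma homB q k x y : hom q k x -> hom q k y -> hom q k (x - y).
Proof. move=> hx hy; apply: homD => //; exact: homN. Qed.
Lemma homZ q k a x : hom q k x -> hom q k (a *: x).
Proof. by move=> hx S nS; rewrite formZ hx // mulr0. Qed.
Lemma hom_sum q k (I : Type) (r : seq I) (P : pred I) (G : I -> F) :
  (forall i : I, P i -> hom q k (G i)) -> hom q k (\sum_(i <- r | P i) G i).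
Proof. move=> hG S nS; rewrite form_sum big1 // => i Pi; exact: hG. Qed.
Lemma hom_Aw q k u x : hom q k x -> hom q (k + 1) (Aw u x).
Proof. move=> hx; apply: hom_sum => i _; apply: homZ; exact: hom_al. Qed.
Lemma hom_Iw q k u x : hom q k x -> hom (q - 1) k (Iw u x).
Proof. move=> hx; apply: hom_sum => i _; apply: homZ; exact: hom_ib. Qed.
Lemma hom_Sw q k u x : hom q k x -> hom q (k - 1) (Sw u x).
Proof. move=> hx; apply: hom_sum => i _; apply: homZ; exact: hom_ia. Qed.
Lemma hom_Mw q k h x : hom q k x -> hom (q - 1) (k + 1) (Mw h x).
Proof. move=> hx; apply: hom_sum => i _; apply: hom_Aw; exact: hom_ib. Qed.
Lemma hom_iter_Mw q k h n x : hom q k x -> hom (q - n%:Z) (k + n%:Z) (iter n (Mw h) x).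
Proof.
move=> hx; elim: n => [|n IH]; first by rewrite subr0 addr0.
by have := hom_Mw h IH; rewrite -addrA -opprD -addrA -PoszD addn1.
Qed.
Lemma hom_om q k x : hom q k x -> hom (q + 1) (k + 1) (om x).
Proof. move=> hx; apply: hom_sum => i _; apply: hom_be; exact: hom_al. Qed.
Lemma hom_proj q k x : hom q k (proj q k x).
Proof. by move=> S nS; rewrite ffunE (negbTE nS). Qed.
Lemma proj_hom q k x : hom q k x -> proj q k x = x.
Proof. by move=> hx; apply/ffunP => S; rewrite ffunE; case: ifPn => // /hx. Qed.
Lemma coefs_proj (P : K -> Prop) q k x : P 0 -> coefs P x -> coefs P (proj q k x).
Proof. by move=> P0 Px S; rewrite ffunE; case: ifP. Qed.
Lemma hom_neg q k x : q < 0 -> hom q k x -> x = 0.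
Proof. move=> q0 hx; apply/ffunP => S; rewrite hx ?form0 // /bideg; lia. Qed.
Lemma hom_negr q k x : k < 0 -> hom q k x -> x = 0.
Proof. move=> q0 hx; apply/ffunP => S; rewrite hx ?form0 // /bideg; lia. Qed.
Lemma hom_count q k x : hom q k x -> \sum_i be i (ib i x) = q%:~R *: x.
Proof.
move=> hx; apply/ffunP => S; rewrite count_beta formZ.
by have [/andP[/eqP <- _]|/hx ->] := boolP (bideg q k S); rewrite ?mulr0.
Qed.

Lemma kz_proj (D : 'I_g -> K -> K) q k x : (forall i, D i 0 = 0) -> kz D 0 (proj q k x) = proj (q + 1) k (kz D 0 x).
Proof.
move=> D0; apply/ffunP => S; rewrite ffunE !form_sum -[RHS]/(if _ then _ else 0).
case: ifPn => h; last first.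
  by rewrite big1 // => i; rewrite ewE; case: ifP => // iS; rewrite fmapE ffunE -bideg_be // (negbTE h) D0 mulr0.
by apply: eq_bigr => i; rewrite !ewE; case: ifP => // iS; rewrite !fmapE ffunE -bideg_be // h.
Qed.

Lemma hom_kz (D : 'I_g -> K -> K) q k x : (forall i, D i 0 = 0) -> hom q k x -> hom (q + 1) k (kz D 0 x).
Proof. move=> D0 /proj_hom <-; rewrite kz_proj //; exact: hom_proj. Qed.

End Operators.

Lemma hom_fmap (K K' : comPzRingType) (g : nat) (phi : K -> K') q k (x : form K (g + g)) :
  phi 0 = 0 -> hom q k x -> hom q k (fmap phi x).
Proof. by move=> p0 hx S /hx; rewrite fmapE => ->. Qed.

(** * Descent along the pole order *)

Section Descent.
Variables (C : numFieldType) (g : nat) (K : comPzRingType) (pole : int -> K -> Prop) (T : 'I_g -> K -> K)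
  (zeta : 'I_g -> K) (hes : 'I_g -> 'I_g -> K) (kc : C -> K) (un : K) (kap : C).
(** [un] is the function 1 normalized to 0 on Theta: it acts as a unit on functions with poles
    ([un1]) without being the unit of K. *)
Local Notation cst := (fun d => kc d * un).
Local Notation Del := (fun j f => T j f - f).
Local Notation del := (kz Del 0).
Local Notation F := (form K (g + g)).
Local Notation FC := (form C (g + g)).
Local Notation Pn n x := (coefs (pole n) x).
Local Notation be i := (@ew K (g + g) (beta i)).
Local Notation al i := (@ew K (g + g) (alpha i)).
Local Notation ib i := (@ei K (g + g) (beta i)).
Local Notation fT j := (fmap (T j)).
Local Notation zw := (Aw zeta).
Local Notation Zi := (Iw zeta).
Local Notation DZ := (fun i j => hes i j - zeta i * zeta j).
Local Notation X := (Mw DZ).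
Local Notation "c ^%" := (fmap cst c : F) (at level 2, format "c ^%").
Implicit Types (n m q k : int) (x y b a e : F) (S : {set 'I_(g + g)}) (l mu : FC) (f : K) (d : C).
Hypotheses (sP : forall n, subgroup (pole n)) (pole_kc : forall n d f, pole n f -> pole n (kc d * f))
  (pole_le : forall m n f, m <= n -> pole m f -> pole n f)
  (poleM : forall m n f (h : K), pole m f -> pole n h -> pole (m + n) (f * h))
  (pole_T : forall n (j : 'I_g) f, pole n f -> pole n (T j f))
  (TB : forall (j : 'I_g) f (h : K), T j (f - h) = T j f - T j h)
  (TM : forall (j : 'I_g) f (h : K), T j (f * h) = T j f * T j h)
  (TC : forall (i j : 'I_g) f, T i (T j f) = T j (T i f))
  (kcD : forall d (d' : C), kc (d + d') = kc d + kc d') (kcM : forall d (d' : C), kc (d * d') = kc d * kc d') (kc1 : kc 1 = 1)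
  (T_kc : forall (j : 'I_g) d, T j (kc d) = kc d) (T_un : forall j : 'I_g, T j un = un)
  (pole_un : pole 0 un) (un1 : forall n f, pole n f -> un * f = f)
  (pole_zeta : forall i : 'I_g, pole 1 (zeta i)) (pole_hes : forall i j : 'I_g, pole 1 (hes i j))
  (zeta_T : forall i j : 'I_g, T j (zeta i) = zeta i + kc (if i == j then kap else 0) * un)
  (T_dz : forall i j k : 'I_g, T k (hes i j - zeta i * zeta j) = hes i j - zeta i * zeta j)
  (unity : exists (B0 : K) (B : 'I_g -> K), [/\ pole (-1) B0, forall i : 'I_g, pole (-1) (B i) & B0 + \sum_i B i * zeta i = un])
  (kap0 : kap != 0)
  (pos_acyclic : forall (n : nat) x, (0 < n)%N -> Pn n%:Z x -> del x = 0 ->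
     (forall S, beta_part S == finset.set0 -> x S = 0) -> exists2 f : F, Pn n%:Z f & del f = x)
  (neg_acyclic : forall (n : nat) x, (0 < n)%N -> Pn (- n%:Z) x -> del x = 0 ->
     (forall S, (g <= #|beta_part S|)%N -> x S = 0) -> exists2 f : F, Pn (- n%:Z) f & del f = x)
  (cocycle_pole0 : forall x, Pn 0 x -> del x = 0 -> exists (mu : FC) (f : F), Pn 0 f /\ x = mu^% + del f)
  (coboundary_cst : forall y mu, Pn 0 y -> del y = mu^% -> mu = 0).

Lemma kc0 : kc 0 = 0. Proof. by apply: (addrI (kc 0)); rewrite -kcD !addr0. Qed.
Lemma kcN d : kc (- d) = - kc d. Proof. by apply: (addrI (kc d)); rewrite -kcD !subrr kc0. Qed.
Lemma T0 (j : 'I_g) : T j 0 = 0. Proof. by have := TB j 0 0; rewrite !subrr. Qed.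
Lemma TN (j : 'I_g) f : T j (- f) = - T j f. Proof. by rewrite -sub0r TB T0 sub0r. Qed.
Lemma TD (j : 'I_g) f (h : K) : T j (f + h) = T j f + T j h. Proof. by rewrite -{1}[h]opprK TB TN opprK. Qed.
Lemma shiftB (j : 'I_g) f (h : K) : Del j (f - h) = Del j f - Del j h.
Proof. rewrite /= TB; ring. Qed.
Lemma shiftC (i j : 'I_g) f : Del i (Del j f) = Del j (Del i f).
Proof. rewrite /= !TB (TC); ring. Qed.

Lemma PnB n x y : Pn n x -> Pn n y -> Pn n (x - y). Proof. exact: coefsB. Qed.
Lemma PnN n x : Pn n x -> Pn n (- x). Proof. move=> px; rewrite -sub0r; apply: PnB => //; exact: coefs0. Qed.
Lemma PnD n x y : Pn n x -> Pn n y -> Pn n (x + y).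
Proof. move=> px py; rewrite -[y]opprK; apply: PnB => //; exact: PnN. Qed.
Lemma PnK n c x : Pn n x -> Pn n (kc c *: x). Proof. move=> px S; rewrite formZ; exact: pole_kc. Qed.
Lemma Pn_le m n x : m <= n -> Pn m x -> Pn n x. Proof. move=> mn px S; exact: pole_le (px S). Qed.
Lemma PnZ m n f x : pole m f -> Pn n x -> Pn (m + n) (f *: x).
Proof. move=> pf px S; rewrite formZ; exact: poleM. Qed.
Lemma Pn_Aw m n (u : 'I_g -> K) x : (forall i : 'I_g, pole m (u i)) -> Pn n x -> Pn (m + n) (Aw u x).
Proof. move=> pu px; apply: coefs_sum => [|i _]; [exact: sP|apply: PnZ => //; exact: coefs_ew]. Qed.
Lemma Pn_Iw m n (u : 'I_g -> K) x : (forall i : 'I_g, pole m (u i)) -> Pn n x -> Pn (m + n) (Iw u x).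
Proof. move=> pu px; apply: coefs_sum => [|i _]; [exact: sP|apply: PnZ => //; exact: coefs_ei]. Qed.
Lemma Pn_Sw m n (u : 'I_g -> K) x : (forall i : 'I_g, pole m (u i)) -> Pn n x -> Pn (m + n) (Sw u x).
Proof. move=> pu px; apply: coefs_sum => [|i _]; [exact: sP|apply: PnZ => //; exact: coefs_ei]. Qed.
Lemma Pn_Mw m n (h : 'I_g -> 'I_g -> K) x : (forall i j : 'I_g, pole m (h i j)) -> Pn n x -> Pn (m + n) (Mw h x).
Proof.
move=> ph px; apply: coefs_sum => [|i _]; first exact: sP.
apply: Pn_Aw => // ; exact: coefs_ei.
Qed.
Lemma Pn_zw n x : Pn n x -> Pn (n + 1) (zw x).
Proof. move=> px; rewrite addrC; apply: Pn_Aw => //. Qed.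
Lemma Pn_del n x : Pn n x -> Pn n (del x).
Proof.
move=> px; apply: coefs_kz => // i u _ pu.
exact: (sP n).2 (pole_T i pu) pu.
Qed.

Lemma delB x y : del (x - y) = del x - del y. Proof. exact: (kzB shiftB). Qed.
Lemma delD x y : del (x + y) = del x + del y. Proof. exact: (kzD shiftB). Qed.
Lemma del0 : del 0 = 0. Proof. exact: (kz0 shiftB). Qed.
Lemma deldel x : del (del x) = 0. Proof. exact: (kz_kz shiftB shiftC). Qed.
Lemma shift0 (i : 'I_g) : Del i 0 = 0. Proof. exact: (D0 shiftB). Qed.

Lemma T_sum (j : 'I_g) (I : Type) (r : seq I) (P : pred I) (G : I -> K) :
  T j (\sum_(i <- r | P i) G i) = \sum_(i <- r | P i) T j (G i).
Proof. apply: (big_morph (T j)); [exact: TD|exact: T0]. Qed.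

Lemma fT_ew (j : 'I_g) (i : 'I_(g + g)) x : fT j (ew i x) = ew i (fT j x). Proof. by apply: fmap_ew => [|S]; rewrite ?T0 ?TN. Qed.
Lemma fT_ei (j : 'I_g) (i : 'I_(g + g)) x : fT j (ei i x) = ei i (fT j x). Proof. by apply: fmap_ei => [|S]; rewrite ?T0 ?TN. Qed.
Lemma fT_Z (j : 'I_g) (f : K) x : fT j (f *: x) = T j f *: fT j x.
Proof. by apply/ffunP => S; rewrite fmapE !formZ fmapE. Qed.
Lemma fT_sum (j : 'I_g) (I : Type) (r : seq I) (P : pred I) (G : I -> F) :
  fT j (\sum_(i <- r | P i) G i) = \sum_(i <- r | P i) fT j (G i).
Proof. by apply/ffunP => S; rewrite fmapE !form_sum T_sum; apply: eq_bigr => i; rewrite fmapE. Qed.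
Lemma fT_Aw (j : 'I_g) (u : 'I_g -> K) x : fT j (Aw u x) = Aw (fun i => T j (u i)) (fT j x).
Proof. by rewrite fT_sum; apply: eq_bigr => i; rewrite fT_Z fT_ew. Qed.
Lemma fT_Iw (j : 'I_g) (u : 'I_g -> K) x : fT j (Iw u x) = Iw (fun i => T j (u i)) (fT j x).
Proof. by rewrite fT_sum; apply: eq_bigr => i; rewrite fT_Z fT_ei. Qed.
Lemma fDel (j : 'I_g) x : fmap (Del j) x = fT j x - x.
Proof. by apply/ffunP => S; rewrite formD !fmapE. Qed.
Lemma Pn_fT n (j : 'I_g) x : Pn n x -> Pn n (fT j x). Proof. move=> px S; rewrite fmapE; exact: pole_T. Qed.

Lemma cst_kc d n f : pole n f -> kc d * un * f = kc d * f.
Proof. by move=> pf; rewrite -mulrA (un1 pf). Qed.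

Lemma kcZ d (d' : C) x : kc d *: (kc d' *: x) = kc (d * d') *: x. Proof. by rewrite scalerA kcM. Qed.
Lemma kc1Z x : kc 1 *: x = x. Proof. by rewrite kc1 scale1r. Qed.
Lemma kc_nat (n : nat) : kc n%:R = n%:R.
Proof. by elim: n => [|n IH]; rewrite ?kc0 // -[n.+1]add1n !natrD kcD kc1 IH. Qed.
Lemma kc_int n : kc n%:~R = n%:~R.
Proof. case: n => n; [exact: kc_nat|rewrite kcN; congr (- _); exact: kc_nat]. Qed.

Lemma zeta_Aw_T n (j : 'I_g) x : Pn n x -> Aw (fun i => T j (zeta i)) x = zw x + kc kap *: al j x.
Proof.
move=> px; rewrite /Aw (eq_bigr (fun i => zeta i *: al i x + (if i == j then kc kap *: al j x else 0))) => [|i _].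
  by rewrite big_split -big_mkcond big_pred1_eq.
rewrite (zeta_T) scalerDl; congr (_ _); apply/ffunP => S.
have pS : pole n (al i x S) by exact: coefs_ew.
rewrite formZ (cst_kc _ pS); case: eqP => [->|_]; first by rewrite formZ.
by rewrite form0 kc0 mul0r.
Qed.

(** The defect comes from the constants T_j zeta_i - zeta_i; on constant forms it is kap omega
    ([del_zw_cst]). *)
Lemma del_zw n x : Pn n x -> del (zw x) = - zw (del x) + kc kap *: \sum_j be j (al j (fT j x)).
Proof.
move=> px; rewrite [zw (\sum_(i | _) _)]linear_sum scaler_sumr -sumrN -big_split; apply: eq_bigr => j /=.
rewrite Aw_be opprK fDel fT_Aw (zeta_Aw_T _ (Pn_fT j px)) addrAC linearD -linearB -fDel.
by rewrite linearZ.
Qed.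

Lemma fT_cst (j : 'I_g) l : fT j l^% = l^%.
Proof.
by apply/ffunP => S; rewrite !fmapE TM T_kc T_un.
Qed.

Lemma del_inv x : (forall j : 'I_g, fT j x = x) -> del x = 0.
Proof. by move=> H; rewrite /kz big1 // => j; rewrite fDel H subrr linear0. Qed.

Lemma Pn_cst l : Pn 0 l^%. Proof. move=> S; rewrite fmapE; exact: pole_kc. Qed.

Lemma fcst0 : kc 0 * un = 0. Proof. by rewrite kc0 mul0r. Qed.

Lemma fcst_lin d l mu : (d *: l + mu)^% = kc d *: l^% + mu^%.
Proof. by apply/ffunP => S; rewrite formD formZ !fmapE formD formZ kcD kcM mulrDl mulrA. Qed.

Lemma fcstZ (d : C) l : (d *: l)^% = kc d *: l^%.
Proof. by rewrite -[d *: l]addr0 fcst_lin (_ : (0 : FC)^% = 0) ?addr0 //; apply/ffunP => S; rewrite fmapE !form0 fcst0. Qed.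

Lemma fcst_ew (i : 'I_(g + g)) l : (ew i l)^% = ew i l^%.
Proof. apply: fmap_ew => [|S]; [exact: fcst0|by rewrite kcN mulNr]. Qed.

Lemma fcst_sum (I : Type) (r : seq I) (P : pred I) (G : I -> FC) :
  (\sum_(i <- r | P i) G i)^% = \sum_(i <- r | P i) (G i)^%.
Proof.
apply: (big_morph (fun l => l^%)) => [u|]; first by have := fcst_lin 1 u; rewrite scale1r kc1Z.
by apply/ffunP => S; rewrite fmapE !form0 fcst0.
Qed.

Lemma fcst_om l : (om l)^% = om l^%.
Proof. by rewrite fcst_sum; apply: eq_bigr => i; rewrite !fcst_ew. Qed.

Lemma hom_cst q k l : hom q k l -> hom q k l^%. Proof. move=> hl; apply: hom_fmap => //; exact: fcst0. Qed.

Lemma del_zw_cst l : del (zw l^%) = (kap *: om l)^%.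
Proof.
rewrite (del_zw (Pn_cst l)) del_inv ?linear0 ?add0r => [|j]; last exact: fT_cst.
by rewrite fcstZ fcst_om; congr (_ _); apply: eq_bigr => j; rewrite fT_cst.
Qed.

Lemma fT_X (j : 'I_g) x : fT j (X x) = X (fT j x).
Proof.
rewrite fT_sum; apply: eq_bigr => i _; rewrite fT_Aw fT_ei; congr Aw.
by apply/funext.
Qed.

Lemma fT_Xn (j : 'I_g) (n : nat) x : fT j (iter n X x) = iter n X (fT j x).
Proof. by elim: n => //= n <-; rewrite fT_X. Qed.

Lemma del_Xn_cst (n : nat) l : del (iter n X l^%) = 0.
Proof. by apply: del_inv => j; rewrite fT_Xn fT_cst. Qed.

Lemma Pn_hes (n : nat) m x : Pn m x -> Pn (n%:Z + m) (iter n (Mw hes) x).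
Proof.
move=> px; elim: n => [|n]; first by rewrite add0r.
by rewrite -[n.+1]add1n PoszD -addrA; apply: Pn_Mw.
Qed.

(** Its product with zeta cancels the excess pole of X^(n+1) l: by [iter_Mw_sub] their sum is a
    power of the derivation of the Hessian part [hes], of order n + 1 only. *)
Definition aW (n : nat) l : F := kc n.+1%:R *: iter n X (Zi l^%).

Lemma Pn_aW (n : nat) l : Pn n.+1 (aW n l).
Proof.
apply: PnK; have [_] := iter_Mw_sub hes (zeta) n l^%. move=> ->.
rewrite -[n.+1]addn1 PoszD; apply: Pn_hes; apply: (Pn_Iw (m := 1) (n := 0)); last exact: Pn_cst.
done.
Qed.

Lemma Pn_X_aW (n : nat) l : Pn n.+1 (iter n.+1 X l^% + zw (aW n l)).
Proof.
have [H] := iter_Mw_sub hes (zeta) n l^%;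
rewrite linearZ kc_nat H; have := Pn_hes n.+1 (Pn_cst l); by rewrite addr0.
Qed.

Lemma Pn_Xn (n : nat) l : Pn n.+2%:Z (iter n.+1 X l^%).
Proof.
have h : n.+1%:Z <= n.+2%:Z by lia. have := Pn_zw (Pn_aW n l); rewrite -PoszD addn1 => H.
by have := PnB (Pn_le h (Pn_X_aW n l)) H; rewrite addrK.
Qed.

(** T_j changes iota_zeta l by kap iota_(beta_j) l, and sum_j beta_j /\ iota_(beta_j) counts the
    beta-degree q - n of X^n l. *)
Lemma del_aW (n : nat) q k l : hom q k l -> del (aW n l) = kc (n.+1%:R * kap * (q - n%:Z)%:~R) *: iter n X l^%.
Proof.
move=> hl; have pc := Pn_cst.
have fZ (j : 'I_g) : fT j (Zi l^%) = Zi l^% + kc kap *: ib j l^%.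
  rewrite fT_Iw fT_cst /Iw (eq_bigr (fun i => zeta i *: ib i l^% + (if i == j then kc kap *: ib j l^% else 0))) => [|i _].
    by rewrite big_split -big_mkcond big_pred1_eq.
  rewrite (zeta_T) scalerDl; congr (_ _); apply/ffunP => S.
  have pS : pole 0 (ib i l^% S) by exact: coefs_ei.
  rewrite formZ (cst_kc _ pS); case: eqP => [->|_]; first by rewrite formZ.
  by rewrite form0 kc0 mul0r.
rewrite -kcZ -kcZ kc_int -(hom_count (hom_iter_Mw DZ (n := n) (hom_cst hl))) scaler_sumr scaler_sumr.
apply: eq_bigr => j _; rewrite fDel fT_Z (_ : T j (kc _) = kc n.+1%:R) // fT_Xn fZ -scalerBr -linearB addrC addKr.
rewrite !linearZ /= !kcZ; congr (_ *: be _); first by rewrite mulrC.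
apply: iter_com; exact: Mw_ib.
Qed.

Lemma pos_hom n q k x : 0 < n -> 1 <= q -> Pn n x -> del x = 0 -> hom q k x ->
  exists2 f : F, Pn n f /\ hom (q - 1) k f & del f = x.
Proof.
case: n => // n n0 q1 px cx hx; have [|f pf dE] := pos_acyclic n0 px cx.
  move=> S /eqP S0; apply: hx; rewrite /bideg S0 cards0; lia.
exists (proj (q - 1) k f); first by split; [apply: coefs_proj pf; exact: (sP _).1|exact: hom_proj].
rewrite kz_proj ?subrK ?dE ?proj_hom //; exact: shift0.
Qed.

Lemma neg_hom n q k x : n < 0 -> q < g%:Z -> Pn n x -> del x = 0 -> hom q k x ->
  exists2 f : F, Pn n f /\ hom (q - 1) k f & del f = x.
Proof.
move=> n0 qg px cx hx; have nE : n = - `|n|%N%:Z by lia. have n1 : (0 < `|n|)%N by lia.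
rewrite nE in px *; have [|f pf dE] := neg_acyclic n1 px cx.
  move=> S Sg; apply: hx; apply/nandP; lia.
exists (proj (q - 1) k f); first by split; [apply: coefs_proj pf; exact: (sP _).1|exact: hom_proj].
rewrite kz_proj ?subrK ?dE ?proj_hom //; exact: shift0.
Qed.

Lemma zero_hom q k x : Pn 0 x -> del x = 0 -> hom q k x ->
  exists mu (f : F), [/\ hom q k mu, Pn 0 f, hom (q - 1) k f & x = mu^% + del f].
Proof.
move=> px cx hx; have [mu [f [pf E]]] := cocycle_pole0 px cx.
exists (proj q k mu), (proj (q - 1) k f); split; [exact: hom_proj|by apply: coefs_proj pf; exact: (sP _).1|exact: hom_proj|].
rewrite kz_proj ?subrK; last exact: shift0.
rewrite -(proj_hom hx) E; apply/ffunP => S; rewrite !(formD, fmapE, ffunE).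
by case: ifP => //; rewrite fcst0 addr0.
Qed.

(** For n <> 0 this amounts to b and db both having order at most n, the leading part of db being -
    n zeta /\ b. *)
Definition Om n b := Pn n b /\ Pn n (zw b).

(** Contract with B from B0 + sum_i B_i zeta_i = 1, where B0 and the B_i vanish on Theta: for a = -
    iota_B b one gets b + zeta /\ a = B0 b + iota_B (zeta /\ b). *)
Lemma zw_split n q k b : Om n b -> hom q k b -> exists a, [/\ Pn (n - 1) a, hom q (k - 1) a & Pn (n - 1) (b + zw a)].
Proof.
move=> [pb]; have [B0 [B [pB0 pB BE]]] := unity.
exists (- Sw B b); split; [|by apply: homN; exact: hom_Sw|].
  rewrite addrC; apply: PnN; exact: Pn_Sw.
have E : b + zw (- Sw B b) = B0 *: b + Sw B (zw b).
  rewrite linearN Sw_Aw addrA; congr (_ - _); apply/ffunP => S; rewrite formD !formZ -mulrDl BE.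
  by rewrite (un1 (pb S)).
by rewrite E addrC; apply: PnD; [apply: PnZ|apply: Pn_Sw].
Qed.

Lemma Om_zw m (f : F) e : Pn m f -> Pn m e -> Om (m + 1) (zw f + e).
Proof.
move=> pf pe; split; first by apply: PnD; [exact: Pn_zw|apply: Pn_le pe; lia].
rewrite linearD /= Aw_Aw0 add0r; exact: Pn_zw.
Qed.

Lemma Pn_tau m a : Pn m a -> Pn m (kc kap *: \sum_j be j (al j (fT j a))).
Proof.
move=> pa; apply: PnK; apply: coefs_sum => [|j _]; first exact: sP.
apply: coefs_ew (sP m) _; apply: coefs_ew (sP m) _; exact: Pn_fT.
Qed.

Lemma Om_del m a : Pn m a -> Pn m (del (zw a)) -> Om m (del a).
Proof.
move=> pa; rewrite (del_zw pa); split; first exact: Pn_del.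
by have := PnB (Pn_tau pa) H; rewrite opprD opprK addrCA subrr addr0.
Qed.

Lemma Pn_del_zw m y (f : F) : Pn m f -> Pn m (y + zw (del f)) -> Pn m (y - del (zw f)).
Proof.
move=> pf H; have := PnB H (Pn_tau pf); congr coefs; rewrite (del_zw pf) opprD opprK addrA; exact: erefl.
Qed.

(** b - del (zeta /\ f) is closed of order m; with a primitive f' of it, e = zeta /\ f + f' lies in
    [Om (m + 1)] because zeta /\ zeta = 0. *)
Lemma lift_om m q k b (f : F) :
  (forall x, Pn m x -> del x = 0 -> hom q k x -> exists2 f : F, Pn m f /\ hom (q - 1) k f & del f = x) ->
  hom q k b -> del b = 0 -> Pn m f -> hom (q - 1) (k - 1) f -> Pn m (b + zw (del f)) ->
  exists e, [/\ Om (m + 1) e, hom (q - 1) k e & del e = b].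
Proof.
move=> ac hb cb pf hf H; have hz : hom (q - 1) k (zw f) by rewrite -[k](subrK 1); exact: hom_Aw.
have [||f' [pf' hf'] dE] := ac _ (Pn_del_zw pf H).
- by rewrite delB cb deldel subrr.
- apply: homB => //; rewrite -[q](subrK 1); apply: hom_kz => //; exact: shift0.
exists (zw f + f'); split; [exact: Om_zw|exact: homD|].
by rewrite delD dE addrC subrK.
Qed.

(** Induction on the alpha-degree, with q + k fixed: the a of [zw_split] has del a in [Om (n - 1)],
    so del a = del e by induction, and a - e is closed of negative order, hence a coboundary;
    [lift_om] concludes. *)
Lemma closed_nonpos_nat (k : nat) n q b : n <= 0 -> q + k%:Z < g%:Z -> Om n b -> del b = 0 -> hom q k%:Z b ->
  exists e, [/\ Om n e, hom (q - 1) k%:Z e & del e = b].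
Proof.
elim: k n q b => [|k IH] n q b n0 qk Ob cb hb; have [a [pa ha pab]] := zw_split Ob hb.
  have a0 : a = 0 by apply: hom_negr ha.
  rewrite a0 linear0 addr0 in pab.
  have n1 : n - 1 < 0 by lia. have qg : q < g%:Z by lia.
  have [f [pf]] := neg_hom n1 qg pab cb hb.
  exists f; split => //; rewrite -[n](subrK 1) -[f]add0r -(linear0 zw); apply: Om_zw => //; exact: coefs0.
have n1 : n - 1 < 0 by lia. have qg : q < g%:Z by lia.
have Oa : Om (n - 1) (del a).
  by apply: Om_del; have := Pn_del pab; rewrite delD cb add0r.
have kE : k.+1%:Z - 1 = k%:Z by lia. rewrite kE in ha.
have [||e [[pe pze] he eE]] := IH (n - 1) (q + 1) (del a) (ltW n1) _ Oa (deldel a).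
- lia.
- apply: hom_kz => //; exact: shift0.
rewrite addrK in he.
have [|||f [pf hf] fE] := @neg_hom (n - 1) q k%:Z (a - e) n1 qg.
- exact: PnB.
- by rewrite delB eE subrr.
- exact: homB.
have := @lift_om (n - 1) q k.+1%:Z b f (fun x px cx hx => neg_hom n1 qg px cx hx).
rewrite subrK kE fE linearB addrA; apply => //; exact: PnB.
Qed.

Lemma closed_nonpos n q k b : n <= 0 -> q + k < g%:Z -> Om n b -> del b = 0 -> hom q k b ->
  exists e, [/\ Om n e, hom (q - 1) k e & del e = b].
Proof.
case: k => k; first exact: closed_nonpos_nat.
move=> _ [pb _] _ hb; have -> : b = 0 by apply: hom_negr hb.
exists 0; split; [split; rewrite ?linear0; exact: coefs0 (sP n)|exact: hom0|exact: del0].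
Qed.

Lemma card_parts S : #|S| = (#|beta_part S| + #|alpha_part S|)%N.
Proof.
rewrite -sum1_card big_split_ord; congr (_ + _)%N; rewrite -sum1_card; apply: eq_bigl => i; by rewrite inE.
Qed.

Lemma hom_lefschetz q k mu : q + k < g%:Z -> hom q k mu -> om mu = 0 -> mu = 0.
Proof.
move=> qk hmu o0; case: (ltrP q 0) => [q0|q0]; first exact: hom_neg hmu.
case: (ltrP k 0) => [k0|k0]; first exact: hom_negr hmu.
apply: (@lefschetz C g (absz (q + k))) => // [m v /eqP||S nS]; [|lia|].
- by rewrite mulf_eq0 pnatr_eq0 => /eqP.
- apply: hmu; apply: contra nS; rewrite card_parts => /andP[/eqP]; lia.
Qed.

(* The base of both descents: a is a form of order 0 whose boundary is of order 0 in the sense of Om. *)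
Lemma level0_split q k b a : q + k < g%:Z -> Pn 0 a -> hom q (k - 1) a -> Pn 0 (b + zw a) -> Om 0 (del a) ->
  exists mu (f : F), [/\ hom q (k - 1) mu, Pn 0 f, hom (q - 1) (k - 1) f & Pn 0 (b + zw mu^% - del (zw f))].
Proof.
move=> qk pa ha pab Oa; have h1 : hom (q + 1) (k - 1) (del a) by apply: hom_kz => //; exact: shift0.
have [|e [[pe pze] he eE]] := closed_nonpos (lexx 0) _ Oa (deldel a) h1; first lia.
rewrite addrK in he; have [|||mu [f [hmu pf hf fE]]] := @zero_hom q (k - 1) (a - e).
- exact: PnB.
- by rewrite delB eE subrr.
- exact: homB.
exists mu, f; split => //; apply: Pn_del_zw => //; rewrite -addrA -linearD -fE linearB addrA; exact: PnB.
Qed.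

(** The constants mu arising at order 0 make kap omega /\ mu the coboundary of a form of order 0, so
    omega /\ mu = 0, and mu = 0 by Lefschetz in degree g - 2. The surviving constants nu are the
    source of the d zeta_I /\ dz_K. *)
Lemma closed_level1 q k b : q + k = g%:Z - 1 -> Om 1 b -> del b = 0 -> hom q k b ->
  exists (nu : FC) e, [/\ hom q k nu, Om 1 e, hom (q - 1) k e & b = nu^% + del e].
Proof.
move=> qk Ob cb hb; have [a [pa ha pab]] := zw_split Ob hb.
have [||mu [f [hmu pf hf py]]] := level0_split _ pa ha pab; first lia.
  by apply: Om_del; have := Pn_del pab; rewrite delD cb add0r.
have dy : del (b + zw mu^% - del (zw f)) = (kap *: om mu)^%.
  by rewrite delB deldel subr0 delD cb add0r del_zw_cst.
have m0 : mu = 0.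
  apply: hom_lefschetz hmu _; first lia.
  have := coboundary_cst py dy => /(congr1 (fun u => kap^-1 *: u)).
  by rewrite scalerA mulVf // scale1r scaler0.
have z0 : (0 : FC)^% = 0 by apply/ffunP => S; rewrite fmapE !form0 fcst0.
rewrite m0 z0 linear0 addr0 in py.
have hz : hom (q - 1) k (zw f) by rewrite -[k](subrK 1); exact: hom_Aw.
have [||nu [f' [hnu pf' hf' fE]]] := @zero_hom q k _ py.
- by rewrite delB cb deldel subrr.
- apply: homB hb _; rewrite -[q](subrK 1); apply: hom_kz => //; exact: shift0.
exists nu, (zw f + f'); split => //; [exact: (@Om_zw 0)|exact: homD|].
by rewrite delD addrCA -fE addrC subrK.
Qed.

(** One order lower, del a = X^n l1 + del e. Subtracting [aW n l] from a - e removes X^n l1, with l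
    proportional to l1, and turns b + zeta /\ a into b - X^(n+1) l + zeta /\ c up to order n + 1. *)
Lemma closed_step (n : nat) q k b : 0 <= q -> Om n.+2%:Z b -> del b = 0 -> hom q k b ->
  (forall b', Om n.+1%:Z b' -> del b' = 0 -> hom (q + 1) (k - 1) b' ->
     exists l e, [/\ hom (q + n.+1%:Z) (k - n.+1%:Z) l, Om n.+1%:Z e, hom q (k - 1) e & b' = iter n X l^% + del e]) ->
  exists l (c : F), [/\ hom (q + n.+1%:Z) (k - n.+1%:Z) l, Pn n.+1%:Z c, del c = 0, hom q (k - 1) c &
    Pn n.+1%:Z (b - iter n.+1 X l^% + zw c)].
Proof.
move=> q0 Ob cb hb IH; have [a [pa ha pab]] := zw_split Ob hb.
have nE : n.+2%:Z - 1 = n.+1%:Z by []. rewrite nE in pab.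
have [|||l1 [e [hl1 [pe pze] he E]]] := IH (del a).
- by apply: Om_del; have := Pn_del pab; rewrite delD cb add0r.
- exact: deldel.
- apply: hom_kz => //; exact: shift0.
(* The factor of [del_aW], nonzero because q + 1 > 0. *)
pose w := n.+1%:R * kap * (q + n.+1%:Z - n%:Z)%:~R.
have : w != 0 by rewrite !mulf_neq0 // intr_eq0; lia.
pose l := w^-1 *: l1; have hl : hom (q + n.+1%:Z) (k - n.+1%:Z) l by exact: homZ.
exists l, (a - e - aW n l); split => //.
- apply: PnB; [exact: PnB|exact: Pn_aW].
- rewrite delB delB E (del_aW n hl) fcstZ [iter n X (_ *: _)]linearZ kcZ divff // kc1Z; by rewrite addrK subrr.
- apply: homB; first exact: homB.
  apply: homZ; have := hom_iter_Mw DZ (n := n) (hom_Iw (zeta) (hom_cst hl)).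
  congr hom; lia.
have -> : b - iter n.+1 X l^% + zw (a - e - aW n l) = (b + zw a) - zw e - (iter n.+1 X l^% + zw (aW n l)).
  rewrite !linearB.
  apply/ffunP => S; rewrite !(formD, formN); ring.
apply: PnB; [exact: PnB|exact: Pn_X_aW].
Qed.

Lemma closed_pos (n : nat) q k b : 1 <= q -> q + k = g%:Z - 1 -> Om n.+1%:Z b -> del b = 0 -> hom q k b ->
  exists l e, [/\ hom (q + n%:Z) (k - n%:Z) l, Om n.+1%:Z e, hom (q - 1) k e & b = iter n X l^% + del e].
Proof.
elim: n q k b => [|n IH] q k b q1 qk Ob cb hb.
  rewrite addr0 subr0; exact: closed_level1.
have [||l [c [hl pc dc hc H]]] := @closed_step n q k b _ Ob cb hb; first lia.
  move=> b' Ob' cb' hb'; have := IH (q + 1) (k - 1) b' _ _ Ob' cb' hb'.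
  have -> : q + 1 + n%:Z = q + n.+1%:Z by lia. have -> : k - 1 - n%:Z = k - n.+1%:Z by lia.
  rewrite addrK; apply; lia.
have [f [pf hf] fE] := pos_hom (isT : 0 < n.+1%:Z) q1 pc dc hc.
have hX : hom q k (iter n.+1 X l^%) by have := hom_iter_Mw DZ (n := n.+1) (hom_cst hl); rewrite addrK subrK.
have [|||e [Oe he eE]] := @lift_om n.+1%:Z q k (b - iter n.+1 X l^%) f (fun x px cx hx => pos_hom (isT : 0 < n.+1%:Z) q1 px cx hx) _ _ pf hf.
- exact: homB.
- by rewrite delB cb del_Xn_cst subrr.
- by rewrite fE.
exists l, e; split => //; first by rewrite (_ : n.+2%:Z = n.+1%:Z + 1) //; lia.
by rewrite eE addrC subrK.
Qed.

(** In beta-degree 0 there is no room for primitives, so the closed c is kept; in that degree closed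
    means invariant under the T_j. *)
Lemma descent_closed (n : nat) b : Om n.+1%:Z b -> del b = 0 -> hom 0 (g%:Z - 1) b ->
  exists l (c : F), [/\ hom n%:Z (g%:Z - 1 - n%:Z) l, Pn n%:Z c, del c = 0, hom 0 (g%:Z - 1 - 1) c &
    Pn n%:Z (b - iter n X l^% + zw c)].
Proof.
case: n => [|n] Ob cb hb.
  have [|nu [e [hnu _ he E]]] := closed_level1 _ Ob cb hb; first by rewrite add0r.
  have e0 : e = 0 by apply: hom_neg he.
  exists nu, 0; rewrite subr0; split => //; [exact: coefs0 (sP 0)|exact: del0|exact: hom0|].
  rewrite E e0 del0 addr0 subrr linear0 addr0; exact: coefs0.
have [|l [c [hl]]] := closed_step (lexx 0) Ob cb hb; last by rewrite add0r in hl; exists l, c.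
move=> b' Ob' cb' hb'; have := @closed_pos n (0 + 1) _ b' _ _ Ob' cb' hb'.
have -> : g%:Z - 1 - 1 - n%:Z = g%:Z - 1 - n.+1%:Z by lia.
apply; lia.
Qed.

Lemma delZ d x : del (kc d *: x) = kc d *: del x.
Proof.
rewrite scaler_sumr; apply: eq_bigr => j; rewrite !fDel fT_Z T_kc -scalerBr.
by rewrite linearZ.
Qed.

(** b = c - [aW n l] lies in [Om n.+1], and its coboundary is a multiple of X^n l that is nonzero
    because n < s; [zw_split] then lowers the order. *)
Lemma top_step (n : nat) (s t : int) l (c : F) : n%:Z < s -> hom s t l ->
  Pn n.+1%:Z c -> del c = 0 -> hom (s - n.+1%:Z) (t + n%:Z) c -> Pn n.+1%:Z (iter n.+1 X l^% + zw c) ->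
  exists a b (w : C), [/\ w != 0, Pn n%:Z a, hom (s - n.+1%:Z) (t + n%:Z - 1) a, del b = - (kc w *: iter n X l^%) & Pn n%:Z (b + zw a)].
Proof.
move=> ns hl pc dc hc H; pose b := c - aW n l.
have hb : hom (s - n.+1%:Z) (t + n%:Z) b.
  apply: homB => //; apply: homZ; have := hom_iter_Mw DZ (n := n) (hom_Iw zeta (hom_cst hl)); congr hom; lia.
have Ob : Om n.+1%:Z b.
  split; first exact: PnB (Pn_aW n l).
  have := PnB H (Pn_X_aW n l); congr coefs.
  rewrite linearB; apply/ffunP => S; rewrite !(formD, formN); ring.
have [a [pa ha pab]] := zw_split Ob hb.
have nE : n.+1%:Z - 1 = n%:Z by lia. rewrite nE in pa pab.
exists a, b, (n.+1%:R * kap * (s - n%:Z)%:~R); split => //; last by rewrite delB dc sub0r (del_aW n hl).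
rewrite !mulf_neq0 // intr_eq0; lia.
Qed.

(** At order 0 a combination of l and omega /\ mu becomes the coboundary of a form of order 0; a
    constant coboundary is 0, so l is proportional to omega /\ mu. *)
Lemma descent_top (n : nat) (s t : int) l (c : F) : s + t = g%:Z -> n%:Z < s -> hom s t l ->
  Pn n.+1%:Z c -> del c = 0 -> hom (s - n.+1%:Z) (t + n%:Z) c -> Pn n.+1%:Z (iter n.+1 X l^% + zw c) ->
  exists mu, hom (s - 1) (t - 1) mu /\ l = om mu.
Proof.
move=> st; elim: n c => [|n IH] c ns hl pc dc hc H; have [a [b [w [w0 pa ha db pab]]]] := top_step ns hl pc dc hc H;
  have dab := Pn_del pab; rewrite delD db in dab.
  have Oa : Om 0 (del a).
    apply: Om_del => //; have := PnD dab (PnK w (Pn_cst l)).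
    by rewrite addrAC addNr add0r.
  have tE : t + 0%N%:Z = t by lia. rewrite tE in ha.
  have [|mu [f [hmu pf hf py]]] := level0_split _ pa ha pab Oa; first lia.
  have dy : del (b + zw mu^% - del (zw f)) = (- w *: l + kap *: om mu)^%.
    by rewrite delB deldel subr0 delD db del_zw_cst fcst_lin kcN scaleNr.
  have := coboundary_cst py dy => E.
  exists ((w^-1 * kap) *: mu); split; first by apply: homZ.
  have : w *: l = kap *: om mu by apply/eqP; rewrite -subr_eq0 -oppr_eq0 opprB addrC -scaleNr E.
  rewrite linearZ /= -scalerA => <-; by rewrite scalerA mulVf // scale1r.
apply: (IH (kc w^-1 *: del a)) => //; [lia|by apply: PnK; exact: Pn_del|by rewrite delZ deldel scaler0| |].
  apply: homZ; have := hom_kz shift0 ha; congr hom; lia.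
have := PnK (- w^-1) (PnB dab (Pn_tau pa)); rewrite (del_zw pa) addrA addrK scalerDr !scalerN kcN !scaleNr !opprK kcZ mulVf // kc1Z.
by rewrite linearZ.
Qed.

End Descent.

(** * Transport of Koszul differentials along an additive map *)

Section Transport.
Variables (K K' : comPzRingType) (g : nat) (phi : K -> K') (P : K -> Prop) (D : 'I_g -> K -> K) (D' : 'I_g -> K' -> K').
Hypotheses (sP : subgroup P) (phiB : forall u v, P u -> P v -> phi (u - v) = phi u - phi v)
  (PD : forall j u, P u -> P (D j u)) (phiD : forall j u, P u -> phi (D j u) = D' j (phi u)).

Lemma phi0 : phi 0 = 0. Proof. by have := phiB sP.1 sP.1; rewrite !subrr. Qed.

Lemma phiN u : P u -> phi (- u) = - phi u.
Proof. by move=> Pu; have := phiB sP.1 Pu; rewrite !sub0r phi0 sub0r. Qed.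

Lemma phi_sum (I : Type) (r : seq I) (Q : pred I) (G : I -> K) : (forall i : I, Q i -> P (G i)) ->
  P (\sum_(i <- r | Q i) G i) /\ phi (\sum_(i <- r | Q i) G i) = \sum_(i <- r | Q i) phi (G i).
Proof.
move=> PG; elim/big_rec2: _ => [|i y1 y2 Qi [P2 E]]; first by rewrite phi0; split => //; exact: sP.1.
have : P (- y2) by exact: subgroupN.
split; first by rewrite -[y2]opprK; apply: sP.2 => //; exact: PG.
by rewrite -[y2]opprK phiB //; [rewrite phiN // opprK E|exact: PG].
Qed.

Lemma fmap_kz m (y : form K (g + g)) : coefs P y -> kz D' m (fmap phi y) = fmap phi (kz D m y).
Proof.
move=> Py; apply/ffunP => S; rewrite fmapE !form_sum.
have PDy i : coefs P (fmap (D i) y) by move=> T; rewrite fmapE; exact: PD.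
have [|_ ->] := @phi_sum 'I_g (index_enum 'I_g) (fun i => (m <= i)%N) (fun i => ew (beta i) (fmap (D i) y) S).
  move=> i _; exact: coefs_ew.
apply: eq_bigr => i _; rewrite -fmapE fmap_ew ?phi0 //; last by move=> T; rewrite phiN //; exact: PDy.
by congr (ew _ _ S); apply/ffunP => T; rewrite !fmapE phiD.
Qed.

Lemma fmap_lift (x : form K' (g + g)) : (forall S, exists2 u, P u & x S = phi u) ->
  exists2 y : form K (g + g), coefs P y & x = fmap phi y.
Proof.
move=> H; have /choice[y Hy] : forall S, exists u, P u /\ x S = phi u by move=> S; have [u] := H S; exists u.
exists [ffun S : {set 'I_(g + g)} => y S] => [S|]; first by rewrite ffunE; have [] := Hy S.
by apply/ffunP => S; rewrite fmapE ffunE; have [] := Hy S.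
Qed.

End Transport.

(** * The exterior derivative and substitution by closed forms *)

Section Derivations.
Variables (g : nat) (K : comPzRingType) (reg : K -> Prop) (D : 'I_g -> K -> K) (h : 'I_g -> 'I_g -> K).
Local Notation F := (form K (g + g)).
Local Notation al i := (@ew K (g + g) (alpha i)).
Local Notation ib i := (@ei K (g + g) (beta i)).
Implicit Types (x y : F) (i j l : 'I_g).
Hypotheses (sR : subgroup reg) (regM : forall f k : K, reg f -> reg k -> reg (f * k))
  (DB : forall i (f k : K), reg f -> reg k -> D i (f - k) = D i f - D i k)
  (DM : forall i (f k : K), reg f -> reg k -> D i (f * k) = f * D i k + k * D i f)
  (reg_h : forall l j, reg (h l j)) (h_closed : forall i l j, D i (h l j) = D j (h l i)).

Definition dd x : F := \sum_i al i (fmap (D i) x).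

Lemma D_sum i (I : Type) (r : seq I) (P : pred I) (G : I -> K) : (forall t : I, reg (G t)) ->
  D i (\sum_(t <- r | P t) G t) = \sum_(t <- r | P t) D i (G t).
Proof. by move=> rG; have [] := @phi_sum K K (D i) reg sR (DB i) I r P G (fun t _ => rG t). Qed.

Lemma fmap_D_sum i (I : Type) (r : seq I) (P : pred I) (G : I -> F) : (forall t : I, coefs reg (G t)) ->
  fmap (D i) (\sum_(t <- r | P t) G t) = \sum_(t <- r | P t) fmap (D i) (G t).
Proof.
move=> rG; apply/ffunP => S; rewrite fmapE !form_sum D_sum => [|t]; last exact: rG.
by apply: eq_bigr => t; rewrite fmapE.
Qed.

Lemma fmap_D_ew i (k : 'I_(g + g)) x : coefs reg x -> fmap (D i) (ew k x) = ew k (fmap (D i) x).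
Proof. move=> rx; apply: fmap_ew => [|S]; [exact: (phi0 sR (DB i))|exact: (phiN sR (DB i))]. Qed.

Lemma fmap_D_ei i (k : 'I_(g + g)) x : coefs reg x -> fmap (D i) (ei k x) = ei k (fmap (D i) x).
Proof. move=> rx; apply: fmap_ei => [|S]; [exact: (phi0 sR (DB i))|exact: (phiN sR (DB i))]. Qed.

Lemma coefs_regZ f x : reg f -> coefs reg x -> coefs reg (f *: x).
Proof. move=> rf rx S; rewrite formZ; exact: regM. Qed.

Lemma fmap_D_Aw i (u : 'I_g -> K) x : (forall j, reg (u j)) -> coefs reg x ->
  fmap (D i) (Aw u x) = Aw (fun j => D i (u j)) x + Aw u (fmap (D i) x).
Proof.
move=> ru rx; have ra j : coefs reg (al j x) by exact: coefs_ew.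
rewrite fmap_D_sum -?big_split => [|j]; last exact: coefs_regZ.
apply: eq_bigr => j _; rewrite -fmap_D_ew //; apply/ffunP => S.
by rewrite [LHS]fmapE formZ (DM _ (ru j) (ra j S)) [RHS]formD !formZ fmapE addrC [D i (u j) * _]mulrC.
Qed.

Lemma coefs_Mw x : coefs reg x -> coefs reg (Mw h x).
Proof.
move=> rx; apply: coefs_sum => // i _; apply: coefs_sum => // j _; apply: coefs_regZ => //.
apply: coefs_ew => //; exact: coefs_ei.
Qed.

(** The terms that differentiate h contain sum_ij (D_i h_lj) alpha_i /\ alpha_j, which is 0 by
    closedness. *)
Lemma dd_Mw x : coefs reg x -> dd (Mw h x) = Mw h (dd x).
Proof.
move=> rx; have rb l : coefs reg (ib l x) by exact: coefs_ei.
have rA l : coefs reg (Aw (h l) (ib l x)).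
  apply: coefs_sum => // j _; apply: coefs_regZ => //; exact: coefs_ew.
rewrite linear_sum /dd (eq_bigr (fun i => (\sum_l al i (Aw (fun j => D i (h l j)) (ib l x))) + Mw h (al i (fmap (D i) x)))) => [|i _].
  rewrite big_split /= exchange_big big1 ?add0r // => l _.
  rewrite -[RHS](@sum_alal K g (fun i j => D i (h l j)) (ib l x)) => [|i]; last exact: h_closed.
  by apply: eq_bigr => i _; rewrite linear_sum; apply: eq_bigr => j; rewrite linearZ.
rewrite Mw_al fmap_D_sum // linear_sum [in RHS]linear_sum -big_split; apply: eq_bigr => l.
by rewrite fmap_D_Aw // linearD fmap_D_ei.
Qed.

Lemma dd_iter_Mw n x : coefs reg x -> dd (iter n (Mw h) x) = iter n (Mw h) (dd x) /\ coefs reg (iter n (Mw h) x).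
Proof.
move=> rx; elim: n => //= n [IH]; split; last exact: coefs_Mw.
by rewrite dd_Mw // IH.
Qed.

End Derivations.

(** * The complex D (x) W *)

Section AbstractKoszul.
Variables (K : comPzRingType) (g : nat).
Local Notation F := (form K (g + g)).
Local Notation al i := (@ew K (g + g) (alpha i)).
Local Notation ia i := (@ei K (g + g) (alpha i)).
Implicit Types (x y z w : F) (S : {set 'I_(g + g)}) (p : K).

Lemma count_alpha y S : (\sum_i al i (ia i y)) S = #|alpha_part S|%:R * y S.
Proof.
rewrite form_sum (bigID (mem (alpha_part S))) /= [X in _ + X]big1 ?addr0 => [|i]; last first.
  by rewrite inE => /negbTE iS; rewrite ewE iS.
rewrite (eq_bigr (fun=> y S)) => [|i]; first by rewrite sumr_const mulr_natl.
rewrite inE => iS; rewrite ewE eiE !inE iS eqxx finset.setD1K // (esgnD1 _ _ iS) ltnn mul1r mulrA esgn2 mul1r //.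
Qed.

Lemma om_Aw (u : 'I_g -> K) y : Aw u (om y) = om (Aw u y).
Proof. by rewrite linear_sum; apply: eq_bigr => i /=; rewrite Aw_be Aw_al linearN opprK. Qed.

Lemma ia_Aw (u : 'I_g -> K) j y : ia j (Aw u y) = u j *: y - Aw u (ia j y).
Proof.
rewrite linear_sum (bigD1 j) //= [X in - X](bigD1 j) //= linearZ /= ia_al eqxx scalerBr -addrA opprD; congr (_ (_ + _)).
by rewrite -sumrN; apply: eq_bigr => i ij; rewrite linearZ /= ia_al eq_sym (negbTE ij) sub0r scalerN.
Qed.

Variables (xv : 'I_g -> K) (dv : 'I_g -> K -> K) (sc : nat -> K -> K).
Hypotheses (dvB : forall i p (q : K), dv i (p - q) = dv i p - dv i q) (dvX : forall i j p, dv j (xv i * p) = (if i == j then p else 0) + xv i * dv j p)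
  (scB : forall n p (q : K), sc n (p - q) = sc n p - sc n q)
  (sc_mul : forall n i p, sc n (xv i * p) = xv i * sc n.+1 p)
  (sc_eul : forall n p, (0 < n)%N -> sc n (\sum_i xv i * dv i p + n%:R * p) = p)
  (char0 : forall m (v : K), m.+1%:R * v = 0 -> v = 0).

Let dv0 i : dv i 0 = 0. Proof. by have := dvB i 0 0; rewrite !subrr. Qed.
Let dvN i p : dv i (- p) = - dv i p. Proof. by rewrite -sub0r dvB dv0 sub0r. Qed.
Let dvD i p (q : K) : dv i (p + q) = dv i p + dv i q. Proof. by rewrite -{1}[q]opprK dvB dvN opprK. Qed.
Let sc0 n : sc n 0 = 0. Proof. by have := scB n 0 0; rewrite !subrr. Qed.
Let scN n p : sc n (- p) = - sc n p. Proof. by rewrite -sub0r scB sc0 sub0r. Qed.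
Let scD n p (q : K) : sc n (p + q) = sc n p + sc n q. Proof. by rewrite -{1}[q]opprK scB scN opprK. Qed.

Definition hD y : F := \sum_i ia i (fmap (dv i) y).

Lemma fmap_dv_Aw j y : fmap (dv j) (Aw xv y) = al j y + Aw xv (fmap (dv j) y).
Proof.
have dew i (x : F) : fmap (dv j) (al i x) = al i (fmap (dv j) x).
  by apply: fmap_ew.
apply/ffunP => S; rewrite fmapE formD !form_sum (big_morph (dv j) (dvD j) (dv0 j)).
rewrite (eq_bigr (fun i => (if i == j then al j y S else 0) + (xv i *: al i (fmap (dv j) y)) S)) => [|i].
  by rewrite big_split -big_mkcond big_pred1_eq.
by rewrite !formZ -dew fmapE dvX; case: eqP => [->|].
Qed.

Lemma koszul_homotopy y S : (Aw xv (hD y) + hD (Aw xv y)) S = \sum_i xv i * dv i (y S) + (g - #|alpha_part S|)%N%:R * y S.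
Proof.
have -> : Aw xv (hD y) + hD (Aw xv y) = \sum_i xv i *: fmap (dv i) y + (y *+ g - \sum_i al i (ia i y)).
  have -> : y *+ g = \sum_(i < g) y by rewrite sumr_const card_ord.
  rewrite -sumrB linear_sum -!big_split; apply: eq_bigr => j.
  rewrite fmap_dv_Aw linearD /= ia_al eqxx ia_Aw.
  by rewrite addrC -addrA subrK addrC.
rewrite formD form_sum formD formN count_alpha; congr (_ + _); first by apply: eq_bigr => i; rewrite formZ fmapE.
rewrite -[y *+ g]scaler_nat formZ -mulrBl natrB //.
rewrite -[leqRHS]card_ord; exact: max_card.
Qed.

(** By [koszul_homotopy] the anticommutator of [Aw xv] and [hD] is the Euler operator plus g -
    #alpha, inverted coefficientwise by [sc]; removing an alpha raises the index of [sc] by one,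
    which [sc_mul] accounts for. Coefficients containing all alphas are 0 since k < g. *)
Lemma koszul_exact k y : (k < g)%N -> (forall S, #|S| != k -> y S = 0) -> Aw xv y = 0 ->
  exists z, y = Aw xv z /\ (forall S, #|S|.+1 != k -> z S = 0).
Proof.
move=> kg yk dy; exists [ffun S : {set 'I_(g + g)} => sc (g - #|alpha_part S|) (hD y S)]; split; last first.
  move=> S Sk; rewrite ffunE (_ : hD y S = 0) // form_sum big1 // => i.
  rewrite eiE; case: ifPn => // iS; rewrite fmapE yk ?dv0 ?mulr0 //.
  by rewrite cardsU1 iS.
apply/ffunP => S; rewrite form_sum.
have := koszul_homotopy y S; rewrite dy (_ : hD 0 = 0) ?addr0; last first.
  rewrite /hD big1 // => i; rewrite (_ : fmap _ _ = 0) ?linear0 //; apply/ffunP => T.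
  by rewrite fmapE !form0.
set a := (g - #|alpha_part S|)%N => E.
rewrite (eq_bigr (fun i => sc a ((xv i *: al i (hD y)) S))) => [|i _]; last first.
  rewrite !formZ sc_mul; congr (_ _); rewrite !ewE; case: ifP => iS; last by [].
  have -> : a.+1 = (g - #|alpha_part (S :\ alpha i)|)%N.
    have : #|alpha_part S| = #|alpha_part (S :\ alpha i)|.+1.
      rewrite (cardsD1 i) inE iS; congr (_.+1); apply: eq_card => j.
      by rewrite !inE alpha_eq.
    have : (#|alpha_part S| <= g)%N by rewrite -[leqRHS]card_ord; exact: max_card.
    lia.
  by rewrite ffunE /esgn -signr_odd; case: odd; rewrite ?mulN1r ?mul1r.
rewrite -(big_morph (sc a) (scD a) (sc0 a)) -form_sum -/(Aw xv (hD y)) E.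
have [a0|a0] := posnP a; last by rewrite sc_eul.
rewrite a0 mul0r addr0 [y S]yk ?big1 // => [i|]; first by rewrite dv0 mulr0.
rewrite card_parts; lia.
Qed.

(** d = [Aw xv] commutes with omega, so omega /\ dy = 0 and Lefschetz gives dy = 0. Then y = dz',
    and x - omega /\ z' is closed, hence exact. *)
Lemma DW_forms_exact k x y : (k < g)%N -> (forall S, #|S| != k -> x S = 0) -> (forall S, #|S|.+1 != k -> y S = 0) ->
  Aw xv x = om y -> exists z w, [/\ x = Aw xv z + om w, forall S, #|S|.+1 != k -> z S = 0 & forall S, #|S|.+2 != k -> w S = 0].
Proof.
move=> kg xk yk E; have d0 : Aw xv y = 0.
  apply: (lefschetz (k := k)) => // [S Sk|]; last by rewrite -om_Aw -E Aw_Aw0.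
  rewrite form_sum big1 // => i; rewrite formZ ewE; case: ifP => iS; last by rewrite mulr0.
  by rewrite yk ?mulr0 //; apply: contra Sk => /eqP <-; rewrite (cardsD1 (alpha i)) iS.
have [z' [yE zk]] : exists z', y = Aw xv z' /\ (forall S, #|S|.+2 != k -> z' S = 0).
  case: k kg xk yk => [|k] kg xk yk; last by apply: (@koszul_exact) => //; lia.
  by exists 0; split => [|S]; rewrite ?form0 // linear0; apply/ffunP => S; rewrite yk ?form0.
have [||z [zE]] := @koszul_exact k (x - om z') kg.
- move=> S Sk; rewrite formD formN xk // sub0r form_sum big1 ?oppr0 // => i.
  rewrite !ewE !inE alpha_beta; case: ifP => // iS; case: ifP => jS; last by rewrite mulr0.
  rewrite zk ?mulr0 //; apply: contra Sk => /eqP <-.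
  by rewrite (cardsD1 (beta i)) iS (cardsD1 (alpha i)) !inE alpha_beta jS.
- by rewrite linearB /= om_Aw -yE E subrr.
by exists z, z'; rewrite -zE subrK.
Qed.

End AbstractKoszul.

(** * Comparison of graded exterior powers with total forms *)

Section ExtForms.
Variables (K : comNzRingType) (g : nat) (X : 'I_g -> K).
Local Notation extV k := (ext K (g + g) k).
Local Notation F := (form K (g + g)).
Implicit Types (S : {set 'I_(g + g)}) (y : F).

Definition x2f k (x : extV k) : F := [ffun S : {set 'I_(g + g)} => ecoef x S].
Definition f2x k y : extV k := [ffun S : ksubset (g + g) k => y (val S)].

Lemma x2fE k (x : extV k) S : x2f x S = ecoef x S. Proof. by rewrite ffunE. Qed.

Lemma x2f_linear k : linear (@x2f k).
Proof. by move=> a x y; apply/ffunP => S; rewrite formD formZ !x2fE ecoef_linear. Qed.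
HB.instance Definition _ k := GRing.isLinear.Build K (extV k) F *:%R (@x2f k) (@x2f_linear k).

Lemma f2x_linear k : linear (@f2x k).
Proof. by move=> a x y; apply/ffunP => S; rewrite !ffunE. Qed.
HB.instance Definition _ k := GRing.isLinear.Build K F (extV k) *:%R (@f2x k) (@f2x_linear k).

Lemma x2fK k : cancel (@x2f k) (@f2x k).
Proof. by move=> x; apply/ffunP => S; rewrite ffunE x2fE ecoefE. Qed.

Lemma f2xK k y : (forall S, #|S| != k -> y S = 0) -> x2f (f2x k y) = y.
Proof.
move=> yk; apply/ffunP => S; rewrite x2fE; have [Sk|Sk] := boolP (#|S| == k); last by rewrite ecoef_out // yk.
by rewrite -[S](insubdK (exist _ S Sk : ksubset (g + g) k) Sk) ecoefE ffunE.
Qed.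

Lemma x2f_out k (x : extV k) S : #|S| != k -> x2f x S = 0.
Proof. by move=> Sk; rewrite x2fE ecoef_out. Qed.

Lemma x2f_wedge1 k l i (x : extV k) : l = k.+1 -> x2f (wedge1 l i x) = ew i (x2f x).
Proof. by move=> lk; apply/ffunP => S; rewrite x2fE ecoef_wedge1 // ewE x2fE. Qed.

Lemma x2f_dextV k l (x : extV k) : l = k.+1 -> x2f (dextV X l x) = Aw X (x2f x).
Proof. by move=> lk; rewrite linear_sum; apply: eq_bigr => i; rewrite linearZ /= x2f_wedge1. Qed.

Lemma x2f_omega k (x : extV k) : x2f (omega_wedge x) = om (x2f x).
Proof. by rewrite linear_sum; apply: eq_bigr => i /=; rewrite !x2f_wedge1. Qed.

Lemma mem_omega k (x : extV k) : x \in span_pred (@omega_ideal K g k) <->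
  exists2 w : F, (forall S, #|S|.+2 != k -> w S = 0) & x2f x = om w.
Proof.
split=> [/span_predP|[w]].
  elim=> [|a y z yI _ [w wk wE]]; first by exists 0 => [S|]; rewrite ?form0 // !linear0.
  rewrite linearP /= wE; have [v vk vE] : exists2 v : F, (forall S, #|S|.+2 != k -> v S = 0) & x2f y = om v.
    case: k y yI {x z wk wE} => [|[|k]] y.
    - by move=> ->; exists 0 => [S|]; rewrite ?form0 // !linear0.
    - by move=> ->; exists 0 => [S|]; rewrite ?form0 // !linear0.
    - move=> [v _ <-]; exists (x2f v); [move=> S; exact: x2f_out|exact: x2f_omega].
  exists (a *: v + w) => [S Sk|]; first by rewrite formD formZ vk // wk // mulr0 addr0.
  by rewrite vE linearP.
case: k x => [|[|k]] x wk E.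
- have w0 : w = 0 by apply/ffunP => S; rewrite wk ?form0.
  by rewrite -[x]x2fK E w0 !linear0 rpred0.
- have w0 : w = 0 by apply/ffunP => S; rewrite wk ?form0.
  by rewrite -[x]x2fK E w0 !linear0 rpred0.
- apply: in_span_self; exists (f2x k w) => //; rewrite -[LHS]x2fK -[RHS]x2fK; congr f2x.
  by rewrite x2f_omega f2xK.
Qed.

End ExtForms.

Section DWExact.
Variables (D : comNzRingType) (g : nat) (X : 'I_g -> D) (dv : 'I_g -> D -> D) (sc : nat -> D -> D).
Hypotheses (dvB : forall i p (q : D), dv i (p - q) = dv i p - dv i q) (dvX : forall i j p, dv j (X i * p) = (if i == j then p else 0) + X i * dv j p)
  (scB : forall n p (q : D), sc n (p - q) = sc n p - sc n q)
  (sc_mul : forall n i p, sc n (X i * p) = X i * sc n.+1 p)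
  (sc_eul : forall n p, (0 < n)%N -> sc n (\sum_i X i * dv i p + n%:R * p) = p)
  (char0 : forall m (v : D), m.+1%:R * v = 0 -> v = 0).

Lemma DW_eq0 k (x : ext D (g + g) k) : qclass (@omega_ideal D g k) x = 0 <->
  exists2 w : form D (g + g), (forall S : {set 'I_(g + g)}, #|S|.+2 != k -> w S = 0) & x2f x = om w.
Proof. rewrite -[0](linear0 (qclass (@omega_ideal D g k))) qclass_eq subr0; exact: mem_omega. Qed.

Lemma dW_exact (a b c : nat) : b = a.+1 -> c = b.+1 -> (b < g)%N -> forall q : DW D g b,
  dW X c q = 0 <-> exists p : DW D g a, dW X b p = q.
Proof.
move=> ba cb bg; split=> [|[p <-]]; last first.
  rewrite !dWE; apply/DW_eq0; exists 0 => [S|]; first by rewrite form0.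
  by rewrite !x2f_dextV // Aw_Aw0 linear0.
rewrite -[q]qreprK; rewrite dWE => /DW_eq0[w wk E]; rewrite x2f_dextV // in E.
have [||z [v [xE zk vk]]] := DW_forms_exact dvB dvX scB sc_mul sc_eul char0 bg _ _ E.
- move=> S; exact: x2f_out.
- by move=> S Sk; apply: wk; rewrite cb.
exists (qclass _ (f2x a z)); rewrite dWE; apply/qclass_eq/mem_omega; exists (- v) => [S Sk|].
  by rewrite formN vk ?oppr0.
rewrite linearB /= x2f_dextV // f2xK => [|S Sk]; last by apply: zk; rewrite ba.
by rewrite xE opprD addrA subrr sub0r linearN.
Qed.

Lemma dW_inj : (0 < g)%N -> injective (dW X 1 : DW D g 0 -> DW D g 1).
Proof.
move=> g0 p q /eqP; rewrite -subr_eq0 -linearB => /eqP; rewrite -[p]qreprK -[q]qreprK -linearB /= dWE.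
move=> /DW_eq0[w wk E]; rewrite x2f_dextV // in E; have w0 : w = 0 by apply/ffunP => S; rewrite wk ?form0.
rewrite w0 linear0 in E; have [|z [zE zk]] := koszul_exact dvB dvX scB sc_mul sc_eul g0 _ E; first by move=> S; exact: x2f_out.
have z0 : z = 0 by apply/ffunP => S; rewrite zk ?form0.
apply/eqP; rewrite -subr_eq0 -linearB; apply/eqP/DW_eq0; exists 0 => [S|]; first by rewrite form0.
by rewrite zE z0 !linear0.
Qed.

End DWExact.

(** * Euler operator on polynomials *)

Section PolynomialKoszul.
Variables (C : numFieldType) (g : nat).
Local Notation D := (mpoly g C).
Implicit Types (p : D).

Definition xv (i : 'I_g) : D := mpolyX C (mnm1 i).

(** The inverse of k plus the Euler operator, for k > 0 ([sc_euler]). *)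
Definition sc (k : nat) p : D := \sum_(m <- msupp p) ((k + mdeg m)%:R^-1 * mcoeff m p) *: mpolyX C m.

Lemma mcoeff_sc k p m : mcoeff m (sc k p) = (k + mdeg m)%:R^-1 * mcoeff m p.
Proof.
rewrite raddf_sum /= (eq_bigr (fun m' => if m' == m then (k + mdeg m)%:R^-1 * mcoeff m p else 0)) => [|m']; last first.
  by rewrite mcoeffZ mcoeffX; case: eqP => [->|_]; rewrite ?mulr1 ?mulr0.
rewrite -big_mkcond; have [mp|mp] := boolP (m \in msupp p).
  rewrite big_mkcond (bigD1_seq m) //= eqxx big1 ?addr0 // => m' /negbTE -> //.
by rewrite -mcoeff_eq0 in mp; rewrite (eqP mp) mulr0 big1.
Qed.

Lemma sc_linear k : linear (sc k).
Proof. by move=> a p q; apply/mpolyP => m; rewrite mcoeffD mcoeffZ !mcoeff_sc mcoeffD mcoeffZ mulrDr mulrCA. Qed.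
HB.instance Definition _ k := GRing.isLinear.Build C D D *:%R (sc k) (sc_linear k).

Lemma sc_X k m : sc k (mpolyX C m) = (k + mdeg m)%:R^-1 *: mpolyX C m.
Proof. by apply/mpolyP => m'; rewrite mcoeff_sc mcoeffZ mcoeffX; case: eqP => [->|_]; rewrite ?mulr0. Qed.

Lemma sc_mulX k i p : sc k (xv i * p) = xv i * sc k.+1 p.
Proof.
elim/mpolyind: p => [|c m p _ _ IH]; first by rewrite mulr0 !linear0 mulr0.
rewrite mulrDr [RHS](_ : _ = xv i * (c *: sc k.+1 (mpolyX C m)) + xv i * sc k.+1 p); last by rewrite linearP mulrDr.
rewrite linearD /= IH; rewrite -!scalerAr linearZ.
rewrite /= sc_X -scalerAr -mpolyXD sc_X mdegD mdeg1 addnA addn1; exact: erefl.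
Qed.

Lemma sc_euler k p : (0 < k)%N -> sc k (\sum_i xv i * mderiv i p + k%:R *: p) = p.
Proof.
move=> k0; elim/mpolyind: p => [|c m p _ _ IH].
  by rewrite scaler0 addr0 big1 ?linear0 // => i; rewrite mderiv0 mulr0.
rewrite -[in RHS]IH (eq_bigr (fun i => c *: (xv i * mderiv i (mpolyX C m)) + xv i * mderiv i p)) => [|i]; last first.
  by rewrite mderivD mderivZ mulrDr scalerAr.
rewrite big_split -scaler_sumr scalerDr addrACA linearD; congr (_ + _).
have -> : \sum_i xv i * mderiv i (mpolyX C m) = (mdeg m)%:R *: mpolyX C m.
  rewrite mdegE natr_sum scaler_suml; apply: eq_bigr => i; rewrite mderivX -scalerAr -mpolyXD.
  have [->|mi] := eqVneq (m i) 0%N; first by rewrite !scale0r.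
  by rewrite addmC submK // lep1mP.
rewrite !scalerA -scalerDl linearZ /= sc_X scalerA; congr (_ *: _).
have nz : (k + mdeg m)%:R != 0 :> C by rewrite pnatr_eq0; lia.
by rewrite natrD in nz; field.
Qed.

Lemma mderiv_xv i j p : mderiv j (xv i * p) = (if i == j then p else 0) + xv i * mderiv j p.
Proof.
rewrite mderivM; rewrite mderivX mnm1E; case: eqVneq => [->|_]; last by rewrite scale0r mul0r.
by rewrite scale1r (_ : _ _ = mnm0) ?mpolyX0 ?mul1r //; apply/mnmP => k; rewrite mnmBE mnm0E subnn.
Qed.

Lemma sc_euler_mul k p : (0 < k)%N -> sc k (\sum_i xv i * mderiv i p + k%:R * p) = p.
Proof. by move=> k0; rewrite -[RHS](sc_euler p k0) mulr_natl scaler_nat. Qed.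

Lemma mpoly_char0 m p : m.+1%:R * p = 0 -> p = 0.
Proof. by move=> /eqP; rewrite mulf_eq0 -mpolyC_nat mpolyC_eq0 pnatr_eq0 => /eqP. Qed.

Lemma sc_sub k p (q : D) : sc k (p - q) = sc k p - sc k q. Proof. ring. Qed.
Lemma mderiv_sub i p (q : D) : mderiv i (p - q) = mderiv i p - mderiv i q. Proof. ring. Qed.

End PolynomialKoszul.

(** * Bases and free modules *)

Section LinearCombinations.
Variables (K : nzRingType) (M : lmodType K).

Lemma malg_ext (I : choiceType) (V : zmodType) (p q : malg I K -> V) :
  {morph p : x y / x + y} -> {morph q : x y / x + y} -> p 0 = 0 -> q 0 = 0 ->
  (forall i a, p (mkmalgU i a) = q (mkmalgU i a)) -> forall c, p c = q c.
Proof.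
move=> pD qD p0 q0 E c; rewrite (monalgE c) (big_morph p pD p0) (big_morph q qD q0).
by apply: eq_bigr.
Qed.

Lemma lincombE (I : choiceType) (b : I -> M) (A : seq I) (c : malg I K) : uniq A -> (forall i, i \notin A -> monalg.mcoeff i c = 0) ->
  lincomb b c = \sum_(i <- A) monalg.mcoeff i c *: b i.
Proof.
move=> uA cA; rewrite [RHS](bigID (fun i => i \in monalg.msupp c)) /= [X in _ + X]big1 ?addr0 => [|i]; last first.
  by rewrite -monalg.mcoeff_eq0 => /eqP ->; rewrite scale0r.
rewrite -[RHS]big_filter; apply: perm_big; apply: uniq_perm => [||i]; [exact: fset_uniq|exact: filter_uniq|].
rewrite mem_filter; case: (boolP (i \in monalg.msupp c)) => //= ic; symmetry; apply: contraTT ic => /cA /eqP.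
by rewrite monalg.mcoeff_eq0.
Qed.

Lemma lincombD (I : choiceType) (b : I -> M) : {morph lincomb b : x y / x + y}.
Proof.
move=> x y; pose A := undup ((monalg.msupp x : seq I) ++ (monalg.msupp y : seq I)); have uA : uniq A by exact: undup_uniq.
have Ax i : i \notin A -> monalg.mcoeff i x = 0.
  by rewrite mem_undup mem_cat negb_or -!monalg.mcoeff_eq0 => /andP[/eqP].
have Ay i : i \notin A -> monalg.mcoeff i y = 0.
  by rewrite mem_undup mem_cat negb_or -!monalg.mcoeff_eq0 => /andP[_ /eqP].
rewrite (lincombE b uA Ax) (lincombE b uA Ay) (lincombE b uA) => [|i iA]; last by rewrite monalg.mcoeffD Ax // Ay // addr0.
by rewrite -big_split; apply: eq_bigr => i; rewrite monalg.mcoeffD scalerDl.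
Qed.

Lemma lincomb0 (I : choiceType) (b : I -> M) : lincomb b 0 = 0.
Proof. by rewrite /lincomb big1 // => i; rewrite monalg.mcoeff0 scale0r. Qed.

Lemma lincombU (I : choiceType) (b : I -> M) i a : lincomb b (mkmalgU i a) = a *: b i.
Proof.
rewrite (@lincombE _ b [:: i]) // => [|j]; last by rewrite inE mcoeffU eq_sym => /negbTE ->.
by rewrite big_seq1 mcoeffU eqxx.
Qed.

Definition fin_basis (r : nat) (b : 'I_r -> M) :=
  (forall q, exists c : 'I_r -> K, q = \sum_j c j *: b j) /\
  (forall c : 'I_r -> K, \sum_j c j *: b j = 0 -> forall j, c j = 0).

Lemma lincomb_sum (I : choiceType) (b : I -> M) (J : Type) (s : seq J) (h : J -> I) (a : J -> K) :
  lincomb b (\sum_(j <- s) mkmalgU (h j) (a j)) = \sum_(j <- s) a j *: b (h j).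
Proof. rewrite (big_morph _ (lincombD b) (lincomb0 b)); apply: eq_bigr => j _; exact: lincombU. Qed.

Lemma fin_basis_free r (b : 'I_r -> M) : fin_basis b -> free_module M.
Proof.
move=> [bS bI]; exists 'I_r, b; split; last first.
  apply/seteqP; split => // q; have [c] := bS q.
  by exists (\sum_(j <- index_enum 'I_r) mkmalgU j (c j)) => //; rewrite lincomb_sum.
have E c : lincomb b c = \sum_j monalg.mcoeff j c *: b j.
  apply: (@malg_ext 'I_r M (lincomb b) (fun c => \sum_j monalg.mcoeff j c *: b j)) => [||||i a].
  - exact: lincombD.
  - by move=> x y; rewrite -big_split; apply: eq_bigr => j; rewrite monalg.mcoeffD scalerDl.
  - exact: lincomb0.
  - by rewrite big1 // => j; rewrite monalg.mcoeff0 scale0r.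
  rewrite lincombU (bigD1 i) //= big1 => [|j ji]; first by rewrite mcoeffU eqxx addr0.
  by rewrite mcoeffU eq_sym (negbTE ji) scale0r.
move=> x y; rewrite !E => /eqP; rewrite -subr_eq0 -sumrB => /eqP H.
have {}H : \sum_j (monalg.mcoeff j x - monalg.mcoeff j y) *: b j = 0.
  by rewrite -[RHS]H; apply: eq_bigr => j; rewrite scalerBl.
apply/malgP => j; apply/eqP; rewrite -subr_eq0; apply/eqP; exact: bI H j.
Qed.

End LinearCombinations.

Lemma free_prod (K : nzRingType) (M : lmodType K) (T : choiceType) (r : nat) (b : 'I_r -> M) :
  fin_basis b -> free_module (M * malg T K)%type.
Proof.
move=> [bS bI]; pose N : lmodType K := (M * malg T K)%type.
pose e (i : 'I_r + T) : N := match i with inl j => (b j, 0) | inr t => (0, mkmalgU t 1) end.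
have UZ t (a : K) : a *: mkmalgU t 1 = mkmalgU t a :> malg T K.
  by apply/malgP => k; rewrite monalg.mcoeffZ !mcoeffU; case: eqP; rewrite ?mulr1 ?mulr0.
exists ('I_r + T)%type, e; split; last first.
  apply/seteqP; split => // -[q y]; have [c] := bS q.
  exists (\sum_(j <- index_enum 'I_r) mkmalgU (inl j) (c j) + \sum_(t <- monalg.msupp y) mkmalgU (inr t) (monalg.mcoeff t y)) => //.
  rewrite lincombD !lincomb_sum; apply/pair_eqP/andP; split; apply/eqP => /=.
    rewrite !raddf_sum /= [X in _ + X]big1 => [|t]; last by rewrite scaler0.
    by rewrite addr0.
  rewrite !raddf_sum /= [X in X + _]big1 => [|t]; last by rewrite scaler0.
  by rewrite add0r [RHS]monalgE; apply: eq_bigr.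
have E1 c : (lincomb e c).1 = \sum_j monalg.mcoeff (inl j) c *: b j.
  apply: (@malg_ext K ('I_r + T)%type M (fun c => (lincomb e c).1) (fun c => \sum_j monalg.mcoeff (inl j) c *: b j)) => [||||[i|t] a].
  - by move=> x y; rewrite lincombD.
  - by move=> x y; rewrite -big_split; apply: eq_bigr => j; rewrite monalg.mcoeffD scalerDl.
  - by rewrite lincomb0.
  - by rewrite big1 // => j; rewrite monalg.mcoeff0 scale0r.
  - rewrite lincombU (bigD1 i) //= big1 => [|j ji]; first by rewrite mcoeffU eqxx addr0.
    by rewrite mcoeffU (_ : (inl i == inl j) = (i == j)) // eq_sym (negbTE ji) scale0r.
  - by rewrite lincombU /= scaler0 big1 // => j; rewrite mcoeffU scale0r.
have E2 t c : monalg.mcoeff t (lincomb e c).2 = monalg.mcoeff (inr t) c.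
  apply: (@malg_ext K ('I_r + T)%type K (fun c => monalg.mcoeff t (lincomb e c).2) (fun c => monalg.mcoeff (inr t) c)) => [||||[i|t'] a].
  - by move=> x y; rewrite lincombD monalg.mcoeffD.
  - by move=> x y; rewrite monalg.mcoeffD.
  - by rewrite lincomb0 monalg.mcoeff0.
  - by rewrite monalg.mcoeff0.
  - by rewrite lincombU /= scaler0 monalg.mcoeff0 mcoeffU.
  - by rewrite lincombU /= UZ !mcoeffU.
move=> x y H; apply/malgP => -[j|t]; last by rewrite -!E2 H.
have H1 : \sum_j (monalg.mcoeff (inl j) x - monalg.mcoeff (inl j) y) *: b j = 0.
  transitivity ((lincomb e x).1 - (lincomb e y).1); last by rewrite H subrr.
  by rewrite !E1 -sumrB; apply: eq_bigr => k; rewrite scalerBl.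
apply/eqP; rewrite -subr_eq0; apply/eqP; exact: bI H1 j.
Qed.

(** A splitting of the cokernel expressed by matrix identities, which survive every ring morphism
    out of the field. *)
Lemma coker_split (C : fieldType) (a n : nat) (M : 'M[C]_(a, n)) :
  exists (r : nat) (B : 'M[C]_(r, n)) (P : 'M[C]_(n, r)) (Q : 'M[C]_(n, a)),
    [/\ (B *m P = 1%:M)%R, (M *m P = 0)%R & (1%:M = Q *m M + P *m B)%R].
Proof.
pose N := cokermx M; pose P := col_base N; exists (\rank N), (pinvmx P), P.
have BP : pinvmx P *m P = 1%:M by apply: mulVpmx; exact: col_base_full.
have : M *m P = 0.
  apply: (row_free_inj (row_base_free N)); rewrite mul0mx -mulmxA mulmx_base; exact: mulmx_coker.
have : (1%:M - P *m pinvmx P <= M)%MS.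
  rewrite submxE -/N -[N in X in _ *m X]mulmx_base mulmxA mulmxBl mul1mx -mulmxA BP mulmx1 subrr mul0mx //.
by move=> /submxP[Q QE]; exists Q; rewrite -QE subrK.
Qed.

Section FreeDW.
Variables (C : fieldType) (D : comNzRingType) (iota : {rmorphism C -> D}) (g : nat).
Local Notation S2 := {set 'I_(g + g)}.

Definition dl (K : comPzRingType) (T : S2) : form K (g + g) := [ffun S : S2 => (S == T)%:R].

Lemma dlE (K : comPzRingType) (T S : S2) : dl K T S = (S == T)%:R. Proof. by rewrite ffunE. Qed.

Lemma form_dl (K : comPzRingType) (w : form K (g + g)) : w = \sum_T w T *: dl K T.
Proof.
apply/ffunP => S; rewrite form_sum (bigD1 S) //= big1 ?addr0 => [|T /negbTE TS].
  by rewrite formZ dlE eqxx mulr1.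
by rewrite formZ dlE eq_sym TS mulr0.
Qed.

Lemma om_dl_iota (T S : S2) : om (dl D T) S = iota (om (dl C T) S).
Proof.
have dE : dl D T = fmap iota (dl C T) by apply/ffunP => U; rewrite fmapE !dlE rmorph_nat.
have fw (i : 'I_(g + g)) (x : form C (g + g)) : fmap iota (ew i x) = ew i (fmap iota x).
  by apply: fmap_ew => [|U]; rewrite ?rmorph0 ?rmorphN.
rewrite dE !form_sum rmorph_sum; apply: eq_bigr => i.
by rewrite -!fw fmapE.
Qed.

(** omega /\ - has constant coefficients, so its image is spanned over D by the rows of a matrix
    over C, and a splitting over C extends to D. *)
Lemma DW_fin_basis k : exists r (b : 'I_r -> DW D g k), fin_basis b.
Proof.
pose #|{: ksubset (g + g) k}|; pose a := #|{: S2}|.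
pose M : 'M[C]_(a, n) := \matrix_(t, s) if (#|(enum_val t : S2)|.+2 == k)%N then om (dl C (enum_val t)) (val (enum_val s)) else 0.
pose vec (x : ext D (g + g) k) : 'rV[D]_n := \row_s x (enum_val s).
pose unv (v : 'rV[D]_n) : ext D (g + g) k := [ffun S => v 0 (enum_rank S)].
have vecK v : vec (unv v) = v by apply/rowP => s; rewrite mxE ffunE enum_valK.
have vecB x y : vec (x - y) = vec x - vec y by apply/rowP => s; rewrite !mxE !ffunE.
pose MD := map_mx iota M.
have memM x : x \in span_pred (@omega_ideal D g k) <-> exists u, vec x = u *m MD.
  rewrite mem_omega; split=> [[w wk E]|[u E]].
    exists (\row_t w (enum_val t)); apply/rowP => s; rewrite !mxE -ecoefE -x2fE E {1}(form_dl w) linear_sum form_sum.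
    rewrite (reindex (@enum_val S2 (mem S2))); last by exists enum_rank => ?; rewrite ?enum_valK ?enum_rankK.
    apply: eq_bigr => t; rewrite linearZ formZ !mxE; case: ifPn => h; first by rewrite om_dl_iota.
    by rewrite wk // mul0r rmorph0 mulr0.
  exists [ffun T : S2 => if (#|T|.+2 == k)%N then u 0 (enum_rank T) else 0] => [S /negbTE h|]; first by rewrite ffunE h.
  set w := finfun _; apply/ffunP => S; rewrite x2fE.
  have [Sk|Sk] := boolP (#|S| == k); last first.
    rewrite ecoef_out // form_sum big1 // => i; rewrite !ewE !inE alpha_beta.
    case: ifP => // iS; case: ifP => jS; last by rewrite mulr0.
    rewrite ffunE; case: ifP => h; last by rewrite !mulr0.
    move: Sk; rewrite (cardsD1 (beta i)) iS (cardsD1 (alpha i)) !inE alpha_beta jS add1n.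
    by rewrite (eqP h) eqxx.
  have -> : S = val (exist _ S Sk : ksubset (g + g) k) by [].
  rewrite ecoefE; have := congr1 (fun v : 'rV[D]_n => v 0 (enum_rank (exist _ S Sk : ksubset (g + g) k))) E.
  rewrite !mxE enum_rankK => ->; rewrite {1}(form_dl w) linear_sum form_sum.
  rewrite [RHS](reindex (@enum_val S2 (mem S2))); last by exists enum_rank => ?; rewrite ?enum_valK ?enum_rankK.
  apply: eq_bigr => t; rewrite linearZ formZ !mxE enum_rankK ffunE enum_valK om_dl_iota.
  by case: ifP; rewrite ?rmorph0 ?mulr0 ?mul0r.
have [r [B [P [Q [BP MP QP]]]]] := coker_split M.
pose BD := map_mx iota B; pose PD := map_mx iota P; pose QD := map_mx iota Q.
have BPD : BD *m PD = 1%:M by rewrite -map_mxM BP map_mx1.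
have MPD : MD *m PD = 0 by rewrite -map_mxM MP map_mx0.
have QPD : 1%:M = QD *m MD + PD *m BD by rewrite -!map_mxM -map_mxD -QP map_mx1.
exists r, (fun j => qclass (@omega_ideal D g k) (unv (row j BD))).
have lc (c : 'I_r -> D) : \sum_j c j *: qclass (@omega_ideal D g k) (unv (row j BD)) = qclass (@omega_ideal D g k) (unv ((\row_j c j) *m BD)).
  rewrite (eq_bigr (fun j => qclass (@omega_ideal D g k) (c j *: unv (row j BD)))) => [|j]; last by rewrite linearZ.
  rewrite -linear_sum; congr qclass; apply/ffunP => S; rewrite sum_ffunE ffunE mxE.
  by apply: eq_bigr => j; rewrite !ffunE !mxE.
split=> [q|c].
  exists (fun j => (vec (qrepr q) *m PD) 0 j); rewrite lc -[LHS]qreprK; apply/qclass_eq/memM.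
  exists (vec (qrepr q) *m QD); rewrite vecB vecK.
  have -> : \row_j (vec (qrepr q) *m PD) 0 j = vec (qrepr q) *m PD by apply/rowP => j; rewrite mxE.
  rewrite -{1}[vec (qrepr q)]mulmx1 QPD mulmxDr !mulmxA addrK //.
rewrite lc -[RHS](linear0 (qclass (@omega_ideal D g k))) => /qclass_eq; rewrite subr0 => /memM[u].
rewrite vecK => /(congr1 (mulmx^~ PD)); rewrite -!mulmxA BPD MPD mulmx1 mulmx0 => H j.
by have := congr1 (fun v : 'rV[D]_r => v 0 j) H; rewrite !mxE.
Qed.

End FreeDW.

(** * Products of one-forms as iterated substitutions *)

Section WedgeSequences.
Variables (K : comPzRingType) (g : nat).
Local Notation F := (form K (g + g)).
Local Notation be i := (@ew K (g + g) (beta i)).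
Local Notation al i := (@ew K (g + g) (alpha i)).
Implicit Types (x y z : F) (S T : {set 'I_(g + g)}) (h : 'I_g -> 'I_g -> K).

Lemma iter_Mw_be h i (m : nat) y : iter m.+1 (Mw h) (be i y) = m.+1%:R *: Aw (h i) (iter m (Mw h) y) + be i (iter m.+1 (Mw h) y).
Proof.
elim: m => [|m IH]; first by rewrite /= scale1r Mw_be.
rewrite [iter m.+2 _ (be i y)]iterS IH linearD linearZ /= Mw_Aw Mw_be addrA.
by rewrite -[m.+2]addn1 natrD scalerDl scale1r.
Qed.

(** A derivation applied as often as there are betas must hit each of them once, in any order: hence
    the factorial. *)
Lemma iter_Mw_bes h (L : seq 'I_g) y : Mw h y = 0 ->
  iter (size L) (Mw h) (foldr (fun i x => be i x) y L) = (size L)`!%:R *: foldr (fun i x => Aw (h i) x) y L /\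
  iter (size L).+1 (Mw h) (foldr (fun i x => be i x) y L) = 0.
Proof.
move=> y0; elim: L => [|i L [IH1 IH2]]; first by rewrite scale1r.
rewrite [foldr _ y (i :: L)]/= !iter_Mw_be; split.
  by rewrite IH1 IH2 linear0 addr0 linearZ scalerA natrM.
by rewrite IH2 iterS IH2 !linear0 addr0.
Qed.

Lemma ew_dl (i : 'I_(g + g)) T : (forall j, j \in T -> (i < j)%N) -> ew i (dl K T) = dl K (i |: T)%SET.
Proof.
move=> iT; have niT : i \notin T by apply/negP => /iT; rewrite ltnn.
apply/ffunP => S; rewrite ewE !dlE; case: ifPn => iS; last first.
  by case: eqVneq iS => // ->; rewrite finset.setU11.
have -> : (S :\ i == T) = (S == (i |: T)%SET).
  by apply/eqP/eqP => [<-|->]; rewrite ?finset.setD1K // finset.setU1K.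
case: eqP => [->|_]; last by rewrite mulr0.
rewrite mulr1 /esgn (_ : #|_| = 0%N) //; apply: eq_card0 => j; rewrite !inE.
apply/negbTE; case: eqVneq => [->|_]; rewrite ?ltnn //; apply/negP => /andP[/iT]; lia.
Qed.

Lemma foldr_ew_dl (L : seq 'I_(g + g)) : sorted (fun i j : 'I_(g + g) => (i < j)%N) L ->
  foldr (fun i x => ew i x) (dl K finset.set0) L = dl K [set i in L]%SET.
Proof.
elim: L => [|i L IH] sL; first by [].
rewrite /= IH; last exact: path_sorted sL.
rewrite ew_dl => [|j]; first by congr dl; apply/finset.setP => j; rewrite !inE.
rewrite inE; have tr : transitive (fun i j : 'I_(g + g) => (i < j)%N) by move=> c; exact: ltn_trans.
have /allP := order_path_min tr sL; exact.
Qed.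

Lemma sorted_enum (n : nat) (A : {set 'I_n}) : sorted (fun i j : 'I_n => (i < j)%N) (enum A).
Proof.
rewrite /enum_mem; apply: sorted_filter; first by move=> c; exact: ltn_trans.
by have := iota_ltn_sorted 0 n; rewrite -val_enum_ord sorted_map -enumT.
Qed.

Lemma dl_foldr S : dl K S = foldr (fun i x => be i x) (foldr (fun i x => al i x) (dl K finset.set0) (enum (alpha_part S))) (enum (beta_part S)).
Proof.
pose L := [seq beta i | i <- enum (beta_part S)] ++ [seq alpha i | i <- enum (alpha_part S)].
have SL : S = [set i in L]%SET.
  apply/finset.setP => j; rewrite inE mem_cat; case: (split_ordP j) => k ->.
    rewrite (mem_map (@lshift_inj _ _)) mem_enum inE; case: (_ \in S) => //=.
    by symmetry; apply/negbTE/negP => /mapP[l _ /eqP]; rewrite eq_lrshift.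
  rewrite (mem_map (@rshift_inj _ _)) mem_enum inE orbC; case: (_ \in S) => //=.
  by symmetry; apply/negbTE/negP => /mapP[l _ /eqP]; rewrite eq_rlshift.
rewrite {1}SL -foldr_ew_dl; last first.
  have tr (n : nat) : transitive (fun i j : 'I_n => (i < j)%N) by move=> c; exact: ltn_trans.
  rewrite (sorted_pairwise (tr _)) pairwise_cat -!(sorted_pairwise (tr _)) !sorted_map; apply/and3P; split.
  - apply/allrelP => _ _ /mapP[i _ ->] /mapP[j _ ->] /=; have := ltn_ord i; lia.
  - exact: sorted_enum.
  - by apply: sub_sorted (sorted_enum _) => j /= ij; rewrite ltn_add2l.
by rewrite foldr_cat !foldr_map.
Qed.

(** Forms in the dz_i, as they occur in [Wfun], become the beta-free forms on V. *)
Definition emb (k : nat) (x : ext K g k) : F := [ffun T : {set 'I_(g + g)} => if beta_part T == finset.set0 then ecoef x (alpha_part T) else 0].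

Lemma embE k (x : ext K g k) T : emb x T = if beta_part T == finset.set0 then ecoef x (alpha_part T) else 0.
Proof. by rewrite ffunE. Qed.

Lemma emb_linear k : linear (@emb k).
Proof. by move=> a x y; apply/ffunP => S; rewrite formD formZ !embE; case: ifP; rewrite ?ecoef_linear ?mulr0 ?addr0. Qed.
HB.instance Definition _ k := GRing.isLinear.Build K (ext K g k) F *:%R (@emb k) (@emb_linear k).

Lemma emb_wedge1 k l i (x : ext K g k) : l = k.+1 -> emb (wedge1 l i x) = al i (emb x).
Proof.
move=> lk; apply/ffunP => S; rewrite ewE !embE ecoef_wedge1 // inE.
have bE : beta_part (S :\ alpha i) = beta_part S by apply/finset.setP => j; rewrite !inE beta_alpha.
have aE : alpha_part (S :\ alpha i) = alpha_part S :\ i by apply/finset.setP => j; rewrite !inE alpha_eq.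
rewrite bE aE; case: ifPn => b0; last by rewrite mulr0 if_same.
case: ifP => // iS; congr (_ * _); congr (_ _).
rewrite -(card_imset _ (@rshift_inj g g)); apply: eq_card => j; rewrite !inE.
apply/imsetP/andP => [[k' + ->]|[jS ji]]; first by rewrite !inE => /andP[?]; rewrite ltn_add2l.
case: (split_ordP j) jS ji => k' -> jS.
  by have := eqP b0 => /finset.setP/(_ k'); rewrite !inE jS.
by exists k' => //; rewrite !inE; apply/andP; move: ji; rewrite ltn_add2l.
Qed.

Lemma emb_wedge k l (v : 'I_g -> K) (x : ext K g k) : l = k.+1 -> emb (wedge l v x) = Aw v (emb x).
Proof. by move=> lk; rewrite linear_sum; apply: eq_bigr => i; rewrite linearZ /= emb_wedge1. Qed.

Lemma emb_wedge_seq (s : seq ('I_g -> K)) : emb (wedge_seq s) = foldr (fun v x => Aw v x) (dl K finset.set0) s.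
Proof.
elim: s => [|v s IH]; last by rewrite emb_wedge // IH.
apply/ffunP => S; rewrite embE dlE.
have [S0|S0] := eqVneq S.
  have -> : beta_part S == finset.set0 by apply/eqP/finset.setP => j; rewrite S0 !inE.
  have -> : alpha_part S = finset.set0 by apply/finset.setP => j; rewrite S0 !inE.
  have h : #|(finset.set0 : {set 'I_g})| == 0%N by rewrite cards0.
  by rewrite -[finset.set0]/(val (exist (fun U : {set 'I_g} => #|U| == 0%N) finset.set0 h)) ecoefE ffunE.
case: ifP => // /eqP b0; rewrite ecoef_out //; apply: contra S0; rewrite cards_eq0 => /eqP a0.
apply/eqP/eqP; rewrite -cards_eq0 card_parts b0 a0 !cards0 //.
Qed.

Definition atop : {set 'I_(g + g)} := [set j : 'I_(g + g) | (g <= j)%N].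

Lemma alpha_atop i : alpha i \in atop. Proof. by rewrite inE leq_addr. Qed.
Lemma beta_atop i : beta i \notin atop. Proof. by rewrite inE /= -ltnNge. Qed.
Lemma beta_part_atop : beta_part atop = finset.set0.
Proof. by apply/finset.setP => i; rewrite inE (negbTE (beta_atop i)) inE. Qed.
Lemma alpha_part_atop : alpha_part atop = [set: 'I_g]%SET.
Proof. by apply/finset.setP => i; rewrite !inE; have := alpha_atop i; rewrite inE. Qed.
Lemma om_atop y : om y atop = 0.
Proof. by rewrite form_sum big1 // => i; rewrite ewE (negbTE (beta_atop i)). Qed.
Lemma bideg_atop S : bideg 0 g S -> S = atop.
Proof.
move=> /andP[/eqP b0 /eqP ag]; apply/finset.setP => j; case: (split_ordP j) => k ->.
  rewrite (negbTE (beta_atop k)); apply/negbTE/negP => h.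
  have : beta_part S = finset.set0 by apply/eqP; rewrite -cards_eq0; lia.
  by move/finset.setP/(_ k); rewrite !inE h.
rewrite (alpha_atop); have : alpha_part S = [set: 'I_g]%SET.
  apply/eqP; rewrite eqEcard finset.subsetT /= cardsT card_ord; by case: ag => ->.
by move/finset.setP/(_ k); rewrite !inE.
Qed.

End WedgeSequences.

Lemma ew_comb (K : comPzRingType) (n : nat) (k : 'I_n) (u v : K) (x y : form K n) :
  ew k ([ffun S : {set 'I_n} => y S + u * (v * x S)] : form K n) = ew k y + u *: (v *: ew k x).
Proof.
apply/ffunP => S; rewrite formD !formZ !ewE ffunE; case: ifP => _; last by rewrite !mulr0 addr0.
ring.
Qed.

Lemma hom_dl_atop (K : comPzRingType) (g : nat) (c : K) : hom 0 g%:Z (c *: dl K (atop g)).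
Proof.
move=> S; rewrite formZ dlE; case: eqP => [->|_ _]; last exact: mulr0.
by rewrite /bideg beta_part_atop alpha_part_atop cards0 cardsT card_ord !eqxx.
Qed.

Lemma lin_diff (K : comPzRingType) (a h k s t : K) : a * h + k - (a * s + t) = a * (h - s) + (k - t).
Proof. ring. Qed.

Lemma ew_subs (K : comPzRingType) (n : nat) (i : 'I_n) (x y z : form K n) S :
  ew i (x - y - z) S = ew i x S - ew i y S - ew i z S :> K.
Proof. by rewrite !linearB !formD !formN. Qed.

(** Used in [kernel]: by antisymmetry sum_ij X_i X_j Ct_ij = 0, so correcting the y_i by sum_j X_j
    Ct_ij does not change sum_i X_i y_i. *)
Lemma koszul_rearr (K : comNzRingType) (V : lmodType K) (I : finType) (X : I -> K) (y z q d : I -> V) (Ct : I -> I -> V) (a : K) :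
  (forall i j, Ct i j = - Ct j i) -> (forall i, Ct i i = 0) ->
  (forall i : I, z i = y i - a *: q i - \sum_j X j *: Ct i j) ->
  \sum_i X i *: y i - (\sum_i X i *: d i + a *: (\sum_i X i *: q i)) = \sum_i X i *: (z i - d i).
Proof.
move=> CN C0 zE; have E : \sum_i X i *: z i = \sum_i X i *: y i - a *: (\sum_i X i *: q i).
  rewrite -[RHS]subr0 -[X in _ - X](@sum_antisym V I (fun i j => (X i * X j) *: Ct i j)) => [|i j|i]; last 2 first.
  - by rewrite mulrC CN scalerN.
  - by rewrite C0 scaler0.
  rewrite scaler_sumr -!sumrB; apply: eq_bigr => i _; rewrite zE !scalerBr !scalerA [a * _]mulrC scaler_sumr.
  by congr (_ - _); apply: eq_bigr => j; rewrite scalerA.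
by rewrite [RHS](eq_bigr (fun i => X i *: z i - X i *: d i)) => [|i]; [rewrite sumrB E opprD addrA addrAC|rewrite scalerBr].
Qed.

Lemma lin_sums (K : comNzRingType) (V : lmodType K) (I : finType) (X : I -> K) (c : K) (y0 y1 z0 z1 : V) (y z : I -> V) :
  c *: (y0 + \sum_i X i *: y i + y1) + (z0 + \sum_i X i *: z i + z1) =
  (c *: y0 + z0) + \sum_i X i *: (c *: y i + z i) + (c *: y1 + z1).
Proof.
have -> : \sum_i X i *: (c *: y i + z i) = c *: (\sum_i X i *: y i) + \sum_i X i *: z i.
  by rewrite scaler_sumr -big_split; apply: eq_bigr => i; rewrite scalerDr !scalerA mulrC.
rewrite !scalerDr addrACA; congr (_ + _); exact: addrACA.
Qed.

Lemma sum_delta (K : nzRingType) (V : lmodType K) (I : finType) (X : I -> K) (i : I) (y : V) :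
  \sum_j X j *: (if j == i then y else 0) = X i *: y.
Proof. by rewrite (bigD1 i) //= eqxx big1 ?addr0 // => j /negbTE ->; rewrite scaler0. Qed.

Lemma sum_pair0 (K : pzRingType) (V W : lmodType K) (I : finType) (X : I -> K) (v : I -> V) :
  \sum_i X i *: ((v i, 0) : V * W) = (\sum_i X i *: v i, 0).
Proof.
pose h (x : V) : V * W := (x, 0); have hD : {morph h : x y / x + y} by move=> x y; apply: congr2; rewrite //= addr0.
apply: etrans (esym (big_morph h hD (erefl : 0 = 0) _ _ _)); apply: eq_bigr => i _.
by apply: (congr2 pair); rewrite //= scaler0.
Qed.

(** * Functions with poles on the theta divisor *)

Section Theta.
Variables (R : realType) (g : nat) (tau : 'M[R[i]]_g).
Local Notation C := R[i].
Local Notation Cg := 'rV[C]_g.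
Local Notation Zg := 'rV[int]_g.
Local Notation zvec := (map_mx (intr : int -> C)).
Local Notation rowR m := (map_mx (intr : int -> R) m).
Local Notation J := (Jfun R g).
Local Notation th := (theta tau).
Hypotheses (tau_sym : tau^T = tau) (tau_pos : im_posdef tau) (nonsing : theta_nonsingular tau).
Let UT : 'I_g -> set R := fun=> setT.
Let Y : 'M[R]_g := map_mx (@complex.Im R) tau.
Local Notation inUT z := ((fun=> Logic.I) : inT UT z).

Section ThetaSeries.
Local Notation CgN := (Cg : normedModType C).
Implicit Types (m : Zg) (z w : Cg) (h k : Cg -> C^o) (f : J).

Lemma Y_sym : Y^T = Y.
Proof. by apply/matrixP => i j; rewrite !mxE -{1}tau_sym mxE. Qed.

Lemma Y_unit : Y \in unitmx.
Proof.
rewrite -row_free_unit -kermx_eq0; apply/eqP/row_matrixP => i; rewrite row0.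
apply: contraTeq isT => /tau_pos; rewrite -row_mul mulmx_ker row0 mul0mx mxE ltxx; done.
Qed.

(** Completing the square at v = y Y^-1; it gives the decay of the theta coefficients at every
    height. *)
Lemma Y_square (y : 'I_g -> R) : exists B, forall x : 'rV[R]_g,
  - (x *m Y *m x^T) 0 0 - 2 * \sum_i x 0 i * y i <= B.
Proof.
pose v := (\row_i y i) *m invmx Y; exists ((v *m Y *m v^T) 0 0) => x.
have nn (u : 'rV[R]_g) : 0 <= (u *m Y *m u^T) 0 0.
  by have [->|/tau_pos/ltW//] := eqVneq u 0; rewrite !mul0mx mxE.
have := nn (x + v); rewrite linearD !mulmxDl !mulmxDr.
have E1 : x *m Y *m v^T = x *m (\row_i y i)^T.
  by rewrite trmx_mul trmx_inv Y_sym !mulmxA mulmxK ?Y_unit.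
have E2 : v *m Y *m x^T = x *m (\row_i y i)^T.
  by rewrite mulmxKV ?Y_unit // -[LHS]trmxK trmx_mul trmxK; apply/rowP => i; rewrite !ord1 mxE.
have : (x *m (\row_i y i)^T) 0 0 = \sum_i x 0 i * y i.
  by rewrite mxE; apply: eq_bigr => i; rewrite !mxE.
have addE (A B : 'M[R]_1) : (A + B) 0 0 = A 0 0 + B 0 0 by rewrite mxE.
rewrite !addE E1 E2; lra.
Qed.

Definition gauss m : C := cexp ((pi *i)%C * (zvec m *m tau *m (zvec m)^T) 0 0).

Lemma quad_formE (x : 'rV[R]_g) : (map_mx (real_complex R) x *m tau *m (map_mx (real_complex R) x)^T) 0 0 =
  ((x *m map_mx (@complex.Re R) tau *m x^T) 0 0 +i* (x *m Y *m x^T) 0 0)%C.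
Proof.
have sE (M : 'M[C]_g) : (map_mx (real_complex R) x *m M *m (map_mx (real_complex R) x)^T) 0 0 = \sum_i \sum_j ((x 0 j * x 0 i)%:C%C * M j i).
  rewrite mxE; apply: eq_bigr => i _; rewrite mxE mulr_suml; apply: eq_bigr => j.
  by rewrite !mxE (rmorphM (real_complex R)) mulrAC.
have sR (M : 'M[R]_g) : (x *m M *m x^T) 0 0 = \sum_i \sum_j (x 0 j * x 0 i) * M j i.
  rewrite mxE; apply: eq_bigr => i _; rewrite mxE mulr_suml; apply: eq_bigr => j.
  by rewrite !mxE mulrAC.
rewrite sE !sR; apply/eqP; rewrite eq_complex; apply/andP; split; apply/eqP.
  rewrite raddf_sum; apply: eq_bigr => i _; rewrite raddf_sum; apply: eq_bigr => j _.
  rewrite mxE; case: (tau j) => a b /=; ring.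
rewrite raddf_sum; apply: eq_bigr => i _; rewrite raddf_sum; apply: eq_bigr => j _.
rewrite mxE; case: (tau j) => a b /=; ring.
Qed.

Lemma zvecE m : zvec m = map_mx (real_complex R) (rowR m).
Proof. by apply/rowP => i; rewrite !mxE rmorph_int. Qed.

Lemma nc_gauss m : nc (gauss m) = expR (- pi * (rowR m *m Y *m (rowR m)^T) 0 0).
Proof. by rewrite /gauss zvecE quad_formE nc_cexp /= mul0r add0r mulNr. Qed.

Lemma decay_gauss : decay UT gauss.
Proof.
move=> y; have [B HB] := Y_square y; exists (expR (pi * B)) => m.
rewrite nc_gauss -expRD ler_expR; have := HB (rowR m).
have -> : \sum_i rowR m 0 i * y i = dot m y by apply: eq_bigr => i; rewrite mxE.
move=> /(ler_wpM2l (pi_ge0 R)); lra.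
Qed.

Lemma UTo : open_box UT. Proof. by split => //; exists 1. Qed.

Lemma theta_ser : theta tau = ser gauss.
Proof.
apply/funext => z; apply: summability_sum; have := serP UTo decay_gauss (inUT z).
apply: eq_hsum => m; rewrite -cexpD; congr cexp; congr (_ + _ * _).
by rewrite mxE; apply: eq_bigr => i; rewrite !mxE.
Qed.

#[local] Opaque theta.

Lemma theta_hol : hol UT th.
Proof. rewrite theta_ser; exact: hol_ser UTo decay_gauss. Qed.

Definition per (j : 'I_g) : Cg := row j tau.
Lemma chr_unitv (n : int) j z : chr (unitv j *~ n) z = cexp (2 * (pi *i)%C * (n%:~R * z 0 j)).
Proof.
rewrite /chr /lin (bigD1 j) //= big1 ?addr0 => [|i ij]; rewrite unitvE ?eqxx //.
by rewrite (negbTE ij) mul0r.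
Qed.

(* the n-th power of the factor of automorphy theta(z) / theta(z + tau_j) *)
Definition autf (n : int) j z : C := cexp (n%:~R * ((pi *i)%C * tau j j)) * chr (unitv j *~ n) z.

Lemma autf_cexp n j z : autf n j z = cexp (n%:~R * ((pi *i)%C * tau j j + 2 * (pi *i)%C * z 0 j)).
Proof. rewrite /autf chr_unitv -cexpD; congr cexp; ring. Qed.

Lemma gauss_shift (n : int) m j : zvec (m - unitv j *~ n) *m tau *m (zvec (m - unitv j *~ n))^T =
  zvec m *m tau *m (zvec m)^T - (2 * n%:~R * (zvec m *m (per j)^T) 0 0)%:M + (n%:~R ^+ 2 * tau j j)%:M :> 'M[C]_1.
Proof.
have uE : zvec (m - unitv j *~ n) = zvec m - n%:~R *: delta_mx 0 j.
  by apply/rowP => i; rewrite -scaler_int !mxE /= intz rmorphB rmorphM /=; case: (i == j); rewrite ?mulr1n ?mulr0n /= ?rmorph1 ?rmorph0.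
have tE : (zvec m - n%:~R *: delta_mx 0 j)^T = (zvec m)^T - n%:~R *: (delta_mx 0 j)^T :> 'cV[C]_g by rewrite linearB linearZ.
rewrite !uE tE !mulmxBl !mulmxBr -!scalemxAl -!scalemxAr.
have E1 : zvec m *m tau *m (delta_mx 0 j)^T = ((zvec m *m (per j)^T) 0 0)%:M.
  apply/matrixP => a b; rewrite !ord1 trmx_delta -colE !mxE; apply: eq_bigr => i.
  by rewrite !mxE -{1}tau_sym mxE.
have E2 : delta_mx 0 j *m tau *m (zvec m)^T = ((zvec m *m (per j)^T) 0 0)%:M.
  rewrite -rowE; apply/matrixP => a b; rewrite !ord1 !mxE; apply: eq_bigr => i.
  by rewrite !mxE mulrC.
have E3 : delta_mx 0 j *m tau *m (delta_mx 0 j)^T = (tau j j)%:M :> 'M[C]_1.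
  by rewrite -rowE trmx_delta -colE; apply/matrixP => a b; rewrite !ord1 !mxE.
rewrite E1 E2 E3; apply/matrixP => a b; rewrite !mxE; ring.
Qed.

Lemma theta_per j z : th (z + per j) = autf (-1) j z * th z.
Proof.
rewrite theta_ser; apply: ser_eq.
have := hsumZ (autf (-1) j z) (serP UTo decay_gauss (inUT z)).
move=> /(@hsum_reindex R _ _ (fun m => m + unitv j) (fun m => m - unitv j) _ _ (addrK _) (subrK _)).
apply: eq_hsum => m; rewrite autf_cexp -!cexpD; congr cexp.
have := gauss_shift (-1) m j; rewrite opprK => ->.
rewrite !mxE mulr1n linDl linDr -[lin (unitv j) z]/(lin (unitv j) z).
have -> : lin (unitv j) z = z 0 j.
  by rewrite /lin (bigD1 j) //= big1 ?addr0 => [|i ij]; rewrite !mxE ?eqxx ?mul1r // (negbTE ij) mul0r.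
have -> : (\sum_k zvec m 0 k * (per j)^T k 0) = lin m (per j) by apply: eq_bigr => i; rewrite !mxE.
rewrite mulr1n (_ : (-1)%:~R = -1); ring.
Qed.

Lemma autf_neq0 n j z : autf n j z != 0. Proof. by rewrite autf_cexp cexp_neq0. Qed.

Lemma autfV n j z : autf (- n) j z = (autf n j z)^-1.
Proof. rewrite !autf_cexp -cexpN; congr cexp; ring. Qed.

Lemma autfX (n : int) j z : autf n j z = autf 1 j z ^ n.
Proof.
have H (p : nat) : autf p j z = autf 1 j z ^+ p.
  rewrite !autf_cexp -cexp_nat; congr cexp; ring.
case: n => p; first exact: H.
by rewrite NegzE autfV H.
Qed.

Lemma theta_per0 j z : (th (z + per j) == 0) = (th z == 0).
Proof. by rewrite theta_per mulf_eq0 (negbTE (autf_neq0 _ _ _)). Qed.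

Lemma theta_zvec z m : th (z + zvec m) = th z.
Proof. exact: theta_hol.2. Qed.

Lemma hol_autf U n j : hol U (autf n j).
Proof. apply: holZ; exact: hol_chr. Qed.

Lemma grad_shift h w z L : has_grad h (z + w) L -> has_grad (fun z => h (z + w)) z L.
Proof.
move=> HL e e0; have [d d0 Hd] := HL e e0.
by exists d => // u ud; have := Hd u ud; rewrite addrA.
Qed.

Lemma hol_shift h w : hol UT h -> hol UT (fun z => h (z + w)).
Proof.
move=> [hh ph]; split => [z _|z m]; last by rewrite addrAC ph.
have [L] := hh (z + w) (inUT _); exists L; exact: grad_shift.
Qed.

Definition Dz (i : 'I_g) h : Cg -> C^o := fun z => 'D_'e_i (h : CgN -> C^o) z.

Lemma hol_grad h z : hol UT h -> has_grad h z (fun i => Dz i h z).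
Proof. by move=> [/(_ z (inUT z))[L HL] _]; have [_ E] := has_gradP HL; apply: (eq_has_grad _ _ HL) => // i; rewrite -E. Qed.

Lemma hol_Dz i h : hol UT h -> hol UT (Dz i h).
Proof.
move=> hh; have [a da aE] := hol_laurent UTo hh.
have := hol_ser UTo (decay_mulm i UTo da); congr hol; apply/funext => z.
have -> : h = ser a by apply/funext => w; exact: aE.
by have [_] := has_gradP (ser_has_grad UTo da (inUT z)); rewrite /Dz.
Qed.

Lemma Dz_comm i j h : hol UT h -> Dz i (Dz j h) = Dz j (Dz i h).
Proof.
move=> hh; have [a da aE] := hol_laurent UTo hh.
have -> : h = ser a by apply/funext => w; exact: aE.
have D1 l b : decay UT b -> Dz l (ser b) = ser (fun m => 2 * (pi *i)%C * (m 0 l)%:~R * b m).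
  by move=> db; apply/funext => z; have [_] := has_gradP (ser_has_grad UTo db (inUT z)); rewrite /Dz.
rewrite !D1 //; do ?exact: decay_mulm UTo da.
congr ser; apply/funext => m; ring.
Qed.

Lemma DzD i h k : hol UT h -> hol UT k -> Dz i (fun z => h z + k z) = fun z => Dz i h z + Dz i k z.
Proof. by move=> hh hk; apply/funext => z; have [_ E] := has_gradP (has_gradD (hol_grad z hh) (hol_grad z hk)); rewrite {1}/Dz. Qed.

Lemma DzM i h k : hol UT h -> hol UT k -> Dz i (fun z => h z * k z) = fun z => h z * Dz i k z + k z * Dz i h z.
Proof. by move=> hh hk; apply/funext => z; have [_ E] := has_gradP (has_gradM (hol_grad z hh) (hol_grad z hk)); rewrite {1}/Dz. Qed.

(** At a zero some derivative of theta is nonzero, so a small step in that direction leaves the zero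
    locus; identities of continuous functions need only be checked off Theta. *)
Lemma theta_dense z (d : R) : 0 < d -> exists2 u : Cg, forall i, nc (u 0 i) < d & th (u + z) != 0.
Proof.
move=> d0; have [z0|/eqP] := pselect (th z = 0); last first.
  exists (0 : Cg) => [i|]; first by rewrite mxE nc0.
  have e0 : (0 : Cg) + z = z by apply/rowP; rewrite add0r.
  by rewrite e0.
have [i Di0] := nonsing z0; have Di : Dz i th z != 0 by [].
have c0 := nc_gt0 Di; have e0 : 0 < nc (Dz i th z) / 2 by rewrite divr_gt0.
have [d' d'0 Hd] := hol_grad z theta_hol e0.
pose t := Num.min d d' / 2; have t0 : 0 < t by rewrite divr_gt0 // lt_min d0.
have td : t < d /\ t < d'.
  have : Num.min d d' <= d by rewrite ge_min lexx. have : Num.min d d' <= d' by rewrite ge_min lexx orbT. rewrite /t; lra.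
pose u : Cg := t%:C%C *: delta_mx 0 i.
have un l : nc (u 0 l) <= t.
  by rewrite !mxE; case: (l == i); rewrite ?mulr1 ?mulr0 ?nc0 ?(ltW t0) // nc_real gtr0_norm.
have us (F : 'I_g -> C) : \sum_l u 0 l * F l = t%:C%C * F i.
  by rewrite (bigD1 i) //= big1 ?addr0 => [|l li]; rewrite !mxE ?eqxx ?mulr1 // (negbTE li) mulr0 mul0r.
exists u => [l|]; first by apply: le_lt_trans td.1.
apply/eqP => thu; have := Hd u (fun l => le_lt_trans (un l) td.2).
rewrite thu z0 subrr sub0r ncN us ncM nc_real gtr0_norm // (_ : \sum_l nc (u 0 l) = t); last first.
  rewrite (bigD1 i) //= big1 ?addr0 => [|l li]; rewrite !mxE ?eqxx ?mulr1 ?nc_real ?gtr0_norm // (negbTE li) mulr0 nc0 //.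
nra.
Qed.

Lemma eq_grad_off h k : (forall z, exists L, has_grad h z L) -> (forall z, exists L, has_grad k z L) ->
  (forall z, th z != 0 -> h z = k z) -> h = k.
Proof.
move=> hh hk E; apply/funext => z; apply/eqP; rewrite -subr_eq0; apply/eqP; apply: nc_small_eq0 => e e0.
have [L HL] := hh z; have [L' HL'] := hk z.
have [d d0 Hd] := has_grad_cont (has_gradD HL (has_gradZ (-1) HL')) e0.
have [u ud /E uE] := theta_dense z d0.
by have := Hd u ud; rewrite uE mulN1r subrr sub0r ncN mulN1r.
Qed.

Lemma eq_off_theta h k : hol UT h -> hol UT k -> (forall z, th z != 0 -> h z = k z) -> h = k.
Proof. move=> [hh _] [hk _]; apply: eq_grad_off => z; [exact: hh (inUT z)|exact: hk (inUT z)]. Qed.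

Lemma zeta_Dz i z : zeta tau i z = Dz i th z / th z. Proof. done. Qed.

Lemma Dz_grad i h z L : has_grad h z L -> Dz i h z = L i.
Proof. by move=> HL; have [_] := has_gradP HL; rewrite /Dz. Qed.

Lemma hol_ex h z : hol UT h -> exists L, has_grad h z L. Proof. move=> [H _]; exact: H. Qed.
Lemma hol_per h z m : hol UT h -> h (z + zvec m) = h z. Proof. move=> [_ H]; exact: H. Qed.
Lemma holI h : (forall z, exists L, has_grad h z L) -> (forall z m, h (z + zvec m) = h z) -> hol UT h.
Proof. by move=> H2; split => [z _|z]. Qed.

#[local] Opaque Dz hol.

Local Notation off := (off_theta tau).

(** Negative n encode vanishing along Theta. *)
Definition psi (n : int) h : J := off (fun z => h z * th z ^ (- n)).

(** Only Z^g-periodicity is built in; invariance under tau Z^g is left to the T_j. *)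
Definition pole (n : int) f := exists2 h, hol UT h & f = psi n h.

Definition Tj (j : 'I_g) f : J := fun z => f (z + per j).

Lemma psiE n h z : th z != 0 -> psi n h z = h z * th z ^ (- n).
Proof. by rewrite /psi /off_theta => /negbTE ->. Qed.

Lemma psi0 n h z : th z = 0 -> psi n h z = 0.
Proof. by rewrite /psi /off_theta => ->; rewrite eqxx. Qed.

Lemma psi_ext n h f : (forall z, th z = 0 -> f z = 0) -> (forall z, th z != 0 -> f z = h z * th z ^ (- n)) -> f = psi n h.
Proof.
move=> f0 fE; apply/funext => z; rewrite /psi /off_theta; case: ifPn => [/eqP|]; [exact: f0|exact: fE].
Qed.

Lemma psi_inj n h k : hol UT h -> hol UT k -> psi n h = psi n k -> h = k.
Proof.
move=> hh hk E; apply: eq_off_theta => // z z0; have := congr1 (fun f => f z) E.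
rewrite !psiE // => /mulIf; apply; exact: expfz_neq0.
Qed.

Lemma psi_lin n (a : C) h k : a *: psi n h + psi n k = psi n (fun z => a * h z + k z).
Proof.
apply: psi_ext => z z0; rewrite -[LHS]/(a * psi n h z + psi n k z); first by rewrite !psi0 // mulr0 addr0.
rewrite !psiE //; ring.
Qed.

Lemma pole_lin n (a : C) f (k : J) : pole n f -> pole n k -> pole n (a *: f + k).
Proof.
move=> [hf Hf ->] [hk Hk ->]; rewrite psi_lin; eexists; last by [].
apply: holD => //; exact: holZ.
Qed.

Lemma pole0 n : pole n 0.
Proof. by exists (fun=> 0); [exact: hol_cst|apply: psi_ext => z //; rewrite mul0r]. Qed.

Lemma psiM (m n : int) h k : psi m h * psi n k = psi (m + n) (fun z => h z * k z).
Proof.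
apply: psi_ext => z z0; rewrite -[LHS]/(psi m h z * psi n k z); first by rewrite !psi0 // mulr0.
rewrite !psiE // opprD expfzDr //; ring.
Qed.

Lemma poleM (m n : int) f (k : J) : pole m f -> pole n k -> pole (m + n) (f * k).
Proof. by move=> [hf Hf ->] [hk Hk ->]; rewrite psiM; eexists; [exact: holM Hf Hk|]. Qed.

Lemma exprz_mulV (x : C) (n : int) : x != 0 -> x * x ^ (- (n + 1)) = x ^ (- n).
Proof. move=> x0; rewrite -{1}[x]expr1z -expfzDr //; congr (_ _); lia. Qed.

Lemma psi_theta n h : psi (n + 1) (fun z => h z * th z) = psi n h.
Proof.
symmetry; apply: psi_ext => z z0; first by rewrite psi0.
by rewrite psiE // -mulrA exprz_mulV.
Qed.

Lemma pole_succ n f : pole n f -> pole (n + 1) f.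
Proof.
by move=> [h]; exists (fun z => h z * th z); [exact: holM theta_hol|rewrite psi_theta].
Qed.

Lemma psi_T n j h : Tj j (psi n h) = psi n (fun z => autf n j z * h (z + per j)).
Proof.
apply: psi_ext => z z0; rewrite /Tj; first by apply: psi0; apply/eqP; rewrite theta_per0; apply/eqP.
rewrite psiE; last by rewrite theta_per0.
rewrite theta_per exprMz_comm; last exact: mulrC.
  have -> : autf (-1) j z ^ (- n) = autf n j z by rewrite autfX exprz_exp mulN1r opprK -autfX.
  ring.
- by rewrite unitfE autf_neq0.
- done.
Qed.

Lemma pole_T n j f : pole n f -> pole n (Tj j f).
Proof.
move=> [h hh ->]; rewrite psi_T; eexists; last by [].
apply: holM; [exact: hol_autf|exact: hol_shift].
Qed.

Lemma TjM j f (k : J) : Tj j (f * k) = Tj j f * Tj j k. Proof. done. Qed.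
Lemma Tj_comm i j f : Tj i (Tj j f) = Tj j (Tj i f).
Proof. by apply/funext => z; rewrite /Tj addrAC. Qed.

Definition regular f := (forall z, th z = 0 -> f z = 0) /\ (forall z, th z != 0 -> exists L, has_grad f z L).

Lemma has_grad_exprz (h : Cg -> C^o) z L (n : int) : h z != 0 -> has_grad h z L ->
  has_grad (fun w => h w ^ n) z (fun i => n%:~R * h z ^ (n - 1) * L i).
Proof.
move=> hz HL.
have H (p : nat) : has_grad (fun w => h w ^+ p) z (fun i => p%:R * h z ^ (p%:Z - 1) * L i).
  elim: p => [|p IH].
    by have := has_grad_cst z 1; apply: eq_has_grad => // i; rewrite mul0r mul0r.
  have := has_gradM HL IH; apply: eq_has_grad => [w|i]; first by rewrite exprS.
  have A : h z ^ (p.+1%:Z - 1) = h z ^+ p by rewrite exprnP; congr (_ _); lia.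
  have B : h z * h z ^ (p%:Z - 1) = h z ^+ p.
    rewrite -{1}[h z]expr1z -expfzDr // exprnP; congr (_ _); lia.
  rewrite A -B; ring.
case: n => p; first apply: (H).
have hp : h z ^+ p.+1 != 0 by rewrite expf_neq0.
have := has_gradV hp (H p.+1); apply: eq_has_grad => // i.
rewrite !mulrA; congr (_ * _); rewrite !mulNr; congr (- _).
rewrite [_ p.+1%:R]mulrC -mulrA; congr (_ _).
have -> : (h z ^+ p.+1) ^- 2 = h z ^ (- (p.+1 * 2)%:Z) by rewrite -exprM -exprnN.
rewrite -expfzDr //; congr (_ _); lia.
Qed.

Lemma pd_grad i f z L : th z != 0 -> has_grad f z L -> pd tau i f z = L i.
Proof. by move=> z0 /has_gradP[_]; rewrite /pd /off_theta (negbTE z0). Qed.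

Lemma near_off z : th z != 0 -> exists2 d : R, 0 < d & forall u : Cg, (forall i, nc (u 0 i) < d) -> th (u + z) != 0.
Proof.
move=> z0; have e0 : 0 < nc (th z) / 2 by rewrite divr_gt0 // nc_gt0.
have [d d0 Hd] := has_grad_cont (hol_grad z theta_hol) e0; exists d; first exact: d0.
move=> u /Hd; apply: contraTneq => ->; rewrite sub0r ncN -ltNge ltr_pdivrMr; last exact: ltr0n.
lra.
Qed.

(** The numerator of the derivative of h / theta^n over theta^(n+1). *)
Definition dpsi (n : int) i h : Cg -> C^o := fun z => Dz i h z * th z + - n%:~R * (h z * Dz i th z).

Lemma dpsiE n i h z : dpsi n i h z = Dz i h z * th z + - n%:~R * (h z * Dz i th z). Proof. done. Qed.

#[local] Opaque dpsi.

Lemma hol_dpsi n i h : hol UT h -> hol UT (dpsi n i h).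
Proof.
move=> hh; have ht := theta_hol; have hD := hol_Dz i hh; have tD := hol_Dz i ht.
rewrite (_ : dpsi n i h = fun z => Dz i h z * th z + - n%:~R * (h z * Dz i th z)); last by [].
exact: holD (holM hD ht) (holZ _ (holM hh tD)).
Qed.

Lemma psi_grad n h z : hol UT h -> th z != 0 -> has_grad (psi n h) z
  (fun i => dpsi n i h z * th z ^ (- (n + 1))).
Proof.
move=> hh z0; have [d d0 Hd] := near_off z0.
have := has_gradM (hol_grad z hh) (has_grad_exprz (- n) z0 (hol_grad z theta_hol)) => H.
apply: (has_grad_near (f := fun w => h w * th w ^ (- n))); last first.
  by exists d => // u /Hd uz; rewrite psiE.
apply: eq_has_grad H => // i.
have -> : th z ^ (- n - 1) = th z ^ (- (n + 1)) by rewrite opprD.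
have -> : (- n)%:~R = - n%:~R :> C by exact: rmorphN.
have alg (u t du dt N x y : C) : t * x = y -> u * (- N * x * dt) + y * du = (du * t + - N * (u * dt)) * x.
  move=> <-; ring.
rewrite dpsiE; exact: alg (exprz_mulV n z0).
Qed.

Lemma pole_regular n f : pole n f -> regular f.
Proof.
move=> [h hh ->]; split; first exact: psi0.
eexists; exact: psi_grad.
Qed.

Lemma pd_psi n i h : hol UT h -> pd tau i (psi n h) = psi (n + 1) (dpsi n i h).
Proof.
move=> hh; apply: psi_ext => z z0; first by rewrite /pd /off_theta z0 eqxx.
exact: pd_grad (psi_grad n hh z0).
Qed.

Lemma pole_pd n i f : pole n f -> pole (n + 1) (pd tau i f).
Proof.
by move=> [h hh ->]; rewrite (pd_psi n i hh); exists (dpsi n i h); [exact: hol_dpsi|].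
Qed.

Lemma pd_lin i (a : C) f (k : J) : regular f -> regular k -> pd tau i (a *: f + k) = a *: pd tau i f + pd tau i k.
Proof.
move=> [_ rf] [_ rk]; apply/funext => z; rewrite -[RHS]/(a * pd tau i f z + pd tau i k z).
have [z0|/eqP z0] := pselect (th z = 0); first by rewrite /pd /off_theta z0 eqxx mulr0 addr0.
have [L HL] := rf z z0; have [L' HL'] := rk z z0.
by rewrite (pd_grad i z0 (has_gradD (has_gradZ a HL) HL')) (pd_grad i z0 HL) (pd_grad i z0 HL').
Qed.

Lemma pdM i f (k : J) : regular f -> regular k -> pd tau i (f * k) = f * pd tau i k + k * pd tau i f.
Proof.
move=> [_ rf] [_ rk]; apply/funext => z; rewrite -[RHS]/(f z * pd tau i k z + k z * pd tau i f z).
have [z0|/eqP z0] := pselect (th z = 0); first by rewrite /pd /off_theta z0 eqxx !mulr0 addr0.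
have [L HL] := rf z z0; have [L' HL'] := rk z z0.
by rewrite (pd_grad i z0 (has_gradM HL HL')) (pd_grad i z0 HL) (pd_grad i z0 HL').
Qed.

Lemma pd_comm n i j f : pole n f -> pd tau i (pd tau j f) = pd tau j (pd tau i f).
Proof.
move=> [h hh ->]; have ht := theta_hol.
have hD l : hol UT (Dz l h) by exact: hol_Dz. have tD l : hol UT (Dz l th) by exact: hol_Dz.
have DF l l' : Dz l (dpsi n l' h) = fun z => (Dz l' h z * Dz l th z + th z * Dz l (Dz l' h) z) +
    (- n%:~R * (h z * Dz l (Dz l' th) z + Dz l' th z * Dz l h z)).
  rewrite (_ : dpsi n l' h = fun z => Dz l' h z * th z + - n%:~R * (h z * Dz l' th z)); last by [].
  rewrite (DzD l (holM (hD l') ht) (holZ _ (holM hh (tD l')))).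
  rewrite (DzM l (hol_cst UT (- n%:~R)) (holM hh (tD l'))) (DzM l (hD l') ht) (DzM l hh (tD l')); apply/funext => z.
  by rewrite (Dz_grad l (has_grad_cst z (- n%:~R))) mulr0 addr0.
rewrite (pd_psi n j hh) (pd_psi n i hh) (pd_psi _ i (hol_dpsi n j hh)) (pd_psi _ j (hol_dpsi n i hh)).
have DFz l l' z := congr1 (fun k : Cg -> C^o => k z) (DF l l').
have C1 := Dz_comm i j hh; have C2 := Dz_comm i j ht.
suff -> : dpsi (n + 1) i (dpsi n j h) = dpsi (n + 1) j (dpsi n i h) by [].
apply/funext => z.
have C1z := congr1 (fun k : Cg -> C^o => k z) C1; have C2z := congr1 (fun k : Cg -> C^o => k z) C2.
rewrite (dpsiE (n + 1) i (dpsi n j h)) (dpsiE (n + 1) j (dpsi n i h)).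
rewrite dpsiE.
rewrite (DFz) (DFz).
have : (n + 1)%:~R = n%:~R + 1 :> C by rewrite rmorphD.
have alg (hi hj hij hji ti tj tij tji u t N N' : C) : hij = hji -> tij = tji -> N' = N + 1 ->
  (hj * ti + t * hij + - N * (u * tij + tj * hi)) * t + - N' * ((hj * t + - N * (u * tj)) * ti) =
  (hi * tj + t * hji + - N * (u * tji + ti * hj)) * t + - N' * ((hi * t + - N * (u * ti)) * tj).
  move=> -> -> ->; ring.
exact: (alg (Dz i h z) (Dz j h z) _ _ (Dz i th z) (Dz j th z) _ _ (h z) (th z) _ _ C1z).
Qed.

Definition cst (c : C) : J := psi 0 (fun=> c).

Lemma cst1 f n : pole n f -> cst 1 * f = f.
Proof. by move=> [h _ ->]; rewrite psiM add0r; congr psi; apply/funext => z; rewrite mul1r. Qed.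

Lemma pole_cst c : pole 0 (cst c). Proof. by exists (fun=> c); [exact: hol_cst|]. Qed.

Lemma zeta_psi i : zeta tau i = psi 1 (Dz i th).
Proof.
apply: psi_ext => z z0; rewrite zeta_Dz; first by rewrite z0 invr0 mulr0.
done.
Qed.

Lemma pole_zeta i : pole 1 (zeta tau i).
Proof. by rewrite zeta_psi; exists (Dz i th); [exact: hol_Dz theta_hol|]. Qed.

Definition kappa : C := - (2 * (pi *i)%C).

Lemma kappa_neq0 : kappa != 0.
Proof.
rewrite oppr_eq0; apply/eqP => h; have := nc_2pi_i R; rewrite h nc0 => /esym/eqP.
by rewrite mulf_eq0 pnatr_eq0 /= gt_eqF // pi_gt0.
Qed.

(** Logarithmic derivative of [theta_per]: the factor exp (- 2 pi i z_j) contributes - 2 pi i to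
    zeta_j. *)
Lemma zeta_T i j : Tj j (zeta tau i) = zeta tau i + cst (if i == j then kappa else 0).
Proof.
have ht := theta_hol.
have H z : Dz i th (z + per j) = autf (-1) j z * (Dz i th z + (if i == j then kappa else 0) * th z).
  have E : (fun z => th (z + per j)) = fun z => autf (-1) j z * th z by apply/funext => w; rewrite theta_per.
  have H1 := grad_shift (hol_grad (z + per j) ht).
  rewrite E in H1.
  have H2 := has_gradM (has_gradZ (cexp ((-1)%:~R * ((pi *i)%C * tau j j))) (has_grad_chr (unitv j *~ -1) z)) (hol_grad z ht).
  rewrite (has_grad_unique H1 H2) unitvE.
  rewrite /kappa /autf; case: (i == j); ring.
rewrite zeta_psi psi_T; apply: esym.
apply: psi_ext => z z0; rewrite -[LHS]/(psi 1 (Dz i th) z + psi 0 (fun=> _) z); first by rewrite !psi0 ?addr0.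
rewrite !psiE // H autfV mulrA divff ?autf_neq0 // mul1r mulrDl mulr1; congr (_ _).
by rewrite -mulrA -{1}[th z]expr1z -expfzDr // mulr1.
Qed.

(** Non-singularity makes theta and its derivatives free of common zeros; b_0 theta + sum_i b_i d_i
    theta = 1 becomes the claim with B = b theta. *)
Lemma partition_of_unity : exists (B0 : J) (B : 'I_g -> J), [/\ pole (-1) B0, forall i, pole (-1) (B i) &
  B0 + \sum_i B i * zeta tau i = cst 1].
Proof.
pose x (o : 'I_g.+1) : Cg -> C^o := if unlift ord0 o is Some i then Dz i th else th.
have x0 : x ord0 = th by rewrite /x unlift_none.
have xS i : x (lift ord0 i) = Dz i th by rewrite /x liftK.
have hx o : hol UT (x o) by rewrite /x; case: (unlift) => [i|]; [apply: hol_Dz|]; exact: theta_hol.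
have [|b [hb bx]] := nullstellensatz hx.
  move=> z; have [z0|/eqP] := pselect (th z = 0); last by exists ord0; rewrite x0.
  by have [i Di] := nonsing z0; exists (lift ord0 i); rewrite xS.
exists (psi (-1) (b ord0)), (fun i => psi (-1) (b (lift ord0 i))); split=> [|i|].
- by exists (b ord0).
- by exists (b (lift ord0 i)).
apply: psi_ext => z z0.
  rewrite -[LHS]/(psi _ _ z + (\sum_i _) z) psi0 // add0r fct_sumE big1 // => i.
  by rewrite -[LHS]/(psi _ _ z * _) psi0 // mul0r.
rewrite -[LHS]/(psi _ _ z + (\sum_i _) z) fct_sumE psiE // mulr1 -(bx z).
rewrite big_ord_recl x0; congr (_ _); apply: eq_bigr => i _.
rewrite -[LHS]/(psi _ _ z * zeta tau i z) psiE // xS -mulrA; congr (_ _).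
by rewrite mulrC mulfVK.
Qed.

Lemma zvec0 : zvec 0 = 0 :> Cg. Proof. by apply/matrixP => a b; rewrite !mxE. Qed.

(** The entire function in [inA] is not assumed periodic; it is, as it equals theta^n f on the dense
    complement of the zero locus. *)
Lemma inA_pole (n : nat) f : inA tau n f <-> pole n f /\ forall j, Tj j f = f.
Proof.
split.
  move=> [f0 fP [h hh hE]]; split; last first.
    move=> j; apply/funext => z; have := fP z 0 (unitv j).
    by rewrite zvec0 addr0 map_delta_mx -rowE.
  exists h; last first.
    by apply: psi_ext => // z z0; rewrite -hE // -exprnN mulrC mulrA mulVf ?mul1r // expf_neq0.
  have H z : exists L, has_grad h z L by eexists; exact: differentiable_has_grad.
  apply: holI => // z m.
  have E : (fun z => h (z + zvec m)) = h.
    apply: eq_grad_off => [w|w|w w0]; [|exact: H|].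
      have [L] := H (w + zvec m); exists L; exact: grad_shift.
    rewrite -(hE w w0) -hE; last by rewrite theta_zvec.
    rewrite theta_zvec; congr (_ _); have := fP w m 0.
    by rewrite zvec0 mul0mx addr0.
  by have := congr1 (fun k : Cg -> C^o => k z) E.
move=> [[h hh fE] fT]; split => [z|z m p|]; first by rewrite fE; exact: psi0.
  have fz w l : f (w + zvec l) = f w.
    by rewrite fE /psi /off_theta theta_zvec hol_per.
  have fn j (k : nat) w : f (w + k%:R *: per j) = f w.
    elim: k w => [|k IH] w; first by rewrite scale0r addr0.
    by rewrite -natr1 scalerDl scale1r addrA -[RHS]IH -{2}(fT j).
  have fi j (k : int) w : f (w + k%:~R *: per j) = f w.
    case: k => k; first exact: fn.
    by rewrite -(fn j k.+1) scaleNr subrK.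
  have -> : zvec p *m tau = \sum_(j < g) (p 0 j)%:~R *: per j.
    by rewrite mulmx_sum_row; apply: eq_bigr => j; rewrite mxE.
  have H (s : seq 'I_g) w : f (w + \sum_(j <- s) (p 0 j)%:~R *: per j) = f w.
    elim: s w => [|j s IH] w; first by rewrite big_nil addr0.
    by rewrite big_cons addrA IH.
  by rewrite H.
exists h => [z|z z0]; first by have [L HL] := hol_ex z hh; exact: (has_gradP HL).1.
by rewrite fE psiE // mulrCA -exprnN divff ?mulr1 // expf_neq0.
Qed.

End ThetaSeries.

(** * Cohomology of the translations T_j by pole order *)

Section GroupCohomology.
Local Notation K := (cfun R g).
Local Notation T := (@Tj).
Implicit Types (m : Zg) (z : Cg) (c d : K).

Lemma uo : open_box UT. Proof. exact: UTo. Qed.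

Lemma ser_inj (a b : Zg -> C) : decay UT a -> decay UT b -> ser a = ser b -> a = b.
Proof.
move=> da db E; apply/funext => m.
have := ser_coef m uo da (inUT 0); have := ser_coef m uo db (inUT 0); rewrite E => ub ua.
exact: ulim_unique ub.
Qed.

Definition dcl : K -> Prop := fun c => decay UT c.

Lemma dcl_sub : subgroup dcl.
Proof.
split; first by move=> y; exists 0 => m; rewrite nc0.
move=> a b da db; have := decayD da (decayZ (-1) db); congr decay.
by apply/funext => m; rewrite mulN1r.
Qed.

Definition Del (j : 'I_g) (f : J) : J := T j f - f.

Lemma DelB i (f h : J) : Del i (f - h) = Del i f - Del i h.
Proof. apply/funext => z; rewrite -[RHS]/((f _ - f z) - (h _ - h z)) -[LHS]/((f _ - _) - (f z - h z)); ring. Qed.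

Notation del := (kz Del 0).

Lemma pole_sub n : subgroup (pole n).
Proof.
split; first exact: pole0.
by move=> f h pf ph; have := pole_lin (-1) ph pf; rewrite scaleN1r addrC.
Qed.

Lemma psiB n (h k : Cg -> C^o) : psi n (fun z => h z - k z) = psi n h - psi n k.
Proof.
have := psi_lin n (-1) k; rewrite scaleN1r addrC.
by rewrite (_ : (fun z => h z - k z) = fun z => -1 * k z + h z) //; apply/funext => z; rewrite mulN1r addrC.
Qed.

Lemma serB (a b : Zg -> C) : decay UT a -> decay UT b -> ser (fun m => a m - b m) = fun z => ser a z - ser b z.
Proof.
move=> da db; apply/funext => z; apply: ser_eq.
have := hsumB (serP uo da (inUT z)) (serP uo db (inUT z)); apply: eq_hsum => m; ring.
Qed.

Section TrivialTwist.

(** The eigenvalue of T_j - 1 on the m-th character. *)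
Definition lamf (j : 'I_g) m : C := chr m (per j) - 1.
Definition D0c (j : 'I_g) c : K := fun m => lamf j m * c m.
Definition Psi0 c : J := psi 0 (ser c).

Lemma nc_chr_per m j : nc (chr m (per j)) = expR (- (2 * pi) * (rowR m *m Y) 0 j).
Proof.
rewrite nc_chr; congr (expR (_ _)); rewrite mxE; apply: eq_bigr => i.
by rewrite /imz !mxE -{1}tau_sym mxE.
Qed.

(** Im tau is invertible and m integral, so some |(m Im tau)_j| is at least 1 / A; then exp (- 2 pi
    (m Im tau)_j), the modulus of the character at tau_j, has distance at least 1 - q from 1. *)
Lemma lamf_lower : exists2 r : R, 0 < r & forall m, m != 0 -> exists j, r <= nc (lamf j m).
Proof.
pose Z := invmx Y; pose A := \sum_i \sum_j `|Z i j| + 1.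
have A0 : 0 < A by rewrite ltr_wpDl // sumr_ge0 // => i; rewrite sumr_ge0.
pose q := expR (- (2 * pi / A)); have q1 : q < 1.
  by rewrite expR_lt1 oppr_lt0 divr_gt0 // mulr_gt0 // pi_gt0.
exists (1 - q); first by rewrite subr_gt0.
move=> m m0; have [i mi] : exists i, m 0 i != 0.
  by apply/existsP; apply: contraNT m0; rewrite negb_exists => /forallP H; apply/eqP/rowP => i; rewrite mxE; apply/eqP; have := H i; rewrite negbK.
pose v := rowR m *m Y; have vm : rowR m = v *m Z by rewrite mulmxK // Y_unit.
have [j vj] : exists j, A^-1 <= `|v 0 j|.
  apply: contrapT => H; have lt j : `|v 0 j| < A^-1 by rewrite ltNge; apply/negP => h; apply: H; exists j.
  have : 1 <= `|rowR m 0 i| by rewrite mxE -intr_norm ler1z; lia.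
  rewrite vm mxE leNgt => /negP; apply; apply: le_lt_trans (ler_norm_sum _ _ _) _.
  apply: (@le_lt_trans _ _ (A^-1 * \sum_k `|Z k i|)).
    rewrite mulr_sumr; apply: ler_sum => k _; rewrite normrM; apply: ler_wpM2r => //; exact: ltW.
  rewrite mulrC ltr_pdivrMr // mul1r ltr_pwDr //; apply: ler_sum => k.
  by rewrite (bigD1 i) //= lerDl sumr_ge0.
exists j; have E := nc_chr_per m j.
have pp := pi_gt0 R.
have [v0|v0] := leP 0 (v 0 j).
  rewrite ger0_norm // in vj; have := ler_nc_dist 1 (chr m (per j)); rewrite nc1 nc_distC E.
  apply: le_trans; rewrite lerD2l lerN2 ler_expR mulNr lerN2.
  by rewrite ler_wpM2l // mulr_ge0 // ltW.
rewrite ltr0_norm // in vj; have := ler_nc_dist (chr m (per j)) 1; rewrite nc1.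
apply: le_trans; have h : 2 * pi / A <= - (2 * pi) * v 0 j.
  by rewrite mulNr -mulrN ler_wpM2l // mulr_ge0 // ltW.
have : expR (2 * pi / A) <= expR (- (2 * pi) * v 0 j) by rewrite ler_expR.
have : q * expR (2 * pi / A) = 1 by rewrite -expRD addNr expR0.
have : 0 <= (1 - q) * (expR (2 * pi / A) - 1).
  by rewrite mulr_ge0 ?subr_ge0 ?(ltW q1) // -expR0 ler_expR divr_ge0 ?(ltW A0) // mulr_ge0 // ltW.
lra.
Qed.

Lemma dotD m y y' : dot m (fun i => y i + y' i) = dot m y + dot m y' :> R.
Proof. by rewrite -big_split; apply: eq_bigr => i; rewrite mulrDr. Qed.

Lemma dcl_chr z c : dcl c -> dcl (fun m => chr m z * c m).
Proof.
move=> dc y; have [B HB] := dc (fun i => y i + imz z i) (fun=> Logic.I); exists B => m.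
have := HB m; rewrite dotD mulrDr expRD ncM nc_chr.
lra.
Qed.

Lemma ser_shift z w c : dcl c -> ser c (z + w) = ser (fun m => chr m w * c m) z.
Proof.
move=> dc; apply/esym/ser_eq; have := serP uo dc (inUT (z + w)); apply: eq_hsum => m.
rewrite chrDr; ring.
Qed.

Lemma hol_dcl c : dcl c -> hol UT (ser c). Proof. exact: hol_ser uo. Qed.

Lemma dcl_D0c j c : dcl c -> dcl (D0c j c).
Proof.
move=> dc; have := dcl_sub.2 _ _ (dcl_chr (per j) dc) dc; congr dcl.
by apply/funext => m; rewrite /D0c mulrBl mul1r.
Qed.

Lemma Psi0B c d : dcl c -> dcl d -> Psi0 (c - d) = Psi0 c - Psi0 d.
Proof. by move=> dc dd; rewrite -psiB -serB. Qed.

Lemma Psi0_D j c : dcl c -> Psi0 (D0c j c) = Del j (Psi0 c).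
Proof.
move=> dc; rewrite /Del /Psi0 psi_T // -psiB.
suff -> : ser (D0c j c) = fun z => autf 0 j z * ser c (z + per j) - ser c z by [].
apply/funext => z; rewrite autf_cexp mul0r cexp0 mul1r ser_shift // -(congr1 (fun h => h z) (serB (dcl_chr (per j) dc) dc)).
by congr (ser _ z); apply/funext => m; rewrite /D0c mulrBl mul1r.
Qed.

Lemma Psi0_inj c d : dcl c -> dcl d -> Psi0 c = Psi0 d -> c = d.
Proof. move=> dc dd /(psi_inj (hol_dcl dc) (hol_dcl dd)); exact: ser_inj. Qed.

Lemma Psi0_lift f : pole 0 f -> exists2 c, dcl c & f = Psi0 c.
Proof.
move=> [h hh ->]; have [a da aE] := hol_laurent uo hh; exists a => //.
rewrite (_ : h = ser a) //; apply/funext => z; exact: aE.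
Qed.

Lemma pole_Psi0 c : dcl c -> pole 0 (Psi0 c).
Proof. by move=> dc; exists (ser c); [exact: hol_dcl|]. Qed.

Definition delta0 (x : C) : K := fun m => if m == 0 then x else 0.

Lemma dcl_delta0 x : dcl (delta0 x).
Proof.
move=> y; exists (nc x) => m; rewrite /delta0; case: eqP => [->|_]; last by rewrite nc0 mul0r nc_ge0.
by rewrite /dot big1 ?mulr0 ?expR0 ?mulr1 // => i; rewrite mxE mul0r.
Qed.

Lemma Psi0_delta0 x : Psi0 (delta0 x) = cst x.
Proof.
rewrite /Psi0 (_ : ser (delta0 x) = fun=> x) //; apply/funext => z; apply: ser_eq.
have := @hsum_fin R _ (fun m => delta0 x m * chr m z) [:: 0] isT.
rewrite big_seq1 /delta0 eqxx chr0 mulr1; apply => m; rewrite inE => /negbTE ->.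
ring.
Qed.

Lemma dcl_kz (y : form K (g + g)) : coefs dcl y -> coefs dcl (kz D0c 0 y).
Proof. move=> dy; apply: coefs_kz => // [|i u _]; [exact: dcl_sub|exact: dcl_D0c]. Qed.

Lemma del_Psi0 (y : form K (g + g)) : coefs dcl y -> del (fmap Psi0 y) = fmap Psi0 (kz D0c 0 y).
Proof. apply: fmap_kz; [exact: dcl_sub|exact: Psi0B|exact: dcl_D0c|exact: Psi0_D]. Qed.

Lemma D0cB i c d : D0c i (c - d) = D0c i c - D0c i d.
Proof. by apply/funext => m; rewrite /D0c -[(c - d) m]/(c m - d m) mulrBr. Qed.

Lemma lamf0 j : lamf j 0 = 0. Proof. by rewrite /lamf chr0 subrr. Qed.

Lemma kz_D0c_at0 (y : form K (g + g)) S : kz D0c 0 y S 0 = 0.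
Proof.
rewrite form_sum fct_sumE big1 // => i; rewrite ewE; case: ifP => //.
by rewrite fmapE -[LHS]/(_ (lamf i 0 * _)) lamf0 mul0r mulr0.
Qed.

Lemma coboundary_cst (y : form J (g + g)) (mu : form C (g + g)) : coefs (pole 0) y -> del y = fmap cst mu -> mu = 0.
Proof.
move=> py E; have [c dc yE] := fmap_lift (fun S => Psi0_lift (py S)).
apply/ffunP => S; rewrite form0; have := congr1 (fun x : form J (g + g) => x S) E.
rewrite yE del_Psi0 // !fmapE -Psi0_delta0 => /Psi0_inj H.
have := congr1 (fun u => u 0) (H (dcl_kz dc S) (dcl_delta0 _)).
by rewrite kz_D0c_at0 /delta0 eqxx.
Qed.

Definition NN m : C := \sum_i lamf i m * conjc (lamf i m).

Lemma NNE m : NN m = (\sum_i nc (lamf i m) ^+ 2)%:C%C.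
Proof.
rewrite [RHS](rmorph_sum (real_complex R)); apply: eq_bigr => i _.
case: lamf => x y; rewrite sqr_sqrtr ?addr_ge0 ?sqr_ge0 //.
apply/eqP; rewrite eq_complex /=; apply/andP; split; apply/eqP; ring.
Qed.

(** Weights of the contracting homotopy away from the constant term ([wf_sum]), bounded thanks to
    [lamf_lower]. *)
Definition wf j m : C := if m == 0 then 0 else conjc (lamf j m) / NN m.
Definition Wf j c : K := fun m => wf j m * c m.

Lemma wf_sum m : m != 0 -> \sum_j lamf j m * wf j m = 1.
Proof.
move=> m0; rewrite /wf (negbTE m0) (eq_bigr (fun j => lamf j m * conjc (lamf j m) / NN m)) => [|j]; last by rewrite mulrA.
rewrite -mulr_suml -/(NN m) divff // NNE -(rmorph0 (real_complex R)) (inj_eq (@complexI R)) gt_eqF //.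
have [r r0 /(_ m m0)[j jr]] := lamf_lower.
rewrite (bigD1 j) //= ltr_pwDl ?exprn_gt0 ?(lt_le_trans r0) // sumr_ge0 // => i _; exact: sqr_ge0.
Qed.

Lemma dcl_Wf j c : dcl c -> dcl (Wf j c).
Proof.
move=> dc; have [r r0 Hr] := lamf_lower; apply: decay_le (decayZ r^-1%:C%C dc) => m.
rewrite !ncM ler_wpM2r ?nc_ge0 // nc_real (ger0_norm (ltW _)) ?invr_gt0 // /wf.
case: eqP => [_|/eqP m0]; first by rewrite nc0 invr_ge0 ltW.
have [i ir] := Hr m m0; pose Q := \sum_i nc (lamf i m) ^+ 2.
have Qi k : nc (lamf k m) ^+ 2 <= Q.
  rewrite /Q (bigD1 k) //= lerDl sumr_ge0 // => l _; exact: sqr_ge0.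
have r2 : r ^+ 2 <= Q by apply: le_trans (Qi i); rewrite lerXn2r ?nnegrE ?nc_ge0 // ltW.
have Q0 : 0 < Q by apply: lt_le_trans r2; rewrite exprn_gt0.
rewrite ncM ncV NNE nc_real -/Q gtr0_norm // (_ : nc (conjc _) = nc (lamf j m)); last by case: lamf => x y /=; rewrite sqrrN.
rewrite ler_pdivrMr // mulrC ler_pdivlMr //.
have := Qi j; have := sqr_ge0 (nc (lamf j m) - r); lra.
Qed.

(** The homotopy sum_j iota_(beta_j) Wf_j recovers every Fourier coefficient except the constant
    one, on which all T_j - 1 vanish; that one is mu. *)
Lemma cocycle_pole0 (x : form J (g + g)) : coefs (pole 0) x -> del x = 0 ->
  exists (mu : form C (g + g)) f, coefs (pole 0) f /\ x = fmap cst mu + del f.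
Proof.
move=> px cx; have [c dc xE] := fmap_lift (fun S => Psi0_lift (px S)).
have kc : kz D0c 0 c = 0.
  apply/ffunP => S; rewrite form0; have := congr1 (fun x : form J (g + g) => x S) cx.
  rewrite xE del_Psi0 // fmapE form0 => E; apply: Psi0_inj; [|exact: dcl_sub.1|].
    exact: dcl_kz.
  rewrite -(subrr (0 : K)) Psi0B ?subrr //; exact: dcl_sub.1.
have WB j u v : Wf j (u - v) = Wf j u - Wf j v by apply/funext => m; rewrite /Wf -[(u - v) m]/(u m - v m) mulrBr.
have kW j : kz D0c 0 (fmap (Wf j) c) = 0.
  rewrite (@fmap_kz K K g (Wf j) (fun=> True) D0c) // ?kc.
    by apply/ffunP => S; rewrite fmapE !form0; apply/funext => m; rewrite /Wf mulr0.
  by move=> i u _; apply/funext => m; rewrite /D0c mulrCA.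
pose f := \sum_j ei (beta j) (fmap (Wf j) c).
have : coefs dcl f.
  apply: coefs_sum; first exact: dcl_sub.
  move=> j _; apply: coefs_ei; [exact: dcl_sub|move=> S; rewrite fmapE; exact: dcl_Wf].
have kf : kz D0c 0 f = \sum_j fmap (D0c j) (fmap (Wf j) c).
  have ksum (s : seq 'I_g) (G : 'I_g -> form K (g + g)) : kz D0c 0 (\sum_(j <- s) G j) = \sum_(j <- s) kz D0c 0 (G j).
    elim: s => [|j s IH]; rewrite ?big_nil ?kz0 ?big_cons ?kzD ?IH //; exact: D0cB.
  rewrite ksum; apply: eq_bigr => j.
  have := ib_kz D0cB (fmap (Wf j) c) (leq0n j); rewrite kW linear0 => /eqP.
  by rewrite eq_sym subr_eq0 => /eqP.
exists [ffun S : {set 'I_(g + g)} => c S 0], (fmap Psi0 f); split; first by move=> S; rewrite fmapE; exact: pole_Psi0.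
rewrite del_Psi0 // kf xE; apply/ffunP => S; rewrite formD !fmapE ffunE -Psi0_delta0.
rewrite form_sum; set v := \sum_j _.
have -> : v = c S - delta0 (c S 0).
  apply/funext => m; rewrite /v fct_sumE -[RHS]/(c S m - delta0 (c S 0) m) /delta0.
  rewrite (eq_bigr (fun j => lamf j m * wf j m * c S m)); last by move=> j _; rewrite !fmapE; exact: mulrA.
  rewrite -mulr_suml; case: eqP => [->|/eqP m0]; last by rewrite wf_sum // mul1r subr0.
  by rewrite big1 ?mul0r ?subrr // => j; rewrite lamf0 mul0r.
by rewrite Psi0B; [rewrite addrC subrK|exact: dc|exact: dcl_delta0].
Qed.

End TrivialTwist.

(** * Nonzero pole order: from Fourier coefficients to shifts *)

Section Twist.
Variables (n : int) (L : 'I_g -> 'I_g -> R) (a : 'I_g -> R).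
Hypotheses (n0 : n != 0) (a0 : forall i, 0 < a i) (L1 : forall i, L i i = 1)
  (L0 : forall k i : 'I_g, (k < i)%N -> L k i = 0)
  (LE : forall x, qform (fun i j => Y i j) x = \sum_i a i * (\sum_k x k * L k i) ^+ 2).

Let s : nat := `|n|%N.
Let eps : R := Num.sg n%:~R.
Let rho : R := pi / s%:R.
Local Notation tt := (tt L).

Lemma s_gt0 : (0 < s)%N. Proof. lia. Qed.
Lemma rho_gt0 : 0 < rho. Proof. by rewrite divr_gt0 ?pi_gt0 // ltr0n s_gt0. Qed.
Lemma eps_norm : `|eps| = 1. Proof. by rewrite normr_sg intr_eq0 n0. Qed.

Lemma eps_rho : eps * rho = pi / n%:~R.
Proof.
have nE : n%:~R = eps * s%:R by rewrite pmulrn intr_norm -numEsg.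
have e2 : eps * eps = 1 by rewrite -expr2 -[eps ^+ 2]real_normK ?num_real // eps_norm expr1n.
rewrite nE invfM mulrCA; congr (_ (_ * _)).
by apply: (mulfI (_ : eps != 0)); rewrite ?divff // -normr_gt0 eps_norm.
Qed.

Lemma qf_tt m : (rowR m *m Y *m (rowR m)^T) 0 0 = \sum_i a i * tt i m ^+ 2.
Proof.
have -> : \sum_i a i * tt i m ^+ 2 = qform (fun i j => Y i j) (fun k => (m 0 k)%:~R) by [].
rewrite mxE /qform exchange_big; apply: eq_bigr => i _; rewrite mxE mulr_suml; apply: eq_bigr => j.
by rewrite !mxE mulrAC.
Qed.

(** The decay is tested at the 2^g heights dual to the linear forms K sum_i +- t_i; the signs of the
    t_i(m) select one. *)
Lemma dcl_tt c : dcl c -> forall K : R, exists B : R, forall m, nc (c m) <= B * expR (- K * \sum_i `|tt i m|).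
Proof.
move=> dc K'; pose y (e : {ffun 'I_g -> bool}) k := - (K' / (2 * pi)) * \sum_i (if e i then 1 else -1) * L k i.
have /choice[B HB] := fun e => dc (y e) (fun=> Logic.I).
have := pi_gt0 R.
exists (\sum_e `|B e|) => m; pose e : {ffun 'I_g -> bool} := [ffun i => 0 <= tt i m].
have := HB e m; have -> : - (2 * pi) * dot m (y e) = K' * \sum_i `|tt i m|.
  rewrite /dot; under eq_bigr do rewrite mulrCA.
  rewrite -mulr_sumr mulrA (_ : - (2 * pi) * - (K' / (2 * pi)) = K'); last by rewrite mulrNN mulrC divfK // mulf_neq0 // gt_eqF.
  congr (_ _); under eq_bigr do rewrite mulr_sumr.
  rewrite exchange_big; apply: eq_bigr => i.
  under eq_bigr do rewrite mulrCA; rewrite -mulr_sumr ffunE.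
  by case: ifPn => h; [rewrite mul1r ger0_norm|rewrite mulN1r ltr0_norm // ltNge].
rewrite mulNr expRN -ler_pdivlMr ?expR_gt0 // => h; apply: le_trans h _.
rewrite ler_wpM2r //; apply: le_trans (ler_norm _) _.
by rewrite (bigD1 e) //= lerDl sumr_ge0.
Qed.

Lemma tt_dcl c : (forall K : R, 0 <= K -> exists B : R, forall m, nc (c m) <= B * expR (- K * \sum_i `|tt i m|)) -> dcl c.
Proof.
move=> H y; pose M := \matrix_(k, i) L k i.
have : M \in unitmx.
  rewrite -row_free_unit -kermx_eq0; apply/eqP/row_matrixP => i; rewrite row0.
  apply: contraTeq isT => /tau_pos; set x := row i _.
  have x0 : x *m M = 0 by rewrite -row_mul mulmx_ker row0.
  have -> : (x *m map_mx (@complex.Im R) tau *m x^T) 0 0 = qform (fun i j => Y i j) (fun k => x 0 k).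
    rewrite mxE /qform exchange_big; apply: eq_bigr => k _; rewrite mxE mulr_suml; apply: eq_bigr => j.
    by rewrite !mxE mulrAC.
  rewrite LE big1 ?ltxx // => k; have := congr1 (fun u : 'rV[R]_g => u 0 k) x0.
  by rewrite !mxE => e; rewrite (eq_bigr (fun j => x 0 j * M j k)) ?e ?expr0n ?mulr0 // => j; rewrite [M _ _]mxE.
pose v := invmx M *m \col_i y i; pose A := \sum_i `|v i 0|.
have A0 : 0 <= A by rewrite sumr_ge0.
have [B HB] := H (2 * pi * A) (mulr_ge0 (mulr_ge0 (ler0n _ 2) (pi_ge0 R)) A0).
exists B => m.
have dE : dot m y = \sum_i tt i m * v i 0.
  have : rowR m *m (\col_i y i) = (rowR m *m M) *m v by rewrite !mulmxA mulmxK.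
  move=> /(congr1 (fun u : 'M[R]_1 => u 0 0)); rewrite !mxE => e.
  rewrite /dot (eq_bigr (fun i => rowR m 0 i * (\col_i y i) i 0)) ?e => [|i]; last by rewrite !mxE.
  by apply: eq_bigr => i _; rewrite mxE; congr (_ * _); apply: eq_bigr => k; rewrite !mxE.
have dle : - dot m y <= A * \sum_i `|tt i m|.
  apply: le_trans (ler_norm _) _; rewrite normrN dE; apply: le_trans (ler_norm_sum _ _ _) _.
  rewrite mulr_sumr; apply: ler_sum => i; rewrite normrM mulrC ler_wpM2r //.
  by rewrite /A (bigD1 i) //= lerDl sumr_ge0.
have := ler_wpM2r (expR_ge0 (- (2 * pi) * dot m y)) (HB m); move=> h; apply: le_trans h _.
have B0 : 0 <= B by have := HB m => /(le_trans (nc_ge0 _)); rewrite pmulr_lge0 // expR_gt0.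
rewrite -(mulrA B) -expRD ler_piMr // -[leRHS]expR0 ler_expR.
have pp := pi_gt0 R; have := ler_wpM2l (mulr_ge0 (ler0n R 2) (ltW pp)) dle; lra.
Qed.

(** Dividing the Fourier coefficients by this Gaussian absorbs the automorphy factor: T_j becomes
    the pure shift m |-> m - n e_j ([Psi_T]). *)
Definition Gn m : C := cexp (n%:~R^-1 * ((pi *i)%C * (zvec m *m tau *m (zvec m)^T) 0 0)).

Lemma nc_Gn m : nc (Gn m) = expR (- (pi / n%:~R * \sum_i a i * tt i m ^+ 2)).
Proof.
rewrite /Gn zvecE quad_formE nc_cexp -qf_tt -(rmorph_int (real_complex R)) -(fmorphV (real_complex R)); congr expR.
rewrite /=; ring.
Qed.

Lemma Gn_neq0 m : Gn m != 0. Proof. exact: cexp_neq0. Qed.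

Local Notation cls := (cls L a rho eps s 0).

Lemma EE0 K' m : EE L a rho eps 0 K' m = pi / n%:~R * \sum_i a i * tt i m ^+ 2 - K' * \sum_i `|tt i m|.
Proof.
rewrite /EE sumrB -!mulr_sumr -eps_rho; congr (_ - _); rewrite -mulrA; congr (_ _).
by rewrite mulr_sumr; apply: eq_bigr => i; rewrite mulrA.
Qed.

Lemma cls_dcl d : cls d -> dcl (fun m => d m * Gn m).
Proof.
move=> [bd _]; apply: tt_dcl => K' K0; have [B] := bd K' K0; exists B => m.
rewrite ncM nc_Gn; apply: (@le_trans _ _ (B * expR (EE L a rho eps 0 K' m) * expR (- (pi / n%:~R * \sum_i a i * tt i m ^+ 2)))).
  by rewrite ler_wpM2r.
rewrite -mulrA -expRD EE0; set q := pi / _ * _; rewrite (_ : _ - q = - K' * \sum_i `|tt i m|) //; ring.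
Qed.

Lemma dcl_cls c : dcl c -> cls (fun m => c m / Gn m).
Proof.
move=> dc; split => // K'; have [B HB] := dcl_tt dc K'; exists B => m.
rewrite ncM ncV nc_Gn EE0 expRN invrK.
by rewrite addrC expRD mulrA -mulNr ler_wpM2r.
Qed.

Definition Psi d : J := psi n (ser (fun m => d m * Gn m)).
Definition Dt j d : K := fun m => d (m - unitv j *~ n) - d m.

Lemma PsiB c d : cls c -> cls d -> Psi (c - d) = Psi c - Psi d.
Proof.
move=> /cls_dcl dc /cls_dcl dd; rewrite -psiB -serB //; congr psi; congr ser.
by apply/funext => m; rewrite -[(c - d) m]/(c m - d m) mulrBl.
Qed.

Lemma Psi_inj d : cls d -> Psi d = 0 -> d = 0.
Proof.
move=> cd E; have cd' := cls_dcl cd.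
have p0 : psi n (ser (fun=> 0)) = 0.
  rewrite (_ : ser _ = 0); last by apply/funext => z; apply: ser_eq; have := @hsum0 R Zg; apply: eq_hsum => m; rewrite mul0r.
  by symmetry; apply: psi_ext => z //; rewrite mul0r.
have := psi_inj (hol_dcl cd') (hol_dcl dcl_sub.1) (etrans E (esym p0)).
move=> /(ser_inj cd' dcl_sub.1) H; apply/funext => m; have := congr1 (fun u => u m) H => /eqP.
by rewrite mulf_eq0 (negbTE (Gn_neq0 m)) orbF => /eqP.
Qed.

Lemma Psi_lift f : pole n f -> exists2 d, cls d & f = Psi d.
Proof.
move=> [h hh ->]; have [c dc cE] := hol_laurent uo hh; exists (fun m => c m / Gn m); first exact: dcl_cls.
rewrite (_ : h = ser c); last by apply/funext => z; exact: cE.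
by congr psi; congr ser; apply/funext => m; rewrite mulfVK // Gn_neq0.
Qed.

Lemma pole_Psi d : cls d -> pole n (Psi d).
Proof. by move=> /cls_dcl/hol_dcl hd; eexists; [exact: hd|]. Qed.

Lemma Gn_shift m j : Gn (m - unitv j *~ n) * chr (m - unitv j *~ n) (per j) * cexp (n%:~R * ((pi *i)%C * tau j j)) = Gn m.
Proof.
have nC : n%:~R != 0 :> C by rewrite intr_eq0.
have lE (v : Zg) : lin v (per j) = (zvec v *m (per j)^T) 0 0 by rewrite mxE; apply: eq_bigr => i; rewrite !mxE.
rewrite -!cexpD; congr cexp; rewrite gauss_shift // linDl lE.
have -> : lin (- (unitv j *~ n)) (per j) = - (n%:~R * tau j j).
  rewrite /lin (bigD1 j) //= big1 ?addr0 => [|i ij]; rewrite mxE unitvE ?eqxx.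
    by rewrite rmorphN mulNr mxE.
  by rewrite (negbTE ij) mul0r.
set u := (zvec m *m (per j)^T) 0 0; set w := zvec m *m tau *m (zvec m)^T.
rewrite (_ : (w - _ + _) 0 0 = w 0 0 - 2 * n%:~R * u + n%:~R ^+ 2 * tau j j); last by rewrite !mxE.
by field.
Qed.

Lemma Psi_T j d : cls d -> T j (Psi d) = Psi (fun m => d (m - unitv j *~ n)).
Proof.
move=> cd; rewrite /Psi psi_T //; set F := ser (fun m => d (m - _) * _).
suff -> : (fun z => autf n j z * ser (fun m => d m * Gn m) (z + per j)) = F by [].
apply/funext => z; symmetry; apply: ser_eq; rewrite ser_shift; last exact: cls_dcl.
have dc := dcl_chr (per j) (cls_dcl cd).
have := hsumZ (autf n j z) (serP uo dc (inUT z)).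
move=> /(@hsum_reindex R _ _ (fun m => m - unitv j *~ n) (fun m => m + unitv j *~ n) _ _ (subrK _) (addrK _)).
apply: eq_hsum => m; rewrite -(Gn_shift m j) /autf.
have -> : chr m z = chr (m - unitv j *~ n) z * chr (unitv j *~ n) z by rewrite -chrDl subrK.
ring.
Qed.

Lemma cls_tw j d : cls d -> cls (fun m => d (m - unitv j *~ n)).
Proof. exact: (cls_shift a0 rho_gt0 eps_norm). Qed.

Lemma cls_Dt j d : cls d -> cls (Dt j d).
Proof. move=> cd; apply: (cls_sub L a rho eps s 0).2 => //; exact: cls_tw. Qed.

Lemma Psi_D j d : cls d -> Psi (Dt j d) = Del j (Psi d).
Proof. move=> cd; rewrite /Del Psi_T // -PsiB //; exact: cls_tw. Qed.

Lemma del_Psi (y : form K (g + g)) : coefs cls y -> del (fmap Psi y) = fmap Psi (kz Dt 0 y).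
Proof. apply: fmap_kz; [exact: cls_sub|exact: PsiB|exact: cls_Dt|exact: Psi_D]. Qed.

Lemma twist_acyclic (Q : pred {set 'I_(g + g)}) :
  (forall b : form K (g + g), coefs cls b -> kz Dt 0 b = 0 -> (forall S, Q S -> b S = 0) -> exists2 f, coefs cls f & kz Dt 0 f = b) ->
  forall x : form J (g + g), coefs (pole n) x -> del x = 0 -> (forall S, Q S -> x S = 0) ->
  exists2 f, coefs (pole n) f & del f = x.
Proof.
move=> H x px cx x0; have [c dc xE] := fmap_lift (fun S => Psi_lift (px S)).
have kdc : coefs cls (kz Dt 0 c) by apply: coefs_kz => // [|i u _]; [exact: cls_sub|exact: cls_Dt].
have [||f df fE] := H c dc.
- apply/ffunP => S; rewrite form0; apply: Psi_inj => //.
  by have := congr1 (fun x : form J (g + g) => x S) cx; rewrite xE del_Psi // fmapE form0.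
- by move=> S /x0; rewrite xE fmapE; apply: Psi_inj.
by exists (fmap Psi f); [move=> S; rewrite fmapE; exact: pole_Psi|rewrite del_Psi // fE].
Qed.

End Twist.

Lemma cholesky_Y : exists (L : 'I_g -> 'I_g -> R) (a : 'I_g -> R), [/\ forall i, 0 < a i, forall i, L i i = 1,
    forall k i : 'I_g, (k < i)%N -> L k i = 0 &
    forall x, qform (fun i j => Y i j) x = \sum_i a i * (\sum_k x k * L k i) ^+ 2].
Proof.
apply: cholesky => [i j|x [l xl]]; first by have := congr1 (fun M : 'M[R]_g => M i j) Y_sym; rewrite mxE.
have := tau_pos (x := \row_k x k); rewrite (_ : (_ _) = qform (fun i j => Y i j) x).
  by apply; apply: contraNneq xl => /rowP/(_ l); rewrite !mxE => ->.
rewrite mxE /qform exchange_big; apply: eq_bigr => i _; rewrite mxE mulr_suml; apply: eq_bigr => j.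
by rewrite !mxE mulrAC.
Qed.

Lemma pos_acyclic (n : nat) (x : form J (g + g)) : (0 < n)%N -> coefs (pole n%:Z) x -> del x = 0 ->
  (forall S, beta_part S == finset.set0 -> x S = 0) -> exists2 f, coefs (pole n%:Z) f & del f = x.
Proof.
move=> n0; have [L [a [a0 L1 L0 LE]]] := cholesky_Y; have n0' : n%:Z != 0 by lia.
apply: (twist_acyclic n0' a0 LE (Q := fun S => beta_part S == finset.set0)) => b cb kb b0.
have e1 : Num.sg (n%:Z%:~R : R) = 1 by rewrite gtr0_sg // ltr0z.
have [f] := shift_pos a0 L1 L0 (rho_gt0 n0') (s_gt0 n0') (eps_norm n0') e1 cb kb (fun S e => b0 S (introT eqP e)).
by exists f.
Qed.

Lemma neg_acyclic (n : nat) (x : form J (g + g)) : (0 < n)%N -> coefs (pole (- n%:Z)) x -> del x = 0 ->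
  (forall S, (g <= #|beta_part S|)%N -> x S = 0) -> exists2 f, coefs (pole (- n%:Z)) f & del f = x.
Proof.
move=> n0; have [L [a [a0 L1 L0 LE]]] := cholesky_Y; have n0' : - n%:Z != 0 by lia.
apply: (twist_acyclic n0' a0 LE (Q := fun S => (g <= #|beta_part S|)%N)) => b cb kb b0.
have e1 : Num.sg ((- n%:Z)%:~R : R) = -1 by rewrite ltr0_sg // ltrz0 oppr_lt0.
have sE : `|(- n%:Z)%R|%N = n by lia.
have DE : Dt (- n%:Z) = Dn n :> ('I_g -> K -> K).
  by apply/funext => j; rewrite /Dt mulrNz opprK.
rewrite DE in kb *; rewrite sE in cb *.
have r0 : 0 < pi / n%:R :> R by rewrite divr_gt0 ?pi_gt0 ?ltr0n.
have [f] := shift_neg a0 L1 L0 r0 n0 (eps_norm n0') e1 cb kb b0.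
by exists f.
Qed.

(** For n = 1 invariance makes the coefficient function d periodic under all unit vectors, hence
    constant, and the numerator is a multiple of theta. *)
Lemma invariant_pole1 f : pole 1 f -> (forall j, T j f = f) -> exists x, f = cst x.
Proof.
move=> pf inv; have [L [a [a0 L1 L0 LE]]] := cholesky_Y; have n0 : (1 : int) != 0 by [].
have [d cd fE] := Psi_lift n0 LE pf.
have per1 j : Dt 1 j d = 0.
  apply: (Psi_inj n0 LE); first exact: cls_Dt.
  by rewrite (Psi_D n0 a0 LE) // /Del -fE inv subrr.
have p1 j m : d (m + unitv j) = d m.
  have := congr1 (fun u => u (m + unitv j)) (per1 j); rewrite /Dt addrK => /eqP.
  by rewrite -[X in _ == X]/0 subr_eq0 => /eqP.
have pz j m (k : int) : d (m + unitv j *~ k) = d m.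
  have pn (l : nat) w : d (w + unitv j *+ l) = d w.
    by elim: l w => [|l IH] w; rewrite ?addr0 // mulrSr addrA p1.
  by case: k => k; [exact: pn|rewrite -(pn k.+1) subrK].
have dc m : d m = d 0.
  have mE : m = \sum_(j < g) unitv j *~ m 0 j.
    by apply/rowP => i; rewrite summxE (bigD1 i) //= big1 ?addr0 => [|j ji]; rewrite unitvE ?eqxx // eq_sym (negbTE ji).
  have H (r : seq 'I_g) w : d (w + \sum_(j <- r) unitv j *~ m 0 j) = d w.
    by elim: r w => [|j r IH] w; rewrite ?big_nil ?addr0 // big_cons addrA IH.
  by rewrite mE -{1}[\sum_(j < g) _]add0r.
exists (d 0); rewrite fE /cst -[psi 0 _](psi_theta); congr psi; apply/funext => z.
rewrite theta_ser //; apply: ser_eq; have := hsumZ (d 0) (serP uo decay_gauss (inUT z)).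
by apply: eq_hsum => m; rewrite dc mulrA /Gn invr1 mul1r.
Qed.

End GroupCohomology.

Lemma dzetaE0 (i j : 'I_g) : dzeta tau i j = pd tau j (zeta tau i). Proof. done. Qed.
Lemma pd0 (i : 'I_g) (f : J) z : th z = 0 -> pd tau i f z = 0. Proof. by move=> z0; rewrite /pd /off_theta z0 eqxx. Qed.
Lemma cstE (c : C) : cst c = psi 0 (fun=> c). Proof. done. Qed.

Definition kc (c : C) : J := fun=> c.
Definition hes (i j : 'I_g) : J := psi 1 (Dz i (Dz j th)).

Lemma pole_kc n c (f : J) : pole n f -> pole n (kc c * f).
Proof. by move=> pf; have := pole_lin c pf (pole0 n); rewrite addr0. Qed.

Lemma kcT (j : 'I_g) c : Tj j (kc c) = kc c. Proof. done. Qed.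

Lemma cst_un (c : C) : cst c = kc c * cst 1.
Proof.
symmetry; apply: psi_ext => z z0; rewrite -[LHS]/(c * cst 1 z) cstE; first by rewrite psi0 // mulr0.
by rewrite psiE // mul1r.
Qed.

Lemma off_theta_un (f : J) : off_theta tau f = cst 1 * f.
Proof.
apply/funext => z; rewrite -[RHS]/(cst 1 z * f z) cstE /off_theta.
have [z0|/eqP z0] := pselect (th z = 0); first by rewrite z0 eqxx psi0 // mul0r.
by rewrite (negbTE z0) psiE // mulr1 mul1r.
Qed.

Lemma Wfun_def S : Wfun tau S = off_theta tau (ecoef
    (wedge_seq ([seq dzeta tau i | i <- enum (beta_part S)] ++ [seq @dz R g k | k <- enum (alpha_part S)]))
    [set: 'I_g]%SET).
Proof. done. Qed.

#[local] Opaque hol psi theta Dz pd dzeta zeta cst pole Wfun off_theta.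

(** * The descent for the theta divisor *)

Section ThetaDescent.
Local Notation T := (@Tj).

Lemma pole_le m n (f : J) : m <= n -> pole m f -> pole n f.
Proof.
move=> mn pf; have -> : n = m + `|n - m|%N%:Z by lia.
elim: `|n - m|%N => [|d]; first by rewrite addr0.
by rewrite -[d.+1]addn1 PoszD addrA; apply: pole_succ.
Qed.

Lemma T_cst (j : 'I_g) c : T j (cst c) = cst c.
Proof.
apply/funext => z; rewrite /Tj !cstE; have [z0|z0] := eqVneq (th z) 0.
  have z1 : th (z + per j) = 0 by apply/eqP; rewrite theta_per0 //; apply/eqP.
  by rewrite (psi0 0 _ z0) psi0.
have z1 : th (z + per j) != 0 by rewrite theta_per0.
have H w : th w != 0 -> psi 0 (fun=> c) w = c by move=> w0; rewrite psiE // mulr1.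
rewrite (H _ z0) (H _ z1); exact: erefl.
Qed.

(** The term - n zeta_i f carries the whole pole of order n + 1; this ties d to zeta /\ -. *)
Lemma pd_lead n (i : 'I_g) (h : Cg -> C^o) : hol (fun=> setT) h ->
  pd tau i (psi n h) = psi n (Dz i h) - kc n%:~R * (zeta tau i * psi n h).
Proof.
move=> hh; rewrite (pd_psi n i hh) zeta_psi psiM.
rewrite -[psi n (Dz i h)](psi_theta) [1 + n]addrC; symmetry.
have := psi_lin (n + 1) (- n%:~R) (fun z => Dz i th z * h z) (fun z => Dz i h z * th z).
set B := _ (fun z => _ * h z); set A := (fun z => th z) => H.
have E : - (kc n%:~R * B) = (- n%:~R) *: B by rewrite scaleNr.
rewrite [LHS]addrC E H; apply: (congr1 (psi (n + 1))); apply/funext => z; rewrite dpsiE.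
move: Dz Dz (h) (th) (n%:~R : C) => p q r s t; ring.
Qed.

Lemma pd_leadE n (i : 'I_g) (h : Cg -> C^o) (f : J) : hol (fun=> setT) h -> f = psi n h ->
  pd tau i f = psi n (Dz i h) - kc n%:~R * (zeta tau i * f).
Proof. move=> hh ->; exact: pd_lead. Qed.

Lemma hol_Dth (l : 'I_g) : hol (fun=> setT) (Dz l th).
Proof. apply: hol_Dz; exact: theta_hol. Qed.

Lemma dzetaE (i j : 'I_g) : dzeta tau i j = hes i j - zeta tau i * zeta tau j.
Proof.
have E := pd_leadE j (hol_Dth i) (zeta_psi i).
rewrite mul1r in E; apply: etrans E _.
exact: (congr2 (fun a b => a - b) (congr1 (psi 1) (Dz_comm j i theta_hol)) (mulrC _ _)).
Qed.

Lemma hes_sym (i j : 'I_g) : hes i j = hes j i.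
Proof. exact: (congr1 (psi 1) (Dz_comm i j theta_hol)). Qed.

Lemma dzeta_sym (i j : 'I_g) : dzeta tau i j = dzeta tau j i.
Proof. apply: etrans (dzetaE i j) _; apply: etrans (esym (dzetaE j i)).
exact: (congr2 (fun a b => a - b) (hes_sym i j) (mulrC _ _)). Qed.

Lemma pole_hes (i j : 'I_g) : pole 1 (hes i j).
Proof. exists (Dz i (Dz j th)); [apply: hol_Dz; exact: hol_Dth|exact: erefl]. Qed.

Lemma pole_dzeta (i j : 'I_g) : pole 2 (dzeta tau i j).
Proof. rewrite dzetaE0; exact: (pole_pd j (pole_zeta i)). Qed.

Lemma pd_T n (i j : 'I_g) (f : J) : pole n f -> pd tau i (T j f) = T j (pd tau i f).
Proof.
move=> pf; have [_ rf] := pole_regular pf; apply/funext => z.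
rewrite -[RHS]/(pd tau i f (z + per j)).
have [z0|z0] := eqVneq (th z) 0.
  have z1 : th (z + per j) = 0 by apply/eqP; rewrite theta_per0 //; apply/eqP.
  by rewrite (pd0 i (T j f) z0) pd0.
have z1 : th (z + per j) != 0 by rewrite theta_per0.
have [L HL] := rf _ z1; rewrite (pd_grad i z1 HL).
apply: (pd_grad i z0); exact: grad_shift.
Qed.

Lemma cst0 : cst 0 = 0. Proof. by rewrite cst_un (_ : kc 0 = 0) // mul0r. Qed.

Lemma pd_cst (i : 'I_g) (c : C) : pd tau i (cst c) = 0.
Proof.
rewrite (pd_lead 0 i (hol_cst _ c)) (_ : kc _ = 0) // mul0r subr0 (_ : Dz i (fun=> c) = 0).
  by rewrite -cstE cst0.
apply/funext => z; exact: Dz_grad (has_grad_cst z c).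
Qed.

Lemma T_dzeta (i j k : 'I_g) : T k (dzeta tau i j) = dzeta tau i j.
Proof.
have pz := pole_zeta i; have pz' := pole_regular pz.
rewrite -(pd_T j k pz) zeta_T.
set d := cst _; have pd' : regular d by exact: (pole_regular (pole_cst _)).
have := pd_lin j 1 pd' pz'; rewrite !scale1r addrC => ->; rewrite pd_cst add0r; exact: erefl.
Qed.

Lemma T_dz (i j k : 'I_g) : T k (hes i j - zeta tau i * zeta tau j) = hes i j - zeta tau i * zeta tau j.
Proof. rewrite -dzetaE; exact: T_dzeta. Qed.

Local Notation F := (form J (g + g)).
Local Notation FC := (form C (g + g)).
Local Notation Pn n x := (coefs (pole n) x).
Local Notation del := (kz (fun (j : 'I_g) (f : J) => T j f - f) 0).
Local Notation X := (Mw (dzeta tau)).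

Definition cf (l : FC) : F := fmap (fun d => kc d * cst 1) l.

Lemma cfE l : cf l = fmap cst l.
Proof. by apply/ffunP => S; rewrite !fmapE -cst_un. Qed.

Lemma unity : exists (B0 : J) (B : 'I_g -> J), [/\ pole (-1) B0, forall i : 'I_g, pole (-1) (B i) & B0 + \sum_i B i * zeta tau i = cst 1].
Proof. exact: partition_of_unity. Qed.

Lemma cocycle0 (x : F) : Pn 0 x -> del x = 0 -> exists (mu : FC) (f : F), Pn 0 f /\ x = cf mu + del f.
Proof.
move=> px cx; have [mu [f [pf E]]] := cocycle_pole0 px cx.
exists mu, f; split; [exact: pf|rewrite cfE; exact: E].
Qed.

Lemma coboundary0 (y : F) (mu : FC) : Pn 0 y -> del y = cf mu -> mu = 0.
Proof. rewrite cfE; exact: coboundary_cst. Qed.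

Lemma zeta_Tk (i j : 'I_g) : T j (zeta tau i) = zeta tau i + kc (if i == j then kappa else 0) * cst 1.
Proof. rewrite -cst_un; exact: zeta_T. Qed.

Lemma XJ : dzeta tau = fun i j => hes i j - zeta tau i * zeta tau j.
Proof. apply/funext => i; apply/funext; exact: dzetaE. Qed.

Lemma TjB (j : 'I_g) (f k : J) : T j (f - k) = T j f - T j k. Proof. done. Qed.
Lemma kcD (c d : C) : kc (c + d) = kc c + kc d. Proof. done. Qed.
Lemma kcM (c d : C) : kc (c * d) = kc c * kc d. Proof. done. Qed.

Lemma J_closed (n : nat) (b : F) : Om pole (zeta tau) n.+1%:Z b -> del b = 0 -> hom 0 (g%:Z - 1) b ->
  exists (l : FC) (c : F), [/\ hom n%:Z (g%:Z - 1 - n%:Z) l, Pn n%:Z c, del c = 0, hom 0 (g%:Z - 1 - 1) c &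
    Pn n%:Z (b - iter n X (cf l) + Aw (zeta tau) c)].
Proof.
rewrite XJ; exact: (@descent_closed C g J pole T (zeta tau) hes kc (cst 1) kappa pole_sub pole_kc pole_le (@poleM)
  (fun n j f => @pole_T n j f) TjB (@TjM) (@Tj_comm) kcD kcM erefl kcT (fun j => T_cst j 1) (pole_cst 1) (fun n f => @cst1 f n)
  pole_zeta pole_hes zeta_Tk T_dz unity kappa_neq0
  pos_acyclic neg_acyclic cocycle0 coboundary0).
Qed.

Lemma J_Xn (n : nat) (l : FC) : Pn n.+2%:Z (iter n.+1 X (cf l)).
Proof.
rewrite XJ; exact: (@Pn_Xn C g J pole (zeta tau) hes kc (cst 1) kappa pole_sub pole_kc pole_le (@poleM)
  kcD erefl (pole_cst 1) pole_zeta pole_hes kappa_neq0).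
Qed.

Lemma J_top (n : nat) (s t : int) (l : FC) (c : F) : s + t = g%:Z -> n%:Z < s -> hom s t l ->
  Pn n.+1%:Z c -> del c = 0 -> hom (s - n.+1%:Z) (t + n%:Z) c -> Pn n.+1%:Z (iter n.+1 X (cf l) + Aw (zeta tau) c) ->
  exists mu, hom (s - 1) (t - 1) mu /\ l = om mu.
Proof.
rewrite XJ; exact: (@descent_top C g J pole T (zeta tau) hes kc (cst 1) kappa pole_sub pole_kc pole_le (@poleM)
  (fun n j f => @pole_T n j f) TjB (@TjM) (@Tj_comm) kcD kcM erefl kcT (fun j => T_cst j 1) (pole_cst 1) (fun n f => @cst1 f n)
  pole_zeta pole_hes zeta_Tk T_dz unity kappa_neq0
  neg_acyclic cocycle0 coboundary0).
Qed.

End ThetaDescent.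

(** * From cochains to differential forms on J *)

Section AbelianFunctions.
Lemma lead n (i : 'I_g) (f : J) : pole n f -> pole n (pd tau i f + @kc n%:~R * (zeta tau i * f)).
Proof.
move=> [h hh E]; rewrite (pd_leadE i hh E) subrK; exists (Dz i h); [exact: hol_Dz|exact: erefl].
Qed.
Local Notation T := (@Tj).
Local Notation F := (form J (g + g)).
Local Notation FC := (form C (g + g)).
Local Notation Pn n x := (coefs (pole n) x).
Local Notation del := (kz (fun (j : 'I_g) (f : J) => T j f - f) 0).
Local Notation X := (Mw (dzeta tau)).
Local Notation ddJ := (dd (pd tau)).
Local Notation zw := (Aw (zeta tau)).
Local Notation A n f := (inA tau n f).
Local Notation al i := (@ew J (g + g) (alpha i)).

Definition mero (f : J) := exists n : int, pole n f.
Definition inv (f : J) := forall j : 'I_g, T j f = f.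

Lemma pole_mero n (f : J) : pole n f -> mero f. Proof. by move=> pf; exists n. Qed.

Lemma mero_sub : subgroup mero.
Proof.
split; first by exists 0; exact: pole0.
move=> f k [m pf] [n pk]; exists (`|m|%N%:Z + `|n|%N%:Z); apply: (pole_sub _).2.
  apply: (pole_le _ pf); lia.
apply: (pole_le _ pk); lia.
Qed.

Lemma meroM (f k : J) : mero f -> mero k -> mero (f * k).
Proof. move=> [m pf] [n]; exists (m + n); exact: poleM. Qed.

Lemma mero_regular f : mero f -> regular f. Proof. move=> [n]; exact: pole_regular. Qed.

Lemma mero_pd (i : 'I_g) f : mero f -> mero (pd tau i f).
Proof. move=> [n]; exists (n + 1); exact: pole_pd. Qed.

Lemma pdZD (i : 'I_g) (a : C) f (k : J) : mero f -> mero k -> pd tau i (a *: f + k) = a *: pd tau i f + pd tau i k.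
Proof. move=> /mero_regular rf /mero_regular; exact: pd_lin. Qed.

Lemma pdB (i : 'I_g) (f k : J) : mero f -> mero k -> pd tau i (f - k) = pd tau i f - pd tau i k.
Proof. by move=> mf mk; have := pdZD i (-1) mk mf; rewrite !scaleN1r addrC => ->; rewrite addrC. Qed.

Lemma pdM_mero (i : 'I_g) (f k : J) : mero f -> mero k -> pd tau i (f * k) = f * pd tau i k + k * pd tau i f.
Proof. move=> /mero_regular rf /mero_regular; exact: pdM. Qed.

Lemma pdC (i j : 'I_g) f : mero f -> pd tau i (pd tau j f) = pd tau j (pd tau i f).
Proof. move=> [n pf]; exact: (pd_comm i j pf). Qed.

Lemma mero_dzeta (i j : 'I_g) : mero (dzeta tau i j).
Proof. exists 2; exact: pole_dzeta. Qed.

Lemma dzeta_closed (i l j : 'I_g) : pd tau i (dzeta tau l j) = pd tau j (dzeta tau l i).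
Proof. rewrite !dzetaE0; apply: pdC; exists 1; exact: pole_zeta. Qed.

Lemma ddX (n : nat) (x : F) : coefs mero x -> ddJ (iter n X x) = iter n X (ddJ x) /\ coefs mero (iter n X x).
Proof. exact: (dd_iter_Mw mero_sub meroM pdB pdM_mero mero_dzeta dzeta_closed). Qed.

Lemma mero_cf l : coefs mero (cf l).
Proof. rewrite cfE => S; rewrite fmapE; exists 0; exact: pole_cst. Qed.

Lemma ddX_cf (n : nat) l : ddJ (iter n X (cf l)) = 0.
Proof.
have [->] := ddX n (mero_cf l); rewrite (_ : ddJ (cf l) = 0) ?linear0 //.
rewrite /dd big1 // => i; rewrite (_ : fmap _ _ = 0) ?linear0 //; apply/ffunP => S.
by rewrite cfE !fmapE form0 pd_cst.
Qed.

Lemma inv_sub : subgroup inv.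
Proof. by split => [j|f k If Ik j]; [exact: erefl|rewrite TjB If Ik]. Qed.

Lemma invM (f k : J) : inv f -> inv k -> inv (f * k).
Proof. by move=> If Ik j; rewrite TjM If Ik. Qed.

Lemma inv_kc c : inv (kc c). Proof. done. Qed.

Lemma inv_X (n : nat) (x : F) : coefs inv x -> coefs inv (iter n X x).
Proof.
move=> Ix; elim: n => [|n]; first exact: Ix.
rewrite iterS; exact: (coefs_Mw inv_sub invM (fun l j k => T_dzeta l j k)).
Qed.

Lemma inv_cf l : coefs inv (cf l).
Proof. rewrite cfE => S j; rewrite fmapE; exact: T_cst. Qed.

Lemma inv_dd n (x : F) : Pn n x -> coefs inv x -> coefs inv (ddJ x).
Proof.
move=> px Ix; apply: coefs_sum => [|i _]; [exact: inv_sub|]; apply: coefs_ew => [|S j]; first exact: inv_sub.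
by rewrite fmapE -(pd_T _ _ (px S)) Ix.
Qed.

Lemma inv_del0 (x : F) : coefs inv x -> del x = 0.
Proof.
move=> Ix; rewrite /kz big1 // => j; rewrite (_ : fmap _ _ = 0) ?linear0 //; apply/ffunP => S.
by rewrite fmapE form0 (Ix) subrr.
Qed.

(** In beta-degree 0 Cartan's formula reads (T_j - 1) x = iota_j (del x). *)
Lemma hom0_inv k (x : F) : hom 0 k x -> del x = 0 -> coefs inv x.
Proof.
move=> hx dx S j; have ib0 : ei (beta j) x = 0 by apply: hom_neg (@hom_ib _ _ 0 k j x hx).
have := ib_kz (@DelB : forall i (u : J), _) x (leq0n j); rewrite ib0 dx linear0 kz0; last exact: (@DelB).
rewrite subr0 => /(congr1 (fun y : F => y S)); rewrite form0 fmapE => /esym/eqP.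
by rewrite subr_eq0 => /eqP.
Qed.

Lemma lead_form n (x : F) : Pn n x -> Pn n (ddJ x + kc n%:~R *: zw x).
Proof.
move=> px; rewrite scaler_sumr -big_split; apply: coefs_sum => [|i _]; [exact: pole_sub|rewrite /=].
have -> : al i (fmap (pd tau i) x) + kc n%:~R *: (zeta tau i *: al i x) =
    al i ([ffun S : {set 'I_(g + g)} => pd tau i (x S) + kc n%:~R * (zeta tau i * x S)] : F).
  rewrite -ew_comb; congr (al _); apply/ffunP => S; rewrite [LHS]ffunE [RHS]ffunE fmapE; exact: erefl.
apply: coefs_ew => [|S]; [exact: pole_sub|rewrite ffunE; exact: lead].
Qed.

Lemma AE n (f : J) : A n f <-> pole n f /\ inv f. Proof. exact: inA_pole. Qed.

Lemma A_coefs (n : nat) (x : F) : coefs (inA tau n) x <-> Pn n%:Z x /\ coefs inv x.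
Proof.
split=> [Ax|[px Ix] S]; last by apply/AE.
by split=> S; have [] := (AE n (x S)).1.
Qed.

Lemma A_sub n : subgroup (inA tau n).
Proof.
split; first by apply/AE; split; [exact: pole0|exact: inv_sub.1].
move=> f k /AE[pf If] /AE[pk Ik]; apply/AE; split; [exact: (pole_sub _).2|exact: inv_sub.2].
Qed.

Lemma A_kc n c (f : J) : A n f -> A n (kc c * f).
Proof.
move=> /AE[pf If]; apply/AE; split; [exact: pole_kc|exact: invM].
Qed.

Lemma A_le m n (f : J) : (m <= n)%N -> A m f -> A n f.
Proof. by move=> mn /AE[pf If]; apply/AE; split=> //; apply: pole_le pf. Qed.

Lemma A_pd n (i : 'I_g) (f : J) : A n f -> A n.+1 (pd tau i f).
Proof.
move=> /AE[pf If]; apply/AE; split.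
  by have := pole_pd i pf; rewrite -PoszD addn1.
by move=> j; rewrite -(pd_T _ _ pf) If.
Qed.

Lemma A_mero n (f : J) : A n f -> mero f. Proof. by move=> /AE[pf]; exists n%:Z. Qed.

Lemma A_const (f : J) : A 1 f -> exists c, f = cst c.
Proof. move=> /AE[pf]; exact: invariant_pole1. Qed.

Lemma A1_form q k (x : F) : hom q k x -> coefs (inA tau 1) x -> exists2 l : FC, hom q k l & x = cf l.
Proof.
move=> hx Ax; have /choice[l Hl] : forall S, exists c, x S = cst c by move=> S; exact: A_const.
exists (proj q k [ffun S : {set 'I_(g + g)} => l S]); first exact: hom_proj.
apply/ffunP => S; rewrite cfE !ffunE; case: ifPn => h; first exact: Hl.
by rewrite hx // cst0.
Qed.

Lemma prev_A n (f : J) : inA_prev tau n f -> A n f.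
Proof. case: n => [|n]; [move=> ->; exact: (A_sub 0).1|exact: A_le]. Qed.

Lemma hom_dd q k (x : F) : hom q k x -> hom q (k + 1) (ddJ x).
Proof.
move=> hx; apply: hom_sum => i _; apply: hom_al; apply: hom_fmap hx.
by have := pdB i mero_sub.1 mero_sub.1; rewrite !subrr.
Qed.

Lemma dd_kc (c : C) n (x : F) : Pn n x -> ddJ (kc c *: x) = kc c *: ddJ x.
Proof.
move=> px; rewrite scaler_sumr; apply: eq_bigr => i _; rewrite -linearZ; congr (al _).
apply/ffunP => S; rewrite fmapE !formZ fmapE.
by have := pdZD i c (pole_mero (px S)) mero_sub.1; rewrite (_ : pd tau i 0 = 0) ?addr0; have := pdB i mero_sub.1 mero_sub.1; rewrite !subrr.
Qed.

Lemma dd0 : ddJ 0 = 0.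
Proof.
rewrite /dd big1 // => i; rewrite (_ : fmap _ _ = 0) ?linear0 //; apply/ffunP => S.
by rewrite fmapE form0; have := pdB i mero_sub.1 mero_sub.1; rewrite !subrr.
Qed.

Lemma kcZZ (c d : C) (x : F) : kc c *: (kc d *: x) = kc (c * d) *: x. Proof. exact: scalerA. Qed.
Lemma kc1 (x : F) : kc 1 *: x = x. Proof. exact: scale1r. Qed.
Lemma pole_kcZ n (c : C) (x : F) : Pn n x -> Pn n (kc c *: x). Proof. move=> px S; rewrite formZ; exact: pole_kc. Qed.
Lemma coefsN (P : J -> Prop) (x : F) : subgroup P -> coefs P x -> coefs P (- x).
Proof. move=> Px; rewrite -sub0r; apply: coefsB => //; exact: coefs0. Qed.

(** [lead_form] is used in both directions: it puts b into [Om], and it replaces zeta /\ c by - d (c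
    / (n + 1)) up to order n + 1. *)
Lemma A_closed_pos n (b : F) : hom 0 (g%:Z - 1) b -> coefs (inA tau n.+2) b -> coefs (inA tau n.+2) (ddJ b) ->
  exists (l : FC) (c : F), [/\ hom n.+1%:Z (g%:Z - 1 - n.+1%:Z) l, hom 0 (g%:Z - 1 - 1) c, coefs (inA tau n.+1) c &
    coefs (inA tau n.+1) (b - iter n.+1 X (cf l) - ddJ c)].
Proof.
move=> hb /A_coefs[pb Ib] /A_coefs[pdb _]; have s2 := pole_sub n.+2%:Z; have s1 := pole_sub n.+1%:Z.
have n2 : n.+2%:R != 0 :> C by rewrite pnatr_eq0. have n1 : n.+1%:R != 0 :> C by rewrite pnatr_eq0.
have Ob : Om pole (zeta tau) n.+2%:Z b.
  split => //; have := pole_kcZ (n.+2%:R^-1) (coefsB s2 (lead_form pb) pdb).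
  by rewrite addrC addKr kcZZ mulVf // kc1.
have [l [c [hl pc dc hc H]]] := J_closed Ob (inv_del0 Ib) hb.
have Ic := hom0_inv hc dc.
have pc' : Pn n.+1%:Z (kc (n.+1%:R^-1) *: c) by exact: pole_kcZ.
have Ic' : coefs inv (kc (n.+1%:R^-1) *: c) by move=> S; rewrite formZ; exact: invM (inv_kc _) (Ic S).
exists l, (kc (n.+1%:R^-1) *: c); split => //; first exact: homZ.
  by apply/A_coefs.
apply/A_coefs; split.
  have E : kc (n.+1%:R^-1) *: (ddJ c + kc n.+1%:R *: zw c) = ddJ (kc (n.+1%:R^-1) *: c) + zw c.
    by rewrite scalerDr (dd_kc (n.+1%:R^-1) pc) kcZZ (mulVf n1) kc1.
  have := coefsB s1 H (pole_kcZ (n.+1%:R^-1) (lead_form pc)); rewrite E opprD addrACA subrr addr0; exact: id.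
apply: (coefsB inv_sub); last exact: inv_dd.
apply: (coefsB inv_sub) => //; apply: inv_X; exact: inv_cf.
Qed.

(** In orders 0 and 1 the functions are constants ([A_const]), so b is itself a constant form and
    the remainder is 0. *)
Lemma A_closed n (b : F) : hom 0 (g%:Z - 1) b -> coefs (inA tau n) b -> coefs (inA tau n) (ddJ b) ->
  exists (l : FC) (c : F), [/\ hom n.-1%:Z (g%:Z - 1 - n.-1%:Z) l, hom 0 (g%:Z - 1 - 1) c, coefs (inA_prev tau n) c &
    coefs (inA_prev tau n) (b - iter n.-1 X (cf l) - ddJ c)].
Proof.
case: n => [|[|n]] hb Ab; last exact: A_closed_pos.
  have [l hl ->] := A1_form hb (fun S => A_le (leqnSn 0) (Ab S)).
  exists l, 0; rewrite subr0 subrr dd0 subr0; split => //; first exact: hom0.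
  - by move=> S; rewrite form0.
  - by move=> S; rewrite form0.
have [l hl ->] := A1_form hb Ab.
exists l, 0; rewrite subr0 subrr dd0 subr0; split => //; first exact: hom0.
- exact: coefs0 (A_sub 0).
- exact: coefs0 (A_sub 0).
Qed.

Lemma A_top p (l : FC) (c : F) : hom p.+1%:Z (g%:Z - p.+1%:Z) l -> hom 0 (g%:Z - 1) c -> coefs (inA tau p.+1) c ->
  coefs (inA tau p.+1) (iter p.+1 X (cf l) + ddJ c) -> exists mu, hom p%:Z (g%:Z - p.+1%:Z - 1) mu /\ l = om mu.
Proof.
move=> hl hc /A_coefs[pc Ic] /A_coefs[H _]; have s1 := pole_sub p.+1%:Z.
have pE : p.+1%:Z - 1 = p%:Z by lia.
have := @J_top p p.+1%:Z (g%:Z - p.+1%:Z) l (- (kc p.+1%:R *: c)).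
rewrite pE; apply => //; try lia.
- apply: coefsN => //; exact: pole_kcZ.
- apply: inv_del0; apply: coefsN; [exact: inv_sub|move=> S; rewrite formZ; exact: invM (Ic S)].
- rewrite subrr; apply: homN; apply: homZ; move: hc; congr hom; lia.
have := coefsB s1 H (lead_form pc); rewrite opprD addrA addrK.
have -> : zw (- (kc p.+1%:R *: c)) = - (kc p.+1%:R *: zw c) by rewrite linearN linearZ.
done.
Qed.

End AbelianFunctions.

Let ms := mero_sub.

(** * The functions of d zeta_I /\ dz_K *)

Section TopClasses.
Local Notation F := (form J (g + g)).
Local Notation FC := (form C (g + g)).
Implicit Types (S T : {set 'I_(g + g)}) (l : FC).

Lemma kcV_nat (n : nat) : (0 < n)%N -> kc (n%:R^-1) * n%:R = 1.
Proof.
move=> n0; have kn : kc n%:R = n%:R by elim: {n0}n => [|n IH]; rewrite // -[n.+1]add1n !natrD kcD IH.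
by rewrite -kn -kcM mulVf // pnatr_eq0 -lt0n.
Qed.

Local Notation X := (Mw (dzeta tau)).
Local Notation ddJ := (dd (pd tau)).
Local Notation A n f := (inA tau n f).
Local Notation al i := (@ew J (g + g) (alpha i)).

(** 1 / p! undoes the factor of [iter_Mw_bes] (see [Wfun_Psi]). *)
Definition Psi_top (p : nat) l : J := kc (p`!%:R^-1) * (iter p X (cf l) (atop g) : J).

Lemma cf_dl S : cf (dl C S) = cst 1 *: dl J S.
Proof.
apply/ffunP => U; rewrite formZ fmapE !dlE; case: eqP; first by rewrite mulrC.
by rewrite mul0r mulr0.
Qed.

Lemma Aw_dz (k : 'I_g) (y : F) : Aw (@dz R g k) y = al k y.
Proof.
rewrite /Aw (bigD1 k) //= big1 => [|j jk]; first by rewrite /dz eqxx scale1r addr0.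
by rewrite /dz (negbTE jk) scale0r.
Qed.

Lemma cf_lin (a : C) l (m : FC) : cf (a *: l + m) = kc a *: cf l + cf m.
Proof. by apply/ffunP => S; rewrite formD formZ !fmapE formD formZ mulrDl mulrA. Qed.

Lemma cf0 : cf 0 = 0.
Proof. by apply/ffunP => S; rewrite fmapE !form0 mul0r. Qed.

Lemma Psi_lin (p : nat) (a : C) l (m : FC) : Psi_top p (a *: l + m) = kc a * Psi_top p l + Psi_top p m.
Proof. by rewrite /Psi_top cf_lin linearP formD formZ mulrDr mulrCA. Qed.

Lemma Psi_top0 p : Psi_top p 0 = 0. Proof. by rewrite /Psi_top cf0 linear0 form0 mulr0. Qed.

Lemma Psi_sum (p : nat) (I : Type) (r : seq I) (P : pred I) (a : I -> C) (l : I -> FC) :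
  Psi_top p (\sum_(i <- r | P i) a i *: l i) = \sum_(i <- r | P i) kc (a i) * Psi_top p (l i).
Proof.
elim: r => [|i r IH]; first by rewrite !big_nil Psi_top0.
by rewrite !big_cons; case: ifP => //; rewrite Psi_lin IH.
Qed.

Lemma Wfun_Psi S : Wfun tau S = Psi_top #|beta_part S| (dl C S).
Proof.
rewrite Wfun_def off_theta_un /Psi_top cf_dl linearZ /= formZ mulrCA; congr (_ * _).
set s := _ ++ _; have -> : ecoef (wedge_seq s) [set: 'I_g]%SET = emb (wedge_seq s) (atop g).
  by rewrite embE beta_part_atop eqxx alpha_part_atop.
rewrite emb_wedge_seq foldr_cat !foldr_map.
pose y := foldr (fun i x => al i x) (dl J finset.set0) (enum (alpha_part S)).
have yE r : foldr (fun (i : 'I_g) x => Aw (@dz R g i) x) (dl J finset.set0) r = foldr (fun i x => al i x) (dl J finset.set0) r.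
  by elim: r => //= k r ->; rewrite Aw_dz.
apply: (etrans (congr1 (fun w => foldr (fun i x => Aw (dzeta tau i) x) w (enum (beta_part S)) (atop g)) (yE (enum (alpha_part S))))).
have Xy : X y = 0.
  rewrite /y; elim: (enum _) => [|k r IH]; last by rewrite Mw_al IH linear0.
  rewrite /Mw big1 // => i; rewrite (_ : ei _ _ = 0) ?linear0 //; apply/ffunP => U.
  rewrite eiE dlE form0; case: ifP => //; case: eqP => [/finset.setP/(_ (beta i))|]; last by rewrite mulr0.
  by rewrite !inE eqxx.
have [E] := iter_Mw_bes (enum (beta_part S)) Xy.
have dS : dl J S = foldr (fun i x => ew (beta i) x) y (enum (beta_part S)) by exact: dl_foldr.
rewrite cardE dS E formZ mulrA kcV_nat ?mul1r ?fact_gt0 //.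
Qed.

Definition Wl l : J := \sum_(S : {set 'I_(g + g)}) kc (l S) * Wfun tau S.

Lemma Wl_Psi (p : nat) (k : int) l : hom p%:Z k l -> Wl l = Psi_top p l.
Proof.
move=> hl; rewrite {2}(form_dl l) Psi_sum; apply: eq_bigr => S.
have [/andP[/eqP b _]|h] := boolP (bideg p%:Z k S); last by rewrite hl // !mul0r.
by rewrite Wfun_Psi; case: b => ->.
Qed.

Lemma A_Xn p l S : A (if p == 0 then 0 else p.+1)%N (iter p X (cf l) S).
Proof.
apply/AE => //; split; last by apply: inv_X; exact: inv_cf.
case: p => [|p]; first by rewrite cfE fmapE; exact: pole_cst.
exact: J_Xn.
Qed.

Lemma A_Psi p l : A (if p == 0 then 0 else p.+1)%N (Psi_top p l).
Proof. apply: A_kc => //; exact: A_Xn. Qed.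

Lemma A_Wfun S : A (if #|beta_part S| == 0 then 0 else #|beta_part S|.+1)%N (Wfun tau S).
Proof. rewrite Wfun_Psi; exact: A_Psi. Qed.

Lemma A_Wlevel S : A (Wlevel S) (Wfun tau S).
Proof. by have := A_Wfun S; rewrite cards_eq0. Qed.

(** X commutes with omega by symmetry of [dzeta], and omega /\ - has no component along dz^g. *)
Lemma Psi_om p l : Psi_top p (om l) = 0.
Proof.
have fe (i : 'I_(g + g)) (m : FC) : cf (ew i m) = ew i (cf m).
  by apply: fmap_ew => [|U]; rewrite ?mul0r // mulNr.
have cfo : cf (om l) = om (cf l).
  rewrite (_ : cf (\sum_i _) = \sum_i cf (ew (beta i) (ew (alpha i) l))); last first.
    by apply: (big_morph _ _ cf0) => u; have := cf_lin 1 u; rewrite scale1r scale1r.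
  by apply: eq_bigr => i; rewrite !fe.
rewrite /Psi_top cfo (@iter_com J g X (@om J g)) => [|y]; last by apply: Mw_om; exact: dzeta_sym.
by rewrite om_atop mulr0.
Qed.

Lemma cf_al (i : 'I_g) l : cf (ew (alpha i) l) = al i (cf l).
Proof. by apply: fmap_ew => [|U]; rewrite ?mul0r // mulNr. Qed.

Lemma Psi_al p (i : 'I_g) l : Psi_top p (ew (alpha i) l) = kc (p`!%:R^-1) * (al i (iter p X (cf l)) (atop g) : J).
Proof. rewrite /Psi_top cf_al (@iter_com J g X (al i)) //; exact: Mw_al. Qed.

Lemma mero0_pd (i : 'I_g) : pd tau i 0 = 0.
Proof. by have := pdB i mero_sub.1 mero_sub.1; rewrite !subrr. Qed.

Lemma pd_kc (i : 'I_g) (a : C) (f : J) : mero f -> pd tau i (kc a * f) = kc a * pd tau i f.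
Proof.
move=> mf; have := pdZD i a mf mero_sub.1.
by rewrite mero0_pd !addr0.
Qed.

Lemma pd_al (i j : 'I_g) (x : F) S : coefs mero x -> pd tau i (al j x S) = al j (fmap (pd tau i) x) S.
Proof.
move=> mx; rewrite -(fmap_D_ew mero_sub pdB i (alpha j) mx) fmapE //.
Qed.

(** This is the dz^g coefficient of d (X^p l) / p!, and X^p l is closed ([ddX_cf]). *)
Lemma sum_pd_Psi p l : \sum_i pd tau i (Psi_top p (ew (alpha i) l)) = 0.
Proof.
have mX : coefs mero (iter p X (cf l)) by move=> S; apply: A_mero (A_Xn p l S).
rewrite (eq_bigr (fun i => kc (p`!%:R^-1) * (al i (fmap (pd tau i) (iter p X (cf l))) (atop g) : J))) => [|i]; last first.
  rewrite Psi_al pd_kc ?pd_al //; exact: (@coefs_ew _ _ mero (alpha i) _ mero_sub mX (atop g)).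
rewrite -mulr_sumr -form_sum -/(ddJ _) ddX_cf // form0 mulr0 //.
Qed.

End TopClasses.

(** * Differential operators acting on meromorphic functions *)

Section DAction.
Local Notation D := (Dring R g).
Implicit Types (P Q : D) (f h : J).

Definition act (s : seq 'I_g) (m : multinom g) f : J := foldr (fun i h => iter (m i) (pd tau i) h) f s.

Lemma Dact_act P f : Dact tau P f = \sum_(m <- msupp P) mcoeff m P *: act (enum 'I_g) m f.
Proof. done. Qed.

Lemma mero_lin (a : C) f h : mero f -> mero h -> mero (a *: f + h).
Proof.
move=> [m pf] mh; have := ms.2 _ _ mh (pole_mero (pole_lin (- a) pf (pole0 m))).
by rewrite addr0 scaleNr opprK addrC.
Qed.

Lemma meroZ (a : C) f : mero f -> mero (a *: f).
Proof. by move=> mf; have := mero_lin a mf ms.1; rewrite addr0. Qed.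

Lemma mero_iter (i : 'I_g) (n : nat) f : mero f -> mero (iter n (pd tau i) f).
Proof. move=> mf; elim: n => //= n; exact: mero_pd. Qed.

Lemma mero_act s m f : mero f -> mero (act s m f).
Proof. move=> mf; elim: s => //= s IH; exact: mero_iter. Qed.

Lemma iter_pd_lin (i : 'I_g) (n : nat) (a : C) f h : mero f -> mero h ->
  iter n (pd tau i) (a *: f + h) = a *: iter n (pd tau i) f + iter n (pd tau i) h.
Proof. move=> mf mh; elim: n => //= n ->; rewrite pdZD //; exact: mero_iter. Qed.

Lemma act_lin s m (a : C) f h : mero f -> mero h -> act s m (a *: f + h) = a *: act s m f + act s m h.
Proof. move=> mf mh; elim: s => //= i s ->; rewrite iter_pd_lin //; exact: mero_act. Qed.

Lemma pd_iter (i j : 'I_g) (n : nat) f : mero f -> pd tau i (iter n (pd tau j) f) = iter n (pd tau j) (pd tau i f).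
Proof.
move=> mf; elim: n => [|n IH]; first exact: erefl.
rewrite !iterS -IH; exact: (pdC i j (mero_iter j n mf)).
Qed.

Lemma pd_act (i : 'I_g) s m f : mero f -> pd tau i (act s m f) = act s m (pd tau i f).
Proof. move=> mf; elim: s => //= j s <-; rewrite pd_iter //; exact: mero_act. Qed.

Lemma iter_act (i : 'I_g) (n : nat) s m f : mero f -> iter n (pd tau i) (act s m f) = act s m (iter n (pd tau i) f).
Proof. move=> mf; elim: n => //= n ->; rewrite pd_act //; exact: mero_iter. Qed.

Lemma act_add s m m' f : mero f -> act s (mnm_add m m') f = act s m (act s m' f).
Proof.
move=> mf; elim: s => //= i s ->; rewrite mnmDE iterD.
rewrite iter_act //; exact: mero_act.
Qed.

Lemma act_mnm1 s (i : 'I_g) f : uniq s -> act s (mnm1 i) f = if i \in s then pd tau i f else f.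
Proof.
elim: s => //= j s IH /andP[js us]; rewrite IH // mnm1E inE; case: eqVneq => [->|ij]; last by [].
by rewrite (negbTE js).
Qed.

Lemma DactE (A : seq (multinom g)) P f : uniq A -> (forall m, m \notin A -> mcoeff m P = 0) ->
  Dact tau P f = \sum_(m <- A) mcoeff m P *: act (enum 'I_g) m f.
Proof.
move=> uA PA; rewrite [RHS](bigID (fun m => m \in msupp P)) /= [X in _ + X]big1 ?addr0 => [|m]; last first.
  by rewrite -mcoeff_eq0 => /eqP ->; rewrite scale0r.
rewrite -[RHS]big_filter; apply: perm_big; apply: uniq_perm => [||m]; [exact: msupp_uniq|exact: filter_uniq|].
rewrite mem_filter; case: (boolP (m \in msupp P)) => //= mP; symmetry; apply: contraTT mP => /PA /eqP.
by rewrite mcoeff_eq0.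
Qed.

Lemma Dact_linl (a : C) P Q f : Dact tau (a *: P + Q) f = a *: Dact tau P f + Dact tau Q f.
Proof.
pose A := undup (msupp P ++ msupp Q); have uA : uniq A by exact: undup_uniq.
have AP m : m \notin A -> mcoeff m P = 0 by rewrite mem_undup mem_cat negb_or -!mcoeff_eq0 => /andP[/eqP].
have AQ m : m \notin A -> mcoeff m Q = 0 by rewrite mem_undup mem_cat negb_or -!mcoeff_eq0 => /andP[_ /eqP].
rewrite (DactE f uA AP) (DactE f uA AQ) (DactE f uA) => [|m mA]; last by rewrite mcoeffD mcoeffZ AP // AQ // mulr0 addr0.
rewrite scaler_sumr -big_split; apply: eq_bigr => m.
by rewrite mcoeffD mcoeffZ scalerDl scalerA.
Qed.

Lemma Dact0l f : Dact tau 0 f = 0.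
Proof. by rewrite (@DactE [::]) ?big_nil // => m; rewrite mcoeff0. Qed.

Lemma DactXl m f : Dact tau (mpolyX C m) f = act (enum 'I_g) m f.
Proof.
rewrite (@DactE [:: m]) // => [|m']; first by rewrite big_seq1 mcoeffX eqxx scale1r.
by rewrite inE mcoeffX eq_sym => /negbTE ->.
Qed.

Lemma mero_sum (I : eqType) (r : seq I) (G : I -> J) : (forall i : I, mero (G i)) -> mero (\sum_(i <- r) G i).
Proof.
move=> mG; elim: r => [|i r IH]; first by rewrite big_nil; exact: ms.1.
by rewrite big_cons; have := mero_lin 1 (mG i) IH; rewrite scale1r.
Qed.

Lemma mero_Dact P f : mero f -> mero (Dact tau P f).
Proof. move=> mf; apply: mero_sum => m; apply: meroZ; exact: mero_act. Qed.

Lemma Dact_linr P (a : C) f h : mero f -> mero h -> Dact tau P (a *: f + h) = a *: Dact tau P f + Dact tau P h.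
Proof.
move=> mf mh; rewrite !Dact_act scaler_sumr -big_split; apply: eq_bigr => m.
by rewrite act_lin // scalerDr !scalerA mulrC.
Qed.

Lemma Dact0r P : Dact tau P 0 = 0.
Proof. by have := Dact_linr P (-1) ms.1 ms.1; rewrite scaler0 addr0 scaleN1r addNr. Qed.

Lemma DactM P Q f : mero f -> Dact tau (P * Q) f = Dact tau P (Dact tau Q f).
Proof.
move=> mf; elim/mpolyind: P => [|c m P _ _ IH]; first by rewrite mul0r !Dact0l.
rewrite mulrDl -scalerAl !Dact_linl IH; congr (_ *: _ + _); rewrite DactXl.
elim/mpolyind: Q {IH} => [|d n Q _ _ IH]; first by rewrite mulr0 !Dact0l -(DactXl) Dact0r.
rewrite mulrDr -scalerAr !Dact_linl IH DactXl act_lin; [|exact: mero_act|exact: mero_Dact].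
by rewrite -mpolyXD DactXl act_add.
Qed.

Lemma Dact_var (i : 'I_g) f : Dact tau (Dvar i) f = pd tau i f.
Proof. by rewrite DactXl act_mnm1 ?enum_uniq // mem_enum. Qed.

Lemma Dact1 f : Dact tau 1 f = f.
Proof.
rewrite -(mpolyX0) DactXl; elim: (enum _) => //= i; by rewrite mnm0E.
Qed.

Lemma DactC (a : C) f : Dact tau (mpolyC g a) f = a *: f.
Proof. by rewrite -[mpolyC g a]mulr1 mul_mpolyC -[a *: 1]addr0 Dact_linl Dact1 Dact0l addr0. Qed.

End DAction.

Hypothesis g_ge2 : (2 <= g)%N.
Let g_gt0 : (0 < g)%N := ltnW g_ge2.

(** * The cohomology group in top degree and the evaluation map *)

Section TopCohomology.
Local Notation F := (form J (g + g)).
Local Notation FC := (form C (g + g)).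
Local Notation A n f := (inA tau n f).
Local Notation Ap n f := (inA_prev tau n f).
Local Notation al i := (@ew J (g + g) (alpha i)).
Local Notation ia i := (@ei J (g + g) (alpha i)).
Implicit Types (S T : {set 'I_(g + g)}) (l : FC) (h k : J).

Let As n := A_sub n.
Let pAp n h : Ap n h -> A n h := @prev_A n h.
Let mA n h : A n h -> mero h := @A_mero n h.

Lemma subgroupD (P : J -> Prop) h k : subgroup P -> P h -> P k -> P (h + k).
Proof. move=> sP Ph Pk; rewrite -[k]opprK; apply: sP.2 => //; exact: subgroupN. Qed.

Lemma subgroup_sum (P : J -> Prop) (I : Type) (r : seq I) (Q : pred I) (G : I -> J) : subgroup P ->
  (forall i : I, P (G i)) -> P (\sum_(i <- r | Q i) G i).
Proof. move=> sP PG; apply: (big_ind) => [|h k|i _]; [exact: sP.1|exact: subgroupD|exact: PG]. Qed.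

Lemma Ap_sub n : subgroup (inA_prev tau n).
Proof.
case: n; last exact: As.
split=> [|u v]; [exact: erefl|move=> -> ->; exact: subrr].
Qed.

Lemma Ap_kc n (a : C) h : Ap n h -> Ap n (kc a * h).
Proof.
case: n => [|n]; last exact: A_kc.
move=> ->; exact: mulr0.
Qed.

Lemma Ap_pd n (i : 'I_g) h : Ap n h -> A n (pd tau i h).
Proof.
case: n => [|n]; last exact: A_pd.
move=> ->; rewrite mero0_pd //; exact: (As 0).1.
Qed.

Lemma Ap_mero n h : Ap n h -> mero h.
Proof. move=> /pAp; exact: mA. Qed.

(** Vanishing in H^g on representatives ([Hclass0]); the signs of (g-1)-forms are absorbed into
    w. *)
Definition in_exact n h := exists w : 'I_g -> J, (forall i : 'I_g, Ap n (w i)) /\ Ap n (h - \sum_i pd tau i (w i)).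

Lemma in_exact_lin n (a : C) h k : in_exact n h -> in_exact n k -> in_exact n (kc a * h + k).
Proof.
move=> [w [Aw Eh]] [v [Av]]; exists (fun i => kc a * w i + v i); split=> [i|].
  by apply: subgroupD; [exact: Ap_sub|exact: Ap_kc|].
have -> : \sum_i pd tau i (kc a * w i + v i) = kc a * (\sum_i pd tau i (w i)) + \sum_i pd tau i (v i).
  rewrite mulr_sumr -big_split; apply: eq_bigr => i _.
  exact: (pdZD i a (Ap_mero (Aw i)) (Ap_mero (Av i))).
apply: (eq_ind_r (fun u => Ap n u) _ (@lin_diff J (kc a) h k _ _)); exact: (subgroupD (Ap_sub n) (Ap_kc a Eh)).
Qed.

Lemma in_exact_prev n h : Ap n h -> in_exact n h.
Proof.
move=> Eh; exists (fun=> 0); split=> [i|]; first exact: (Ap_sub n).1.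
rewrite big1 ?subr0 // => i _; exact: mero0_pd.
Qed.

Lemma gr_class0 n (f : Afun tau n) : gr_class f = 0 <-> Ap n f.
Proof.
have -> : (gr_class f = 0) = (gr_class f = qclass [set f : Afun tau n | Ap n f] 0) by rewrite linear0.
split=> [/qclass_eq|Ef]; last by apply/qclass_eq; rewrite subr0; exact: in_span_self.
rewrite subr0 => /span_predP; elim=> [|a x y Ex _ Ey]; first exact: (Ap_sub n).1.
have := subgroupD (Ap_sub n) (Ap_kc a Ex) Ey; exact: id.
Qed.

Definition sgt (i : 'I_g) : J := (-1) ^+ #|[set j in [set: 'I_g] | (j < i)%N]%SET|.

Lemma sgt2 i : sgt i * sgt i = 1.
Proof. by rewrite /sgt -signr_odd; case: odd; rewrite ?mul1r // mulrNN mul1r. Qed.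

Lemma sgt_sub (P : J -> Prop) i h : subgroup P -> P h -> P (sgt i * h).
Proof. move=> Ph; rewrite /sgt -signr_odd; case: odd; rewrite ?mul1r // mulN1r; exact: subgroupN. Qed.

Lemma pd_sgt (i j : 'I_g) h : mero h -> pd tau i (sgt j * h) = sgt j * pd tau i h.
Proof.
move=> mh; rewrite /sgt -signr_odd; case: odd; rewrite ?mul1r // !mulN1r.
by have := pdB i ms.1 mh; rewrite !sub0r mero0_pd // sub0r.
Qed.

Lemma ecoef_dform (w : ext J g g.-1) : ecoef (dform tau g w) [set: 'I_g]%SET =
  \sum_i sgt i * pd tau i (ecoef w ([set: 'I_g] :\ i)%SET).
Proof.
rewrite (big_morph (fun x : ext J g g => ecoef x [set: 'I_g]%SET) (id1 := 0) (op1 := +%R)); last 2 first.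
- by move=> x y; have := ecoef_linear 1 x y [set: 'I_g]%SET; rewrite scale1r mul1r.
- exact: ecoef0.
apply: eq_bigr => i; rewrite ecoef_wedge1; last by rewrite prednK.
rewrite inE; rewrite /ecoef; case: insub => [T|] /=; first by rewrite ffunE.
by rewrite mero0_pd.
Qed.

Lemma Hclass0 n (f : Afun tau n) : Hclass f = 0 <-> in_exact n f.
Proof.
have -> : (Hclass f = 0) = (Hclass f = qclass (@exact_gr R g tau n) 0) by rewrite linear0.
split=> [/qclass_eq|[w [Aw Ef]]].
  rewrite subr0 => /span_predP; move E : (gr_class f) => x Hx.
  elim: Hx f E => [|a y z [k [w [Aw Ek ->]]] _ IH] f E; first by apply: in_exact_prev; apply/gr_class0.
  have Ek' : in_exact n k.
    exists (fun i => sgt i * ecoef w ([set: 'I_g] :\ i)%SET).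
    have Aw' i : Ap n (ecoef w ([set: 'I_g] :\ i)%SET).
      rewrite /ecoef; case: insub; [exact: Aw|exact: (Ap_sub n).1].
    split=> [i|]; first by apply: sgt_sub; [exact: Ap_sub|].
    rewrite -Ek ecoef_dform [X in - X](eq_bigr (fun i => sgt i * pd tau i (ecoef w ([set: 'I_g] :\ i)%SET))) => [|i].
      rewrite subrr; exact: (Ap_sub n).1.
    rewrite pd_sgt //; exact: Ap_mero.
  have Ez : gr_class (f - a *: k) = z.
    have : gr_class (f - a *: k) = gr_class f - a *: gr_class k by rewrite /gr_class linearB linearZ.
    by rewrite E addrAC subrr add0r.
  have := in_exact_lin a Ek' (IH _ Ez); congr in_exact.
  by change (a *: (k : J) + ((f : J) - a *: (k : J)) = (f : J)); rewrite addrC subrK.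
apply/qclass_eq; rewrite subr0; apply: in_span_self.
pose E := \sum_i pd tau i (w i); have AE : E \in A_pred tau n.
  apply/asboolP; apply: subgroup_sum; [exact: As|move=> i; exact: Ap_pd].
pose v : ext J g g.-1 := [ffun T : ksubset g g.-1 => \sum_(i | i \notin val T) sgt i * w i].
have vE i : ecoef v ([set: 'I_g] :\ i)%SET = sgt i * w i.
  have c : #|([set: 'I_g] :\ i)%SET| == g.-1.
    have := cardsD1 i [set: 'I_g]%SET; rewrite inE cardsT card_ord; lia.
  rewrite /ecoef insubT /= ffunE (bigD1 i) /=; last by rewrite !inE eqxx.
  by rewrite big1 ?addr0 // => j; rewrite !inE andbT negbK => /andP[/eqP ->]; rewrite eqxx.
exists (MkAfun AE), v; split=> [T||].
- rewrite ffunE; apply: subgroup_sum; [exact: Ap_sub|move=> i; apply: sgt_sub; [exact: Ap_sub|exact: Aw]].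
- rewrite ecoef_dform; apply: eq_bigr => i; rewrite vE pd_sgt; last exact: Ap_mero.
  by rewrite mulrA sgt2 mul1r.
- by apply/qclass_eq; apply: in_span_self.
Qed.

Lemma Hclass_lin n (a : C) (f k : Afun tau n) : Hclass (a *: f + k) = a *: Hclass f + Hclass k.
Proof. by rewrite /Hclass /gr_class linearP linearP. Qed.

Definition lev n l := forall S, ~~ ((#|S| == g) && (Wlevel S == n)) -> l S = 0.

(** The default 0 is not met when n is the level of S ([WAE]). *)
Definition WA n S : Afun tau n := insubd (0 : Afun tau n) (Wfun tau S).

Lemma WAE n S : Wlevel S = n -> WA n S = Wfun tau S :> J.
Proof.
move=> <-; rewrite val_insubd (_ : _ _ = true) //; apply/asboolP; exact: A_Wlevel.
Qed.

Definition FW n l : Afun tau n := \sum_S l S *: WA n S.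

Lemma Aval_sum n (I : Type) (r : seq I) (a : I -> C) (G : I -> Afun tau n) :
  (\sum_(i <- r) a i *: G i : Afun tau n) = \sum_(i <- r) kc (a i) * (G i : J) :> J.
Proof. by elim: r => [|i r IH]; rewrite ?big_nil // !big_cons -IH. Qed.

Lemma FWE n l : lev n l -> FW n l = Wl l :> J.
Proof.
move=> hl; rewrite Aval_sum; apply: eq_bigr => S.
have [/andP[_ /eqP Sn]|/hl ->] := boolP ((#|S| == g) && (Wlevel S == n)); first by rewrite WAE.
by rewrite !mul0r.
Qed.

Lemma Hclass_sum n (I : Type) (r : seq I) (a : I -> C) (G : I -> Afun tau n) :
  Hclass (\sum_(i <- r) a i *: G i) = \sum_(i <- r) a i *: Hclass (G i).
Proof.
elim: r => [|i r IH]; last by rewrite !big_cons Hclass_lin IH.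
by rewrite !big_nil /Hclass /gr_class !linear0.
Qed.

Lemma Wgr_FW n (x : Hg tau n) : Wgr tau n x <-> exists2 l, lev n l & x = Hclass (FW n l).
Proof.
split=> [|[l hl ->]]; last first.
  rewrite Hclass_sum; apply/span_predP; apply: rpred_sum => S _.
  have [/andP[Sg /eqP Sn]|/hl ->] := boolP ((#|S| == g) && (Wlevel S == n)); last by rewrite scale0r rpred0.
  apply: rpredZ; apply: in_span_self; exists (WA n S) => //.
  exists (exist _ S Sg); split=> //; exact: WAE.
elim=> [|a y z [k [S [Sn kE]] <-] _ [l hl ->]].
  exists 0 => [S|]; first by rewrite form0.
  by rewrite Hclass_sum big1 // => S; rewrite form0 scale0r.
exists (a *: dl C (val S) + l) => [T hT|].
  rewrite formD formZ dlE hl // addr0; case: eqP => [TS|_]; last by rewrite mulr0.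
  by rewrite TS (valP S) Sn eqxx in hT.
have -> : k = WA n (val S) by apply: val_inj; exact: etrans (esym (WAE Sn)).
rewrite -Hclass_lin; congr Hclass; rewrite [RHS](eq_bigr (fun T => a *: (dl C (val S) T *: WA n T) + l T *: WA n T)) => [|T].
  rewrite big_split; congr (_ _); rewrite -scaler_sumr.
  rewrite (bigD1 (val S)) //= big1 => [|T /negbTE TS]; last by rewrite dlE TS scale0r.
  by rewrite dlE eqxx scale1r addr0.
by rewrite formD formZ scalerDl scalerA.
Qed.

(** Packs g functions into a (g-1)-form so that alpha_i /\ - recovers w_i and d becomes sum_i d_i
    w_i. *)
Definition bform (w : 'I_g -> J) : F := \sum_i ia i (w i *: dl J (atop g)).

Lemma hom_bform w : hom 0 (g%:Z - 1) (bform w).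
Proof. apply: hom_sum => i _; apply: hom_ia; exact: hom_dl_atop. Qed.

Lemma coefs_bform (P : J -> Prop) w : subgroup P -> (forall i : 'I_g, P (w i)) -> coefs P (bform w).
Proof.
move=> sP Pw; apply: coefs_sum => // i _; apply: coefs_ei => // S; rewrite formZ dlE.
case: eqP => _; rewrite ?mulr1 // mulr0; exact: sP.1.
Qed.

Lemma al_bform w i : al i (bform w) (atop g) = w i.
Proof.
rewrite ewE alpha_atop form_sum (bigD1 i) //= big1 => [|j ji].
  rewrite addr0 eiE !inE eqxx finset.setD1K ?alpha_atop // formZ dlE eqxx mulr1.
  by rewrite (esgnD1 J (alpha i) (alpha_atop i)) ltnn mul1r mulrA esgn2 mul1r.
by rewrite eiE !inE (inj_eq (@rshift_inj _ _)) ji; have := alpha_atop j; rewrite inE => ->.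
Qed.

Lemma dd_atop (x : F) : coefs mero x -> dd (pd tau) x (atop g) = \sum_i pd tau i (al i x (atop g)).
Proof. by move=> mx; rewrite form_sum; apply: eq_bigr => i; rewrite pd_al. Qed.

Lemma dd_bform w : (forall i : 'I_g, mero (w i)) -> dd (pd tau) (bform w) (atop g) = \sum_i pd tau i (w i).
Proof.
move=> mw; rewrite dd_atop; last exact: coefs_bform.
by apply: eq_bigr => i; rewrite al_bform.
Qed.

End TopCohomology.

Variables (B : nat -> choiceType) (f : forall n, B n -> Afun tau n).

(** * The evaluation map *)

Section Evaluation.
Local Notation D := (Dring R g).
Local Notation iota := (@mpolyC g C : C -> D).
Local Notation FD := (form D (g + g)).
Local Notation FC := (form C (g + g)).
Local Notation X := (@Dvar R g).
Local Notation DUB := (DU R g B).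
Local Notation H := (DH R g B).
Implicit Types (S T : {set 'I_(g + g)}) (l : FC) (P : D) (y : H).

Lemma Dact_add P (h k : J) : mero h -> mero k -> Dact tau P (h + k) = Dact tau P h + Dact tau P k.
Proof. by move=> mh mk; have := Dact_linr P 1 mh mk; rewrite !scale1r. Qed.

Lemma Dact_addl P (Q : D) (h : J) : Dact tau (P + Q) h = Dact tau P h + Dact tau Q h.
Proof. by have := Dact_linl 1 P Q h; rewrite !scale1r. Qed.

Lemma mero_add (h k : J) : mero h -> mero k -> mero (h + k).
Proof. by move=> mh mk; have := mero_lin 1 mh mk; rewrite scale1r. Qed.

Lemma Dact_sumr (I : Type) (r : seq I) (Q : pred I) P (G : I -> J) : (forall i : I, mero (G i)) ->
  Dact tau P (\sum_(i <- r | Q i) G i) = \sum_(i <- r | Q i) Dact tau P (G i) /\ mero (\sum_(i <- r | Q i) G i).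
Proof.
move=> mG; elim: r => [|i r [IH]]; first by rewrite !big_nil Dact0r //; split => //; exact: ms.1.
rewrite !big_cons; case: ifP => //; split; first by rewrite Dact_add // IH.
exact: mero_add.
Qed.

Lemma mero_Wfun S : mero (Wfun tau S). Proof. exact: A_mero (A_Wlevel S). Qed.

Lemma mero_f n (b : B n) : mero (Aval (f b)).
Proof. apply: (@A_mero n); have := Aprop (f b); by move/asboolP. Qed.

(** Evaluation before dividing by omega; it descends to D (x) W^g by [evF_om]. *)
Definition evF (x : FD) : J := \sum_(S : {set 'I_(g + g)} | #|S| == g) Dact tau (x S) (Wfun tau S).

Lemma mero_evF x : mero (evF x).
Proof. by have [_] := @Dact_sumr _ (index_enum {set 'I_(g + g)}) (fun S => #|S| == g) 0 (fun S => Dact tau (x S) (Wfun tau S)) (fun S => mero_Dact (x S) (mero_Wfun S)). Qed.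

Lemma evF_lin P (x y : FD) : evF (P *: x + y) = Dact tau P (evF x) + evF y.
Proof.
have [-> _] := @Dact_sumr _ (index_enum {set 'I_(g + g)}) (fun S => #|S| == g) P (fun S => Dact tau (x S) (Wfun tau S)) (fun S => mero_Dact (x S) (mero_Wfun S)).
rewrite -big_split; apply: eq_bigr => S.
rewrite formD formZ Dact_addl DactM //; exact: mero_Wfun.
Qed.

Lemma evF0 : evF 0 = 0.
Proof. by rewrite /evF big1 // => S; rewrite form0 Dact0l. Qed.

Lemma evF_sum (I : Type) (r : seq I) (P : I -> D) (x : I -> FD) :
  evF (\sum_(i <- r) P i *: x i) = \sum_(i <- r) Dact tau (P i) (evF (x i)).
Proof. by elim: r => [|i r IH]; rewrite ?big_nil ?evF0 // !big_cons evF_lin IH. Qed.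

Lemma evF_dl S : #|S| == g -> evF (dl D S) = Wfun tau S.
Proof.
move=> Sg; rewrite /evF (bigD1 S) //= big1 => [|T /andP[_ TS]]; first by rewrite dlE eqxx Dact1 addr0.
by rewrite dlE (negbTE TS) Dact0l.
Qed.

Lemma evF_iota l : (forall S, #|S| != g -> l S = 0) -> evF (fmap iota l) = Wl l.
Proof.
move=> lg; rewrite [RHS](bigID (fun S => #|S| == g)) /= [X in _ + X]big1 ?addr0 => [|S Sg]; last first.
  by rewrite lg // mul0r.
by apply: eq_bigr => S; rewrite fmapE DactC.
Qed.

Lemma iota_ew (i : 'I_(g + g)) l : fmap iota (ew i l) = ew i (fmap iota l).
Proof. by apply: fmap_ew => [|S]; rewrite ?mpolyCN. Qed.

Lemma iota_dl S : fmap iota (dl C S) = dl D S.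
Proof. by apply/ffunP => T; rewrite fmapE !dlE; case: eqP. Qed.

Lemma iota_om l : fmap iota (om l) = om (fmap iota l).
Proof.
apply/ffunP => S; rewrite fmapE !form_sum raddf_sum.
by apply: eq_bigr => i; rewrite -!iota_ew fmapE.
Qed.

Lemma hom_dl T : hom #|beta_part T|%:Z #|alpha_part T|%:Z (dl C T).
Proof. by move=> S; rewrite dlE; case: eqVneq => // ->; rewrite /bideg !eqxx. Qed.

Lemma hom_card q k l : hom q k l -> q + k = g%:Z -> forall S, #|S| != g -> l S = 0.
Proof.
move=> hl qk S Sg; apply: hl; apply: contra Sg => /andP[/eqP]; rewrite card_parts.
lia.
Qed.

Lemma evF_om (w : FD) : (forall S, #|S|.+2 != g -> w S = 0) -> evF (om w) = 0.
Proof.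
move=> wg; rewrite (form_dl w) linear_sum (eq_bigr (fun T => w T *: om (dl D T))) => [|T]; last by rewrite linearZ.
rewrite evF_sum big1 // => T; have [Tg|/wg ->] := eqVneq #|T|.+2 g; last by rewrite Dact0l.
have hT : hom (#|beta_part T|%:Z + 1) (#|alpha_part T|%:Z + 1) (om (dl C T)) by apply: hom_om; exact: hom_dl.
have cT : #|beta_part T|%:Z + 1 + (#|alpha_part T|%:Z + 1) = g%:Z by have := card_parts T; lia.
rewrite -iota_dl -iota_om evF_iota; last exact: hom_card cT.
have pE : #|beta_part T|%:Z + 1 = #|beta_part T|.+1%:Z by lia.
rewrite pE in hT; rewrite (Wl_Psi hT) Psi_om // Dact0r //.
Qed.

Lemma evF_dX (x : FD) : (forall S, #|S|.+1 != g -> x S = 0) -> evF (Aw X x) = 0.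
Proof.
move=> xg; rewrite (form_dl x) linear_sum (eq_bigr (fun T => x T *: Aw X (dl D T))) => [|T]; last by rewrite linearZ.
rewrite evF_sum big1 // => T; have [Tg|/xg ->] := eqVneq #|T|.+1 g; last by rewrite Dact0l.
have cT : #|beta_part T|%:Z + (#|alpha_part T|%:Z + 1) = g%:Z by have := card_parts T; lia.
rewrite evF_sum (eq_bigr (fun i => pd tau i (Psi_top #|beta_part T| (ew (alpha i) (dl C T))))) => [|i _].
  by rewrite sum_pd_Psi // Dact0r.
have hT : hom #|beta_part T| (#|alpha_part T|%:Z + 1) (ew (alpha i) (dl C T)) by apply: hom_al; exact: hom_dl.
rewrite Dact_var; congr (pd); rewrite -iota_dl -iota_ew.
exact: etrans (evF_iota (hom_card hT cT)) (Wl_Psi hT).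
Qed.

Definition evW (q : DW D g g) : J := evF (x2f (qrepr q)).

Lemma evW_class (x : ext D (g + g) g) : evW (qclass _ x) = evF (x2f x).
Proof.
have : qrepr (qclass (@omega_ideal D g g) x) - x \in span_pred (@omega_ideal D g g).
  by apply/qclass_eq; rewrite qreprK.
move=> /mem_omega[w wg]; rewrite linearB => E.
have := evF_lin 1 (om w) (x2f x); rewrite scale1r -E subrK => E1.
by rewrite /evW E1 E evF_om // Dact0r // add0r.
Qed.

Lemma evW_lin P (p q : DW D g g) : evW (P *: p + q) = Dact tau P (evW p) + evW q.
Proof. by rewrite -[p]qreprK -[q]qreprK -linearP !evW_class linearP evF_lin. Qed.

Definition evU (c : DUB) : J := \sum_(t <- monalg.msupp c) Dact tau (monalg.mcoeff t c) (Aval (f (tagged t))).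

Lemma evUE (As : seq {n : nat & B n}) (c : DUB) : uniq As -> (forall t, t \notin As -> monalg.mcoeff t c = 0) ->
  evU c = \sum_(t <- As) Dact tau (monalg.mcoeff t c) (Aval (f (tagged t))).
Proof.
move=> uA cA; rewrite [RHS](bigID (fun t => t \in monalg.msupp c)) /= [X in _ + X]big1 ?addr0 => [|t]; last first.
  by rewrite -monalg.mcoeff_eq0 => /eqP ->; rewrite Dact0l.
rewrite -[RHS]big_filter; apply: perm_big; apply: uniq_perm => [||t]; [exact: fset_uniq|exact: filter_uniq|].
rewrite mem_filter; case: (boolP (t \in monalg.msupp c)) => //= tc; symmetry; apply: contraTT tc => /cA /eqP.
by rewrite monalg.mcoeff_eq0.
Qed.

Lemma evU_lin P (c d : DUB) : evU (P *: c + d) = Dact tau P (evU c) + evU d.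
Proof.
pose As := undup ((monalg.msupp c : _) ++ (monalg.msupp d : _)); have uA : uniq As by exact: undup_uniq.
have Ac t : t \notin As -> monalg.mcoeff t c = 0.
  by rewrite mem_undup mem_cat negb_or -!monalg.mcoeff_eq0 => /andP[/eqP].
have Ad t : t \notin As -> monalg.mcoeff t d = 0.
  by rewrite mem_undup mem_cat negb_or -!monalg.mcoeff_eq0 => /andP[_ /eqP].
have cE t : monalg.mcoeff t (P *: c + d) = P * monalg.mcoeff t c + monalg.mcoeff t d.
  by rewrite monalg.mcoeffD monalg.mcoeffZ.
rewrite (evUE uA Ac) (evUE uA Ad) (evUE uA) => [|t tA]; last by rewrite cE Ac // Ad // mulr0 addr0.
have [-> _] := @Dact_sumr _ As predT P (fun t => Dact tau (monalg.mcoeff t c) (Aval (f (tagged t)))) (fun => mero_Dact _ (mero_f _)).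
rewrite -big_split; apply: eq_bigr => t.
rewrite cE Dact_addl DactM //; exact: mero_f.
Qed.

Lemma evU0 : evU 0 = 0.
Proof. by rewrite (@evUE [::]) ?big_nil // => t; rewrite monalg.mcoeff0. Qed.

Lemma evU_U P (t : {n : nat & B n}) : evU (mkmalgU t P) = Dact tau P (Aval (f (tagged t))).
Proof.
rewrite (@evUE [:: t]) // => [|s]; first by rewrite big_seq1 mcoeffU eqxx.
by rewrite inE mcoeffU eq_sym => /negbTE ->.
Qed.

Definition ev y : J := evW y.1 + evU y.2.

Lemma mero_evU c : mero (evU c).
Proof. by have [_] := @Dact_sumr _ (monalg.msupp c : _) predT 0 (fun t => Dact tau (monalg.mcoeff t c) (Aval (f (tagged t)))) (fun => mero_Dact _ (mero_f _)). Qed.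

Lemma mero_evW q : mero (evW q). Proof. exact: mero_evF. Qed.

Lemma ev_lin P (x y : H) : ev (P *: x + y) = Dact tau P (ev x) + ev y.
Proof.
rewrite /ev evW_lin evU_lin Dact_add; [|exact: mero_evW|exact: mero_evU].
ring.
Qed.

Lemma evW0 : evW 0 = 0.
Proof. by rewrite -(linear0 (qclass (@omega_ideal D g g))) evW_class linear0 evF0. Qed.

Lemma ev_is_evaluation : is_evaluation f ev.
Proof.
split=> [P x y|P S|P t]; first exact: ev_lin.
  rewrite /ev /= evU0 addr0 evW_class.
  have -> : x2f (P *: ebasis D S) = P *: dl D (val S).
    rewrite linearZ; congr (_ *: _); apply/ffunP => T; rewrite x2fE dlE.
    have [Tg|Tg] := boolP (#|T| == g); last first.
      rewrite ecoef_out //; have [TS|//] := eqVneq; by move: Tg; rewrite TS (valP S).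
    by rewrite -[T]/(val (exist (fun U : {set 'I_(g + g)} => #|U| == g) T Tg)) ecoefE ffunE.
  rewrite -[P *: _]addr0 evF_lin evF0 addr0 evF_dl //; exact: (valP S).
by rewrite /ev evW0 add0r evU_U.
Qed.

Lemma ev_dH (w : DW D g g.-1) : ev (@dH R g B w) = 0.
Proof.
rewrite /ev evU0 addr0 evW_class x2f_dextV ?evF_dX //; last lia.
move=> S Sg; apply: x2f_out; lia.
Qed.

Definition iW k l : DW D g k := qclass _ (f2x k (fmap iota l)).

Lemma iW_lin k (a : C) l (m : FC) : iW k (a *: l + m) = iota a *: iW k l + iW k m.
Proof.
rewrite -linearP -linearP; congr (qclass _ (f2x k _)); apply/ffunP => S.
by rewrite formD !fmapE formD formZ mpolyCD mpolyCM.
Qed.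

Lemma evW_iW l : (forall S, #|S| != g -> l S = 0) -> evW (iW g l) = Wl l.
Proof.
move=> lg; rewrite evW_class f2xK ?evF_iota // => S Sg.
rewrite fmapE lg //.
Qed.

Lemma iW_om (m : FC) : (forall S, #|S|.+2 != g -> m S = 0) -> iW g (om m) = 0.
Proof.
move=> mg; apply/DW_eq0; exists (fmap iota m) => [S Sg|].
  rewrite fmapE mg //.
rewrite f2xK ?iota_om // => S Sg; rewrite form_sum big1 // => i.
rewrite !ewE !inE alpha_beta; case: ifP => // iS; case: ifP => jS; last by rewrite mulr0.
rewrite fmapE mg ?mulr0 //; apply: contra Sg => /eqP Sg; apply/eqP.
by rewrite (cardsD1 (beta i)) iS (cardsD1 (alpha i)) !inE alpha_beta jS.
Qed.

Lemma dW_iW l : (forall S, #|S|.+1 != g -> l S = 0) -> dW X g (iW g.-1 l) = \sum_i X i *: iW g (ew (alpha i) l).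
Proof.
move=> lg; pose L := fmap iota l; have E : dextV X g (f2x g.-1 L) = \sum_i X i *: f2x g (fmap iota (ew (alpha i) l)).
  rewrite -[LHS]x2fK x2f_dextV; last lia.
  rewrite f2xK => [|S Sg]; last by rewrite fmapE lg //; lia.
  by rewrite linear_sum; apply: eq_bigr => i; rewrite linearZ iota_ew.
rewrite dWE E linear_sum; apply: eq_bigr => i _; exact: linearZ.
Qed.

End Evaluation.

Variables (U : forall n : nat, set (Hg tau n)) (u : forall n : nat, B n -> Hg tau n).
Hypotheses (U_complement : forall n : nat, complement (Wgr tau n) (@U n)) (u_basis : forall n : nat, is_basis (@u n) (@U n))
  (f_lift : forall (n : nat) (b : B n), Hclass (f b) = u b).

(** * Exactness at D (x) H^g and at A by induction on the degree *)

Section Filtration.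
Local Notation D := (Dring R g).
Local Notation iota := (@mpolyC g C : C -> D).
Local Notation F := (form J (g + g)).
Local Notation FC := (form C (g + g)).
Local Notation A n f := (inA tau n f).
Local Notation Ap n f := (inA_prev tau n f).
Local Notation X := (@Dvar R g).

Definition FU n (s : seq (C * B n)) : Afun tau n := \sum_(p <- s) p.1 *: f p.2.

(* V stands for D (x) H^g and T for D (x) W^(g-1): abstracting them keeps the
   algebraic structures opaque to conversion. *)
Variables (V T : lmodType D) (evV : V -> J) (dV : T -> V) (wV : FC -> V) (wT : FC -> T) (jV : forall n, seq (C * B n) -> V).
Hypotheses (ev_lin : forall P y z, evV (P *: y + z) = Dact tau P (evV y) + evV z)
  (dH_lin : forall P w w', dV (P *: w + w') = P *: dV w + dV w') (ev_dH : forall w, evV (dV w) = 0)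
  (wV_lin : forall a l m, wV (a *: l + m) = iota a *: wV l + wV m)
  (wV_om : forall m : FC, (forall S : {set 'I_(g + g)}, #|S|.+2 != g -> m S = 0) -> wV (om m) = 0)
  (ev_wV : forall l : FC, (forall S : {set 'I_(g + g)}, #|S| != g -> l S = 0) -> evV (wV l) = Wl l)
  (dH_wT : forall l : FC, (forall S : {set 'I_(g + g)}, #|S|.+1 != g -> l S = 0) -> dV (wT l) = \sum_i X i *: wV (ew (alpha i) l))
  (jV_nil : forall n, @jV n [::] = 0)
  (jV_lin : forall n a (s s' : seq (C * B n)), jV ([seq (a * p.1, p.2) | p <- s] ++ s') = iota a *: jV s + jV s')
  (jV_eq0 : forall n (s : seq (C * B n)), \sum_(p <- s) mkmalgU p.2 p.1 = 0 -> jV s = 0)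
  (ev_jV : forall n (s : seq (C * B n)), evV (jV s) = FU s)
  (V_ind : forall Q : V -> Prop, Q 0 -> (forall P (S : {set 'I_(g + g)}) y, #|S| = g -> Q y -> Q (P *: wV (dl C S) + y)) ->
    (forall P n (b : B n) y, Q y -> Q (P *: jV [:: (1, b)] + y)) -> forall y, Q y).
Implicit Types (S : {set 'I_(g + g)}) (l : FC) (P : D) (y z : V).

Let As n := A_sub n.
Let Aps n := Ap_sub n.

Let ev0' : evV 0 = 0. Proof. by have := ev_lin (-1) 0 0; rewrite scaler0 addr0 => E; have := ev_lin 1 0 0; rewrite scale1r addr0 Dact1 => /esym/eqP; rewrite -subr_eq0 addrK => /eqP. Qed.
Let evD' y z : evV (y + z) = evV y + evV z. Proof. by have := ev_lin 1 y z; rewrite scale1r Dact1. Qed.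
Let evN' y : evV (- y) = - evV y.
Proof. by have := evD' y (- y); rewrite subrr ev0' => /esym/eqP; rewrite addrC addr_eq0 => /eqP. Qed.
Let evB' y z : evV (y - z) = evV y - evV z. Proof. by rewrite evD' evN'. Qed.
Let evX' (i : 'I_g) y : evV (X i *: y) = pd tau i (evV y).
Proof. by have := ev_lin (X i) y 0; rewrite addr0 ev0' addr0 Dact_var. Qed.
Let evC' (a : C) y : evV (iota a *: y) = kc a * evV y.
Proof. by have := ev_lin (iota a) y 0; rewrite addr0 ev0' addr0 DactC. Qed.
Let wV0 : wV 0 = 0. Proof. by have := wV_lin (-1) 0 0; rewrite scaler0 addr0 mpolyCN mpolyC1 scaleN1r addNr. Qed.

Lemma ev_sumX (y : 'I_g -> V) : evV (\sum_i X i *: y i) = \sum_i pd tau i (evV (y i)).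
Proof. by rewrite (big_morph evV evD' ev0'); apply: eq_bigr => i _; exact: evX'. Qed.

(** Constant lifts of the elements of H^g_(N-g). *)
Definition Lgen N y := exists l (s : seq (C * B N)), lev N l /\ y = wV l + jV s.

(* The elements of D (x) H^g of total degree less than N. *)
Fixpoint Gfil (N : nat) y : Prop := if N is N'.+1 then
  exists y0 (yi : 'I_g -> V) y1,
    [/\ Lgen N' y0, forall i, Gfil N' (yi i), Gfil N' y1 & y = y0 + \sum_i X i *: yi i + y1]
  else y = 0.

Lemma lev_lin n (a : C) l (m : FC) : lev n l -> lev n m -> lev n (a *: l + m).
Proof. by move=> hl hm S nS; rewrite formD formZ hl // hm // mulr0 addr0. Qed.

Lemma Lgen_lin N (a : C) y (z : V) : Lgen N y -> Lgen N z -> Lgen N (iota a *: y + z).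
Proof.
move=> [l [s [hl ->]]] [m [s' [hm ->]]]; exists (a *: l + m), ([seq (a * p.1, p.2) | p <- s] ++ s').
by split; [exact: lev_lin|rewrite wV_lin jV_lin scalerDr addrACA].
Qed.

Lemma Lgen0 N : Lgen N 0.
Proof.
exists 0, [::]; split=> [S|]; first by rewrite form0.
by rewrite jV_nil addr0.
Qed.

Lemma Gfil0 N : Gfil N 0.
Proof.
elim: N => //=; exists 0, (fun=> 0), 0; split=> //; first exact: Lgen0.
by rewrite big1 ?addr0 // => i; rewrite scaler0.
Qed.

Lemma Gfil_lin N (a : C) y (z : V) : Gfil N y -> Gfil N z -> Gfil N (iota a *: y + z).
Proof.
elim: N y z => [|N IH] y z /=; first by move=> -> ->; rewrite scaler0 addr0.
move=> [y0 [yi [y1 [Ly Gy Gy1 ->]]]] [z0 [zi [z1 [Lz Gz Gz1 ->]]]].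
exists (iota a *: y0 + z0), (fun i => iota a *: yi i + zi i), (iota a *: y1 + z1).
split; [exact: Lgen_lin|by move=> i; exact: IH|exact: IH|].
exact: lin_sums.
Qed.

Lemma GfilD N y (z : V) : Gfil N y -> Gfil N z -> Gfil N (y + z).
Proof. by move=> Gy Gz; have := Gfil_lin 1 Gy Gz; rewrite scale1r. Qed.

Lemma GfilZ N (a : C) y : Gfil N y -> Gfil N (iota a *: y).
Proof. by move=> Gy; have := Gfil_lin a Gy (Gfil0 N); rewrite addr0. Qed.

Lemma GfilN N y : Gfil N y -> Gfil N (- y).
Proof. by move=> /(GfilZ (-1)); rewrite mpolyCN scaleN1r. Qed.

Lemma Gfil_le1 N y : Gfil N y -> Gfil N.+1 y.
Proof.
move=> Gy; exists 0, (fun=> 0), y; split=> // [|i|]; [exact: Lgen0|exact: Gfil0|].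
by rewrite big1 ?add0r // => i; rewrite scaler0.
Qed.

Lemma Gfil_le M N y : (M <= N)%N -> Gfil M y -> Gfil N y.
Proof.
move=> MN; rewrite -(subnK MN); elim: (N - M)%N => // k IH /IH; exact: Gfil_le1.
Qed.

Lemma Gfil_sumX N (y : 'I_g -> V) : (forall i, Gfil N (y i)) -> Gfil N.+1 (\sum_i X i *: y i).
Proof.
move=> Gy; exists 0, y, 0; split=> //; [exact: Lgen0|exact: Gfil0|by rewrite addr0 add0r].
Qed.

Lemma GfilX N (i : 'I_g) y : Gfil N y -> Gfil N.+1 (X i *: y).
Proof.
move=> Gy; apply: (eq_ind _ (Gfil N.+1) _ _ (@sum_delta D V 'I_g X i y)); apply: Gfil_sumX => j.
case: ifP => // _; exact: Gfil0.
Qed.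

Lemma Lgen_G N y : Lgen N y -> Gfil N.+1 y.
Proof.
move=> Ly; exists y, (fun=> 0), 0; split=> // [i||]; [exact: Gfil0|exact: Gfil0|].
by rewrite big1 ?addr0 // => i; rewrite scaler0.
Qed.

Lemma lev_supp n l : lev n l -> forall S, #|S| != g -> l S = 0.
Proof. by move=> hl S Sg; apply: hl; rewrite (negbTE Sg). Qed.

Lemma ev_Lgen N l (s : seq (C * B N)) : lev N l -> evV (wV l + jV s) = (FW N l : J) + (FU s : J).
Proof. move=> hl; rewrite evD' ev_jV; rewrite FWE // ev_wV //; exact: lev_supp hl. Qed.

Lemma A_Aval n (k : Afun tau n) : A n k. Proof. by have := Aprop k; move/asboolP. Qed.

Lemma Gfil_ev N y : Gfil N y -> Ap N (evV y).
Proof.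
elim: N y => [|N IH] y /=; first by move=> ->.
move=> [y0 [yi [y1 [[l [s [hl ->]]] Gy Gy1 ->]]]]; rewrite evD' evD' ev_sumX ev_Lgen //.
apply: (subgroupD (As N)); last by apply: prev_A; exact: IH.
apply: (subgroupD (As N)); first exact: (subgroupD (As N) (A_Aval _) (A_Aval _)).
apply: (subgroup_sum _ _ (As N)) => i; apply: Ap_pd => //; exact: IH.
Qed.

Lemma Hclass_FU N (s : seq (C * B N)) : Hclass (FU s) = \sum_(p <- s) p.1 *: u p.2.
Proof. by rewrite Hclass_sum; apply: eq_bigr => p; rewrite f_lift. Qed.

Lemma U_range N (c : malg (B N) C) : U (lincomb (@u N) c).
Proof. by have [_ <-] := u_basis N. Qed.

(** Split the class of h into its W and U parts and lift them; the difference is exact up to lower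
    order, and induction applies to the primitive and to the rest. *)
Lemma surj N (h : J) : Ap N h -> exists y, Gfil N y /\ evV y = h.
Proof.
elim: N h => [|N IH] h; first by move=> ->; exists 0; split => //; exact: ev0'.
move=> Ah; have hA : h \in A_pred tau N by apply/asboolP.
pose Fh := MkAfun hA; have [_ _ /(_ (Hclass Fh))[w [v [Ww Uv hE]]]] := U_complement N.
have [l hl wE] := (Wgr_FW w).1 Ww.
have [c _ cE] : range (lincomb (@u N)) v by have [_ ->] := u_basis N.
pose s := [seq (monalg.mcoeff b c, b) | b <- monalg.msupp c : seq _].
have vE : v = Hclass (FU s) by rewrite -cE Hclass_FU big_map.
pose K := FW N l + FU s.
have : Hclass (Fh - K) = 0.
  have : Hclass (Fh - K) = Hclass Fh - (Hclass (FW N l) + Hclass (FU s)) by rewrite /Hclass /gr_class !linearB !linearD.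
  by rewrite hE wE vE subrr.
move=> /(Hclass0)[e [Ae Er]].
have /choice[yi Hy] : forall i, exists y, Gfil N y /\ evV y = e i by move=> i; exact: IH.
have [y1 [Gy1 y1E]] := IH _ Er.
exists ((wV l + jV s) + \sum_i X i *: yi i + y1); split.
  exists (wV l + jV s), yi, y1; split=> //; first by exists l, s.
  by move=> i; have [] := Hy i.
have eE : \sum_i pd tau i (evV (yi i)) = \sum_i pd tau i (e i) by apply: eq_bigr => i; have [_ ->] := Hy i.
have e1 : evV (wV l + jV s) = (K : J) := ev_Lgen s hl.
have e2 : evV y1 = h - (K : J) - \sum_i pd tau i (e i) := y1E.
have -> : evV (wV l + jV s + \sum_i X i *: yi i + y1) = (K : J) + \sum_i pd tau i (e i) + (h - (K : J) - \sum_i pd tau i (e i)).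
  have e3 := etrans (evD' (wV l + jV s) (\sum_i X i *: yi i)) (congr2 (fun a b => a + b) e1 (etrans (ev_sumX yi) eE)).
  exact: etrans (evD' _ _) (congr2 (fun a b => a + b) e3 e2).
ring.
Qed.

Lemma cst_inj : injective cst.
Proof.
move=> a b ab; have := psi_inj (hol_cst _ a) (hol_cst _ b) (ab : psi 0 _ = psi 0 _).
by move=> /(congr1 (fun h : 'rV[C]_g -> C => h 0)).
Qed.

Lemma lev0_atop l : lev 0 l -> l = l (atop g) *: dl C (atop g).
Proof.
move=> hl; apply/ffunP => S; rewrite formZ dlE; case: eqP => [->|SN]; first by rewrite mulr1.
rewrite mulr0 hl //; apply/negP => /andP[/eqP Sg]; rewrite /Wlevel; case: ifP => [/eqP b0 _|//]; apply: SN; apply: bideg_atop.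
by have := card_parts S; rewrite b0 cards0 add0n => gE; rewrite /bideg b0 cards0 -gE Sg !eqxx.
Qed.

Lemma bideg_card (p : nat) (k : int) S : bideg p%:Z k S -> #|beta_part S| = p /\ #|S|%:Z = p%:Z + k.
Proof. by move=> /andP[/eqP[b] /eqP a]; rewrite card_parts PoszD b a. Qed.

Lemma lev_hom p l : lev p.+2 l -> hom p.+1%:Z (g%:Z - p.+1%:Z) l.
Proof.
move=> hl S nS; apply: hl; apply: contra nS => /andP[/eqP Sg]; rewrite /Wlevel; case: ifP => //.
have := card_parts S; rewrite Sg /bideg /=.
lia.
Qed.

Lemma hom_lev p k l : hom p%:Z k l -> p%:Z + k = g%:Z -> lev (if p == 0 then 0 else p.+1)%N l.
Proof.
move=> hl pk S nS; apply: hl; apply: contra nS => /bideg_card[b cS]; apply/andP; split.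
  lia.
by rewrite /Wlevel -cards_eq0 b.
Qed.

(** Injectivity of W^g -> H^g by levels: level 0 is a constant, which must be 0; level 1 is empty,
    since [Wlevel] jumps from 0 to 2; level p + 2 is [A_top]. *)
Lemma Wl_exact N l : lev N l -> in_exact N (Wl l) -> wV l = 0.
Proof.
case: N => [|[|p]] hl.
- move=> [w [w0]]; rewrite big1 => [|i]; last by rewrite (w0 i : w i = 0) mero0_pd.
  rewrite subr0 => W0; have l1 := lev0_atop hl; have hl0 : hom 0%:Z g%:Z l by rewrite l1; exact: hom_dl_atop.
  have := Wl_Psi hl0; rewrite W0 /Psi_top invr1 mul1r cfE fmapE => E.
  have l0 : l (atop g) = 0 by apply: cst_inj; rewrite cst0.
  by rewrite l1 l0 scale0r.
- move=> _; rewrite (_ : l = 0) //; apply/ffunP => S; rewrite form0 hl // /Wlevel.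
  by rewrite negb_and; apply/orP; right; case: ifPn => //; rewrite eqSS cards_eq0.
move=> [w [Aw Er]]; have hl1 := lev_hom hl; have sA := As p.+1.
have WE := Wl_Psi hl1; pose n := p.+1`!; pose Yv := iter p.+1 (Mw (dzeta tau)) (cf l).
have nW : kc n%:R * Wl l = Yv (atop g).
  rewrite WE mulrA [kc _ * _]mulrC.
  have -> : kc n%:R^-1 * kc n%:R = 1 by rewrite -kcM mulVf // pnatr_eq0 -lt0n fact_gt0.
  ring.
pose c := bform (fun i => kc (- n%:R) * w i); have Aw' i : A p.+1 (kc (- n%:R) * w i) by exact: (A_kc _ (Aw i)).
have mw' i : mero (kc (- n%:R) * w i) by apply: A_mero.
have hY : hom 0 g%:Z Yv.
  have hc : hom p.+1%:Z (g%:Z - p.+1%:Z) (cf l) by apply: hom_fmap hl1; exact: mul0r.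
  by have := @hom_iter_Mw J g _ _ (dzeta tau) p.+1 _ hc; rewrite subrr subrK.
have : coefs (inA tau p.+1) (Yv + dd (pd tau) c).
  move=> S; have [/bideg_atop ->|nS] := boolP (bideg 0 g S); last first.
    have hc : hom 0 g%:Z (dd (pd tau) c).
      by have := hom_dd (hom_bform (fun i => kc (- n%:R) * w i)); rewrite subrK.
    rewrite formD hY // hc // addr0; exact: sA.1.
  rewrite formD dd_bform // -nW (eq_bigr (fun i => kc (- n%:R) * pd tau i (w i))) => [|i]; last first.
    rewrite pd_kc //; exact: (A_mero (Aw i)).
  rewrite -mulr_sumr; have := A_kc n%:R Er.
  by rewrite mulrBr -mulNr.
move=> AT; have [mu [hmu ->]] := A_top hl1 (hom_bform _) (coefs_bform sA Aw') AT.
apply: wV_om => S Sg; apply: hmu; apply: contra Sg => /bideg_card[_].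
lia.
Qed.

(** The constant generators of top level have class 0 in H^g, where W and the basis of U are
    independent, so they drop out of y. *)
Lemma kernel_top N y : Gfil N.+1 y -> Ap N (evV y) ->
  exists (yi : 'I_g -> V) y1, [/\ forall i, Gfil N (yi i), Gfil N y1 & y = \sum_i X i *: yi i + y1].
Proof.
move=> /= [y0 [yi [y1 [[l [s [hl y0E]]] Gy Gy1 yE]]]]; exists yi, y1.
have E0 : in_exact N (FW N l + FU s : Afun tau N).
  exists (fun i => evV (- yi i)); split=> [i|]; first by apply: Gfil_ev; exact: GfilN.
  rewrite -ev_sumX; have : Ap N (evV (y - y1)) by rewrite evB'; apply: (Aps N).2 => //; exact: Gfil_ev.
  rewrite yE addrK evD' y0E (ev_Lgen s hl) (_ : \sum_i X i *: - yi i = - \sum_i X i *: yi i); last first.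
    by rewrite -sumrN; apply: eq_bigr => i; rewrite scalerN.
  by rewrite evN' opprK.
have := (Hclass0 _).2 E0.
have -> : Hclass (FW N l + FU s) = Hclass (FW N l) + Hclass (FU s) by rewrite /Hclass /gr_class !linearD.
move=> H0; pose c := \sum_(p <- s) mkmalgU p.2 p.1 : malg (B N) C.
have cE : Hclass (FU s) = lincomb (@u N) c by rewrite Hclass_FU lincomb_sum.
have [_ WU] := U_complement N; have [u_inj] := u_basis N.
have WW : Wgr tau N (Hclass (FW N l)) by apply/(Wgr_FW); exists l.
have U0 : Hclass (FU s) = 0.
  have : (Wgr tau N `&` @U N) (Hclass (FU s)).
    split; last by rewrite cE; exact: U_range.
    have -> : Hclass (FU s) = - Hclass (FW N l) by apply/eqP; rewrite -addr_eq0 addrC H0.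
    by apply/span_predP; rewrite rpredN; apply/span_predP.
  by rewrite WU.
have c0 : c = 0 by apply: u_inj; rewrite -cE lincomb0.
have W0 : wV l = 0.
  apply: (Wl_exact hl); rewrite -(FWE hl).
  by apply/(Hclass0); rewrite U0 addr0 in H0.
by rewrite yE y0E W0 jV_eq0 // addr0 add0r.
Qed.

Lemma Gfil_wV m (k : int) l : hom m.-1%:Z k l -> m.-1%:Z + k = g%:Z -> Gfil m.+1 (wV l).
Proof.
move=> hl pk; have L1 : Lgen (if m.-1 == 0 then 0 else m.-1.+1)%N (wV l).
  by exists l, [::]; split; [exact: hom_lev pk|rewrite jV_nil addr0].
by apply: Gfil_le (Lgen_G L1); case: m {hl pk L1} => [|[|m]].
Qed.

Let dHD w w' : dV (w + w') = dV w + dV w'. Proof. by have := dH_lin 1 w w'; rewrite !scale1r. Qed.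
Let dH0 : dV 0 = 0. Proof. by have := dHD 0 0; rewrite addr0 => /esym/eqP; rewrite -subr_eq0 addrK => /eqP. Qed.
Let dHZ P w : dV (P *: w) = P *: dV w. Proof. by have := dH_lin P w 0; rewrite dH0 !addr0. Qed.

Local Notation al i := (@ew J (g + g) (alpha i)).

Lemma al_dd (i : 'I_g) (c : F) : coefs mero c -> al i (dd (pd tau) c) (atop g) = \sum_j pd tau j (al i (al j c) (atop g)).
Proof.
move=> mc; rewrite linear_sum form_sum; apply: eq_bigr => j _.
have mj : coefs mero (al j c) := coefs_ew (alpha j) ms mc.
have E1 : pd tau j (al i (al j c) (atop g)) = al i (fmap (pd tau j) (al j c)) (atop g) := pd_al j i (atop g) mj.
have E2 : fmap (pd tau j) (al j c) = al j (fmap (pd tau j) c).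
  apply/ffunP => S; apply: etrans (fmapE _ _ _) _; exact: pd_al.
exact: esym (etrans E1 (congr1 (fun x => (al i x (atop g) : J)) E2)).
Qed.

(** With y = sum_i X_i y_i + y1, the functions ev y_i form a (g-1)-form b whose differential has no
    larger order, and [A_closed] writes b as X^p l + dc + lower terms. The first is matched by
    [wT l], the second is removed from the y_i by an antisymmetric family [Ct], and induction treats
    the third. *)
Lemma kernel N y : Gfil N.+1 y -> Ap N (evV y) -> exists w, Gfil N (y - dV w).
Proof.
elim: N y => [|m IH] y Gy Ay; have [yi [y1 [Gi G1 yE]]] := kernel_top Gy Ay.
  exists 0; rewrite dH0 subr0 yE (G1 : y1 = 0) addr0 big1 // => i; by rewrite (Gi i : yi i = 0) scaler0.
pose e i := evV (yi i); have Ae i : A m (e i) by exact: (Gfil_ev (Gi i)).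
have me i : mero (e i) by exact: (A_mero (Ae i)).
pose b := bform e; pose p := m.-1; have Ab : coefs (inA tau m) b by exact: coefs_bform.
have Adb : coefs (inA tau m) (dd (pd tau) b).
  move=> S; have [/bideg_atop ->|nS] := boolP (bideg 0 g S); last first.
    have := hom_dd (hom_bform e); rewrite subrK => /(_ S nS) ->; exact: (As m).1.
  rewrite dd_bform //; have -> : \sum_i pd tau i (e i) = evV y - evV y1 by rewrite yE evD' ev_sumX addrK.
  apply: (As m).2 => //; exact: (Gfil_ev G1).
have [l [c [hl hc Ac Ar]]] := A_closed (hom_bform e) Ab Adb.
have mc : coefs mero c by move=> S; exact: (Ap_mero (Ac S)).
pose cc i j := al i (al j c) (atop g).
have Acc i j : Ap m (cc i j) by exact: (coefs_ew (alpha i) (Aps m) (coefs_ew (alpha j) (Aps m) Ac)).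
have /choice[Yv HY] : forall q : 'I_g * 'I_g, exists y, Gfil m y /\ evV y = cc q.1 q.2 by move=> q; exact: surj.
(* Lifts under ev are not unique; using them for i < j only makes the family antisymmetric. *)
pose Ct (i j : 'I_g) := if (i < j)%N then Yv (i, j) else if (j < i)%N then - Yv (j, i) else 0.
have CN i j : Ct i j = - Ct j i by rewrite /Ct; case: ltngtP; rewrite ?opprK ?oppr0.
have C0 i : Ct i i = 0 by rewrite /Ct ltnn.
have CG i j : Gfil m (Ct i j).
  rewrite /Ct; case: ifP => _; first by have [] := HY (i, j).
  by case: ifP => _; [apply: GfilN; have [] := HY (j, i)|exact: Gfil0].
have Cev i j : evV (Ct i j) = cc i j.
  rewrite /Ct; case: ltngtP => [_|_|/ord_inj ->]; first by have [_] := HY (i, j).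
    by rewrite evN'; have [_ ->] := HY (j, i); rewrite /cc ewew formN opprK.
  by rewrite /cc ewew0 form0.
(* p! compensates the 1 / p! in [Psi_top]. *)
pose q i := wV (ew (alpha i) l); pose a : C := p`!%:R.
pose z i := yi i - iota a *: q i - \sum_j X j *: Ct i j.
have hal i : hom p%:Z (g%:Z - 1 - p%:Z + 1) (ew (alpha i) l) by apply: hom_al.
have pk : p%:Z + (g%:Z - 1 - p%:Z + 1) = g%:Z by lia.
have Gz i : Gfil m.+1 (z i).
  apply: GfilD; last by apply: GfilN; exact: Gfil_sumX.
  apply: GfilD => //; apply: GfilN; apply: GfilZ; exact: Gfil_wV.
have supp i S : #|S| != g -> ew (alpha i) l S = 0.
  by move=> Sg; apply: hal; apply: contra Sg => /bideg_card[_]; rewrite pk => /eqP.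
have evz i : evV (z i) = al i (b - iter p (Mw (dzeta tau)) (cf l) - dd (pd tau) c) (atop g).
  rewrite evB' evB' evC' ev_sumX (ev_wV (supp i)) (Wl_Psi (hal i)) Psi_al mulrA -kcM mulfV; last first.
    by rewrite pnatr_eq0 -lt0n fact_gt0.
  apply: (etrans _ (esym (ew_subs (alpha i) b (iter p (Mw (dzeta tau)) (cf l)) (dd (pd tau) c) (atop g)))).
  apply: (congr2 (fun v w => v - w)); last first.
    have E4 : \sum_j pd tau j (evV (Ct i j)) = \sum_j pd tau j (cc i j) by apply: eq_bigr => j; rewrite Cev.
    exact: etrans (esym (al_dd i mc)).
  apply: (congr2 (fun v w => v - w)); [exact: esym (al_bform e i)|exact: mul1r].
have Az i : Ap m (evV (z i)) by rewrite evz; exact: (coefs_ew (alpha i) (Aps m)).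
have /choice[w] : forall i, exists w, Gfil m (z i - dV w) by move=> i; exact: IH.
exists (\sum_i X i *: w i + iota a *: wT l).
have -> : dV (\sum_i X i *: w i + iota a *: wT l) = \sum_i X i *: dV (w i) + iota a *: \sum_i X i *: q i.
  rewrite dHD dHZ (big_morph dV dHD dH0) dH_wT; last first.
    move=> S Sg; apply: hl; apply: contra Sg => /bideg_card[_]; lia.
  by congr (_ + _); apply: eq_bigr.
rewrite yE addrAC (koszul_rearr (z := z) _ CN) //; apply: GfilD => //; exact: Gfil_sumX.
Qed.

Lemma Gfil_mul P N y : Gfil N y -> exists M, Gfil M (P *: y).
Proof.
pose Q (P : D) := forall N y, Gfil N y -> exists M, Gfil M (P *: y).
have QM P1 P2 : Q P1 -> Q P2 -> Q (P1 * P2).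
  by move=> q1 q2 k x Gx; have [k1 G1] := q2 k x Gx; have [k2] := q1 _ _ G1; exists k2; rewrite -scalerA.
have Q1 : Q 1 by move=> k; exists k; rewrite scale1r.
have QX i : Q (X i) by move=> k; exists k.+1; exact: GfilX.
have QC c : Q (iota c) by move=> k; exists k; exact: GfilZ.
have QD P1 P2 : Q P1 -> Q P2 -> Q (P1 + P2).
  move=> q1 q2 k x Gx; have [k1 G1] := q1 k x Gx; have [k2 G2] := q2 k x Gx; exists (maxn k1 k2); rewrite scalerDl.
  apply: GfilD; [apply: Gfil_le G1; exact: leq_maxl|apply: Gfil_le G2; exact: leq_maxr].
have QXn (i : 'I_g) k : Q (X i ^+ k) by elim: k => [|k]; rewrite // exprS; exact: QM.
move: N y; elim/mpolyind: P => [|c m P _ IH]; first by move=> N; exists 0%N; exact: scale0r.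
apply: (QD) => //; rewrite -mul_mpolyC; apply: (QM) => //; rewrite mpolyXE_id.
exact: (@big_ind D Q 1 *%R Q1 QM 'I_g _ _ _ (fun i _ => QXn i _)).
Qed.

Lemma Gfil_all y : exists N, Gfil N y.
Proof.
have step P x y' N : Gfil N x -> (exists M, Gfil M y') -> exists M, Gfil M (P *: x + y').
  move=> Gx [M Gy]; have [K GK] := Gfil_mul P Gx; exists (maxn K M).
  apply: GfilD; [apply: Gfil_le GK; exact: leq_maxl|apply: Gfil_le Gy; exact: leq_maxr].
elim/V_ind: y => [|P S y Sg IH|P n b y IH]; first by exists 0%N.
- apply: (step P _ _ _ _ IH); apply: Lgen_G; exists (dl C S), [::]; split; last by rewrite jV_nil addr0.
  by apply: (hom_lev (@hom_dl S)); rewrite -PoszD -card_parts Sg.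
- apply: (step P _ _ _ _ IH); apply: Lgen_G; exists 0, [:: (1, b)]; split; last by rewrite wV0 add0r.
  by move=> S; rewrite form0.
Qed.

(** Corrections by [kernel] lower the filtration degree of y step by step to 0. *)
Lemma exact_at_ev y : evV y = 0 <-> exists w, dV w = y.
Proof.
split=> [|[w <-]]; last exact: ev_dH.
have [N Gy] := Gfil_all y; elim: N y Gy => [|N IH] y Gy y0.
  by exists 0; rewrite dH0.
have [w Gw] : exists w, Gfil N (y - dV w) by apply: kernel => //; rewrite y0; exact: (Aps N).1.
have [|w' w'E] := IH _ Gw; first by rewrite evB' ev_dH subr0.
by exists (w' + w); rewrite dHD w'E subrK.
Qed.

Lemma range_ev : range evV = abelian_functions tau.
Proof.
apply/seteqP; split=> [_ [y _ <-]|h [n Ah]].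
  by have [N /Gfil_ev] := Gfil_all y; move/(prev_A); exists N.
by have [y [_]] := @surj n.+1 h Ah; exists y.
Qed.

End Filtration.

(** * Instantiation at D (x) H^g *)

Section Instance.
Local Notation D := (Dring R g).
Local Notation iota := (@mpolyC g C : C -> D).
Local Notation DUB := (DU R g B).
Local Notation H := (DH R g B).

Definition jU n (s : seq (C * B n)) : DUB := \sum_(p <- s) mkmalgU (existT (fun n => B n : Type) n p.2) (iota p.1).

Lemma jU_lin n (a : C) (s s' : seq (C * B n)) : jU ([seq (a * p.1, p.2) | p <- s] ++ s') = iota a *: jU s + jU s'.
Proof.
rewrite /jU big_cat big_map; congr (_ + _); rewrite scaler_sumr; apply: eq_bigr => p _.
by apply/malgP => t; rewrite monalg.mcoeffZ !mcoeffU mpolyCM mulrnAr.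
Qed.

Lemma jU_eq0 n (s : seq (C * B n)) : \sum_(p <- s) mkmalgU p.2 p.1 = 0 :> malg (B n) C -> jU s = 0.
Proof.
move=> s0; apply/malgP => t; rewrite monalg.mcoeff0.
have cD : {morph (fun c : DUB => monalg.mcoeff t c) : c d / c + d} by move=> d; exact: monalg.mcoeffD.
rewrite (big_morph _ cD (monalg.mcoeff0 _)).
case: t {cD} => m b; have [mn|mn] := eqVneq m n; last first.
  by rewrite big1 // => p; rewrite mcoeffU; case: eqP => // - [nm]; rewrite nm eqxx in mn.
subst.
have cD : {morph (fun c : malg (B n) C => iota (monalg.mcoeff b c)) : c d / c + d}.
  by move=> c d; rewrite monalg.mcoeffD mpolyCD.
have c0 : iota (monalg.mcoeff b (0 : malg (B n) C)) = 0 by rewrite monalg.mcoeff0.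
apply: etrans (etrans (congr1 (fun c => iota (monalg.mcoeff b c)) s0) c0).
rewrite [RHS](big_morph _ cD c0); apply: eq_bigr => p _; rewrite !mcoeffU eq_Tagged.
ring.
Qed.

Lemma DH_ind (Q : H -> Prop) : Q 0 ->
  (forall P (S : {set 'I_(g + g)}) y, #|S| = g -> Q y -> Q (P *: ((iW g (dl C S), 0) : H) + y)) ->
  (forall P n (b : B n) y, Q y -> Q (P *: ((0, jU [:: (1, b)]) : H) + y)) -> forall y, Q y.
Proof.
move=> Q0 QW QU [q c].
have QUc : Q (0, c).
  rewrite (monalgE c); elim: (monalg.msupp c : seq _) => [|[n b] r IH]; first by rewrite big_nil.
  rewrite big_cons; have := QU (monalg.mcoeff (existT _ n b) c) n b _ IH; congr Q; apply: (congr2 pair).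
    by rewrite /= scaler0 addr0.
  congr (_ + _); rewrite /jU big_seq1; apply/malgP => t.
  by rewrite monalg.mcoeffZ !mcoeffU mulrnAr mulr1.
pose x := qrepr q; have -> : q = \sum_S x2f x S *: iW g (dl C S).
  rewrite -[LHS]qreprK -[qrepr q]x2fK [in LHS](form_dl (x2f (qrepr q))) linear_sum linear_sum.
  by apply: eq_bigr => S; rewrite linearZ linearZ /iW iota_dl.
elim: (index_enum) => [|S r IH]; first by rewrite big_nil.
rewrite big_cons; have [Sg|Sg] := eqVneq #|S| g; last by rewrite x2f_out // scale0r add0r.
have := QW (x2f x S) S _ Sg IH; congr Q; apply: (congr2 pair); first by [].
by rewrite /= scaler0 add0r.
Qed.

Lemma evU_jU n (s : seq (C * B n)) : evU (jU s) = FU s.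
Proof.
have eD : {morph evU : c d / c + d}.
  by move=> c; have := evU_lin 1 c; rewrite scale1r Dact1.
rewrite (big_morph _ eD (evU0)) Aval_sum; apply: eq_bigr => p _.
exact: etrans (evU_U _ _) (DactC _ _).
Qed.

Lemma dH_linear P (w w' : DW D g g.-1) : @dH R g B (P *: w + w') = P *: dH B w + dH B w'.
Proof. by rewrite /dH linearP; apply: congr2; rewrite //= scaler0 addr0. Qed.

Lemma exact_at_dH : exact_at 0 (@dH R g B) ev.
Proof.
move=> y.
apply: (exact_at_ev
  (V := H) (T := DW D g g.-1) (wV := fun l => (iW g l, 0)) (wT := iW g.-1) (jV := fun n s => (0, jU s))).
- exact: ev_lin.
- exact: dH_linear.
- exact: ev_dH.
- by move=> a l m; rewrite iW_lin; apply: congr2; rewrite //= scaler0 addr0.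
- by move=> m mg; rewrite iW_om.
- move=> lg; rewrite /ev evU0 addr0; exact: evW_iW.
- move=> l lg; rewrite /dH dW_iW //; exact: esym (sum_pair0 _ _ _).
- by move=> n; rewrite /jU big_nil.
- by move=> n a s s'; rewrite jU_lin; apply: congr2; rewrite //= scaler0 addr0.
- by move=> n s s0; rewrite jU_eq0.
- move=> n s; exact: etrans (congr1 (fun v : Jfun R g => v + evU (jU s)) evW0) (etrans (add0r _) (evU_jU s)).
- exact: DH_ind.
Qed.

Lemma range_evaluation : range ev = abelian_functions tau.
Proof.
apply: (range_ev
  (V := H) (wV := fun l => (iW g l, 0)) (jV := fun n s => (0, jU s))).
- exact: ev_lin.
- by move=> a l m; rewrite iW_lin; apply: congr2; rewrite //= scaler0 addr0.
- move=> lg; rewrite /ev evU0 addr0; exact: evW_iW.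
- by move=> n; rewrite /jU big_nil.
- by move=> n a s s'; rewrite jU_lin; apply: congr2; rewrite //= scaler0 addr0.
- move=> n s; exact: etrans (congr1 (fun v : Jfun R g => v + evU (jU s)) evW0) (etrans (add0r _) (evU_jU s)).
- exact: DH_ind.
Qed.

End Instance.

End Theta.

Theorem corollary4 (R : realType) (g : nat) (tau : 'M[R[i]]_g)
    (g_ge2 : (2 <= g)%N)
    (tau_sym : tau^T = tau)
    (tau_pos : im_posdef tau)
    (Theta_nonsingular : theta_nonsingular tau)
    (U : forall n : nat, set (Hg tau n))
    (U_complement : forall n : nat, complement (Wgr tau n) (U n))
    (B : nat -> choiceType)
    (u : forall n : nat, B n -> Hg tau n)
    (u_basis : forall n : nat, is_basis (u n) (U n))
    (f : forall n : nat, B n -> Afun tau n)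
    (f_lift : forall (n : nat) (b : B n), Hclass (f n b) = u n b) :
  exists ev : DH R g B -> Jfun R g,
    is_evaluation f ev /\
    [/\ injective (dTW (R := R) (g := g) 0),
        forall k : nat, (k.+1 < g.-1)%N ->
          exact_at 0 (dTW (R := R) (g := g) k) (dTW k.+1),
        exact_at 0 (dW (Dvar (R := R)) g.-1 : DW _ g g.-2 -> _) (@dH R g B),
        exact_at 0 (@dH R g B) ev
      & range ev = abelian_functions tau] /\
    (forall k : nat, (k < g)%N -> free_module (DW (Dring R g) g k)) /\
    free_module (DH R g B).
Proof.
have g_gt0 : (0 < g)%N := ltnW g_ge2.
have W_exact (a b c : nat) : b = a.+1 -> c = b.+1 -> (b < g)%N ->
    forall q : DW (Dring R g) g b, dW (Dvar (R := R)) c q = 0 <-> exists p : DW _ g a, dW (Dvar (R := R)) b p = q.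
  move=> ba cb bg; exact: (@dW_exact (Dring R g) g (@Dvar R g) (fun i p => mderiv i p) (@sc R[i] g)
    (@mderiv_sub _ g) (@mderiv_xv _ g) (@sc_sub _ g) (@sc_mulX _ g) (@sc_euler_mul _ g) (@mpoly_char0 _ g) a b c ba cb bg).
exists (ev f); split; first exact: ev_is_evaluation.
split; [split|split].
- exact: (@dW_inj (Dring R g) g (@Dvar R g) (fun i p => mderiv i p) (@sc R[i] g)
    (@mderiv_sub _ g) (@mderiv_xv _ g) (@sc_sub _ g) (@sc_mulX _ g) (@sc_euler_mul _ g) g_gt0).
- by move=> k kg; apply: W_exact => //; lia.
(* The second component of [dH] is 0, so its kernel is that of [dW]. *)
- move=> q; rewrite -(W_exact g.-2 g.-1 g); [|lia|lia|lia].
  by split=> [[]|E] //; apply: (congr2 pair).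
- exact: (exact_at_dH tau_sym tau_pos Theta_nonsingular g_ge2 U_complement u_basis f_lift).
- exact: (range_evaluation tau_sym tau_pos Theta_nonsingular g_ge2 U_complement u_basis f_lift).
- move=> k _; have [r [b fb]] := DW_fin_basis (@mpolyC g R[i] : {rmorphism R[i] -> Dring R g}) g k.
  exact: fin_basis_free fb.
- have [r [b fb]] := DW_fin_basis (@mpolyC g R[i] : {rmorphism R[i] -> Dring R g}) g g.
  exact: free_prod fb.
Qed.
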